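(* Let $\Bbbk$ be an algebraically closed field of characteristic different from $2$ and $3$. Consider a Chilean configuration of $12$ conics and $9$ base points $p_1,\dots,p_9$ in $\mathbb P^2$, and let $\pi\colon S\to\mathbb P^2$ be the blow-up of $p_1,\dots,p_9$, with exceptional curves $E_1,\dots,E_9$. For each $i$ let $B_i\subset S$ be the fixed curve of the Bertini involution $\beta_{E_i}$ and let $\ell_i=\pi(B_i)$. Then $\ell_1,\dots,\ell_9$ are nine lines in $\mathbb P^2$ which, together with the $12$ intersection points of conics that are the singular points of the four reducible fibers (three for each), form a configuration isomorphic to the dual Hesse configuration $(9_4,12_3)$ of $9$ lines and $12$ points.
   Context: Chilean configuration: let $\epsilon$ be a primitive cube root of unity and $a\in\Bbbk$, $a\neq0$, such that the cubic $x^3+y^3+z^3-\frac{a^3+2}{a}xyz=0$ is nonsingular. The pencil of sextics $$(xy-az^2)(xz-ay^2)(yz-ax^2)+\lambda\bigl(a(x^3+y^3+z^3)-(a^3+2)xyz\bigr)^2=0$$ has double base points at the nine points $(a:1:1),(\epsilon a:\epsilon^2:1),(\epsilon^2a:\epsilon:1),(1:a:1),(\epsilon:\epsilon^2a:1),(\epsilon^2:\epsilon a:1),(1:1:a),(\epsilon:\epsilon^2:a),(\epsilon^2:\epsilon:a)$, denoted $p_1,\dots,p_9$, and (apart from the double cubic) exactly four reducible members, each a union of three smooth conics. The $12$ conics and the points $p_1,\dots,p_9$ form the Chilean configuration. The pencil defines an elliptic fibration $f\colon S\to\mathbb P^1$, and its four reducible fibers, of type $I_3$, are the unions of the proper transforms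 of three conics; they have three singular points each, whose images in $\mathbb P^2$ are intersection points of two conics of the same reducible member, $12$ in total. Bertini involution: for a $(-1)$-curve $E$ on $S$ the restriction of $E$ to the generic fiber $F_\eta$ of $f$ is a point of degree $2$ and its complete linear system defines a separable degree-$2$ map $F_\eta\to\mathbb P^1_\eta$. Its deck transformation extends to a biregular involution $\beta_E$ of $S$. Its fixed curve $B_E$ is the closure in $S$ of the fixed point scheme of $\beta_E$ on $F_\eta$ (an effective divisor of degree $4$). The Hesse configuration is the configuration $(12_3,9_4)$ of the $12$ lines and $9$ points of the affine plane over $\mathbb F_3$ (equivalently the nine base points of the Hesse pencil $\lambda(x^3+y^3+z^3)+\mu xyz=0$ and the $12$ lines that are components of its four singular members). The dual Hesse configuration is obtained by interchanging the roles of points and lines: $9$ lines, $12$ points, four points on each line, and three lines through each point. *)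

(* Defs.v *)
From HB Require Import structures.
From mathcomp Require Import all_boot all_order all_algebra.
From mathcomp Require Import mpoly.
From Stdlib Require Import ClassicalEpsilon.

Set Implicit Arguments.
Unset Strict Implicit.
Unset Printing Implicit Defensive.

Import GRing.Theory.
Local Open Scope ring_scope.

(* The projective plane over k: a point is a 1-dimensional subspace of k^3.
   A line is given by its coefficients [a : b : c], i.e. by a point of the dual
   plane, which is modelled by the same type. *)
Definition proj2 (k : fieldType) := {U : {vspace 'rV[k]_3} | \dim U == 1%N}.

Definition coords (k : fieldType) (U : proj2 k) : 'rV[k]_3 := vpick (val U).

Definition dot (R : nzRingType) (u v : 'rV[R]_3) : R := \sum_(c < 3) u 0 c * v 0 c.

Definition cross (R : nzRingType) (u v : 'rV[R]_3) : 'rV[R]_3 :=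
  \row_(c < 3) (u 0 (c + 1) * v 0 (c + 2%:R) - u 0 (c + 2%:R) * v 0 (c + 1)).

Definition on_line (k : fieldType) (q l : proj2 k) : bool :=
  dot (coords q) (coords l) == 0.

Section Forms.
Variable k : fieldType.
Implicit Types F G : {mpoly k[3]}.

Definition on_curve F (q : proj2 k) : Prop := F.@[coords q 0] = 0.

Definition nonsingular F : Prop :=
  forall v : 'rV[k]_3, v != 0 -> F.@[v 0] = 0 ->
  exists c : 'I_3, (mderiv c F).@[v 0] <> 0.

Definition smooth_conic F : Prop := F \is 2.-homog /\ nonsingular F.

Definition reducible F : Prop :=
  exists G H : {mpoly k[3]}, [/\ F = G * H, (1 < msize G)%N & (1 < msize H)%N].

End Forms.

(* The surface S: blow-up of P^2 at nine distinct points with homogeneous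
   coordinates p i.  The blow-up of P^2 at p i is the incidence variety of pairs
   (point q, line through p i and q); S is the fibre product over P^2 of these
   nine blow-ups, a closed subvariety of P^2 x (P^2)^9. *)
Section BlowUp.
Variables (k : fieldType) (p : 'I_9 -> 'rV[k]_3).

Record blowup := BlowUp {
  proj : proj2 k;
  dir : 'I_9 -> proj2 k;
  dir_base : forall i, dot (p i) (coords (dir i)) = 0;
  dir_proj : forall i, on_line proj (dir i) }.

Definition exceptional (i : 'I_9) (s : blowup) : Prop :=
  val (proj s) = <[p i]>%VS.

(* Forms on P^2 x (P^2)^9: polynomials in a 10 x 3 matrix of variables,
   row 0 being the coordinates on P^2 and row i+1 those of the i-th line. *)
Definition multihomog (d : 'I_(1 + 9) -> nat) (P : {mpoly k[(1 + 9) * 3]}) : Prop :=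
  forall m, m \in msupp P ->
  forall j, (\sum_(c < 3) m (mxvec_index j c) = d j)%N.

Definition mx_coords (R : Type) (q : 'rV[R]_3) (l : 'I_9 -> 'rV[R]_3) :
  'I_((1 + 9) * 3) -> R :=
  mxvec (col_mx q (\matrix_(i < 9) l i)) 0.

Definition form_at (s : blowup) (P : {mpoly k[(1 + 9) * 3]}) : k :=
  P.@[mx_coords (coords (proj s)) (fun i => coords (dir s i))].

(* The function field k(S) = k(P^2), written in the affine chart z = 1. *)
Definition funfield := {fraction {mpoly k[2]}}.

Definition cst (c : k) : funfield := tofrac (mpolyC 2 c).

(* The generic point (x : y : 1) of P^2. *)
Definition generic_pt : 'rV[funfield]_3 :=
  \row_(c < 3) nth 1 [:: tofrac 'X_0; tofrac 'X_1] c.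

(* A form on P^2 x (P^2)^9 at the generic point of S, whose i-th line is the
   line joining p i to (x : y : 1). *)
Definition form_generic (P : {mpoly k[(1 + 9) * 3]}) : funfield :=
  mmap cst (mx_coords generic_pt (fun i => cross (map_mx cst (p i)) generic_pt)) P.

(* Membership in the local ring O_{S,s}. *)
Definition regular_at (s : blowup) (h : funfield) : Prop :=
  exists d N D, [/\ multihomog d N, multihomog d D, form_at s D <> 0 &
                    h = form_generic N / form_generic D].

(* The local ring of S at the generic point of the exceptional curve E_i: the
   functions that are regular at some point of E_i. *)
Definition exc_ring (i : 'I_9) (h : funfield) : Prop :=
  exists s, exceptional i s /\ regular_at s h.

(* Zariski closure in S of the inverse image of the curve F = 0 minus the
   blown-up points. *)
Definition proper_transform (F : {mpoly k[3]}) (s : blowup) : Prop :=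
  forall d P, multihomog d P ->
  (forall t, on_curve F (proj t) -> (forall i, ~ exceptional i t) ->
     form_at t P = 0) ->
  form_at s P = 0.

Definition proj_image (Z : blowup -> Prop) (q : proj2 k) : Prop :=
  exists s, Z s /\ proj s = q.

End BlowUp.

(* The generic fibre F_eta of the fibration f : S --> P^1 given by the rational
   function f.  It is the regular projective curve over K = k(f) with function
   field k(S); its closed points are the valuation rings K <= O < k(S). *)
Section GenericFibre.
Variables (k : fieldType) (f : funfield k).
Local Notation FF := (funfield k).

Definition base_field (h : FF) : Prop :=
  exists u v : {poly k},
    (map_poly (@cst k) v).[f] != 0 /\
    h = (map_poly (@cst k) u).[f] / (map_poly (@cst k) v).[f].

Record closed_point (O : FF -> Prop) : Prop := ClosedPoint {
  cp_base : forall h, base_field h -> O h;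
  cp_sub : forall g h, O g -> O h -> O (g - h);
  cp_mul : forall g h, O g -> O h -> O (g * h);
  cp_val : forall h, O h \/ O h^-1;
  cp_proper : exists h, ~ O h }.

Definition max_ideal (O : FF -> Prop) (h : FF) : Prop :=
  O h /\ (h = 0 \/ ~ O h^-1).

(* The Riemann-Roch space L(E) of a closed point E.  As O_E is a discrete
   valuation ring, the first condition says that h has at most a simple pole
   at E. *)
Definition RRspace (E : FF -> Prop) (h : FF) : Prop :=
  (forall t, max_ideal E t -> E (t * h)) /\
  (forall O, closed_point O -> ~ (forall g, O g <-> E g) -> O h).

(* A nontrivial deck transformation of the map F_eta --> P^1 given by the
   complete linear system |E|, as an automorphism of k(S).  Since L(E) contains
   K, it is an automorphism over K. *)
Definition deck (E : FF -> Prop) (sigma : {rmorphism FF -> FF}) : Prop :=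
  [/\ bijective sigma,
      (forall h, RRspace E h -> sigma h = h) &
      exists h, sigma h <> h].

(* beta_E, by its action on k(S).  The map has degree 2, so that there is only
   one nontrivial deck transformation; epsilon is a definite description. *)
Definition bertini (E : FF -> Prop) : {rmorphism FF -> FF} :=
  epsilon (inhabits (idfun : {rmorphism FF -> FF})) (deck E).

(* The fixed point scheme of sigma has at O the ideal generated by the
   sigma h - h for h in O, so O belongs to it iff these lie in the maximal
   ideal. *)
Definition fixed_point (sigma : {rmorphism FF -> FF}) (O : FF -> Prop) : Prop :=
  closed_point O /\ forall h, O h -> max_ideal O (sigma h - h).

(* The closure in S of the fixed point scheme of beta_E on F_eta.  A point s of
   S is a specialization of a closed point O of F_eta iff O_{S,s} <= O. *)
Definition fixed_curve (p : 'I_9 -> 'rV[k]_3) (E : FF -> Prop) (s : blowup p) : Prop :=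
  exists O, fixed_point (bertini E) O /\ (forall h, regular_at s h -> O h).

End GenericFibre.

Section Chilean.
Variable k : fieldType.

Local Notation x := ('X_0 : {mpoly k[3]}).
Local Notation y := ('X_1 : {mpoly k[3]}).
Local Notation z := ('X_(2%:R) : {mpoly k[3]}).

Definition base_pt (eps a : k) (i : 'I_9) : 'rV[k]_3 :=
  \row_(c < 3) nth 0 (nth [::]
    [:: [:: a; 1; 1]; [:: eps * a; eps ^+ 2; 1]; [:: eps ^+ 2 * a; eps; 1];
        [:: 1; a; 1]; [:: eps; eps ^+ 2 * a; 1]; [:: eps ^+ 2; eps * a; 1];
        [:: 1; 1; a]; [:: eps; eps ^+ 2; a]; [:: eps ^+ 2; eps; a]] i) c.

Definition hesse_cubic (a : k) : {mpoly k[3]} :=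
  x ^+ 3 + y ^+ 3 + z ^+ 3 - ((a ^+ 3 + 2%:R) / a) *: (x * y * z).

Definition pencil_sextic (a : k) : {mpoly k[3]} :=
  (x * y - a *: z ^+ 2) * (x * z - a *: y ^+ 2) * (y * z - a *: x ^+ 2).

Definition pencil_cubic (a : k) : {mpoly k[3]} :=
  a *: (x ^+ 3 + y ^+ 3 + z ^+ 3) - (a ^+ 3 + 2%:R) *: (x * y * z).

(* All the members of the pencil except the double cubic. *)
Definition pencil_member (a lambda : k) : {mpoly k[3]} :=
  pencil_sextic a + lambda *: pencil_cubic a ^+ 2.

(* The rational function whose value on the member with parameter lambda is
   lambda. *)
Definition fibration (a : k) : funfield k :=
  let at_generic := mmap (@cst k) (generic_pt k 0) in
  - at_generic (pencil_sextic a) / at_generic (pencil_cubic a) ^+ 2.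

(* The four reducible members, C r 0, C r 1 and C r 2 being the conics in the
   r-th one. *)
Record chilean (a : k) (lambda : 'I_4 -> k) (C : 'I_4 -> 'I_3 -> {mpoly k[3]}) :
  Prop := Chilean {
  chilean_inj : injective lambda;
  chilean_red : forall l, reducible (pencil_member a l) <-> exists r, lambda r = l;
  chilean_conic : forall r j, smooth_conic (C r j);
  chilean_member : forall r, pencil_member a (lambda r) = \prod_(j < 3) C r j }.

(* The singular points of the union of the proper transforms of three smooth
   conics that form a fibre of type I_3. *)
Definition fibre_sing (p : 'I_9 -> 'rV[k]_3) (C : 'I_3 -> {mpoly k[3]})
    (s : blowup p) : Prop :=
  exists i j, [/\ i != j, proper_transform (C i) s & proper_transform (C j) s].

End Chilean.

(* The Hesse configuration: points and lines of the affine plane over F_3. *)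
Definition hesse_pt := 'rV['F_3]_2.

Definition affine_line (l : {set hesse_pt}) : bool :=
  [exists u : hesse_pt, exists v : hesse_pt,
    (v != 0) && (l == [set u + t *: v | t : 'F_3])].

Definition hesse_line := {l : {set hesse_pt} | affine_line l}.

Definition hesse_inc (u : hesse_pt) (l : hesse_line) : bool := u \in val l.

Definition dual_hesse_inc (l : hesse_line) (u : hesse_pt) : bool := hesse_inc u l.

(* Isomorphism of incidence structures (points, lines, incidence). *)
Definition config_iso (P L P' L' : Type) (inc : P -> L -> bool)
    (inc' : P' -> L' -> bool) : Prop :=
  exists (phi : P -> P') (psi : L -> L'),
    [/\ bijective phi, bijective psi & forall u l, inc u l = inc' (phi u) (psi l)].

(* Main.v *)
Require Import Defs.
From HB Require Import structures.
From mathcomp Require Import all_boot all_order all_algebra.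
From mathcomp Require Import mpoly.
From mathcomp Require Import ring zify.
From mathcomp Require classical_sets.
From Stdlib Require Import Classical ClassicalEpsilon FunctionalExtensionality PropExtensionality.

(** The nine lines are the axes of nine reflections of the plane.

    A permutation of the coordinates and a scaling by cube roots of unity carry
    the base point p_i to (a : 1 : 1) and preserve the two forms that span the
    pencil. In the coordinates x, y, z adapted to p_i in this way, the reflection
    τ that exchanges y and z preserves every member of the pencil, hence acts on
    the generic fibre F_η; its axis is the line y = z. The heart of the proof is
    that τ is the Bertini involution of E_i.

    Let f be the parameter of the pencil, K = k(f), c the cubic of the pencil,
    and t = (y z - a x^2) (x + a y + a z) / c. A pole of t on F_η lies over a
    base point [base_center]; there the tangents of the cubic and of the two
    conics of the sextic are distinct, which makes t regular except along E_i,
    where it has a simple pole [pole_center]. So 1 and t belong to L(E_i), and τ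
    fixes both. Two identities describe the function field over K(t): x / (y + z)
    is in K(t) [slopeE], and the product w of (y - z) / (y + z) with an element
    of K(t) satisfies w^2 = q(t), where q in K[t] has degree 4 [branchE]. Thus
    k(S) = K(t)(w) with τ w = - w, and an automorphism that fixes L(E_i) fixes
    K(t), so that it is τ or the identity [deck_unique]. It remains to see that τ
    fixes all of L(E_i) [rr_fixed]. Otherwise L(E_i) contains some g = h w with h
    in K(t), not 0. Since g^2 has no pole outside E_i, it is integral over K[t],
    hence a polynomial in t [integral_ev, a consequence of Chevalley's extension
    theorem]; since q is squarefree [branch_quartic_sqfree], so is h; and then
    g^2 = h^2 q has degree at least 4 in t although the pole of g is simple.

    The fixed curve lies over the axis because a function with τ h = - h that is
    regular at a fixed point vanishes there, and off the axis there are such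
    functions with a regular inverse [fixed_center]. It covers the axis because f
    is not constant on the axis, so that the axis is a closed point of F_η
    [line_fibre_pt], because τ is the identity on it [line_fixed], and because
    its proper transform in S has a point over each of its points [axis_point].

    The reducible members correspond to the four triangles of the Hesse pencil.
    In the coordinates ξ, η, ζ given by the sides of a triangle, one member is
    the product of the conics η ζ = b ξ^2, ζ ξ = b η^2 and ξ η = b ζ^2
    [tri_member], and such a product determines its factors [conic_match], so
    that the given conics are these. Two of them meet in a vertex of the triangle
    and in base points [conics_meet]; at a base point their tangents differ
    [tangents_differ], so that their proper transforms do not meet over it. Hence
    the singular points of the reducible fibres lie over the twelve vertices.

    The base points are numbered by F_3^2. Whether a vertex lies on an axis is a
    linear condition on the base point over F_3 [axis_vertex], and the twelve
    vertices give each of the twelve lines of F_3^2 once.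

    Nonsingularity of the cubic enters through a^3 <> 1 and a^3 <> -8
    [nonsingular_cubic]. *)

Set Implicit Arguments.
Unset Strict Implicit.
Unset Printing Implicit Defensive.

Import GRing.Theory.
Local Open Scope ring_scope.

(** * Valuation rings and Chevalley's extension theorem *)

Record subring (F : fieldType) (A : F -> Prop) : Prop := Subring {
  subring1 : A 1;
  subringB : forall g h, A g -> A h -> A (g - h);
  subringM : forall g h, A g -> A h -> A (g * h) }.

Section SubringTheory.
Variables (F : fieldType) (A : F -> Prop).
Hypothesis sA : subring A.

Lemma subring0 : A 0.
Proof. by rewrite -(subrr 1); apply: (subringB sA); exact: subring1. Qed.

Lemma subringN g : A g -> A (- g).
Proof. by move=> Ag; rewrite -sub0r; apply: (subringB sA) => //; exact: subring0. Qed.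

Lemma subringD g h : A g -> A h -> A (g + h).
Proof. by move=> Ag Ah; rewrite -[h]opprK; apply: (subringB sA) => //; exact: subringN. Qed.

Lemma subringX g n : A g -> A (g ^+ n).
Proof.
move=> Ag; elim: n => [|n IH]; first exact: subring1.
by rewrite exprS; apply: (subringM sA).
Qed.

Lemma subringMn n : A n%:R.
Proof.
elim: n => [|n IH]; first exact: subring0.
by rewrite -natr1; apply: subringD => //; exact: subring1.
Qed.

Lemma subring_sum (I : Type) (r : seq I) (P : pred I) (E : I -> F) :
  (forall i, P i -> A (E i)) -> A (\sum_(i <- r | P i) E i).
Proof.
by move=> AE; elim/big_rec: _ => [|i x /AE Ai Ax]; [exact: subring0 | exact: subringD].
Qed.

Lemma subring_horner (p : {poly F}) x :
  (forall i, A p`_i) -> A x -> A p.[x].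
Proof.
move=> Ap Ax; rewrite horner_coef; apply: subring_sum => i _.
by apply: (subringM sA) => //; exact: subringX.
Qed.

End SubringTheory.

(** The trivial valuation ring F itself is allowed: for it, a statement
    about centres of valuations becomes one about points of the plane. *)
Record valring (F : fieldType) (O : F -> Prop) : Prop := Valring {
  valringB : forall g h, O g -> O h -> O (g - h);
  valringM : forall g h, O g -> O h -> O (g * h);
  valring_tot : forall h, O h \/ O h^-1 }.

Definition maxid (F : fieldType) (O : F -> Prop) (h : F) : Prop :=
  O h /\ (h = 0 \/ ~ O h^-1).

Section ValringTheory.
Variables (F : fieldType) (O : F -> Prop).
Hypothesis vO : valring O.
Local Notation m := (maxid O).

Lemma valring1 : O 1.
Proof. by case: (valring_tot vO 1); rewrite ?invr1. Qed.

Lemma valring_subring : subring O.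
Proof. by split; [exact: valring1 | exact: valringB | exact: valringM]. Qed.

Lemma valringVn h : ~ O h -> m h^-1.
Proof.
move=> nOh; split; last by right; rewrite invrK.
by case: (valring_tot vO h).
Qed.

Lemma maxid_in h : m h -> O h. Proof. by case. Qed.

Lemma maxid0 : m 0.
Proof. by split; [exact: subring0 valring_subring | left]. Qed.

Lemma maxid1 : ~ m 1.
Proof.
by case=> _ [/eqP|]; [rewrite oner_eq0 | apply; rewrite invr1; exact: valring1].
Qed.

Lemma unit_maxidN h : h != 0 -> O h^-1 -> ~ m h.
Proof. by move=> h0 Oh [_ [/eqP|//]]; rewrite (negPf h0). Qed.

Lemma maxidN_unit h : O h -> ~ m h -> h != 0 /\ O h^-1.
Proof.
move=> Oh nmh; case: (eqVneq h 0) => [h0|h0].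
  by case: nmh; rewrite h0; exact: maxid0.
by split=> //; apply: NNPP => nOh; apply: nmh; split=> //; right.
Qed.

Lemma maxidMr g h : m g -> O h -> m (g * h).
Proof.
move=> [Og mg] Oh; split; first exact: (valringM vO).
case: (eqVneq (g * h) 0) => [->|]; first by left.
rewrite mulf_eq0 negb_or => /andP[g0 h0]; right => Ogh.
case: mg => [/eqP|]; first by rewrite (negPf g0).
apply; have -> : g^-1 = h * (g * h)^-1 by rewrite invfM mulrC mulfVK.
exact: (valringM vO).
Qed.

Lemma maxidMl g h : O g -> m h -> m (g * h).
Proof. by move=> Og mh; rewrite mulrC; exact: maxidMr. Qed.

Lemma maxidD g h : m g -> m h -> m (g + h).
Proof.
move=> mg mh; wlog Ogh : g h mg mh / O (g / h).
  move=> W; case: (valring_tot vO (g / h)) => [|O1]; first exact: W.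
  by rewrite addrC; apply: W => //; rewrite -invf_div.
case: (eqVneq h 0) => [->|h0]; first by rewrite addr0.
have -> : g + h = (g / h + 1) * h by rewrite mulrDl mulfVK // mul1r.
apply: maxidMl => //; apply: subringD => //; first exact: valring_subring.
exact: valring1.
Qed.

Lemma maxidNN g : m g -> m (- g).
Proof.
move=> mg; rewrite -mulN1r; apply: maxidMl => //.
by apply: subringN; [exact: valring_subring | exact: valring1].
Qed.

Lemma maxidB g h : m g -> m h -> m (g - h).
Proof. by move=> mg mh; apply: maxidD => //; exact: maxidNN. Qed.

Lemma maxidM_prime g h : O g -> O h -> m (g * h) -> m g \/ m h.
Proof.
move=> Og Oh mgh; apply: NNPP => /not_or_and[].
move=> /(maxidN_unit Og)[g0 Og1] /(maxidN_unit Oh)[h0 Oh1].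
apply: (@unit_maxidN (g * h)) => //; first by rewrite mulf_neq0.
by rewrite invfM; exact: (valringM vO).
Qed.

Lemma maxidX_prime g n : O g -> m (g ^+ n) -> m g.
Proof.
move=> Og; elim: n => [/maxid1//|n IH]; rewrite exprS.
by move=> /(maxidM_prime Og)[] //; apply: subringX => //; exact: valring_subring.
Qed.

Lemma maxid_prod_prime (I : Type) (r : seq I) (E : I -> F) :
  (forall i, O (E i)) -> m (\prod_(i <- r) E i) -> exists i, m (E i).
Proof.
move=> OE; elim: r => [|i r IH]; first by rewrite big_nil => /maxid1.
rewrite big_cons => /maxidM_prime[]//.
- by elim/big_rec: _ => [|j x _ Ox]; [exact: valring1 | exact: (valringM vO)].
- by exists i.
Qed.

End ValringTheory.

Section Chevalley.
Variable F : fieldType.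
Implicit Types A B : F -> Prop.

Definition adjoin A (x : F) (y : F) : Prop :=
  exists2 p : {poly F}, (forall i, A p`_i) & y = p.[x].

Lemma adjoin_sub A x y : subring A -> A y -> adjoin A x y.
Proof.
move=> sA Ay; exists y%:P; last by rewrite hornerC.
by case=> [|i]; rewrite coefC //=; exact: subring0.
Qed.

Lemma adjoin_gen A x : subring A -> adjoin A x x.
Proof.
move=> sA; exists 'X; last by rewrite hornerX.
by move=> i; rewrite coefX; exact: subringMn.
Qed.

Lemma adjoin_subring A x : subring A -> subring (adjoin A x).
Proof.
move=> sA; split.
- exact: adjoin_sub (subring1 sA).
- move=> _ _ [p Ap ->] [q Aq ->]; exists (p - q); last by rewrite !hornerE.
  by move=> i; rewrite coefB; apply: (subringB sA).
- move=> _ _ [p Ap ->] [q Aq ->]; exists (p * q); last by rewrite !hornerE.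
  move=> i; rewrite coefM; apply: subring_sum => // j _.
  exact: (subringM sA).
Qed.

Section Maximal.
Variables (B : F -> Prop) (u : F).
Hypotheses (sB : subring B) (Bu : B u) (nBu : ~ B u^-1).
Hypothesis maxB : forall B', subring B' -> (forall x, B x -> B' x) ->
  ~ B' u^-1 -> forall x, B' x -> B x.

Let u0 : u != 0.
Proof. by apply: contra_notN nBu => /eqP->; rewrite invr0; exact: subring0. Qed.

(** Otherwise the localization of B at the powers of s = 1 - u b would be a
    larger subring, and it avoids u^-1 as well: if u^-1 = y / s^n with
    s^n = 1 - u c, then u^-1 = y + c is in B. *)
Lemma max_unit b : B b -> B (1 - u * b)^-1.
Proof.
move=> Bb; set s := 1 - u * b.
have [c Bs]: exists c, s = 1 - u * c /\ B c by exists b.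
pose B' x := exists y c n, [/\ B y, B c, s ^+ n = 1 - u * c & x = y / s ^+ n].
have sX n : exists2 c, B c & s ^+ n = 1 - u * c.
  elim: n => [|n [d Bd IH]].
    by exists 0; [exact: subring0 | rewrite mulr0 subr0].
  exists (d + b - u * b * d); last by rewrite exprS IH /s; ring.
  apply: (subringB sB); first exact: subringD.
  by apply: (subringM sB) => //; exact: (subringM sB).
have s0 : s != 0.
  apply/negP; rewrite subr_eq0 => /eqP E; apply: nBu.
  by rewrite -[u^-1]mulr1 E mulKf.
have BX n : B (s ^+ n).
  by apply: subringX => //; apply: (subringB sB); [exact: subring1|exact: (subringM sB)].
have sB' : subring B'.
  have mk y n : B y -> B' (y / s ^+ n).
    by move=> By; have [d Bd E] := sX n; exists y, d, n.
  split.
  - by rewrite -[1]divr1 -(expr0 s); apply: mk; exact: subring1.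
  - move=> _ _ [y [d [n [By _ _ ->]]]] [y' [d' [n' [By' _ _ ->]]]].
    have -> : y / s ^+ n - y' / s ^+ n' = (y * s ^+ n' - y' * s ^+ n) / s ^+ (n + n').
      by rewrite exprD; field; rewrite !expf_neq0.
    by apply: mk; apply: (subringB sB); apply: (subringM sB).
  - move=> _ _ [y [d [n [By _ _ ->]]]] [y' [d' [n' [By' _ _ ->]]]].
    rewrite mulf_div -exprD; apply: mk; exact: (subringM sB).
have BB' x : B x -> B' x.
  move=> Bx; exists x, 0, 0; split=> //; first exact: subring0.
    by rewrite mulr0 subr0.
  by rewrite expr0 divr1.
apply: (maxB sB' BB').
  move=> [y [d [n [By Bd E E']]]]; apply: nBu.
  have : u^-1 * s ^+ n = y by rewrite E' mulfVK // expf_neq0.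
  rewrite E mulrBr mulr1 mulKf // => Ey; move: By; rewrite -Ey.
  by move=> By'; rewrite -[u^-1](subrK d); apply: subringD.
exists 1, b, 1%N; split=> //; first exact: subring1.
by rewrite mul1r.
Qed.

(** The ideal generated by u in B[x] is the unit ideal, as witnessed by a
    polynomial of degree at most n. *)
Definition unit_eqn x n := exists p : {poly F},
  [/\ forall i, B p`_i, (size p <= n.+1)%N & u * p.[x] = 1].

Lemma unit_eqn0 x : ~ unit_eqn x 0.
Proof.
case=> p [Bp /size1_polyC -> ]; rewrite hornerC => E; apply: nBu.
by rewrite -[u^-1]mulr1 -E mulKf.
Qed.

(** As 1 - u q_0 is invertible in B (max_unit), the equation of x^-1
    presents 1 as a polynomial in x^-1 without constant term; multiplied
    with it, the term of degree n + 1 in the equation of x becomes a sum of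
    terms of degree at most n. *)
Lemma unit_eqn_shorten x n l : x != 0 -> (l <= n.+1)%N ->
  unit_eqn x n.+1 -> unit_eqn x^-1 l -> unit_eqn x n.
Proof.
move=> x0 ln [p [Bp sp pE]] [q [Bq sq qE]].
pose e := (1 - u * q`_0)^-1; pose y := x^-1.
have Be : B e by exact: max_unit.
have e0 : 1 - u * q`_0 != 0.
  apply/negP; rewrite subr_eq0 => /eqP E; apply: nBu.
  by rewrite -[u^-1]mulr1 E mulKf.
have qE' : u * \sum_(j < l) q`_j.+1 * y ^+ j.+1 = 1 - u * q`_0.
  rewrite -qE (horner_coef_wide _ sq) big_ord_recl expr0 mulr1 mulrDr addrAC.
  by rewrite subrr add0r.
pose c := u * p`_n.+1 * e.
exists (\poly_(i < n.+1) p`_i + \sum_(j < l) (c * q`_j.+1) *: 'X^(n - j)); split.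
- move=> i; rewrite coefD coef_poly coef_sum; apply: subringD => //.
    by case: ifP => // _; exact: subring0.
  apply: subring_sum => // j _; rewrite coefZ coefXn.
  by do !apply: (subringM sB) => //; exact: subringMn.
- rewrite (leq_trans (size_polyD _ _)) // geq_max size_poly /=.
  apply: (leq_trans (size_sum _ _ _)); apply/bigmax_leqP => j _.
  by rewrite (leq_trans (size_scale_leq _ _)) // size_polyXn ltnS leq_subr.
- rewrite hornerD horner_poly horner_sum.
  rewrite -[RHS]pE (horner_coef_wide _ sp) [in RHS]big_ord_recr /=; congr (_ * (_ + _)).
  have -> : p`_n.+1 * x ^+ n.+1 =
      p`_n.+1 * x ^+ n.+1 * (e * (u * \sum_(j < l) q`_j.+1 * y ^+ j.+1)).
    by rewrite qE' mulVf // mulr1.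
  rewrite !mulr_sumr; apply: eq_bigr => j _.
  rewrite hornerZ hornerXn.
  have -> : x ^+ n.+1 = x ^+ (n - j) * x ^+ j.+1.
    rewrite -exprD; congr (_ ^+ _); rewrite addnS subnK //.
    by rewrite -ltnS (leq_trans _ ln).
  have yj : x ^+ j.+1 * y ^+ j.+1 = 1 by rewrite /y exprVn mulfV // expf_neq0.
  by rewrite /c -[LHS]mulr1 -yj; ring.
Qed.

(** If neither x nor x^-1 is in B, then B[x] and B[x^-1] contain u^-1, which
    gives an equation for each of them; shortening the longer of the two by
    the other never comes to an end. *)
Lemma max_valring : valring B.
Proof.
split; [exact: subringB | exact: subringM | move=> x].
apply: NNPP => /not_or_and[nBx nBy].
have x0 : x != 0 by apply: contra_notN nBx => /eqP->; exact: subring0.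
have ex z : ~ B z -> exists n, unit_eqn z n.
  move=> nBz; have /NNPP[p Bp E] : ~ ~ adjoin B z u^-1.
    move=> nz; apply: nBz; apply: (maxB (adjoin_subring z sB)) => //.
      by move=> t; exact: adjoin_sub.
    exact: adjoin_gen.
  by exists (size p), p; split=> //; rewrite -E mulfV.
have [n rn] := ex x nBx; have [l rl] := ex _ nBy.
have [N le] := ubnP (n + l).
elim: N => // N IH in x n l x0 le rn rl {nBx nBy ex} *.
wlog ln : x n l x0 le rn rl / (l <= n)%N.
  move=> W; case: (leqP l n) => [|/ltnW] ln; first exact: (W x n l).
  apply: (W x^-1 l n) => //; first by rewrite invr_eq0.
    by rewrite addnC.
  by rewrite invrK.
case: n => [|n] in le rn ln; first exact: (unit_eqn0 rn).
exact: (IH x n l x0 _ (unit_eqn_shorten x0 ln rn rl) rl).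
Qed.

End Maximal.

(** Chevalley's extension theorem. By max_valring, a maximal element among
    the subrings that contain A and avoid u^-1 is a valuation ring. *)
Lemma chevalley A u : subring A -> A u -> ~ A u^-1 ->
  exists O, [/\ valring O, forall x, A x -> O x & ~ O u^-1].
Proof.
move=> sA Au nAu.
(* The premise admits the empty set, as the union of the empty chain. *)
pose P (B : F -> Prop) := (exists x, B x) ->
  [/\ subring B, forall x, A x -> B x & ~ B u^-1].
have [|B [PB maxB]] := @classical_sets.Zorn_bigcup F P.
  move=> G GP tot [x [B GB Bx]].
  have PB C : G C -> forall z, C z -> [/\ subring C, forall x, A x -> C x & ~ C u^-1].
    by move=> GC z Cz; apply: (GP C GC); exists z.
  have [sB AB nB] := PB B GB x Bx.
  split; last by move=> [C GC Cu]; have [_ _] := PB C GC _ Cu; apply.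
    have cmp g h : (classical_sets.bigcup G id) g -> (classical_sets.bigcup G id) h ->
        exists C, [/\ G C, subring C, C g & C h].
      move=> [C GC Cg] [D GD Dh].
      have [sC _ _] := PB C GC _ Cg; have [sD _ _] := PB D GD _ Dh.
      have [CD|DC] := tot C D GC GD.
        by exists D; split=> //; apply: CD.
      by exists C; split=> //; apply: DC.
    split.
    - by exists B => //; exact: subring1.
    - by move=> g h /cmp /[apply] -[C [GC sC Cg Ch]]; exists C => //; exact: subringB.
    - by move=> g h /cmp /[apply] -[C [GC sC Cg Ch]]; exists C => //; exact: subringM.
  by move=> z Az; exists B => //; exact: AB.
have exB : exists x, B x.
  apply: NNPP => nB; apply: (maxB A) => //.
  split=> [x Bx|]; first by case: nB; exists x.
  move=> /(_ 1 (subring1 sA)) B1; by apply: nB; exists 1.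
have [sB AB nB] := PB exB.
exists B; split=> //; apply: (@max_valring B u) => //; first exact: AB.
move=> B' sB' BB' nB' x B'x; apply: NNPP => nBx.
apply: (maxB B'); first by split=> //; move=> /(_ x B'x).
by move=> _; split=> // z /AB /BB'.
Qed.

End Chevalley.

(** * Morphisms out of a fraction field *)

Section FracLift.
Variables (R : idomainType).

Lemma fracE (h : {fraction R}) : exists n d : R, d != 0 /\ h = tofrac n / tofrac d.
Proof.
have [x ->] : exists x : {ratio R}, h = \pi_({fraction R})%qT x.
  by exists (repr h); rewrite reprK.
exists (\n_x), (\d_x); split; first exact: denom_ratioP.
have d0 : tofrac \d_x != 0 by rewrite tofrac_eq0 denom_ratioP.
apply: (mulIf d0); rewrite mulfVK //.
unlock FracField.tofrac; rewrite -[LHS]FracField.pi_mul.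
apply/eqP; rewrite FracField.equivf_def /FracField.mulf /=.
by rewrite !numden_Ratio ?mulf_neq0 ?oner_neq0 ?denom_ratioP //= !mulr1 mulrC.
Qed.

Variables (F : fieldType) (φ : {rmorphism R -> F}).
Hypothesis φ_inj : injective φ.

Lemma frac_lift : exists ψ : {rmorphism {fraction R} -> F}, forall x, ψ (tofrac x) = φ x.
Proof.
have φ0 x : x != 0 -> φ x != 0 by apply: contra_neq => E; apply: φ_inj; rewrite E rmorph0.
pose num h := proj1_sig (constructive_indefinite_description _ (fracE h)).
have numP h : exists d, d != 0 /\ h = tofrac (num h) / tofrac d.
  exact: (proj2_sig (constructive_indefinite_description _ (fracE h))).
pose den h := proj1_sig (constructive_indefinite_description _ (numP h)).
have denP h : den h != 0 /\ h = tofrac (num h) / tofrac (den h).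
  exact: (proj2_sig (constructive_indefinite_description _ (numP h))).
pose g h := φ (num h) / φ (den h).
have gE n d : d != 0 -> g (tofrac n / tofrac d) = φ n / φ d.
  move=> d0; rewrite /g; set h := tofrac n / _.
  have [e0 /eqP] := denP h; rewrite {1}/h.
  rewrite eqr_div ?tofrac_eq0 // -!tofracM tofrac_eq => /eqP E.
  by apply/eqP; rewrite eqr_div ?φ0 // -!rmorphM; apply/eqP; rewrite E.
have gB : zmod_morphism g.
  move=> h h'; have [n [d [d0 ->]]] := fracE h; have [n' [d' [d0' ->]]] := fracE h'.
  rewrite -mulNr addf_div ?tofrac_eq0 // -tofracN -!tofracM -tofracD.
  rewrite !gE ?mulf_neq0 //.
  by rewrite -[in RHS]mulNr addf_div ?φ0 // rmorphD !rmorphM rmorphN.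
have gM : monoid_morphism g.
  split.
    by rewrite -[1]divr1 -tofrac1 gE ?oner_neq0 // rmorph1 divr1.
  move=> h h'; have [n [d [d0 ->]]] := fracE h; have [n' [d' [d0' ->]]] := fracE h'.
  by rewrite mulf_div -!tofracM !gE ?mulf_neq0 // !rmorphM /= mulf_div.
pose M1 := GRing.isZmodMorphism.Build {fraction R} F g gB.
pose M2 := GRing.isMonoidMorphism.Build {fraction R} F g gM.
pose G : {rmorphism {fraction R} -> F} := HB.pack g M1 M2.
exists G => x; rewrite -[tofrac x]divr1 -tofrac1 /G /=.
by rewrite gE ?oner_neq0 // rmorph1 divr1.
Qed.

End FracLift.

Section FracImage.
Variables (R : idomainType) (F : fieldType) (φ : {rmorphism R -> F}).
Hypothesis φ_inj : injective φ.

Definition frac_image (h : F) : Prop := exists A B : R, B != 0 /\ h = φ A / φ B.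

Let φ0 (A : R) : A != 0 -> φ A != 0.
Proof. by apply: contra_neq => E; apply: φ_inj; rewrite E rmorph0. Qed.

Lemma frac_image_in A : frac_image (φ A).
Proof. by exists A, 1; rewrite oner_neq0 rmorph1 divr1. Qed.
Lemma frac_imageB g h : frac_image g -> frac_image h -> frac_image (g - h).
Proof.
move=> [A [B [B0 ->]]] [A' [B' [B0' ->]]]; exists (A * B' - A' * B), (B * B').
split; first exact: mulf_neq0.
rewrite rmorphB !rmorphM /=; have := φ0 B0; have := φ0 B0'.
by move: (φ A) (φ B) (φ A') (φ B') => p q p' q' q0' q0; field; rewrite q0 q0'.
Qed.
Lemma frac_imageM g h : frac_image g -> frac_image h -> frac_image (g * h).
Proof.
move=> [A [B [B0 ->]]] [A' [B' [B0' ->]]]; exists (A * A'), (B * B').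
by split; [exact: mulf_neq0 | rewrite !rmorphM /= mulf_div].
Qed.
Lemma frac_imageV g : frac_image g -> frac_image g^-1.
Proof.
move=> [A [B [B0 ->]]]; rewrite invf_div.
case: (eqVneq A 0) => [->|A0]; last by exists B, A.
by rewrite rmorph0 invr0 mulr0 -(rmorph0 φ); exact: frac_image_in.
Qed.
End FracImage.

(** * Residues and centres of valuations on the plane *)

Section Residue.
Variables (k : closedFieldType) (F : fieldType) (κ : {rmorphism k -> F}).
Variable O : F -> Prop.
Hypotheses (vO : valring O) (kO : forall c, O (κ c)).
Local Notation m := (maxid O).
Let sO := valring_subring vO.

Definition res (h : F) (r : k) : Prop := m (h - κ r).

Lemma res_in h r : res h r -> O h.
Proof.
by move=> /maxid_in Or; rewrite -[h](subrK (κ r)); exact: (subringD sO).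
Qed.

Lemma res_cst r : res (κ r) r.
Proof. by rewrite /res subrr; exact: maxid0. Qed.

Lemma resD h h' r r' : res h r -> res h' r' -> res (h + h') (r + r').
Proof.
move=> H H'; rewrite /res rmorphD.
have -> : h + h' - (κ r + κ r') = (h - κ r) + (h' - κ r') by ring.
exact: (maxidD vO).
Qed.

Lemma resM h h' r r' : res h r -> res h' r' -> res (h * h') (r * r').
Proof.
move=> H H'; rewrite /res rmorphM.
have -> : h * h' - κ r * κ r' = (h - κ r) * h' + κ r * (h' - κ r') by ring.
apply: (maxidD vO); first exact: maxidMr (res_in H').
by apply: maxidMl.
Qed.

Lemma resN h r : res h r -> res (- h) (- r).
Proof.
move=> H; rewrite /res rmorphN -opprD; exact: maxidNN.
Qed.

Lemma resB h h' r r' : res h r -> res h' r' -> res (h - h') (r - r').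
Proof. by move=> H H'; apply: resD => //; exact: resN. Qed.

Lemma resX h r n : res h r -> res (h ^+ n) (r ^+ n).
Proof.
move=> H; elim: n => [|n IH]; last by rewrite !exprS; exact: resM.
by rewrite !expr0 -(rmorph1 κ); exact: res_cst.
Qed.

Lemma resMn n : res n%:R n%:R.
Proof. by rewrite -(rmorph_nat κ); exact: res_cst. Qed.

Lemma res1 : res 1 1. Proof. exact: (resMn 1). Qed.

Lemma res0 h : res h 0 <-> m h.
Proof. by rewrite /res rmorph0 subr0. Qed.

Lemma res_neq0 h r : res h r -> r != 0 -> ~ m h.
Proof.
move=> H r0 mh; apply: (@maxid1 _ _ vO).
have mr : m (κ r).
  by have := maxidB vO mh H; rewrite subKr.
rewrite -[1](@mulfV _ (κ r)) ?fmorph_eq0 //; apply: maxidMr => //.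
by rewrite -fmorphV.
Qed.

Lemma resV h r : res h r -> r != 0 -> res h^-1 r^-1.
Proof.
move=> H r0; have [h0 Oh1] := maxidN_unit vO (res_in H) (res_neq0 H r0).
have kr0 : κ r != 0 by rewrite fmorph_eq0.
rewrite /res fmorphV.
have -> : h^-1 - (κ r)^-1 = (h - κ r) * (- h^-1 * (κ r)^-1).
  by field; rewrite kr0 h0.
apply: maxidMr => //; apply: (valringM vO); first exact: (subringN sO).
by rewrite -fmorphV.
Qed.

Lemma res_div h h' r r' : res h r -> res h' r' -> r' != 0 -> res (h / h') (r / r').
Proof. by move=> H H' r0; apply: resM => //; exact: resV. Qed.

(** Over k a polynomial splits into linear factors, and none of them
    vanishes at u modulo m. *)
Lemma res_poly_unit (p : {poly k}) u : O u -> (forall r, ~ res u r) ->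
  p != 0 -> ~ m (map_poly κ p).[u].
Proof.
move=> Ou nu p0; have [s ps] := closed_field_poly_normal p.
rewrite ps map_polyZ rmorph_prod /= hornerZ horner_prod => mp.
have Os r : O (map_poly κ ('X - r%:P)).[u].
  rewrite rmorphB /= map_polyX map_polyC /= !hornerE.
  exact: (valringB vO).
case: (maxidM_prime vO _ _ mp) => //.
- by elim/big_rec: _ => [|i x _ Ox]; [exact: valring1 | apply: (valringM vO)].
- apply: res_neq0 (res_cst _) _; by rewrite lead_coef_eq0.
- move=> /(maxid_prod_prime vO Os)[r].
  rewrite rmorphB /= map_polyX map_polyC /= !hornerE; exact: nu.
Qed.

End Residue.

Definition cubic_at (R : comNzRingType) (a x y z : R) : R :=
  a * (x ^+ 3 + y ^+ 3 + z ^+ 3) - (a ^+ 3 + 2%:R) * (x * y * z).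
Definition sextic_at (R : comNzRingType) (a x y z : R) : R :=
  (x * y - a * z ^+ 2) * (x * z - a * y ^+ 2) * (y * z - a * x ^+ 2).
(** The conic and the line pass, together, through all the base points
    except (a : 1 : 1); therefore the quotient of this form by the cubic has
    its only pole over that point. *)
Definition nodal_cubic_at (R : comNzRingType) (a x y z : R) : R :=
  (y * z - a * x ^+ 2) * (x + a * y + a * z).

(** The base points, when v runs over the cube roots of unity. *)
Definition std_pt (R : comNzRingType) (a : R) (r : nat) (v : R) : R * R * R :=
  match r with
  | 0 => (v * a, v ^+ 2, 1)
  | 1 => (v, v ^+ 2 * a, 1)
  | _ => (v, v ^+ 2, a)
  end.

Section Center.
Variables (k : closedFieldType) (F : fieldType) (κ : {rmorphism k -> F}).
Variable O : F -> Prop.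
Hypotheses (vO : valring O) (kO : forall c, O (κ c)).
Variables (a eps : k).
Hypotheses (a0 : a != 0) (eps0 : eps ^+ 2 + eps + 1 = 0).
Local Notation m := (maxid O).
Local Notation A := (κ a).
Local Notation E := (κ eps).
Let sO := valring_subring vO.

Let A0 : A != 0. Proof. by rewrite fmorph_eq0. Qed.

Lemma maxid_cst_cancel c h : c != 0 -> O h -> m (κ c * h) -> m h.
Proof.
move=> c0 Oh mh.
have -> : h = (κ c)^-1 * (κ c * h) by rewrite mulKf // fmorph_eq0.
by apply: maxidMl => //; rewrite -fmorphV.
Qed.

(** Eliminating X between the cubic and the conic X Y = a Z^2 leaves a
    (Y^3 - Z^3) (Y^3 - a^3 Z^3), whose six linear factors correspond to the
    six base points on that conic. *)
Lemma conic_center X Y Z : O X -> O Y -> O Z -> ~ [/\ m X, m Y & m Z] ->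
  m (X * Y - A * Z ^+ 2) -> m (cubic_at A X Y Z) ->
  ~ m Z /\ exists2 v, v ^+ 3 = 1 &
    (m (X - κ v * A * Z) /\ m (Y - κ v ^+ 2 * Z)) \/
    (m (X - κ v * Z) /\ m (Y - κ v ^+ 2 * A * Z)).
Proof.
move=> OX OY OZ nXYZ mq mc.
have OA : O A by [].
have OX' n : O (X ^+ n) by exact: (subringX sO).
have OY' n : O (Y ^+ n) by exact: (subringX sO).
have OZ' n : O (Z ^+ n) by exact: (subringX sO).
have nZ : ~ m Z.
  move=> mZ.
  have mXY : m (X * Y).
    have -> : X * Y = (X * Y - A * Z ^+ 2) + Z * (A * Z) by ring.
    by apply: (maxidD vO) => //; apply: maxidMr => //; exact: (valringM vO).
  have OA3 : O ((A ^+ 3 + 2) * (X * Y)).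
    apply: (valringM vO); last exact: (valringM vO).
    by apply: (subringD sO); [apply: (subringX sO) | exact: (subringMn sO 2)].
  have mXY3 : m (A * (X ^+ 3 + Y ^+ 3)).
    have -> : A * (X ^+ 3 + Y ^+ 3) = cubic_at A X Y Z
       + Z * ((A ^+ 3 + 2) * (X * Y) - A * Z ^+ 2) by rewrite /cubic_at; ring.
    apply: (maxidD vO) => //; apply: maxidMr => //; apply: (valringB vO) => //.
    exact: (valringM vO).
  have {}mXY3 : m (X ^+ 3 + Y ^+ 3) by apply: maxid_cst_cancel mXY3 => //; exact: (subringD sO).
  apply: nXYZ; case: (maxidM_prime vO OX OY mXY) => mX; split=> //.
    apply: (maxidX_prime vO (n := 3)) => //.
    have -> : Y ^+ 3 = (X ^+ 3 + Y ^+ 3) - X * X ^+ 2 by ring.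
    by apply: (maxidB vO) => //; exact: maxidMr.
  apply: (maxidX_prime vO (n := 3)) => //.
  have -> : X ^+ 3 = (X ^+ 3 + Y ^+ 3) - Y * Y ^+ 2 by ring.
  by apply: (maxidB vO) => //; exact: maxidMr.
split=> //.
have E2 : E ^+ 2 + E + 1 = 0.
  by rewrite -(rmorphXn κ) -rmorphD /= -(rmorph1 κ) -rmorphD eps0 rmorph0.
have e3 : eps ^+ 3 = 1.
  apply/eqP; rewrite -subr_eq0; apply/eqP.
  have -> : eps ^+ 3 - 1 = (eps ^+ 2 + eps + 1) * (eps - 1) by ring.
  by rewrite eps0 mul0r.
pose roots : seq k := [:: 1; eps; eps ^+ 2; a; a * eps; a * eps ^+ 2].
have mprod : m (\prod_(w <- roots) (Y - κ w * Z)).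
  rewrite /roots !big_cons big_nil !(rmorphXn, rmorphM, rmorph1) /=.
  apply: (@maxid_cst_cancel a) => //.
    have OZk c : O (Y - c * Z) <-> O (Y - c * Z) by [].
    have Ol c : O (κ c) -> O (Y - κ c * Z).
      by move=> Oc; apply: (valringB vO) => //; exact: (valringM vO).
    rewrite -{1}(rmorph1 κ) -(rmorphXn κ) -!(rmorphM κ).
    by do 5!(apply: (valringM vO); first exact: Ol); rewrite mulr1; exact: Ol.
  have -> : A * ((Y - 1 * Z) * ((Y - E * Z) * ((Y - E ^+ 2 * Z) *
     ((Y - A * Z) * ((Y - A * E * Z) * ((Y - A * E ^+ 2 * Z) * 1)))))) =
     A * (Y ^+ 3 - Z ^+ 3) * (Y ^+ 3 - A ^+ 3 * Z ^+ 3).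
    have -> : E ^+ 2 = - E - 1 by rewrite -[RHS]addr0 -E2; ring.
    have K (T : F) : (Y - T) * ((Y - E * T) * (Y - (- E - 1) * T)) = Y ^+ 3 - T ^+ 3.
      have -> : (Y - T) * ((Y - E * T) * (Y - (- E - 1) * T)) =
        Y ^+ 3 - T ^+ 3 + (E ^+ 2 + E + 1) * (T ^+ 3 - Y * T ^+ 2) by ring.
      by rewrite E2 mul0r addr0.
    by rewrite -exprMn -!K; ring.
  have -> : A * (Y ^+ 3 - Z ^+ 3) * (Y ^+ 3 - A ^+ 3 * Z ^+ 3) =
    Y ^+ 3 * cubic_at A X Y Z - (X * Y - A * Z ^+ 2) *
     (A * (X ^+ 2 * Y ^+ 2 + X * Y * A * Z ^+ 2 + A ^+ 2 * Z ^+ 4)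
      - (A ^+ 3 + 2) * Y ^+ 3 * Z) by rewrite /cubic_at; ring.
  apply: (maxidB vO); first exact: maxidMl.
  apply: maxidMr => //.
  have OA2 n : O (A ^+ n) by exact: (subringX sO).
  have O2 : O 2%:R by exact: (subringMn sO).
  by do !first [assumption | exact: OA2 | exact: OX' | exact: OY' | exact: OZ'
     | apply: (valringB vO) | apply: (subringD sO) | apply: (valringM vO)].
have OkZ w : O (Y - κ w * Z).
  by apply: (valringB vO) => //; exact: (valringM vO).
have [w rw mw] : exists2 w, w \in roots & m (Y - κ w * Z).
  move: mprod; elim: (roots) => [|w r IH]; first by rewrite big_nil => /(maxid1 vO).
  rewrite big_cons => /(maxidM_prime vO)[] //.
  - by elim/big_rec: _ => [|i x _ Ox]; [exact: valring1 | apply: (valringM vO)].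
  - by exists w; rewrite ?mem_head.
  - by move=> /IH[w' rw' mw']; exists w'; rewrite ?inE ?rw' ?orbT.
have key : m (κ w * X - A * Z).
  have : m (Z * (κ w * X - A * Z)).
    have -> : Z * (κ w * X - A * Z) = (X * Y - A * Z ^+ 2) - X * (Y - κ w * Z) by ring.
    by apply: (maxidB vO) => //; exact: maxidMl.
  case/(maxidM_prime vO) => //; apply: (valringB vO); exact: (valringM vO).
have case1 v : v ^+ 3 = 1 -> w = v -> exists2 v, v ^+ 3 = 1 &
    (m (X - κ v * A * Z) /\ m (Y - κ v ^+ 2 * Z)) \/
    (m (X - κ v * Z) /\ m (Y - κ v ^+ 2 * A * Z)).
  move=> v3 Ew; rewrite {}Ew in key mw.
  have V3 : κ v ^+ 3 = 1 by rewrite -rmorphXn v3 rmorph1.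
  exists (v ^+ 2); first by rewrite exprAC v3 expr1n.
  left; rewrite rmorphXn /=; split.
    have -> : X - κ v ^+ 2 * A * Z = κ v ^+ 2 * (κ v * X - A * Z) - (κ v ^+ 3 - 1) * X by ring.
    rewrite V3 subrr mul0r subr0; apply: maxidMl => //; exact: (subringX sO).
  have -> : Y - (κ v ^+ 2) ^+ 2 * Z = (Y - κ v * Z) - (κ v ^+ 3 - 1) * κ v * Z by ring.
  by rewrite V3 subrr !mul0r subr0.
have case2 v : v ^+ 3 = 1 -> w = a * v -> exists2 v, v ^+ 3 = 1 &
    (m (X - κ v * A * Z) /\ m (Y - κ v ^+ 2 * Z)) \/
    (m (X - κ v * Z) /\ m (Y - κ v ^+ 2 * A * Z)).
  move=> v3 Ew; rewrite {}Ew rmorphM /= in key mw.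
  have V3 : κ v ^+ 3 = 1 by rewrite -rmorphXn v3 rmorph1.
  have {}key : m (κ v * X - Z).
    apply: (@maxid_cst_cancel a) => //.
      by apply: (valringB vO) => //; exact: (valringM vO).
    by rewrite mulrBr mulrA.
  exists (v ^+ 2); first by rewrite exprAC v3 expr1n.
  right; rewrite rmorphXn /=; split.
    have -> : X - κ v ^+ 2 * Z = κ v ^+ 2 * (κ v * X - Z) - (κ v ^+ 3 - 1) * X by ring.
    rewrite V3 subrr mul0r subr0; apply: maxidMl => //; exact: (subringX sO).
  have -> : Y - (κ v ^+ 2) ^+ 2 * A * Z = (Y - A * κ v * Z) - (κ v ^+ 3 - 1) * κ v * A * Z by ring.
  by rewrite V3 subrr !mul0r subr0.
move: rw; rewrite !inE => /or4P[/eqP|/eqP|/eqP|/or3P[/eqP|/eqP|/eqP]].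
- by apply: case1; rewrite expr1n.
- exact: case1.
- by apply: case1; rewrite exprAC e3 expr1n.
- by move=> Ew; apply: (case2 1); rewrite ?expr1n ?mulr1.
- exact: case2.
- by apply: case2; rewrite exprAC e3 expr1n.
Qed.

(** The other two conics are obtained from X Y = a Z^2 by permutations of
    the coordinates, which preserve the cubic. *)
Lemma base_center X Y Z : O X -> O Y -> O Z -> ~ [/\ m X, m Y & m Z] ->
  m (cubic_at A X Y Z) -> m (sextic_at A X Y Z) ->
  exists r v, [/\ v ^+ 3 = 1, ~ m Z &
    let: (p0, p1, p2) := std_pt a r v in
    m (κ p2 * X - κ p0 * Z) /\ m (κ p2 * Y - κ p1 * Z)].
Proof.
move=> OX OY OZ nXYZ mc ms.
have OA : O A by [].
have OX' n : O (X ^+ n) by exact: (subringX sO).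
have OY' n : O (Y ^+ n) by exact: (subringX sO).
have OZ' n : O (Z ^+ n) by exact: (subringX sO).
have O1 : O (X * Y - A * Z ^+ 2) by apply: (valringB vO); apply: (valringM vO).
have O2 : O (X * Z - A * Y ^+ 2) by apply: (valringB vO); apply: (valringM vO).
have O3 : O (Y * Z - A * X ^+ 2) by apply: (valringB vO); apply: (valringM vO).
have nZ' (U W : F) : O U -> O W -> forall v, v ^+ 3 = 1 -> m (W - κ v * U) -> ~ m U -> ~ m W.
  move=> OU OW v v3 mW nU mW'; apply: nU.
  have v0 : v != 0 by apply: contra_eq_neq v3 => ->; rewrite expr0n eq_sym oner_eq0.
  apply: (maxid_cst_cancel v0) => //.
  have -> : κ v * U = W - (W - κ v * U) by ring.
  exact: (maxidB vO).
have Ok2 v : O (κ v ^+ 2) by rewrite -rmorphXn.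
have [{}ms|{}ms] := maxidM_prime vO (valringM vO O1 O2) O3 ms.
  have [{}ms|{}ms] := maxidM_prime vO O1 O2 ms.
    have [nZ [v v3 H]] := conic_center OX OY OZ nXYZ ms mc.
    case: H => -[mX mY]; [exists 0, v | exists 1, v]; split=> //=;
      by rewrite rmorph1 !mul1r !(rmorphXn, rmorphM).
  have mc' : m (cubic_at A X Z Y).
    have -> // : cubic_at A X Z Y = cubic_at A X Y Z by rewrite /cubic_at; ring.
  have nXZY : ~ [/\ m X, m Z & m Y] by case=> *; apply: nXYZ.
  have [nY [v v3 H]] := conic_center OX OZ OY nXZY ms mc'.
  have V3 : κ v ^+ 3 = 1 by rewrite -rmorphXn v3 rmorph1.
  case: H => -[mX mZ].
    have mY : m (Y - κ v * Z).
      have -> : Y - κ v * Z = - (κ v * (Z - κ v ^+ 2 * Y)) - (κ v ^+ 3 - 1) * Y by ring.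
      by rewrite V3 subrr mul0r subr0; apply: maxidNN => //; exact: maxidMl.
    exists 0, (v ^+ 2); split=> /=; first by rewrite exprAC v3 expr1n.
      by apply: (nZ' Y Z _ _ (v ^+ 2)) => //; rewrite ?rmorphXn // exprAC v3 expr1n.
    rewrite rmorph1 !mul1r !(rmorphXn, rmorphM) /=; split.
      have -> : X - κ v ^+ 2 * A * Z = (X - κ v * A * Y) + κ v * A * (Y - κ v * Z) by ring.
      apply: (maxidD vO) => //; apply: maxidMl => //; exact: (valringM vO).
    have -> : Y - (κ v ^+ 2) ^+ 2 * Z = (Y - κ v * Z) - (κ v ^+ 3 - 1) * κ v * Z by ring.
    by rewrite V3 subrr !mul0r subr0.
  have mY : m (A * Y - κ v * Z).
    have -> : A * Y - κ v * Z = - (κ v * (Z - κ v ^+ 2 * A * Y)) - (κ v ^+ 3 - 1) * (A * Y) by ring.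
    by rewrite V3 subrr mul0r subr0; apply: maxidNN => //; exact: maxidMl.
  exists 2, (v ^+ 2); split=> /=; first by rewrite exprAC v3 expr1n.
    move=> mZ'; apply: nY; apply: (maxid_cst_cancel a0) => //.
    have -> : A * Y = (A * Y - κ v * Z) + κ v * Z by ring.
    by apply: (maxidD vO) => //; exact: maxidMl.
  rewrite !rmorphXn /=; split.
    have -> : A * X - κ v ^+ 2 * Z = A * (X - κ v * Y) + κ v * (A * Y - κ v * Z) by ring.
    by apply: (maxidD vO) => //; apply: maxidMl.
  have -> : A * Y - (κ v ^+ 2) ^+ 2 * Z = (A * Y - κ v * Z) - (κ v ^+ 3 - 1) * κ v * Z by ring.
  by rewrite V3 subrr !mul0r subr0.
have mc' : m (cubic_at A Y Z X).
  have -> // : cubic_at A Y Z X = cubic_at A X Y Z by rewrite /cubic_at; ring.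
have nYZX : ~ [/\ m Y, m Z & m X] by case=> *; apply: nXYZ.
have [nX [v v3 H]] := conic_center OY OZ OX nYZX ms mc'.
have V3 : κ v ^+ 3 = 1 by rewrite -rmorphXn v3 rmorph1.
case: H => -[mY mZ].
  have mX : m (X - κ v * Z).
    have -> : X - κ v * Z = - (κ v * (Z - κ v ^+ 2 * X)) - (κ v ^+ 3 - 1) * X by ring.
    by rewrite V3 subrr mul0r subr0; apply: maxidNN => //; exact: maxidMl.
  exists 1, v; split=> //=.
    by apply: (nZ' X Z _ _ (v ^+ 2)) => //; rewrite ?rmorphXn // exprAC v3 expr1n.
  rewrite rmorph1 !mul1r !(rmorphXn, rmorphM) /=; split=> //.
  have -> : Y - κ v ^+ 2 * A * Z = (Y - κ v * A * X) + κ v * A * (X - κ v * Z) by ring.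
  apply: (maxidD vO) => //; apply: maxidMl => //; exact: (valringM vO).
have mX : m (A * X - κ v * Z).
  have -> : A * X - κ v * Z = - (κ v * (Z - κ v ^+ 2 * A * X)) - (κ v ^+ 3 - 1) * (A * X) by ring.
  by rewrite V3 subrr mul0r subr0; apply: maxidNN => //; exact: maxidMl.
exists 2, v; split=> //=.
  move=> mZ'; apply: nX; apply: (maxid_cst_cancel a0) => //.
  have -> : A * X = (A * X - κ v * Z) + κ v * Z by ring.
  by apply: (maxidD vO) => //; exact: maxidMl.
rewrite !rmorphXn /=; split=> //.
have -> : A * Y - κ v ^+ 2 * Z = A * (Y - κ v * X) + κ v * (A * X - κ v * Z) by ring.
by apply: (maxidD vO) => //; apply: maxidMl.
Qed.

End Center.

(** * Poles of the nodal cubic over the cubic of the pencil *)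

Section Local.
Variables (k : closedFieldType) (F : fieldType) (κ : {rmorphism k -> F}).
Variable O : F -> Prop.
Hypotheses (vO : valring O) (kO : forall c, O (κ c)).
Local Notation m := (maxid O).
Local Notation res := (res κ O).
Let sO := valring_subring vO.

Variable f : F.
Hypotheses (Of : O f) (f_nres : forall r, ~ res f r).

(** At a base point with local coordinates β and γ, the cubic is c1 β + c2 γ
    and the sextic is the product of a1 β + a2 γ, b1 β + b2 γ and a unit q.
    The residues of the coefficients are the tangents; detA and detB say
    that the cubic is not tangent to the conics. *)
Section Tangents.
Variables (β γ c1 c2 a1 a2 b1 b2 q : F) (C1 C2 A1 A2 B1 B2 Q : k).
Hypotheses (rc1 : res c1 C1) (rc2 : res c2 C2) (ra1 : res a1 A1) (ra2 : res a2 A2)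
  (rb1 : res b1 B1) (rb2 : res b2 B2) (rq : res q Q).
Hypotheses (Q0 : Q != 0) (detA : C1 * A2 - C2 * A1 != 0) (detB : C1 * B2 - C2 * B1 != 0).
Local Notation c := (c1 * β + c2 * γ).
Hypothesis c_neq0 : c != 0.
Hypothesis fE : f * c ^+ 2 = - ((a1 * β + a2 * γ) * (b1 * β + b2 * γ) * q).

(** (β' : γ') is the direction at the base point in which the valuation is
    centred, and two linear forms with independent residues have no common
    zero among the directions. *)
Lemma tangent_indep (d1 d2 D1 D2 : k) (x1 x2 β' γ' : F) :
  O β' -> O γ' -> β' = 1 \/ γ' = 1 -> res x1 D1 -> res x2 D2 ->
  C1 * D2 - C2 * D1 != 0 -> m (c1 * β' + c2 * γ') -> ~ m (x1 * β' + x2 * γ').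
Proof.
move=> Oβ Oγ one rx1 rx2 det mc mx.
have rdet := resB vO (resM vO kO rc1 rx2) (resM vO kO rc2 rx1).
have nm := res_neq0 vO kO rdet det.
case: one => E; rewrite E in mc mx.
  apply: nm; have -> : c1 * x2 - c2 * x1 =
    x2 * (c1 * 1 + c2 * γ') - c2 * (x1 * 1 + x2 * γ') by ring.
  by apply: (maxidB vO); apply: maxidMl => //; [exact: res_in rx2|exact: res_in rc2].
apply: nm; have -> : c1 * x2 - c2 * x1 =
    c1 * (x1 * β' + x2 * 1) - x1 * (c1 * β' + c2 * 1) by ring.
by apply: (maxidB vO); apply: maxidMl => //; [exact: res_in rc1|exact: res_in rx1].
Qed.

Section Ratio.
Variable μ : F.
Hypotheses (μ0 : μ != 0) (Oβ : O (β / μ)) (Oγ : O (γ / μ)) (one : β / μ = 1 \/ γ / μ = 1).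
Local Notation c' := (c1 * (β / μ) + c2 * (γ / μ)).

Let fE' : f * c' ^+ 2 =
  - ((a1 * (β / μ) + a2 * (γ / μ)) * (b1 * (β / μ) + b2 * (γ / μ)) * q).
Proof.
have -> : c' = c / μ by field.
have -> : (a1 * (β / μ) + a2 * (γ / μ)) = (a1 * β + a2 * γ) / μ by field.
have -> : (b1 * (β / μ) + b2 * (γ / μ)) = (b1 * β + b2 * γ) / μ by field.
have -> : f * (c / μ) ^+ 2 = (f * c ^+ 2) / μ ^+ 2 by field.
by rewrite fE; field.
Qed.

Let Olin x1 x2 : O x1 -> O x2 -> O (x1 * (β / μ) + x2 * (γ / μ)).
Proof. by move=> O1 O2; apply: (subringD sO); apply: (valringM vO). Qed.

(** If c' vanished in the direction of the valuation, then by the equation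
    of f one of the two conics would vanish in the same direction, in
    contradiction with tangent_indep. *)
Lemma cubic_unit : ~ m c'.
Proof.
move=> mc.
have [[Oa1 Oa2] [Ob1 Ob2]] : (O a1 /\ O a2) /\ (O b1 /\ O b2).
  by split; split; [exact: res_in ra1|exact: res_in ra2|exact: res_in rb1|exact: res_in rb2].
have : m (- (f * c' ^+ 2)).
  by apply: (maxidNN vO); apply: maxidMl => //; rewrite expr2; apply: maxidMl => //; case: mc.
rewrite fE' opprK => /(maxidM_prime vO (valringM vO (Olin Oa1 Oa2) (Olin Ob1 Ob2)) (res_in vO kO rq)).
case=> [|mq]; last by exact: (res_neq0 vO kO rq Q0 mq).
case/(maxidM_prime vO (Olin Oa1 Oa2) (Olin Ob1 Ob2)).
  exact: tangent_indep ra1 ra2 detA mc.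
exact: tangent_indep rb1 rb2 detB mc.
Qed.

Let Oc' : O c'. Proof. by apply: Olin; [exact: res_in rc1 | exact: res_in rc2]. Qed.

Lemma vanish_div d1 d2 : O d1 -> O d2 -> O ((d1 * β + d2 * γ) / c).
Proof.
move=> O1 O2; have [c0 Oci] := maxidN_unit vO Oc' cubic_unit.
have -> : (d1 * β + d2 * γ) / c = (d1 * (β / μ) + d2 * (γ / μ)) * (c')^-1.
  have E : c' = c / μ by field.
  by rewrite E; field; rewrite c_neq0 μ0.
by apply: (valringM vO) => //; exact: Olin.
Qed.

(** A direction with coordinates in k would give f a residue in k. *)
Lemma ratio_nres r r' : res (β / μ) r -> res (γ / μ) r' -> False.
Proof.
move=> rβ rγ.
have rc := resD vO (resM vO kO rc1 rβ) (resM vO kO rc2 rγ).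
have R0 : C1 * r + C2 * r' != 0.
  by apply/eqP => E; apply: cubic_unit; apply/(res0 κ); rewrite -E.
have ra := resD vO (resM vO kO ra1 rβ) (resM vO kO ra2 rγ).
have rb := resD vO (resM vO kO rb1 rβ) (resM vO kO rb2 rγ).
have [c0 _] := maxidN_unit vO Oc' cubic_unit.
have R20 : (C1 * r + C2 * r') ^+ 2 != 0 by rewrite expf_neq0.
have := res_div vO kO (resN vO (resM vO kO (resM vO kO ra rb) rq)) (resX vO kO 2 rc) R20.
by rewrite -fE' mulfK ?expf_neq0 //; exact: f_nres.
Qed.

End Ratio.

Lemma local_chart : O β -> O γ -> exists μ, [/\ μ != 0, O (β / μ), O (γ / μ) & β / μ = 1 \/ γ / μ = 1].
Proof.
move=> Oβ Oγ; case: (eqVneq γ 0) => [γ0|γ0].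
  have β0 : β != 0.
    by apply: contraNneq c_neq0 => ->; rewrite γ0 !mulr0 addr0.
  exists β; rewrite γ0 mul0r divff //; split=> //; [exact: valring1|exact: subring0 sO|by left].
case: (eqVneq β 0) => [β0|β0].
  exists γ; rewrite β0 mul0r divff //; split=> //; [exact: subring0 sO|exact: valring1|by right].
case: (valring_tot vO (β / γ)) => H.
  by exists γ; rewrite divff //; split=> //; [exact: valring1|right].
exists β; rewrite divff //; split=> //; [exact: valring1| |by left].
by rewrite invf_div in H.
Qed.

(** After division by the generator μ of the ideal (β, γ) the cubic is a
    unit (cubic_unit), and the numerator is still integral. *)
Lemma vanish_div_cubic d1 d2 : O β -> O γ -> O d1 -> O d2 -> O ((d1 * β + d2 * γ) / c).
Proof.
move=> Oβ Oγ O1 O2; have [μ [μ0 H1 H2 H3]] := local_chart Oβ Oγ.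
exact: (vanish_div μ0 H1 H2 H3).
Qed.

(** The cases β = 0 and γ / β not integral are those of a direction with
    coordinates in k, which ratio_nres excludes. *)
Lemma slope_nres : O β -> O γ -> [/\ β != 0, O (γ / β) & forall r, ~ res (γ / β) r].
Proof.
move=> Oβ Oγ; case: (eqVneq β 0) => [β0|β0].
  have γ0 : γ != 0.
    by apply: contraNneq c_neq0 => ->; rewrite β0 !mulr0 addr0.
  case: (@ratio_nres γ γ0 _ _ _ 0 1).
  - by rewrite β0 mul0r; exact: subring0 sO.
  - by rewrite divff //; exact: valring1.
  - by right; rewrite divff.
  - by rewrite β0 mul0r; apply/res0; exact: maxid0.
  - by rewrite divff //; exact: res1.
have [Oγβ|nO] := classic (O (γ / β)).
  split=> // r rr; apply: (@ratio_nres β β0 _ Oγβ _ 1 r) => //.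
  - by rewrite divff //; exact: valring1.
  - by left; rewrite divff.
  - by rewrite divff //; exact: res1.
have γ0 : γ != 0.
  by apply: contra_notN nO => /eqP->; rewrite mul0r; exact: subring0 sO.
have := valringVn vO nO; rewrite invf_div => mβγ.
case: (@ratio_nres γ γ0 _ _ _ 0 1).
- exact: maxid_in mβγ.
- by rewrite divff //; exact: valring1.
- by right; rewrite divff.
- by apply/res0.
- by rewrite divff //; exact: res1.
Qed.

End Tangents.
End Local.

Section CenterMain.
Variables (k : closedFieldType) (F : fieldType) (κ : {rmorphism k -> F}).
Variable O : F -> Prop.
Hypotheses (vO : valring O) (kO : forall c, O (κ c)).
Local Notation m := (maxid O).
Local Notation res := (res κ O).
Let sO := valring_subring vO.

Variable f : F.
Hypotheses (Of : O f) (f_nres : forall r, ~ res f r).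

Variables (a eps : k).
Hypotheses (a0 : a != 0) (eps0 : eps ^+ 2 + eps + 1 = 0) (three0 : 3%:R != 0 :> k).
Hypothesis a3 : a ^+ 3 != 1.
Local Notation A := (κ a).

(** Divide by a coordinate of smallest valuation. *)
Lemma min_coord (x y z : F) : ~ [/\ x = 0, y = 0 & z = 0] ->
  exists w, [/\ w != 0, O (x / w), O (y / w), O (z / w) &
    ~ [/\ m (x / w), m (y / w) & m (z / w)]].
Proof.
have O1 (w : F) : w != 0 -> O (w / w) by move=> w0; rewrite divff //; exact: valring1.
have N1 (w : F) : w != 0 -> ~ m (w / w) by move=> w0; rewrite divff //; exact: maxid1.
have two (u v : F) : ~ (u = 0 /\ v = 0) -> exists2 w, w = u \/ w = v &
    [/\ w != 0, O (u / w) & O (v / w)].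
  move=> uv; case: (eqVneq u 0) => [u0|u0].
    have v0 : v != 0 by apply/eqP => v0; apply: uv.
    by exists v; [right|rewrite u0 mul0r; split=> //; [exact: subring0 sO|exact: O1]].
  case: (valring_tot vO (v / u)) => H.
    by exists u; [left|split=> //; exact: O1].
  case: (eqVneq v 0) => [v0|v0].
    by exists u; [left|rewrite v0 mul0r; split=> //; [exact: O1|exact: subring0 sO]].
  by exists v; [right|split=> //; [rewrite -invf_div|exact: O1]].
move=> nz; case: (eqVneq x 0) => [x0|x0].
  have [w E [w0 Oy Oz]] : exists2 w, w = y \/ w = z & [/\ w != 0, O (y / w) & O (z / w)].
    by apply: two => -[y0 z0]; apply: nz.
  exists w; rewrite x0 mul0r; split=> //; first exact: subring0 sO.
  by move=> [_ my mz]; case: E => E; [apply: (N1 y)|apply: (N1 z)]; rewrite -?E // E in my mz *.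
have [w E [w0 Oy Ox]] : exists2 w, w = y \/ w = x & [/\ w != 0, O (y / w) & O (x / w)].
  by apply: two => -[_ x0']; rewrite x0' eqxx in x0.
have [u E' [u0 Ow Oz]] : exists2 u, u = w \/ u = z & [/\ u != 0, O (w / u) & O (z / u)].
  by apply: two => -[w0']; rewrite w0' eqxx in w0.
exists u; split=> //.
- have -> : x / u = (x / w) * (w / u) by rewrite mulrA mulfVK.
  exact: (valringM vO).
- have -> : y / u = (y / w) * (w / u) by rewrite mulrA mulfVK.
  exact: (valringM vO).
- move=> [mx my mz]; apply: (N1 u u0).
  by case: E' => E'; [case: E => E; move: (mx) (my); rewrite -E -E'|move: mz; rewrite -E'].
Qed.

Lemma cubic_scale (R : comNzRingType) (c s x y z : R) :
  cubic_at c (s * x) (s * y) (s * z) = s ^+ 3 * cubic_at c x y z.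
Proof. by rewrite /cubic_at; ring. Qed.
Lemma sextic_scale (R : comNzRingType) (c s x y z : R) :
  sextic_at c (s * x) (s * y) (s * z) = s ^+ 6 * sextic_at c x y z.
Proof. by rewrite /sextic_at; ring. Qed.
Lemma nodal_scale (R : comNzRingType) (c s x y z : R) :
  nodal_cubic_at c (s * x) (s * y) (s * z) = s ^+ 3 * nodal_cubic_at c x y z.
Proof. by rewrite /nodal_cubic_at; ring. Qed.

Variables β γ : F.
Hypotheses (rβ : res β 0) (rγ : res γ 0).
Local Notation "3" := (3%:R).
Local Notation "2" := (2%:R).

Ltac res_tac := do ! first [exact rβ | exact rγ | exact: (res_cst κ vO)
  | exact: (res1 κ vO) | exact: (resMn κ vO)
  | apply: (resX vO kO) | apply: (resB vO) | apply: (resM vO kO)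
  | apply: (resD vO) | apply: (resN vO) ].

(* Coefficients of β and γ in the cubic (c1, c2, with the residues C1, C2)
   and in the three conics, expanded at the point (P0, P1, P2). *)
Let c1 (P0 P1 P2 : F) := A * (3 * P0 ^+ 2 + 3 * P0 * β + β ^+ 2) - (A ^+ 3 + 2) * (P2 * P1).
Let c2 (P0 P1 P2 : F) := A * (3 * P1 ^+ 2 + 3 * P1 * γ + γ ^+ 2) - (A ^+ 3 + 2) * (P2 * (P0 + β)).
Let C1 (p0 p1 p2 : k) := a * (3 * p0 ^+ 2 + 3 * p0 * 0 + 0 ^+ 2) - (a ^+ 3 + 2) * (p2 * p1).
Let C2 (p0 p1 p2 : k) := a * (3 * p1 ^+ 2 + 3 * p1 * 0 + 0 ^+ 2) - (a ^+ 3 + 2) * (p2 * (p0 + 0)).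

Let rc1 p0 p1 p2 : res (c1 (κ p0) (κ p1) (κ p2)) (C1 p0 p1 p2).
Proof. rewrite /c1 /C1; res_tac. Qed.
Let rc2 p0 p1 p2 : res (c2 (κ p0) (κ p1) (κ p2)) (C2 p0 p1 p2).
Proof. rewrite /c2 /C2; res_tac. Qed.

Let cE (P0 P1 P2 : F) : cubic_at A (P0 + β) (P1 + γ) P2 =
  cubic_at A P0 P1 P2 + (c1 P0 P1 P2 * β + c2 P0 P1 P2 * γ).
Proof. by rewrite /cubic_at /c1 /c2; ring. Qed.

Let xy1 (P1 : F) := P1.
Let xy2 (P0 : F) := P0 + β.
Let xz1 (P2 : F) := P2.
Let xz2 (P1 : F) := - (A * (2 * P1 + γ)).
Let yz1 (P0 : F) := - (A * (2 * P0 + β)).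
Let yz2 (P2 : F) := P2.

Let xyE (P0 P1 P2 : F) : (P0 + β) * (P1 + γ) - A * P2 ^+ 2 =
  (P0 * P1 - A * P2 ^+ 2) + (xy1 P1 * β + xy2 P0 * γ).
Proof. by rewrite /xy1 /xy2; ring. Qed.
Let xzE (P0 P1 P2 : F) : (P0 + β) * P2 - A * (P1 + γ) ^+ 2 =
  (P0 * P2 - A * P1 ^+ 2) + (xz1 P2 * β + xz2 P1 * γ).
Proof. by rewrite /xz1 /xz2; ring. Qed.
Let yzE (P0 P1 P2 : F) : (P1 + γ) * P2 - A * (P0 + β) ^+ 2 =
  (P1 * P2 - A * P0 ^+ 2) + (yz1 P0 * β + yz2 P2 * γ).
Proof. by rewrite /yz1 /yz2; ring. Qed.

Let Oβ : O β := res_in vO kO rβ.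
Let Oγ : O γ := res_in vO kO rγ.
Let Ores h r : res h r -> O h := @res_in _ _ κ O vO kO h r.

Let a31 : a ^+ 3 - 1 != 0. Proof. by rewrite subr_eq0. Qed.

(** At each base point the determinants formed by the tangents of the cubic
    and of the two conics are multiples of 3 a (a^3 - 1), so that the
    results on tangents apply. The nodal cubic vanishes at all base points
    but (a : 1 : 1), and there vanish_div_cubic gives the first alternative;
    at (a : 1 : 1) slope_nres gives the second one. *)
Lemma nodal_div_at_base r v : v ^+ 3 = 1 ->
  let: (p0, p1, p2) := std_pt a r v in
  cubic_at A (κ p0 + β) (κ p1 + γ) (κ p2) != 0 ->
  f * cubic_at A (κ p0 + β) (κ p1 + γ) (κ p2) ^+ 2 =
    - sextic_at A (κ p0 + β) (κ p1 + γ) (κ p2) ->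
  O (nodal_cubic_at A (κ p0 + β) (κ p1 + γ) (κ p2) /
     cubic_at A (κ p0 + β) (κ p1 + γ) (κ p2)) \/
  [/\ r = 0%N, v = 1, β != 0, O (γ / β) & forall r, ~ res (γ / β) r].
Proof.
move=> v3; have V3 : κ v ^+ 3 = 1 by rewrite -rmorphXn v3 rmorph1.
have v0 : v != 0 by apply: contra_eq_neq v3 => ->; rewrite expr0n eq_sym oner_eq0.
have V3' : κ v ^+ 3 - 1 = 0 by rewrite V3 subrr.
have v3' : v ^+ 3 - 1 = 0 by rewrite v3 subrr.
have three_a : 3 * a != 0 by rewrite mulf_neq0.
case: r => [|[|r]] /=.
- have K0 : κ (v * a) = κ v * A by rewrite rmorphM.
  have K1 : κ (v ^+ 2) = κ v ^+ 2 by rewrite rmorphXn.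
  have ec : cubic_at A (κ (v * a)) (κ (v ^+ 2)) (κ 1) = 0.
    rewrite K0 K1 rmorph1 /cubic_at.
    have -> : A * ((κ v * A) ^+ 3 + (κ v ^+ 2) ^+ 3 + 1 ^+ 3) -
      (A ^+ 3 + 2) * (κ v * A * κ v ^+ 2 * 1) = A * (κ v ^+ 3 - 1) ^+ 2 by ring.
    by rewrite V3' expr0n mulr0.
  have exy : κ (v * a) * κ (v ^+ 2) - A * κ 1 ^+ 2 = 0.
    rewrite K0 K1 rmorph1.
    have -> : κ v * A * κ v ^+ 2 - A * 1 ^+ 2 = A * (κ v ^+ 3 - 1) by ring.
    by rewrite V3' mulr0.
  have exz : κ (v * a) * κ 1 - A * κ (v ^+ 2) ^+ 2 = 0.
    rewrite K0 K1 rmorph1.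
    have -> : κ v * A * 1 - A * (κ v ^+ 2) ^+ 2 = - A * κ v * (κ v ^+ 3 - 1) by ring.
    by rewrite V3' mulr0.
  rewrite /sextic_at cE ec add0r => cn0.
  rewrite (xyE (κ (v * a))) exy add0r (xzE (κ (v * a))) exz add0r => fE.
  set q := (κ (v ^+ 2) + γ) * κ 1 - A * (κ (v * a) + β) ^+ 2 in fE.
  have rq : res q ((v ^+ 2 + 0) * 1 - a * (v * a + 0) ^+ 2) by rewrite /q; res_tac.
  have q0 : (v ^+ 2 + 0) * 1 - a * (v * a + 0) ^+ 2 != 0.
    have -> : (v ^+ 2 + 0) * 1 - a * (v * a + 0) ^+ 2 = - v ^+ 2 * (a ^+ 3 - 1) by ring.
    by rewrite mulf_neq0 // oppr_eq0 expf_neq0.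
  have ra1 : res (xy1 (κ (v ^+ 2))) (v ^+ 2) by rewrite /xy1; res_tac.
  have ra2 : res (xy2 (κ (v * a))) (v * a + 0) by rewrite /xy2; res_tac.
  have rb1 : res (xz1 (κ 1)) 1 by rewrite /xz1; res_tac.
  have rb2 : res (xz2 (κ (v ^+ 2))) (- (a * (2 * v ^+ 2 + 0))) by rewrite /xz2; res_tac.
  have dA : C1 (v * a) (v ^+ 2) 1 * (v * a + 0) - C2 (v * a) (v ^+ 2) 1 * v ^+ 2 != 0.
    have -> : C1 (v * a) (v ^+ 2) 1 * (v * a + 0) - C2 (v * a) (v ^+ 2) 1 * v ^+ 2 =
      3 * a * (a ^+ 3 - 1) + (v ^+ 3 - 1) * (3 * a ^+ 4 - 3 * a * (v ^+ 3 + 1)).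
      by rewrite /C1 /C2; ring.
    by rewrite v3' mul0r addr0 mulf_neq0.
  have dB : C1 (v * a) (v ^+ 2) 1 * (- (a * (2 * v ^+ 2 + 0))) - C2 (v * a) (v ^+ 2) 1 * 1 != 0.
    have -> : C1 (v * a) (v ^+ 2) 1 * (- (a * (2 * v ^+ 2 + 0))) - C2 (v * a) (v ^+ 2) 1 * 1 =
      v * (- (3 * a * (a ^+ 3 - 1)) + (v ^+ 3 - 1) * (a - 4%:R * a ^+ 4)).
      by rewrite /C1 /C2; ring.
    by rewrite v3' mul0r addr0 mulf_neq0 // oppr_eq0 mulf_neq0.
  case: (eqVneq v 1) => [v1|v1].
    right; have [? ? ?] := slope_nres vO kO Of f_nres (rc1 _ _ _) (rc2 _ _ _) ra1 ra2 rb1 rb2 rq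
      q0 dA dB cn0 fE Oβ Oγ.
    by split.
  left; rewrite /nodal_cubic_at -/q.
  have vv : κ v ^+ 2 + κ v + 1 = 0.
    have : (v - 1) * (v ^+ 2 + v + 1) = 0 by rewrite -v3'; ring.
    move/eqP; rewrite mulf_eq0 subr_eq0 (negPf v1) /= => /eqP E.
    by rewrite -(rmorphXn κ) -rmorphD -(rmorph1 κ) -rmorphD /= E rmorph0.
  have -> : q * (κ (v * a) + β + A * (κ (v ^+ 2) + γ) + A * κ 1) = q * β + (q * A) * γ.
    rewrite K0 K1 rmorph1.
    have -> : q * (κ v * A + β + A * (κ v ^+ 2 + γ) + A * 1) =
      q * β + q * A * γ + q * A * (κ v ^+ 2 + κ v + 1) by ring.
    by rewrite vv mulr0 addr0.
  apply: (vanish_div_cubic vO kO Of (rc1 _ _ _) (rc2 _ _ _) ra1 ra2 rb1 rb2 rq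
      q0 dA dB cn0 fE Oβ Oγ); first exact: Ores rq.
  by apply: (valringM vO) => //; exact: Ores rq.
- have K1 : κ (v ^+ 2 * a) = κ v ^+ 2 * A by rewrite rmorphM rmorphXn.
  have ec : cubic_at A (κ v) (κ (v ^+ 2 * a)) (κ 1) = 0.
    rewrite K1 rmorph1 /cubic_at.
    have -> : A * (κ v ^+ 3 + (κ v ^+ 2 * A) ^+ 3 + 1 ^+ 3) -
      (A ^+ 3 + 2) * (κ v * (κ v ^+ 2 * A) * 1) =
      (κ v ^+ 3 - 1) * (A ^+ 4 * κ v ^+ 3 - A) by ring.
    by rewrite V3' mul0r.
  have exy : κ v * κ (v ^+ 2 * a) - A * κ 1 ^+ 2 = 0.
    rewrite K1 rmorph1.
    have -> : κ v * (κ v ^+ 2 * A) - A * 1 ^+ 2 = A * (κ v ^+ 3 - 1) by ring.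
    by rewrite V3' mulr0.
  have eyz : κ (v ^+ 2 * a) * κ 1 - A * κ v ^+ 2 = 0 by rewrite K1 rmorph1; ring.
  rewrite /sextic_at cE ec add0r => cn0.
  rewrite (xyE (κ v)) exy add0r (yzE (κ v)) eyz add0r => fE.
  set q := (κ v + β) * κ 1 - A * (κ (v ^+ 2 * a) + γ) ^+ 2 in fE.
  have rq : res q ((v + 0) * 1 - a * (v ^+ 2 * a + 0) ^+ 2) by rewrite /q; res_tac.
  have q0 : (v + 0) * 1 - a * (v ^+ 2 * a + 0) ^+ 2 != 0.
    have -> : (v + 0) * 1 - a * (v ^+ 2 * a + 0) ^+ 2 =
      - v * (a ^+ 3 - 1) - (v ^+ 3 - 1) * a ^+ 3 * v by ring.
    by rewrite v3' !mul0r subr0 mulf_neq0 // oppr_eq0.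
  have ra1 : res (xy1 (κ (v ^+ 2 * a))) (v ^+ 2 * a) by rewrite /xy1; res_tac.
  have ra2 : res (xy2 (κ v)) (v + 0) by rewrite /xy2; res_tac.
  have rb1 : res (yz1 (κ v)) (- (a * (2 * v + 0))) by rewrite /yz1; res_tac.
  have rb2 : res (yz2 (κ 1)) 1 by rewrite /yz2; res_tac.
  have dA : C1 v (v ^+ 2 * a) 1 * (v + 0) - C2 v (v ^+ 2 * a) 1 * (v ^+ 2 * a) != 0.
    have -> : C1 v (v ^+ 2 * a) 1 * (v + 0) - C2 v (v ^+ 2 * a) 1 * (v ^+ 2 * a) =
      - (3 * a * (a ^+ 3 - 1)) + (v ^+ 3 - 1) * (3 * a - 3 * a ^+ 4 * (v ^+ 3 + 1)).
      by rewrite /C1 /C2; ring.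
    by rewrite v3' mul0r addr0 oppr_eq0 mulf_neq0.
  have dB : C1 v (v ^+ 2 * a) 1 * 1 - C2 v (v ^+ 2 * a) 1 * (- (a * (2 * v + 0))) != 0.
    have -> : C1 v (v ^+ 2 * a) 1 * 1 - C2 v (v ^+ 2 * a) 1 * (- (a * (2 * v + 0))) =
      v ^+ 2 * (3 * a * (a ^+ 3 - 1) + (v ^+ 3 - 1) * (6%:R * a ^+ 4)).
      by rewrite /C1 /C2; ring.
    by rewrite v3' mul0r addr0 mulf_neq0 ?expf_neq0 // mulf_neq0.
  left; rewrite /nodal_cubic_at (yzE (κ v)) eyz add0r mulrDl ![_ * β * _]mulrAC ![_ * γ * _]mulrAC.
  have fE' : f * (c1 (κ v) (κ (v ^+ 2 * a)) (κ 1) * β + c2 (κ v) (κ (v ^+ 2 * a)) (κ 1) * γ) ^+ 2 =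
    - ((xy1 (κ (v ^+ 2 * a)) * β + xy2 (κ v) * γ) * (yz1 (κ v) * β + yz2 (κ 1) * γ) * q).
    by rewrite fE; ring.
  have OL : O (κ v + β + A * (κ (v ^+ 2 * a) + γ) + A * κ 1).
    by apply: (subringD sO); last exact: (valringM vO);
       apply: (subringD sO); [exact: (subringD sO)|apply: (valringM vO) => //; exact: (subringD sO)].
  by apply: (vanish_div_cubic vO kO Of (rc1 _ _ _) (rc2 _ _ _) ra1 ra2 rb1 rb2 rq
      q0 dA dB cn0 fE' Oβ Oγ); apply: (valringM vO) => //; [exact: Ores rb1|exact: Ores rb2].
- have K1 : κ (v ^+ 2) = κ v ^+ 2 by rewrite rmorphXn.
  have ec : cubic_at A (κ v) (κ (v ^+ 2)) A = 0.
    rewrite K1 /cubic_at.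
    have -> : A * (κ v ^+ 3 + (κ v ^+ 2) ^+ 3 + A ^+ 3) -
      (A ^+ 3 + 2) * (κ v * (κ v ^+ 2) * A) =
      (κ v ^+ 3 - 1) * (A * κ v ^+ 3 - A ^+ 4) by ring.
    by rewrite V3' mul0r.
  have exz : κ v * A - A * κ (v ^+ 2) ^+ 2 = 0.
    rewrite K1.
    have -> : κ v * A - A * (κ v ^+ 2) ^+ 2 = - A * κ v * (κ v ^+ 3 - 1) by ring.
    by rewrite V3' mulr0.
  have eyz : κ (v ^+ 2) * A - A * κ v ^+ 2 = 0 by rewrite K1; ring.
  rewrite /sextic_at cE ec add0r => cn0.
  rewrite (xzE (κ v)) exz add0r (yzE (κ v)) eyz add0r => fE.
  set q := (κ v + β) * (κ (v ^+ 2) + γ) - A * A ^+ 2 in fE.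
  have rq : res q ((v + 0) * (v ^+ 2 + 0) - a * a ^+ 2) by rewrite /q; res_tac.
  have q0 : (v + 0) * (v ^+ 2 + 0) - a * a ^+ 2 != 0.
    have -> : (v + 0) * (v ^+ 2 + 0) - a * a ^+ 2 =
      - (a ^+ 3 - 1) + (v ^+ 3 - 1) by ring.
    by rewrite v3' addr0 oppr_eq0.
  have ra1 : res (xz1 A) a by rewrite /xz1; res_tac.
  have ra2 : res (xz2 (κ (v ^+ 2))) (- (a * (2 * v ^+ 2 + 0))) by rewrite /xz2; res_tac.
  have rb1 : res (yz1 (κ v)) (- (a * (2 * v + 0))) by rewrite /yz1; res_tac.
  have rb2 : res (yz2 A) a by rewrite /yz2; res_tac.
  have dA : C1 v (v ^+ 2) a * (- (a * (2 * v ^+ 2 + 0))) - C2 v (v ^+ 2) a * a != 0.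
    have -> : C1 v (v ^+ 2) a * (- (a * (2 * v ^+ 2 + 0))) - C2 v (v ^+ 2) a * a =
      a * v * (3 * a * (a ^+ 3 - 1) + (v ^+ 3 - 1) * (a * (2 * a ^+ 3 - 5%:R))).
      by rewrite /C1 /C2; ring.
    by rewrite v3' mul0r addr0 !mulf_neq0.
  have dB : C1 v (v ^+ 2) a * a - C2 v (v ^+ 2) a * (- (a * (2 * v + 0))) != 0.
    have -> : C1 v (v ^+ 2) a * a - C2 v (v ^+ 2) a * (- (a * (2 * v + 0))) =
      a * v ^+ 2 * (- (3 * a * (a ^+ 3 - 1)) + (v ^+ 3 - 1) * (6%:R * a)).
      by rewrite /C1 /C2; ring.
    by rewrite v3' mul0r addr0 mulf_neq0 ?oppr_eq0 ?mulf_neq0 ?expf_neq0.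
  left; rewrite /nodal_cubic_at (yzE (κ v)) eyz add0r mulrDl ![_ * β * _]mulrAC ![_ * γ * _]mulrAC.
  have fE' : f * (c1 (κ v) (κ (v ^+ 2)) A * β + c2 (κ v) (κ (v ^+ 2)) A * γ) ^+ 2 =
    - ((xz1 A * β + xz2 (κ (v ^+ 2)) * γ) * (yz1 (κ v) * β + yz2 A * γ) * q).
    by rewrite fE; ring.
  have OL : O (κ v + β + A * (κ (v ^+ 2) + γ) + A * A).
    by apply: (subringD sO); last exact: (valringM vO);
       apply: (subringD sO); [exact: (subringD sO)|apply: (valringM vO) => //; exact: (subringD sO)].
  by apply: (vanish_div_cubic vO kO Of (rc1 _ _ _) (rc2 _ _ _) ra1 ra2 rb1 rb2 rq
      q0 dA dB cn0 fE' Oβ Oγ); apply: (valringM vO) => //; [exact: Ores rb1|exact: Ores rb2].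
Qed.

End CenterMain.

Section PoleCenter.
Variables (k : closedFieldType) (F : fieldType) (κ : {rmorphism k -> F}).
Variable O : F -> Prop.
Hypotheses (vO : valring O) (kO : forall c, O (κ c)).
Let sO := valring_subring vO.
Variables (f : F) (a eps : k).
Hypotheses (Of : O f) (f_nres : forall r, ~ res κ O f r).
Hypotheses (a0 : a != 0) (eps0 : eps ^+ 2 + eps + 1 = 0) (three0 : 3%:R != 0 :> k).
Hypothesis a3 : a ^+ 3 != 1.
Local Notation A := (κ a).

(** At a pole of the quotient the cubic vanishes, and by the equation of f
    so does the sextic: the valuation is centred at a base point, which by
    nodal_div_at_base is (a : 1 : 1). *)
Lemma pole_center ξ η ζ : cubic_at A ξ η ζ != 0 ->
  f * cubic_at A ξ η ζ ^+ 2 = - sextic_at A ξ η ζ ->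
  ~ O (nodal_cubic_at A ξ η ζ / cubic_at A ξ η ζ) ->
  [/\ ζ != 0, res κ O (ξ / ζ) a, res κ O (η / ζ) 1, ξ / ζ - A != 0 &
    O ((η / ζ - 1) / (ξ / ζ - A)) /\
    forall r, ~ res κ O ((η / ζ - 1) / (ξ / ζ - A)) r].
Proof.
move=> c0 fE nO.
have nz : ~ [/\ ξ = 0, η = 0 & ζ = 0].
  by case=> E1 E2 E3; move: c0; rewrite E1 E2 E3 /cubic_at !expr0n /= !addr0 !mulr0 subrr eqxx.
have [w [w0 Ox Oy Oz nm]] := min_coord vO nz.
have wi0 : w^-1 != 0 by rewrite invr_eq0.
have cs (s : F) : s != 0 -> cubic_at A (s * ξ) (s * η) (s * ζ) != 0.
  by move=> s0; rewrite cubic_scale mulf_neq0 // expf_neq0.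
have fs (s : F) : f * cubic_at A (s * ξ) (s * η) (s * ζ) ^+ 2 =
    - sextic_at A (s * ξ) (s * η) (s * ζ).
  rewrite cubic_scale sextic_scale -mulrN -fE; ring.
have ns (s : F) : s != 0 ->
   nodal_cubic_at A (s * ξ) (s * η) (s * ζ) / cubic_at A (s * ξ) (s * η) (s * ζ) =
   nodal_cubic_at A ξ η ζ / cubic_at A ξ η ζ.
  by move=> s0; rewrite cubic_scale nodal_scale -mulf_div divff ?mul1r // expf_neq0.
rewrite ![_ / w]mulrC in Ox Oy Oz nm.
set X := w^-1 * ξ in Ox nm; set Y := w^-1 * η in Oy nm; set Z := w^-1 * ζ in Oz nm.
have OA : O A by [].
have On : O (nodal_cubic_at A X Y Z).
  by rewrite /nodal_cubic_at expr2; do ! first [assumption | apply: (valringB vO) | apply: (subringD sO) | apply: (valringM vO)].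
have mc : maxid O (cubic_at A X Y Z).
  have -> : cubic_at A X Y Z = (cubic_at A X Y Z / nodal_cubic_at A X Y Z) * nodal_cubic_at A X Y Z.
    rewrite mulfVK //; apply: contra_notN nO => /eqP E.
    by rewrite -(ns _ wi0) E mul0r; exact: subring0 sO.
  apply: maxidMr => //; rewrite -invf_div; apply: valringVn => //.
  by rewrite (ns _ wi0).
have ms : maxid O (sextic_at A X Y Z).
  rewrite -[sextic_at _ _ _ _]opprK -fs; apply: (maxidNN vO).
  by apply: maxidMl => //; rewrite expr2; apply: maxidMr => //; exact: maxid_in mc.
have [r [v [v3 nZ]]] := base_center vO kO a0 eps0 Ox Oy Oz nm mc ms.
have v0 : v != 0 by apply: contra_eq_neq v3 => ->; rewrite expr0n eq_sym oner_eq0.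
have [Z0 OZi] := maxidN_unit vO Oz nZ.
have ζ0 : ζ != 0 by apply: contra_neq Z0 => E; rewrite /Z E mulr0.
have [p20 key] : (std_pt a r v).2 != 0 /\ (v = 1 -> r = 0%N -> std_pt a r v = (a, 1, 1)).
  split; first by case: (r) => [|[|?]] //=; rewrite ?oner_eq0.
  by move=> -> -> /=; rewrite mul1r expr1n.
have := @nodal_div_at_base k F κ O vO kO f Of f_nres a a0 three0 a3.
case E : (std_pt a r v) => [[p0 p1] p2] /= H [mX mY]; rewrite E /= in p20.
pose s := κ p2 / ζ.
have s0 : s != 0 by rewrite mulf_neq0 ?invr_eq0 // fmorph_eq0.
have eZ : s * ζ = κ p2 by rewrite /s mulfVK.
have rβ : res κ O (s * ξ - κ p0) 0.
  apply/res0; have -> : s * ξ - κ p0 = (κ p2 * X - κ p0 * Z) * Z^-1.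
    by rewrite /s /X /Z; field; rewrite w0 ζ0.
  exact: maxidMr.
have rγ : res κ O (s * η - κ p1) 0.
  apply/res0; have -> : s * η - κ p1 = (κ p2 * Y - κ p1 * Z) * Z^-1.
    by rewrite /s /Y /Z; field; rewrite w0 ζ0.
  exact: maxidMr.
have := H _ _ rβ rγ r v v3; rewrite E !subrKC => {}H.
have := H _ _; rewrite -eZ => /(_ (cs _ s0) (fs s)) [|[r0 v1 β0 Ou nu]].
  by rewrite ns.
have := key v1 r0; rewrite E => -[p0E p1E p2E].
have sE : s = ζ^-1 by rewrite /s p2E rmorph1 mul1r.
move: rβ rγ β0 Ou nu; rewrite sE p0E p1E rmorph1 ![ζ^-1 * _]mulrC => rβ rγ β0 Ou nu.
split=> //.
- by apply/(res0 κ).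
- by rewrite /res rmorph1; apply/(res0 κ).
Qed.

End PoleCenter.

(** * The valuation ring of a curve in a chart *)

Section EvalPair.
Variables (k : fieldType) (F : fieldType) (κ : {rmorphism k -> F}) (s t : F).

Definition eval_pair : {poly {poly k}} -> F :=
  horner_eval s \o map_poly (horner_eval t \o map_poly κ).
HB.instance Definition _ := GRing.RMorphism.on eval_pair.

Lemma eval_pairC p : eval_pair p%:P = (map_poly κ p).[t].
Proof. by rewrite /eval_pair /= map_polyC /= /horner_eval hornerC. Qed.
Lemma eval_pairX : eval_pair 'X = s.
Proof. by rewrite /eval_pair /= map_polyX /horner_eval hornerX. Qed.
Lemma eval_pairCX : eval_pair ('X)%:P = t.
Proof. by rewrite eval_pairC map_polyX hornerX. Qed.
Lemma eval_pairCC c : eval_pair (c%:P)%:P = κ c.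
Proof. by rewrite eval_pairC map_polyC /= hornerC. Qed.

End EvalPair.

Lemma poly_Xfactor (R : nzRingType) (A : {poly R}) : A != 0 ->
  exists e (A' : {poly R}), A = A' * 'X^e /\ A'`_0 != 0.
Proof.
elim/poly_ind: A => [|A c IH]; first by rewrite eqxx.
case: (eqVneq c 0) => [->|c0 _].
  rewrite addr0; case: (eqVneq A 0) => [->|/IH[e [A' [-> A0]]] _].
    by rewrite mul0r eqxx.
  by exists e.+1, A'; rewrite exprSr mulrA.
by exists 0, (A * 'X + c%:P); rewrite mulr1 coefD coefMX coefC add0r.
Qed.

Section Chart.
Variables (k : closedFieldType) (F : fieldType) (κ : {rmorphism k -> F}) (s t : F).
Variable ev : {rmorphism {poly {poly k}} -> F}.
Hypothesis evX : ev 'X = s.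
Hypothesis evC : forall p, ev p%:P = (map_poly κ p).[t].
Hypothesis ev_inj : injective ev.
Hypothesis ev_frac : forall h, exists A B : {poly {poly k}}, B != 0 /\ h = ev A / ev B.

(** On a surface with coordinates s and t, this is the local ring at the
    generic point of the curve s = 0. *)
Definition chart_ring (h : F) : Prop :=
  exists A B : {poly {poly k}}, B`_0 != 0 /\ h = ev A / ev B.
Local Notation V := chart_ring.

Let ev0 (B : {poly {poly k}}) : B != 0 -> ev B != 0.
Proof. by apply: contra_neq => E; apply: ev_inj; rewrite E rmorph0. Qed.

Let coef0_neq0 (B : {poly {poly k}}) : B`_0 != 0 -> B != 0.
Proof. by apply: contra_neq => ->; rewrite coef0. Qed.

Let evn0 (B : {poly {poly k}}) : B`_0 != 0 -> ev B != 0. Proof. by move=> /coef0_neq0/ev0. Qed.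

Lemma chart_normal h : h != 0 -> exists (A B : {poly {poly k}}) m n,
  [/\ A`_0 != 0, B`_0 != 0 & h = ev A * s ^+ m / (ev B * s ^+ n)].
Proof.
move=> h0; have [A [B [B0 E]]] := ev_frac h.
have A0 : A != 0 by apply: contra_neq h0 => A0; rewrite E A0 rmorph0 mul0r.
have [m [A' [EA A'0]]] := poly_Xfactor A0; have [n [B' [EB B'0]]] := poly_Xfactor B0.
exists A', B', m, n; split=> //.
by rewrite E EA EB !rmorphM !rmorphXn /= !evX.
Qed.

Lemma chart_s0 : s != 0.
Proof. by rewrite -evX ev0 // polyX_eq0. Qed.

Lemma chart_ringE (A B : {poly {poly k}}) : B`_0 != 0 -> V (ev A / ev B).
Proof. by move=> B0; exists A, B. Qed.

Lemma chart_ring_ev A : V (ev A).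
Proof. by rewrite -[ev A]divr1 -(rmorph1 ev); apply: chart_ringE; rewrite coef1 oner_eq0. Qed.

Lemma chart_valring : valring V.
Proof.
split.
- move=> _ _ [A [B [B0 ->]]] [C [D [D0 ->]]]; exists (A * D - C * B), (B * D).
  split; first by rewrite coef0M mulf_neq0.
  by rewrite rmorphB !rmorphM /=; field; rewrite !evn0.
- move=> _ _ [A [B [B0 ->]]] [C [D [D0 ->]]]; exists (A * C), (B * D).
  split; first by rewrite coef0M mulf_neq0.
  by rewrite !rmorphM /= mulf_div.
- move=> h; case: (eqVneq h 0) => [->|h0].
    by left; rewrite -(rmorph0 ev); exact: chart_ring_ev.
  have [A [B [m [n [A0 B0 ->]]]]] := chart_normal h0.
  have s0 := chart_s0.
  case: (leqP n m) => nm; [left|right].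
    exists (A * 'X^(m - n)), B; split=> //.
    rewrite rmorphM rmorphXn /= evX -{1}(subnK nm) exprD.
    by rewrite mulrA -mulf_div divff ?mulr1 // expf_neq0.
  exists (B * 'X^(n - m)), A; split=> //.
  rewrite invf_div rmorphM rmorphXn /= evX -{1}(subnK (ltnW nm)) exprD.
  by rewrite mulrA -mulf_div divff ?mulr1 // expf_neq0.
Qed.

Lemma chart_maxid (A B : {poly {poly k}}) : B`_0 != 0 -> maxid V (ev A / ev B) <-> A`_0 = 0.
Proof.
move=> B0; split.
  move=> [_ H]; apply/eqP; apply: contraT => A0; case: H.
    by move/eqP; rewrite mulf_eq0 invr_eq0 !(negPf (evn0 _)).
  by case; rewrite invf_div; exact: chart_ringE.
move=> A0; split; first exact: chart_ringE.
case: (eqVneq A 0) => [->|An0]; first by left; rewrite rmorph0 mul0r.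
right=> -[C [D [D0 E]]].
have {}E : B * D = C * A.
  apply: ev_inj; rewrite !rmorphM /=.
  have : (ev A / ev B)^-1 * (ev A * ev D) = ev C / ev D * (ev A * ev D) by rewrite E.
  rewrite invf_div => H.
  have a1 := ev0 An0; have d1 := evn0 D0.
  have -> : ev B * ev D = ev B / ev A * (ev A * ev D) by field.
  by rewrite H; field.
have : (B * D)`_0 != 0 by rewrite coef0M mulf_neq0.
by rewrite E coef0M A0 mulr0 eqxx.
Qed.

Lemma chart_uniformizer h : maxid V h -> exists2 g, V g & h = s * g.
Proof.
move=> mh; have [A [B [B0 E]]] := mh.1.
move: mh; rewrite E => /(chart_maxid _ B0) A0.
have [Q EQ] : exists Q, A = Q * 'X.
  move: A0; elim/poly_ind: (A) => [|Q c _]; first by exists 0; rewrite mul0r.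
  by rewrite coefD coefMX coefC add0r /= => ->; exists Q; rewrite addr0.
exists (ev Q / ev B); first exact: chart_ringE.
by rewrite EQ rmorphM /= evX mulrA [s * _]mulrC.
Qed.

Lemma chart_ring_cst c : V (κ c).
Proof.
have <- : ev (c%:P)%:P = κ c by rewrite evC map_polyC /= hornerC.
exact: chart_ring_ev. Qed.

Lemma chart_ring_s : V s.
Proof. by rewrite -evX; exact: chart_ring_ev. Qed.

Lemma chart_maxid_s : maxid V s.
Proof.
have := @chart_maxid 'X 1; rewrite rmorph1 divr1 evX => H.
by apply/H; rewrite ?coefX ?coef1 ?oner_eq0.
Qed.

(** V is a discrete valuation ring with uniformizer s, and an element of O
    outside V brings s^-1 into O. *)
Lemma chart_maximal (O : F -> Prop) : valring O -> (forall h, V h -> O h) ->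
  (exists h, ~ O h) -> forall h, O h -> V h.
Proof.
move=> vO VO [g nOg] h Oh; apply: NNPP => nVh; apply: nOg.
have sO := valring_subring vO; have s0 := chart_s0.
have Osi : O s^-1.
  have := valringVn chart_valring nVh => /chart_uniformizer[u Vu E].
  have h0 : h != 0.
    apply: contra_notN nVh => /eqP->; rewrite -(rmorph0 ev); exact: chart_ring_ev.
  have -> : s^-1 = u * h.
    apply: (mulfI s0); rewrite mulrA -E mulVf // mulfV //.
  by apply: (valringM vO) => //; exact: VO.
case: (eqVneq g 0) => [->|g0]; first exact: subring0 sO.
have [A [B [m [n [A0 B0 ->]]]]] := chart_normal g0.
have -> : ev A * s ^+ m / (ev B * s ^+ n) = (ev A / ev B) * (s ^+ m * s^-1 ^+ n).
  by rewrite -mulf_div exprVn.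
apply: (valringM vO); first by apply: VO; exact: chart_ringE.
apply: (valringM vO); last exact: subringX.
by apply: subringX => //; apply: VO; exact: chart_ring_s.
Qed.

(** Modulo s the denominators of elements of V are non-zero polynomials in
    t, which are units of O because t has no residue in k (res_poly_unit). *)
Lemma chart_sub (O : F -> Prop) : valring O -> (forall c, O (κ c)) ->
  maxid O s -> O t -> (forall r, ~ res κ O t r) -> forall h, V h -> O h.
Proof.
move=> vO kO ms Ot nt _ [A [B [B0 ->]]].
have sO := valring_subring vO.
have Oc (p : {poly k}) : O (map_poly κ p).[t].
  apply: (subring_horner sO); last exact: Ot.
  by move=> i; rewrite coef_map; exact: kO.
have OA C : O (ev C).
  elim/poly_ind: C => [|Q c IH]; first by rewrite rmorph0; exact: subring0 sO.
  rewrite rmorphD rmorphM /= evX evC; apply: (subringD sO) => //.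
  by apply: (valringM vO) => //; exact: maxid_in ms.
have E : exists C, ev B = (map_poly κ B`_0).[t] + ev C * s.
  elim/poly_ind: (B) => [|Q c _].
    by exists 0; rewrite coef0 !rmorph0 horner0 mul0r addr0.
  exists Q; rewrite coefD coefMX coefC /= add0r rmorphD rmorphM /= evX evC addrC.
  by [].
have [C EC] := E.
have nm : ~ maxid O (ev B).
  rewrite EC => H; apply: (res_poly_unit vO kO Ot nt B0).
  rewrite -[X in maxid _ X](addrK (ev C * s)); apply: (maxidB vO) => //.
  exact: (maxidMl vO).
have [_ OBi] := maxidN_unit vO (OA B) nm.
exact: (valringM vO).
Qed.

End Chart.

(** * The branch quartic is squarefree *)

Section CoefDeriv.
Variable R : comNzRingType.
(** The derivation with respect to the inner of the two variables. *)
Definition coef_deriv (p : {poly {poly R}}) : {poly {poly R}} := map_poly (@deriv R) p.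

Lemma coef_derivE p i : (coef_deriv p)`_i = (p`_i)^`().
Proof. by rewrite coef_map_id0 // deriv0. Qed.

Lemma coef_derivM p q : coef_deriv (p * q) = coef_deriv p * q + p * coef_deriv q.
Proof.
apply/polyP => i; rewrite coef_derivE coefD !coefM raddf_sum -big_split /=.
by apply: eq_bigr => j _; rewrite derivM !coef_derivE.
Qed.

Lemma coef_derivD p q : coef_deriv (p + q) = coef_deriv p + coef_deriv q.
Proof. by apply/polyP => i; rewrite !(coefD, coef_derivE) derivD. Qed.

Lemma coef_deriv_lift (p : {poly R}) : coef_deriv (map_poly polyC p) = 0.
Proof. by apply/polyP => i; rewrite coef_derivE coef_map derivC coef0. Qed.

Lemma coef_derivC (p : {poly R}) : coef_deriv p%:P = (p^`())%:P.
Proof. by apply/polyP => i; rewrite coef_derivE !coefC; case: i => //=; rewrite deriv0. Qed.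
End CoefDeriv.

Section ClearDenom.
Variables (R : idomainType) (K : fieldType) (tK : {rmorphism R -> K}).
Hypothesis tK_inj : injective tK.
Hypothesis tK_frac : forall r, exists n d, d != 0 /\ r = tK n / tK d.

Lemma poly_clear_denom (v : {poly K}) :
  exists d (v' : {poly R}), d != 0 /\ tK d *: v = map_poly tK v'.
Proof.
elim/poly_ind: v => [|v c [d [v' [d0 E]]]].
  by exists 1, 0; rewrite oner_neq0 scaler0 rmorph0.
have [n [e [e0 Ec]]] := tK_frac c.
exists (d * e), (e%:P * v' * 'X + (d * n)%:P); split; first exact: mulf_neq0.
have e0' : tK e != 0 by rewrite (raddf_eq0 _ tK_inj).
rewrite rmorphD !rmorphM /= map_polyX !map_polyC /= -E Ec !rmorphM /= -!mul_polyC !polyCM.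
have : (tK e)%:P * ((tK e)^-1)%:P = 1 by rewrite -polyCM divff.
move: (tK e)%:P ((tK e)^-1)%:P (tK d)%:P (tK n)%:P => x y z u xy.
have -> : z * x * (v * 'X + u * y) = x * (z * v) * 'X + z * u * (x * y) by ring.
by rewrite xy mulr1.
Qed.
End ClearDenom.

(** -9 D times the discriminant of A + B f + C f^2 + D f^3, in a form that
    exhibits it as a combination of this cubic and its derivative
    (cubic_resultantP). *)
Definition cubic_resultant (R : comNzRingType) (A B C D : R) : R :=
  let E := 6%:R * B * D - 2%:R * C ^+ 2 in
  let G := 9%:R * A * D - B * C in
  B * E ^+ 2 + 3%:R * D * G ^+ 2 - 2%:R * C * E * G.

Lemma rmorph_cubic_resultant (R S : comNzRingType) (φ : {rmorphism R -> S}) A B C D :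
  φ (cubic_resultant A B C D) = cubic_resultant (φ A) (φ B) (φ C) (φ D).
Proof. by rewrite /cubic_resultant; cbv zeta; rewrite !(rmorphB, rmorphD, rmorphXn, rmorphM, rmorph1, rmorph_nat). Qed.

Section Quartic.
Variable k : closedFieldType.
Variables (K : fieldType) (tK : {rmorphism {poly k} -> K}).
Hypothesis tK_inj : injective tK.
Hypothesis tK_frac : forall r, exists n d, d != 0 /\ r = tK n / tK d.
Variables a : k.
Hypotheses (two0 : 2%:R != 0 :> k) (three0 : 3%:R != 0 :> k).
Hypotheses (a0 : a != 0) (a3 : a ^+ 3 != 1).
Let b := a ^+ 3 + 2%:R.

(** The branch quartic, a polynomial of degree 4 in t over K = k(f), is also
    a cubic A + B f + C f^2 + D f^3 over k[t], with D constant. Its square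
    factors are detected by the discriminant of this cubic. *)
Definition branchA : {poly k} := 'X ^+ 2 * ('X + 1) ^+ 2.
Definition branchB : {poly k} :=
  'X * (- 2%:R * (1 + (b - 3%:R)%:P * 'X + (b - 6%:R)%:P * 'X ^+ 2
    + (2%:R * (b - 3%:R))%:P * 'X ^+ 3)).
Definition branchC : {poly k} :=
  (9%:R - 4%:R * b)%:P + 'X * ((12%:R - 10%:R * b)%:P + (b ^+ 2 - 24%:R * b + 36%:R)%:P * 'X).
Definition branchD : k := 4%:R * (b - 3%:R) ^+ 2.

Lemma branchD_neq0 : branchD != 0.
Proof.
rewrite /branchD mulf_neq0 ?expf_neq0 //.
  by (have -> : 4%:R = 2%:R * 2%:R :> k by ring); rewrite mulf_neq0.
have -> : b - 3%:R = a ^+ 3 - 1 by rewrite /b; ring.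
by rewrite subr_eq0.
Qed.

Lemma cubic_resultantP (R : comNzRingType) (A B C D f : R) :
  exists U V, cubic_resultant A B C D =
    U * (A + B * f + C * f ^+ 2 + D * f ^+ 3) + V * (B + 2%:R * C * f + 3%:R * D * f ^+ 2).
Proof.
set E := 6%:R * B * D - 2%:R * C ^+ 2; set G := 9%:R * A * D - B * C.
exists (- 9%:R * D * (3%:R * D * (E * f - G) + 2%:R * C * E)).
exists (E ^+ 2 + (3%:R * D * (E * f - G) + 2%:R * C * E) * (3%:R * D * f + C)).
by rewrite /cubic_resultant /E /G; ring.
Qed.

(** For the branch quartic, A is divisible by t^2 and B by t. The lowest
    coefficients in t then decide that the discriminant is not zero. *)
Lemma cubic_resultant_order2 (R : comNzRingType) (X A' B' C' c0 D : R) :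
  cubic_resultant (X ^+ 2 * A') (X * B') (c0 + X * C') D = - (9%:R * D) * X ^+ 2 *
  ((B' ^+ 2 - 4%:R * A' * c0) * c0 ^+ 2 + X * ((X * B' ^+ 2 * C' ^+ 2
    - 4%:R * X ^+ 2 * A' * C' ^+ 3 - 4%:R * B' ^+ 3 * D
  - 27%:R * X * A' ^+ 2 * D ^+ 2 + 18%:R * X * A' * B' * C' * D) +
   c0 * (2%:R * B' ^+ 2 * C' - 12%:R * A' * C' * (c0 + X * C') + 18%:R * A' * B' * D))).
Proof. by rewrite /cubic_resultant; ring. Qed.

(** With c0 = 1 - 4 a^3, the coefficient of t^2 is a non-zero multiple of 4
    (1 - c0) c0^2. If c0 = 0, the coefficient of t^3 is not zero. *)
Lemma branch_resultant_neq0 : cubic_resultant branchA branchB branchC branchD%:P != 0.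
Proof.
pose A' : {poly k} := ('X + 1) ^+ 2.
pose B' : {poly k} := (- 2%:R * (1 + (b - 3%:R)%:P * 'X + (b - 6%:R)%:P * 'X ^+ 2
    + (2%:R * (b - 3%:R))%:P * 'X ^+ 3)).
pose C' : {poly k} := (12%:R - 10%:R * b)%:P + (b ^+ 2 - 24%:R * b + 36%:R)%:P * 'X.
pose c0 := 9%:R - 4%:R * b.
pose D := branchD%:P.
have EA : branchA = 'X ^+ 2 * A' by [].
have EB : branchB = 'X * B' by [].
have EC : branchC = c0%:P + 'X * C' by [].
pose R' := 'X * B' ^+ 2 * C' ^+ 2 - 4%:R * 'X ^+ 2 * A' * C' ^+ 3 - 4%:R * B' ^+ 3 * D
  - 27%:R * 'X * A' ^+ 2 * D ^+ 2 + 18%:R * 'X * A' * B' * C' * D.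
pose R := (B' ^+ 2 - 4%:R * A' * c0%:P) * c0%:P ^+ 2 + 'X * (R' +
   c0%:P * (2%:R * B' ^+ 2 * C' - 12%:R * A' * C' * (c0%:P + 'X * C') + 18%:R * A' * B' * D)).
have -> : cubic_resultant branchA branchB branchC D = - (9%:R * D) * 'X ^+ 2 * R.
  by rewrite EA EB EC; exact: cubic_resultant_order2.
have nine0 : 9%:R != 0 :> k by (have -> : 9%:R = 3%:R * 3%:R :> k by ring); rewrite mulf_neq0.
have nine0' : 9%:R * D != 0.
  have -> : 9%:R = (9%:R)%:P :> {poly k} by rewrite rmorph_nat.
  by rewrite /D -polyCM polyC_eq0; apply: mulf_neq0 => //; exact: branchD_neq0.
have hn n : (n%:R : {poly k}).[0] = n%:R by rewrite -polyC_natr hornerC.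
have B0 : B'.[0] = - 2%:R.
  by rewrite /B' !(hornerE, hn) /=; ring.
have A0 : A'.[0] = 1 by rewrite /A' !hornerE /=; ring.
have four0 : 4%:R != 0 :> k by (have -> : 4%:R = 2%:R * 2%:R :> k by ring); rewrite mulf_neq0.
suff R0 : R != 0 by rewrite !mulf_neq0 ?oppr_eq0 ?expf_neq0 ?polyX_eq0.
clear EA EB EC; clearbody A' B' C'.
case: (eqVneq c0 0) => [E0|c00].
  have ER : R = 'X * R' by rewrite /R E0 polyC0 expr0n /= mulr0 !mul0r addr0 add0r.
  have : R'.[0] != 0.
    rewrite /R' !(hornerE, hn) /= B0.
    set L := (X in X != 0); have -> : L = 4%:R * 2%:R ^+ 3 * branchD by rewrite /L /branchD; ring.
    apply: mulf_neq0; last exact: branchD_neq0.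
    by apply: mulf_neq0 => //; exact: expf_neq0.
  by rewrite ER mulf_eq0 polyX_eq0 /=; apply: contra_neq => ->; rewrite horner0.
have : R.[0] != 0.
  rewrite /R !(hornerE, hn) /= A0 B0.
  set L := (X in X != 0); have -> : L = 4%:R * (1 - c0) * c0 ^+ 2 by rewrite /L /c0; ring.
  have -> : 1 - c0 = 4%:R * a ^+ 3 by rewrite /c0 /b; ring.
  by rewrite !mulf_neq0 ?expf_neq0.
by apply: contra_neq => ->; rewrite horner0.
Qed.

Definition branch_quartic2 : {poly {poly k}} :=
  map_poly polyC branchA + map_poly polyC branchB * ('X)%:P
  + map_poly polyC branchC * ('X)%:P ^+ 2 + (branchD%:P)%:P * ('X)%:P ^+ 3.

Definition branch_quartic : {poly K} := map_poly (tK) branch_quartic2.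

Lemma branch_quartic_size : (4 < size branch_quartic)%N.
Proof.
suff H : branch_quartic2`_4 != 0.
  rewrite ltnNge; apply/negP => /(nth_default 0) /eqP.
  by rewrite coef_map (raddf_eq0 _ tK_inj) (negPf H).
suff : (branch_quartic2`_4).[0] != 0 by apply: contra_neq => ->; rewrite horner0.
rewrite /branch_quartic2 !coefD -!rmorphXn !coefMC !coef_map /= !hornerE /=.
rewrite ?mulr0 ?addr0 ?mul0r.
have -> : branchA = 'X ^+ 4 + 2%:R * 'X ^+ 3 + 'X ^+ 2 by rewrite /branchA; ring.
by rewrite !coefD mulr_natl coefMn !coefXn /= mul0rn !addr0 oner_neq0.
Qed.

(** After clearing denominators, v divides the quartic and its derivative
    with respect to f, hence their resultant, which is a polynomial in t
    over k. So, if v is not constant, it has a root z in k, and then the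
    cubic in f obtained at t = z is identically zero, in contradiction with
    its leading coefficient D. *)
Lemma branch_quartic_sqfree v : v ^+ 2 %| branch_quartic -> (size v <= 1)%N.
Proof.
move=> /dvdpP[s Es].
have [d [v' [d0 Ev]]] := poly_clear_denom tK_inj tK_frac v.
have [e [s' [e0 Es']]] := poly_clear_denom tK_inj tK_frac s.
have t0 x : x != 0 -> tK x != 0 by move=> x0; rewrite (raddf_eq0 _ tK_inj).
have td0 := t0 _ d0; have te0 := t0 _ e0.
have inj : injective (map_poly tK) by apply: map_inj_poly => //; exact: rmorph0.
have szv : size v = size v' by rewrite -(size_scale v td0) Ev size_map_inj_poly ?rmorph0.
have [g gE g0] : exists2 g, g = e * d ^+ 2 & g != 0.
  by exists (e * d ^+ 2) => //; rewrite mulf_neq0 // expf_neq0.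
have E2 : g%:P * branch_quartic2 = v' ^+ 2 * s'.
  apply: inj; rewrite !(rmorphXn, rmorphM) /= -Ev -Es' map_polyC /= -/branch_quartic Es.
  by rewrite gE !(rmorphXn, rmorphM) /= -!mul_polyC; ring.
pose Bf := map_poly polyC branchB + 2%:R * map_poly polyC branchC * ('X)%:P
   + 3%:R * (branchD%:P)%:P * ('X)%:P ^+ 2.
have dQ : coef_deriv branch_quartic2 = Bf.
  rewrite /branch_quartic2 !coef_derivD !expr2 exprSr expr2 !coef_derivM !coef_deriv_lift.
  by rewrite !coef_derivC derivX derivC polyC0 polyC1 /Bf; ring.
have [r Er] : exists r, g%:P ^+ 2 * Bf = v' * r.
  have : coef_deriv (g%:P * branch_quartic2) = coef_deriv (v' ^+ 2 * s') by rewrite E2.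
  rewrite coef_derivM dQ coef_derivC => H.
  have {}H : g%:P * Bf = coef_deriv (v' ^+ 2 * s') - (g^`())%:P * branch_quartic2 by rewrite -H; ring.
  exists (g%:P * (2%:R * coef_deriv v' * s' + v' * coef_deriv s') - (g^`())%:P * v' * s').
  rewrite expr2 -mulrA H mulrBr mulrCA E2 expr2 !coef_derivM; ring.
have [U [V EUV]] := cubic_resultantP (map_poly polyC branchA) (map_poly polyC branchB)
  (map_poly polyC branchC) (branchD%:P)%:P ('X)%:P.
pose res := cubic_resultant branchA branchB branchC branchD%:P.
have Eres : map_poly polyC res = cubic_resultant (map_poly polyC branchA) (map_poly polyC branchB)
  (map_poly polyC branchC) (branchD%:P)%:P.
  by rewrite /res rmorph_cubic_resultant /= map_polyC.
have dvd : v %| map_poly (tK) (map_poly polyC res).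
  have : exists r', g%:P ^+ 2 * map_poly polyC res = v' * r'.
    rewrite Eres EUV -/branch_quartic2 -/Bf.
    exists (U * g%:P * v' * s' + V * r).
    rewrite -[X in U * X]/branch_quartic2; clear dQ; move: branch_quartic2 Bf E2 Er => Q B' E2 Er.
    have -> : g%:P ^+ 2 * (U * Q + V * B') = U * g%:P * (g%:P * Q) + V * (g%:P ^+ 2 * B') by ring.
    by rewrite E2 Er; ring.
  case=> r' H; apply/dvdpP; exists (((tK g) ^+ 2)^-1 *: (tK d *: map_poly (tK) r')).
  have : map_poly (tK) (g%:P ^+ 2 * map_poly polyC res) = map_poly (tK) (v' * r') by rewrite H.
  rewrite !(rmorphXn, rmorphM) /= map_polyC /= -Ev => H'.
  have tg0 : tK g ^+ 2 != 0 by rewrite expf_neq0 // t0.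
  rewrite -[LHS](scalerK tg0) -[tK g ^+ 2 *: _]mul_polyC polyC_exp H'.
  by rewrite -!mul_polyC; ring.
rewrite leqNgt; apply/negP => sv.
have [rs Ers] := closed_field_poly_normal res.
have res0 : res != 0 by exact: branch_resultant_neq0.
pose cK : {rmorphism k -> K} := tK \o polyC.
have Emap : map_poly (tK) (map_poly polyC res) =
   cK (lead_coef res) *: \prod_(z <- rs) ('X - (cK z)%:P).
  rewrite -map_poly_comp -/cK Ers map_polyZ rmorph_prod /= lead_coefZ.
  rewrite (monicP (monic_prod_XsubC _ _ _)) mulr1; congr (_ *: _).
  by apply: eq_bigr => z _; rewrite rmorphB /= map_polyX map_polyC.
have [z rz] : exists z, root v (cK z).
  apply: NNPP => nr.
  have cop : coprimep v (\prod_(z <- rs) ('X - (cK z)%:P)).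
    elim: (rs) => [|z l IH]; first by rewrite big_nil coprimep1.
    rewrite big_cons coprimepMr IH andbT coprimep_XsubC.
    by apply/negP => rz; apply: nr; exists z.
  move: dvd; rewrite Emap dvdpZr ?fmorph_eq0 ?lead_coef_eq0 // => dvd.
  have : v %| 1 by rewrite -(Gauss_dvdpr 1 cop) mulr1.
  by rewrite dvdp1 => /eqP E; rewrite E in sv.
have : root branch_quartic (cK z).
  by rewrite Es expr2 !rootM rz !orbT.
rewrite /branch_quartic /root.
have -> : (map_poly (tK) branch_quartic2).[cK z] =
  tK (branch_quartic2.[z%:P]) by rewrite -horner_map.
rewrite (raddf_eq0 _ tK_inj) /branch_quartic2 => /eqP /(congr1 (fun p : {poly k} => p`_3)).
have hl (p : {poly k}) : (map_poly polyC p).[z%:P] = (p.[z])%:P by rewrite horner_map.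
rewrite !(hornerD, hornerM, hornerC, horner_exp) !hl !coefD !coefCM !coefXM !coefX coefC coef0 /=.
rewrite ?mulr0 ?mulr1 ?add0r => /eqP.
by rewrite (negPf branchD_neq0).
Qed.

End Quartic.

(** * The function field as a quadratic extension of K(t) *)

Section BranchData.
Variable R : comNzRingType.
Implicit Types a t f : R.

Definition slope_num a t f := a * (t ^+ 3 + (1 + 3%:R * t) * f).
Definition slope_den a t f :=
  t * (1 + t) * (1 + 2%:R * t) - (1 + (a ^+ 3 + 2%:R) * t) * f.
Definition quartic_at a t f :=
  t ^+ 2 * (1 + t) ^+ 2
  - 2%:R * t * (1 + (a ^+ 3 - 1) * t + (a ^+ 3 - 4%:R) * t ^+ 2 + 2%:R * (a ^+ 3 - 1) * t ^+ 3) * f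
  + ((1 - 4%:R * a ^+ 3) - (8%:R + 10%:R * a ^+ 3) * t
     + ((a ^+ 3 + 2%:R) ^+ 2 - 24%:R * a ^+ 3 - 12%:R) * t ^+ 2) * f ^+ 2
  + 4%:R * (a ^+ 3 - 1) ^+ 2 * f ^+ 3.
(** If this is not zero, the definition of t can be solved for y / (y + 1)^2
    in branchE. *)
Definition branch_factor a t := (1 + 2%:R * t) ^+ 3 + a ^+ 3 * t ^+ 3.
End BranchData.

Section BranchMorph.
Variables (R S : comNzRingType) (φ : {rmorphism R -> S}).
Let φE := (rmorphB φ, rmorphD φ, rmorphXn φ, rmorphM φ, rmorph1 φ, rmorph_nat φ).
Lemma rmorph_slope_den a t f : φ (slope_den a t f) = slope_den (φ a) (φ t) (φ f).
Proof. by rewrite /slope_den !φE. Qed.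
Lemma rmorph_quartic_at a t f : φ (quartic_at a t f) = quartic_at (φ a) (φ t) (φ f).
Proof. by rewrite /quartic_at !φE. Qed.
Lemma rmorph_branch_factor a t : φ (branch_factor a t) = branch_factor (φ a) (φ t).
Proof. by rewrite /branch_factor !φE. Qed.
End BranchMorph.

Lemma slope_den_horner0 (K : fieldType) (α φ : K) : (slope_den α%:P 'X φ%:P).[0] = - φ.
Proof. by rewrite /slope_den !hornerE /= ?mulr0 ?mul0r ?addr0 ?mul1r; ring. Qed.

Lemma branch_factor_horner0 (K : fieldType) (α : K) : (branch_factor α%:P 'X).[0] = 1.
Proof. by rewrite /branch_factor !hornerE /=; ring. Qed.

Section BranchCoefs.
Variable R : comNzRingType.
Implicit Types a t : R.
Definition coefA_at t := t ^+ 2 * (t + 1) ^+ 2.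
Definition coefB_at a t := t * (- 2%:R * (1 + (a ^+ 3 - 1) * t + (a ^+ 3 - 4%:R) * t ^+ 2
  + 2%:R * (a ^+ 3 - 1) * t ^+ 3)).
Definition coefC_at a t := (1 - 4%:R * a ^+ 3) + t * (- (8%:R + 10%:R * a ^+ 3)
  + ((a ^+ 3 + 2%:R) ^+ 2 - 24%:R * a ^+ 3 - 12%:R) * t).
Definition coefD_at a := 4%:R * (a ^+ 3 - 1) ^+ 2.
Lemma quartic_atE a t f : quartic_at a t f =
  coefA_at t + coefB_at a t * f + coefC_at a t * f ^+ 2 + coefD_at a * f ^+ 3.
Proof. by rewrite /quartic_at /coefA_at /coefB_at /coefC_at /coefD_at; ring. Qed.
End BranchCoefs.

Section BranchCoefMorph.
Variables (R S : comNzRingType) (φ : {rmorphism R -> S}).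
Let φE := (rmorphB φ, rmorphD φ, rmorphN φ, rmorphXn φ, rmorphM φ, rmorph1 φ, rmorph_nat φ).
Lemma rmorph_coefA_at t : φ (coefA_at t) = coefA_at (φ t).
Proof. by rewrite /coefA_at !φE. Qed.
Lemma rmorph_coefB_at a t : φ (coefB_at a t) = coefB_at (φ a) (φ t).
Proof. by rewrite /coefB_at !φE. Qed.
Lemma rmorph_coefC_at a t : φ (coefC_at a t) = coefC_at (φ a) (φ t).
Proof. by rewrite /coefC_at !φE. Qed.
Lemma rmorph_coefD_at a : φ (coefD_at a) = coefD_at (φ a).
Proof. by rewrite /coefD_at !φE. Qed.
End BranchCoefMorph.

Lemma branch_quartic2E (k : closedFieldType) (a : k) :
  branch_quartic2 a = quartic_at (a%:P)%:P 'X ('X)%:P.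
Proof.
have pE := (polyCB, polyCD, polyCN, polyC_exp, polyCM, polyC1, polyC_natr).
have -> : branch_quartic2 a = map_poly polyC (coefA_at 'X)
  + map_poly polyC (coefB_at a%:P 'X) * ('X)%:P
  + map_poly polyC (coefC_at a%:P 'X) * ('X)%:P ^+ 2 + (coefD_at a%:P)%:P * ('X)%:P ^+ 3.
  rewrite /branch_quartic2; congr (_ + _ * _ + _ * _ + _%:P * _).
  - by rewrite /branchB /coefB_at !pE; ring.
  - by rewrite /branchC /coefC_at !pE; ring.
  - by rewrite /branchD /coefD_at !pE; ring.
rewrite rmorph_coefA_at !rmorph_coefB_at !rmorph_coefC_at rmorph_coefD_at.
by rewrite /= map_polyX !map_polyC /= -quartic_atE.
Qed.

Section Identities.
Variable F : fieldType.
Implicit Types a x y t f s q : F.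

(** The reflection (x : y : 1) -> (x : 1 : y) has the invariants
    s = x / (y + 1) and q = y / (y + 1)^2, and t and f are rational
    functions of them. Eliminating q gives s in terms of t and f. *)
Lemma slopeE a x y f : y + 1 != 0 -> cubic_at a x y 1 != 0 ->
  f * cubic_at a x y 1 ^+ 2 = - sextic_at a x y 1 ->
  let t := nodal_cubic_at a x y 1 / cubic_at a x y 1 in
  x / (y + 1) * slope_den a t f = slope_num a t f.
Proof.
move=> y1 c0 fE t.
have key : x * (nodal_cubic_at a x y 1 * (cubic_at a x y 1 + nodal_cubic_at a x y 1)
     * (cubic_at a x y 1 + 2%:R * nodal_cubic_at a x y 1)
   + (cubic_at a x y 1 + (a ^+ 3 + 2%:R) * nodal_cubic_at a x y 1) * sextic_at a x y 1)
  = a * (y + 1) * (nodal_cubic_at a x y 1 ^+ 3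
     - (cubic_at a x y 1 + 3%:R * nodal_cubic_at a x y 1) * sextic_at a x y 1).
  by rewrite /nodal_cubic_at /cubic_at /sextic_at; ring.
rewrite /t /slope_den /slope_num => {t}.
have {fE} -> : f = - sextic_at a x y 1 / cubic_at a x y 1 ^+ 2.
  by rewrite -fE mulfK // expf_neq0.
move: (cubic_at _ _ _ _) (nodal_cubic_at _ _ _ _) (sextic_at _ _ _ _) c0 key => c d p c0 key.
have -> : x / (y + 1) * (d / c * (1 + d / c) * (1 + 2%:R * (d / c)) -
   (1 + (a ^+ 3 + 2%:R) * (d / c)) * (- p / c ^+ 2)) =
   x * (d * (c + d) * (c + 2%:R * d) + (c + (a ^+ 3 + 2%:R) * d) * p) / ((y + 1) * c ^+ 3).
  by field; rewrite c0 y1.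
by rewrite key; field; rewrite c0 y1.
Qed.

(** In terms of the invariants s and q of the reflection,
    ((y - 1) / (y + 1))^2 is 1 - 4 q, the definition of t is linear in q,
    and s is known by slopeE. *)
Lemma branchE a x y f : a != 0 -> y + 1 != 0 -> cubic_at a x y 1 != 0 ->
  f * cubic_at a x y 1 ^+ 2 = - sextic_at a x y 1 ->
  let t := nodal_cubic_at a x y 1 / cubic_at a x y 1 in
  t != 0 -> branch_factor a t != 0 ->
  ((y - 1) / (y + 1) * slope_den a t f) ^+ 2 = quartic_at a t f.
Proof.
move=> a0 y1 c0 fE t t0 H0.
have E1 := slopeE y1 c0 fE; rewrite /= -/t in E1.
set s := x / (y + 1) in E1.
pose q := y / (y + 1) ^+ 2.
pose D := slope_den a t f; pose N := slope_num a t f.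
have xE : x = s * (y + 1) by rewrite /s mulfVK.
have cE : cubic_at a x y 1 = (y + 1) ^+ 3 *
   (a * s ^+ 3 + a - 3%:R * a * q - (a ^+ 3 + 2%:R) * s * q).
  by rewrite xE /cubic_at /q; field.
have dE : nodal_cubic_at a x y 1 = (y + 1) ^+ 3 * ((q - a * s ^+ 2) * (s + a)).
  by rewrite xE /nodal_cubic_at /q; field.
have E2 : q * ((s + a) + t * (3%:R * a + (a ^+ 3 + 2%:R) * s)) =
    a * (t * (s ^+ 3 + 1) + s ^+ 2 * (s + a)).
  have : t * (a * s ^+ 3 + a - 3%:R * a * q - (a ^+ 3 + 2%:R) * s * q) =
     (q - a * s ^+ 2) * (s + a).
    have y3 : (y + 1) ^+ 3 != 0 by rewrite expf_neq0.
    apply: (mulfI y3); rewrite -dE mulrCA -cE /t mulfVK //.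
  move=> E; apply/eqP; rewrite -subr_eq0; apply/eqP.
  have -> : q * (s + a + t * (3%:R * a + (a ^+ 3 + 2%:R) * s)) -
     a * (t * (s ^+ 3 + 1) + s ^+ 2 * (s + a)) = (q - a * s ^+ 2) * (s + a)
     - t * (a * s ^+ 3 + a - 3%:R * a * q - (a ^+ 3 + 2%:R) * s * q) by ring.
  by rewrite E subrr.
have -> : ((y - 1) / (y + 1) * D) ^+ 2 = (1 - 4%:R * q) * D ^+ 2.
  by rewrite exprMn; congr (_ * _); rewrite /q; field.
rewrite /branch_factor in H0; set H := _ + _ in H0.
have atH0 : a * t * H != 0 by apply: mulf_neq0 => //; exact: mulf_neq0.
apply: (mulIf atH0).
have WD : ((s + a) + t * (3%:R * a + (a ^+ 3 + 2%:R) * s)) * D = a * t * H.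
  have -> : ((s + a) + t * (3%:R * a + (a ^+ 3 + 2%:R) * s)) * D =
    (1 + (a ^+ 3 + 2%:R) * t) * (s * D) + a * (1 + 3%:R * t) * D by ring.
  by rewrite E1 /D /slope_num /slope_den /H; ring.
have -> : (1 - 4%:R * q) * D ^+ 2 * (a * t * H) =
  (a * t * H) * D ^+ 2 - 4%:R * a * (t * ((s * D) ^+ 3 + D ^+ 3) + (s * D) ^+ 2 * (s * D + a * D)).
  rewrite -WD.
  have -> : (1 - 4%:R * q) * D ^+ 2 * (((s + a) + t * (3%:R * a + (a ^+ 3 + 2%:R) * s)) * D) =
    ((s + a) + t * (3%:R * a + (a ^+ 3 + 2%:R) * s)) * D * D ^+ 2 -
    4%:R * D ^+ 3 * (q * ((s + a) + t * (3%:R * a + (a ^+ 3 + 2%:R) * s))) by ring.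
  by rewrite E2; ring.
by rewrite E1 /D /slope_den /slope_num /H /quartic_at; ring.
Qed.

End Identities.

Lemma branch_quarticE (k : closedFieldType) (K : fieldType) (tK : {rmorphism {poly k} -> K}) (a : k) :
  branch_quartic tK a = quartic_at (tK a%:P)%:P 'X (tK 'X)%:P.
Proof.
rewrite /branch_quartic branch_quartic2E rmorph_quartic_at.
by congr quartic_at; [exact: map_polyC | exact: map_polyX | exact: map_polyC].
Qed.

(** * The Riemann-Roch space and its deck transformation *)

(** K stands for k(f), embedded in F by jK, and ev evaluates polynomials
    over K at t. E is a closed point of F over K where t has a simple pole,
    and t has no other pole; τ is the reflection. *)
Section RiemannRoch.
Variables (k : closedFieldType) (F : fieldType) (κ : {rmorphism k -> F}).
Variables (K : fieldType) (tK : {rmorphism {poly k} -> K}).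
Hypotheses (tK_inj : injective tK).
Hypothesis tK_frac : forall r, exists n d, d != 0 /\ r = tK n / tK d.
Variables (a : k) (x y f : F).
Hypotheses (two0 : 2%:R != 0 :> k) (three0 : 3%:R != 0 :> k).
Hypotheses (a0 : a != 0) (a3 : a ^+ 3 != 1).
Local Notation A := (κ a).
Local Notation c := (cubic_at A x y 1).
Let t := nodal_cubic_at A x y 1 / c.
Hypotheses (y0 : y != 0) (y1 : y + 1 != 0) (c0 : c != 0).
Hypothesis fE : f * c ^+ 2 = - sextic_at A x y 1.
Hypothesis gen : forall S : F -> Prop, (forall r, S (κ r)) ->
  (forall g h, S g -> S h -> S (g - h)) -> (forall g h, S g -> S h -> S (g * h)) ->
  (forall h, S h -> S h^-1) -> S x -> S y -> forall h, S h.

Variable jK : {rmorphism K -> F}.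
Hypothesis jKE : forall p, jK (tK p) = (map_poly κ p).[f].
Variable ev : {rmorphism {poly K} -> F}.
Hypothesis evX : ev 'X = t.
Hypothesis evC : forall r, ev r%:P = jK r.

Let Q4 := branch_quartic tK a.
Let Q4E : Q4 = quartic_at (tK a%:P)%:P 'X (tK 'X)%:P := branch_quarticE tK a.
Let Q4_size : (4 < size Q4)%N := branch_quartic_size tK_inj a.
Let Q4_sqfree v : v ^+ 2 %| Q4 -> (size v <= 1)%N :=
  branch_quartic_sqfree tK_inj tK_frac two0 three0 a0 a3 (v := v).

Variable cpoint : (F -> Prop) -> Prop.
Hypothesis cpointP : forall O, cpoint O <->
  [/\ valring O, (forall r, O (jK r)) & exists h, ~ O h].

Variable E : F -> Prop.
Hypotheses (cE : cpoint E) (t0 : t != 0) (mt : maxid E t^-1).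
Hypothesis Et : forall u, maxid E u -> E (u * t).
Hypothesis Eother : forall O, cpoint O -> ~ (forall g, O g <-> E g) -> O t.

Variable τ : {rmorphism F -> F}.
Hypotheses (τκ : forall r, τ (κ r) = κ r) (τx : τ x = x / y) (τy : τ y = y^-1).

Definition rr_space (h : F) : Prop :=
  (forall u, maxid E u -> E (u * h)) /\
  (forall O, cpoint O -> ~ (forall g, O g <-> E g) -> O h).

Let vE : valring E. Proof. by have /cpointP[] := cE. Qed.
Let EK r : E (jK r). Proof. by have /cpointP[_] := cE. Qed.

Lemma ev_horner P : ev P = (map_poly jK P).[t].
Proof.
elim/poly_ind: P => [|P r IH]; first by rewrite !rmorph0 horner0.
rewrite !rmorphD !rmorphM /= evX evC IH map_polyX map_polyC.
by rewrite hornerD hornerM hornerX hornerC.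
Qed.

(** Since t has a pole at E, the leading term of P dominates; its
    coefficient is in K, hence a unit of E. *)
Lemma ev_degree P : P != 0 ->
  E (ev P / t ^+ (size P).-1) /\ ~ maxid E (ev P / t ^+ (size P).-1).
Proof.
move=> P0; set n := (size P).-1.
have sP : size P = n.+1 by rewrite prednK // lt0n size_poly_eq0.
have tn i : t ^+ i != 0 by rewrite expf_neq0.
have H : maxid E (ev P / t ^+ n - jK (lead_coef P)).
  rewrite ev_horner (horner_coef_wide _ (leqnn _)) size_map_poly sP big_ord_recr /=.
  rewrite mulrDl !coef_map /= mulfK // lead_coefE -/n addrK mulr_suml.
  elim/big_rec: _ => [|i z _ mz]; first exact: maxid0.
  apply: (maxidD vE) => //; rewrite coef_map /= -mulrA; apply: (maxidMl vE) => //.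
  have -> : t ^+ n = t ^+ i * t ^+ (n - i) by rewrite -exprD subnKC // ltnW.
  rewrite invfM mulrA mulfV // mul1r -exprVn.
  have : (0 < n - i)%N by rewrite subn_gt0.
  case: (n - i)%N => // j _; rewrite exprS; apply: maxidMr => //.
  by apply: subringX; [exact: valring_subring | exact: maxid_in mt].
have lP : ~ maxid E (jK (lead_coef P)).
  have l0 : lead_coef P != 0 by rewrite lead_coef_eq0.
  by apply: unit_maxidN; rewrite ?fmorph_eq0 // -fmorphV.
have OP : E (ev P / t ^+ n).
  rewrite -[ev P / _](subrK (jK (lead_coef P))).
  by apply: subringD; [exact: valring_subring|exact: maxid_in H|].
split=> // mP; apply: lP; rewrite -[jK _](subKr (ev P / t ^+ n)).
exact: (maxidB vE).
Qed.

Lemma ev_inj : injective ev.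
Proof.
apply: raddf_inj => P EP; apply/eqP/contraT => /ev_degree[_]; case.
by rewrite EP mul0r; exact: maxid0.
Qed.

Let ev0 P : P != 0 -> ev P != 0.
Proof. by apply: contra_neq => EP; apply: ev_inj; rewrite EP rmorph0. Qed.

Let f_K : jK (tK 'X) = f.
Proof. by rewrite jKE map_polyX hornerX. Qed.
Let cst_K r : jK (tK r%:P) = κ r.
Proof. by rewrite jKE map_polyC hornerC. Qed.

(** The cubic and the sextic are symmetric in their last two variables. *)
Lemma τfix_f : τ f = f.
Proof.
have Ef : f = - sextic_at A x y 1 / c ^+ 2 by rewrite -fE mulfK // expf_neq0.
have Ec : τ c = c / y ^+ 3.
  rewrite /cubic_at !(rmorphB, rmorphD, rmorphXn, rmorphM, rmorph_nat, rmorph1) /= τκ τx τy.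
  by field.
have Es : τ (sextic_at A x y 1) = sextic_at A x y 1 / y ^+ 6.
  rewrite /sextic_at !(rmorphB, rmorphD, rmorphXn, rmorphM, rmorph_nat, rmorph1) /= τκ τx τy.
  by field.
rewrite Ef fmorph_div rmorphN rmorphXn /= Ec Es.
by move: c0; move: c => d d0; field; rewrite d0 y0.
Qed.

Lemma τfix_t : τ t = t.
Proof.
have Ec : τ c = c / y ^+ 3.
  rewrite /cubic_at !(rmorphB, rmorphD, rmorphXn, rmorphM, rmorph_nat, rmorph1) /= τκ τx τy.
  by field.
have Es : τ (nodal_cubic_at A x y 1) = nodal_cubic_at A x y 1 / y ^+ 3.
  rewrite /nodal_cubic_at !(rmorphB, rmorphD, rmorphXn, rmorphM, rmorph_nat, rmorph1) /= τκ τx τy.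
  by field.
rewrite /t fmorph_div /= Ec Es.
by move: c0; move: c => d d0; field; rewrite d0 y0.
Qed.

Lemma fix_jK (σ : {rmorphism F -> F}) : (forall r, σ (κ r) = κ r) -> σ f = f ->
  forall r, σ (jK r) = jK r.
Proof.
move=> σκ σf r; have [n [d [d0 ->]]] := tK_frac r.
rewrite !fmorph_div /= !jKE -!horner_map /= σf -!map_poly_comp.
by congr (_ / _); congr (_.[_]); apply: eq_map_poly => i /=; rewrite σκ.
Qed.

Lemma fix_ev (σ : {rmorphism F -> F}) : (forall r, σ (κ r) = κ r) -> σ f = f -> σ t = t ->
  forall P, σ (ev P) = ev P.
Proof.
move=> σκ σf σt P; rewrite ev_horner -horner_map /= σt -map_poly_comp.
by congr (_.[_]); apply: eq_map_poly => i /=; rewrite fix_jK.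
Qed.

Lemma τK h : τ (τ h) = h.
Proof.
apply: (gen (S := fun h => τ (τ h) = h)) => [r|g g' H H'|g g' H H'|g H| |].
- by rewrite !τκ.
- by rewrite !rmorphB /= H H'.
- by rewrite !rmorphM /= H H'.
- by rewrite !fmorphV /= H.
- by rewrite τx fmorph_div /= τx τy invrK mulfVK.
- by rewrite τy fmorphV /= τy invrK.
Qed.

Local Notation KtP := (frac_image ev).
Let Kt_ev P : KtP (ev P) := frac_image_in ev P.
Let KtB g h : KtP g -> KtP h -> KtP (g - h) := frac_imageB ev_inj (g := g) (h := h).
Let KtM g h : KtP g -> KtP h -> KtP (g * h) := frac_imageM (g := g) (h := h).
Let KtV g : KtP g -> KtP g^-1 := frac_imageV (g := g).
Lemma Kt0 : KtP 0. Proof. by rewrite -(rmorph0 ev); exact: Kt_ev. Qed.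
Lemma Kt1 : KtP 1. Proof. by rewrite -(rmorph1 ev); exact: Kt_ev. Qed.
Lemma KtN g : KtP g -> KtP (- g).
Proof. by move=> H; rewrite -sub0r; apply: KtB => //; exact: Kt0. Qed.
Lemma KtD g h : KtP g -> KtP h -> KtP (g + h).
Proof. by move=> H H'; rewrite -[h]opprK; apply: KtB => //; exact: KtN. Qed.
Lemma Kt_K r : KtP (jK r). Proof. by rewrite -evC; exact: Kt_ev. Qed.
Lemma Kt_t : KtP t. Proof. by rewrite -evX; exact: Kt_ev. Qed.
Lemma Kt_f : KtP f. Proof. by rewrite -f_K; exact: Kt_K. Qed.
Lemma Kt_cst r : KtP (κ r). Proof. by rewrite -cst_K; exact: Kt_K. Qed.
Lemma Kt_nat n : KtP n%:R. Proof. by rewrite -(rmorph_nat jK); exact: Kt_K. Qed.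

Lemma Kt_fix (σ : {rmorphism F -> F}) : (forall r, σ (κ r) = κ r) -> σ f = f -> σ t = t ->
  forall h, KtP h -> σ h = h.
Proof. by move=> ? ? ? h [P [Q [_ ->]]]; rewrite fmorph_div /= !fix_ev. Qed.

Let D := slope_den A t f.

Lemma slope_den_neq0 : D != 0.
Proof.
have -> : D = ev (slope_den (tK a%:P)%:P 'X (tK 'X)%:P).
  by rewrite rmorph_slope_den evX !evC f_K cst_K.
apply: ev0; have : (slope_den (tK a%:P)%:P 'X (tK 'X)%:P : {poly K}).[0] != 0.
  by rewrite slope_den_horner0 oppr_eq0 (raddf_eq0 _ tK_inj) polyX_eq0.
by apply: contra_neq => ->; rewrite horner0.
Qed.

Let w := (y - 1) / (y + 1) * D.

Lemma branch_ev : ev (Q4) = quartic_at A t f.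
Proof.
by rewrite Q4E rmorph_quartic_at evX !evC f_K cst_K.
Qed.

Lemma w_sqr : w ^+ 2 = ev (Q4).
Proof.
rewrite branch_ev /w; apply: branchE => //; first by rewrite fmorph_eq0.
have -> : branch_factor A t = ev (branch_factor (tK a%:P)%:P 'X).
  by rewrite rmorph_branch_factor evX evC cst_K.
apply: ev0; have : (branch_factor (tK a%:P)%:P 'X : {poly K}).[0] != 0.
  by rewrite branch_factor_horner0 oner_neq0.
by apply: contra_neq => ->; rewrite horner0.
Qed.

Let Kt_D : KtP D.
Proof.
rewrite /D /slope_den; do ! first [exact: Kt_f | exact: Kt_t | exact: Kt_cst | exact: Kt_nat | exact: Kt1
   | apply: KtB | apply: KtM | apply: KtD | rewrite exprSr | rewrite expr0].
Qed.

Lemma τw : τ w = - w.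
Proof.
rewrite /w rmorphM /= (Kt_fix τκ τfix_f τfix_t Kt_D) -mulNr; congr (_ * _).
rewrite fmorph_div rmorphB rmorphD rmorph1 /= τy.
by field; rewrite y1 ?y0 ?[1 + y]addrC ?y1.
Qed.

Let τ_Kt h : KtP h -> τ h = h := Kt_fix τκ τfix_f τfix_t (h := h).

(** K(t) + K(t) w is a field, since w^2 is in K(t), and it contains x and y:
    both (y - 1) / (y + 1) and x / (y + 1) are in it (slopeE). *)
Lemma quadratic_decomp h : exists h0 h1, [/\ KtP h0, KtP h1 & h = h0 + h1 * w].
Proof.
pose S h := exists h0 h1, [/\ KtP h0, KtP h1 & h = h0 + h1 * w].
have w2 : KtP (w ^+ 2) by rewrite w_sqr; exact: Kt_ev.
have S_Kt g : KtP g -> S g.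
  by move=> Kg; exists g, 0; rewrite mul0r addr0; split=> //; exact: Kt0.
have SB g g' : S g -> S g' -> S (g - g').
  move=> [h0 [h1 [H0 H1 ->]]] [h0' [h1' [H0' H1' ->]]]; exists (h0 - h0'), (h1 - h1').
  by split; [exact: KtB | exact: KtB | ring].
have SM g g' : S g -> S g' -> S (g * g').
  move=> [h0 [h1 [H0 H1 ->]]] [h0' [h1' [H0' H1' ->]]].
  exists (h0 * h0' + h1 * h1' * w ^+ 2), (h0 * h1' + h1 * h0').
  by split; [apply: KtD; [exact: KtM | by apply: KtM => //; exact: KtM] | by apply: KtD; apply: KtM | ring].
have SV g : S g -> S g^-1.
  move=> Sg; case: (eqVneq g 0) Sg => [->|g0]; first by rewrite invr0.
  move=> [h0 [h1 [H0 H1 Eg]]].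
  pose N := h0 ^+ 2 - h1 ^+ 2 * w ^+ 2.
  have EN : N = g * τ g.
    by rewrite Eg rmorphD rmorphM /= τw !τ_Kt // /N; ring.
  have N0 : N != 0 by rewrite EN mulf_neq0 // fmorph_eq0.
  have KN : KtP N^-1.
    by apply: KtV; rewrite /N !expr2; apply: KtB; first exact: KtM; apply: KtM; [exact: KtM | rewrite -expr2].
  exists (h0 / N), (- h1 / N); split; [exact: KtM | by apply: KtM => //; exact: KtN |].
  apply: (mulfI g0); rewrite mulfV //.
  have -> : g * (h0 / N + - h1 / N * w) = g * (h0 - h1 * w) / N by ring.
  have -> : h0 - h1 * w = τ g by rewrite Eg rmorphD rmorphM /= τw !τ_Kt //; ring.
  by rewrite -EN mulfV.
have Sw : S w by exists 0, 1; rewrite add0r mul1r; split=> //; [exact: Kt0 | exact: Kt1].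
have Sw0 : S ((y - 1) / (y + 1)).
  have -> : (y - 1) / (y + 1) = w * D^-1 by rewrite /w mulfK // slope_den_neq0.
  by apply: SM => //; apply: SV; apply: S_Kt.
have S1 : S 1 by apply: S_Kt; exact: Kt1.
have Sy : S (y + 1).
  have -> : y + 1 = 2%:R * (1 - (y - 1) / (y + 1))^-1.
    have -> : 1 - (y - 1) / (y + 1) = 2%:R / (y + 1) by field.
    have two0' : 2%:R != 0 :> F by rewrite -(rmorph_nat κ) fmorph_eq0.
    by rewrite invf_div mulrCA divff // mulr1.
  apply: SM; first by apply: S_Kt; exact: Kt_nat.
  by apply: SV; apply: SB.
apply: (gen (S := S)) => //.
- by move=> r; apply: S_Kt; exact: Kt_cst.
- have -> : x = x / (y + 1) * (y + 1) by rewrite mulfVK.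
  apply: SM => //.
  have -> : x / (y + 1) = slope_num A t f / D.
    by rewrite -(slopeE y1 c0 fE) -/t -/D mulfK // slope_den_neq0.
  apply: S_Kt; apply: KtM; last exact: KtV.
  rewrite /slope_num; do ! first [exact: Kt_f | exact: Kt_t | exact: Kt_cst | exact: Kt_nat | exact: Kt1
   | apply: KtB | apply: KtM | apply: KtD | rewrite exprSr | rewrite expr0].
- by rewrite -[y](addrK 1); apply: SB.
Qed.

Lemma rr_K r : rr_space (jK r).
Proof.
split=> [u mu|O cO _]; last by have /cpointP[] := cO.
by have [Eu _] := mu; apply: (valringM vE).
Qed.

Lemma rr_t : rr_space t. Proof. by split. Qed.

(** σ fixes K(t), which is generated by elements of the Riemann-Roch space.
    So it fixes w^2, and σ w = w or σ w = - w. *)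
Lemma deck_unique (σ : {rmorphism F -> F}) : (forall h, rr_space h -> σ h = h) ->
  (exists h, σ h <> h) -> forall h, σ h = τ h.
Proof.
move=> fix_rr [g ng].
have σκ r : σ (κ r) = κ r by rewrite -cst_K fix_rr //; exact: rr_K.
have σf : σ f = f by rewrite -f_K fix_rr //; exact: rr_K.
have σt : σ t = t by rewrite fix_rr //; exact: rr_t.
have σ_Kt := Kt_fix σκ σf σt.
have : σ w ^+ 2 = w ^+ 2 by rewrite -rmorphXn /= σ_Kt // w_sqr; exact: Kt_ev.
move/eqP; rewrite eqf_sqr => /orP[] /eqP σw.
  by case: ng; have [h0 [h1 [H0 H1 ->]]] := quadratic_decomp g; rewrite rmorphD rmorphM /= σw !σ_Kt.
move=> h; have [h0 [h1 [H0 H1 ->]]] := quadratic_decomp h.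
rewrite [LHS]rmorphD [σ (_ * _)]rmorphM /= σw [RHS]rmorphD [τ (_ * _)]rmorphM /= τw.
by rewrite !σ_Kt // !τ_Kt.
Qed.

Let pullτ (O : F -> Prop) g := O (τ g).

Lemma pull_cpoint O : cpoint O -> cpoint (pullτ O).
Proof.
move=> /cpointP[vO KO [h nOh]]; apply/cpointP; rewrite /pullτ; split.
- split=> [g g'|g g'|g]; rewrite ?rmorphB ?rmorphM ?fmorphV; [exact: (valringB vO)|exact: (valringM vO)|].
  exact: (valring_tot vO).
- by move=> r; rewrite (fix_jK τκ τfix_f).
- by exists (τ h); rewrite τK.
Qed.

Let nEt : ~ E t.
Proof. by move=> H; case: mt => _ []; [move/eqP; rewrite invr_eq0 (negPf t0) | rewrite invrK]. Qed.

(** The inverse image of E under τ is a closed point at which τ t = t has a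
    pole. *)
Lemma pullE g : E (τ g) <-> E g.
Proof.
have H : forall g, E (τ g) <-> E g.
  by apply: NNPP => nH; have := Eother (pull_cpoint cE) nH; rewrite /pullτ τfix_t.
exact: H.
Qed.

Lemma maxidτ u : maxid E u -> maxid E (τ u).
Proof.
move=> [Eu H]; split; first by apply/pullE.
case: H => [->|H]; [by left; rewrite rmorph0 | right].
by rewrite -fmorphV => /pullE.
Qed.

Lemma rr_τ h : rr_space h -> rr_space (τ h).
Proof.
move=> [H1 H2]; split=> [u mu|O cO nO].
  apply/pullE; rewrite rmorphM /= τK; apply: H1; exact: maxidτ.
apply: (H2 (pullτ O)) => [|H]; first exact: pull_cpoint.
apply: nO => g; rewrite -(τK g); rewrite -[O _]/(pullτ O (τ g)) H.
by rewrite -pullE.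
Qed.

(** If G is not in K[t][G^-1], then Chevalley's theorem gives a valuation
    ring that contains K[t] but not G; it is a closed point, and not E since
    it contains t. So G is in K[t][G^-1], which is an equation of integral
    dependence over K[t], and K[t] is integrally closed. *)
Lemma integral_ev G : (forall O, cpoint O -> ~ (forall g, O g <-> E g) -> O G) ->
  KtP G -> exists P, G = ev P.
Proof.
move=> OG [P [Q [Q0 EG]]].
case: (eqVneq G 0) => [->|G0]; first by exists 0; rewrite rmorph0.
have P0 : P != 0 by apply: contra_neq G0 => P0; rewrite EG P0 rmorph0 mul0r.
wlog cop : P Q P0 Q0 EG / coprimep P Q.
  move=> W; set d := gcdp P Q.
  have d0 : d != 0 by rewrite gcdp_eq0 negb_and P0.
  have EP : P = P %/ d * d by rewrite divpK // dvdp_gcdl.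
  have EQ : Q = Q %/ d * d by rewrite divpK // dvdp_gcdr.
  apply: (W (P %/ d) (Q %/ d)).
  - by apply: contraNneq P0 => H; rewrite EP H mul0r.
  - by apply: contraNneq Q0 => H; rewrite EQ H mul0r.
  - rewrite EG {1}EP {1}EQ !rmorphM /= -mulf_div divff ?mulr1 //; exact: ev0.
  - by apply: coprimep_div_gcd; rewrite P0.
pose A0 h := exists R, h = ev R.
have sA0 : subring A0.
  split; first by exists 1; rewrite rmorph1.
  - by move=> _ _ [R ->] [R' ->]; exists (R - R'); rewrite rmorphB.
  - by move=> _ _ [R ->] [R' ->]; exists (R * R'); rewrite rmorphM.
pose A1 := adjoin A0 G^-1.
have sA1 : subring A1 := adjoin_subring _ sA0.
have A01 R : A1 (ev R) by apply: adjoin_sub => //; exists R.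
have : A1 G.
  apply: NNPP => nA; have A1G : A1 G^-1 := adjoin_gen _ sA0.
  have nA' : ~ A1 G^-1^-1 by rewrite invrK.
  have [O [vO AO nO]] := chevalley sA1 A1G nA'.
  rewrite invrK in nO; apply: (nO); apply: OG.
    apply/cpointP; split=> //; first by move=> r; rewrite -evC; apply: AO.
    by exists G.
  move=> H; apply: nEt; apply/H; rewrite -evX; exact: AO.
case=> p Ap EGp.
have [p' Ep] : exists p' : {poly {poly K}}, p = map_poly ev p'.
  elim/poly_ind: (p) Ap => [|q r IH] Aq; first by exists 0; rewrite rmorph0.
  have [|q' Eq] := IH; first by move=> i; have := Aq i.+1; rewrite coefD coefMX coefC addr0.
  have [R ER] := Aq 0%N; rewrite coefD coefMX coefC add0r /= in ER.
  by exists (q' * 'X + R%:P); rewrite rmorphD rmorphM /= map_polyX map_polyC /= -Eq -ER.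
pose n := size p'.
pose R := \sum_(i < n) p'`_i * Q ^+ i * P ^+ (n - i).
have key : P ^+ n.+1 = Q * R.
  apply: ev_inj; rewrite !(rmorphXn, rmorphM) /=.
  have eP := ev0 P0; have eQ := ev0 Q0.
  have -> : ev P ^+ n.+1 = ev Q * (G * ev P ^+ n).
    by rewrite EG exprS mulrA mulrCA mulfV // mulr1.
  congr (_ * _); rewrite EGp Ep (horner_coef_wide _ (leqnn _)) size_map_inj_poly ?rmorph0 //; last exact: ev_inj.
  rewrite mulr_suml /R rmorph_sum /=; apply: eq_bigr => i _.
  rewrite coef_map /= !(rmorphXn, rmorphM) /= EG invf_div expr_div_n.
  have -> : ev P ^+ n = ev P ^+ i * ev P ^+ (n - i) by rewrite -exprD subnKC // ltnW.
  have := expf_neq0 i eP; move: (ev P ^+ i) (ev P ^+ _) (ev Q ^+ i) (ev p'`_i) => u v z r u0.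
  by field.
have : Q %| P ^+ n.+1 by rewrite key dvdp_mulr.
move=> dQ; have : coprimep Q (P ^+ n.+1) by rewrite coprimep_sym coprimep_expl.
move=> cQ; have : Q %| 1 by rewrite -(Gauss_dvdpr 1 cQ) mulr1.
rewrite dvdp1 => /size_poly1P[q q0 EQ].
exists (q^-1 *: P); rewrite EG EQ evC -mul_polyC rmorphM /= evC fmorphV.
by rewrite mulrC.
Qed.

(** g = h - τ h is anti-invariant, hence g = h1 w with h1 in K(t), and g^2
    is a polynomial P in t (integral_ev). Writing h1 = U / W in lowest
    terms, P W^2 = q U^2 for the branch quartic q, which is squarefree, so W
    is constant. If g is not 0, then P has degree at least 4, whereas the
    pole of g^2 at E has order at most 2. *)
Lemma rr_fixed h : rr_space h -> τ h = h.
Proof.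
move=> rh; have [g gE] : exists g, g = h - τ h by exists (h - τ h).
suff g0 : g = 0 by apply/esym/eqP; rewrite -subr_eq0 -gE g0.
have [rg1 rg2] : rr_space g.
  rewrite gE.
  have [H1 H2] := rh; have [H1' H2'] := rr_τ rh.
  split=> [u mu|O cO nO]; first by rewrite mulrBr; apply: (valringB vE); [exact: H1|exact: H1'].
  have /cpointP[vO _ _] := cO; apply: (valringB vO); [exact: H2|exact: H2'].
have τg : τ g = - g by rewrite gE rmorphB /= τK opprB.
have [g' [h1 [K0 K1 Eg]]] := quadratic_decomp g.
have g'0 : g' = 0.
  have : g' + g' = 0.
    have : τ g = - g := τg; rewrite Eg rmorphD rmorphM /= τw !τ_Kt // => H.
    have -> : g' + g' = (g' + h1 * - w) - - (g' + h1 * w) by ring.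
    by rewrite H subrr.
  rewrite -mulr2n -mulr_natl => /eqP; rewrite mulf_eq0 -(rmorph_nat κ) fmorph_eq0.
  by rewrite (negPf two0) => /eqP.
rewrite {}g'0 add0r {K0 g'} in Eg.
case: (eqVneq g 0) => // gn0; exfalso.
have [U [W [W0 Eh1]]] := K1.
have U0 : U != 0 by apply: (contra_neq _ gn0) => U0; rewrite Eg Eh1 U0 rmorph0 !mul0r.
have {U W W0 Eh1 U0} [U [W [U0 W0 Eh1 cop]]] : exists U W,
    [/\ U != 0, W != 0, h1 = ev U / ev W & coprimep U W].
  set d := gcdp U W.
  have d0 : d != 0 by rewrite gcdp_eq0 negb_and U0.
  have EP : U = U %/ d * d by rewrite divpK // dvdp_gcdl.
  have EQ : W = W %/ d * d by rewrite divpK // dvdp_gcdr.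
  exists (U %/ d), (W %/ d); split.
  - by apply: contraNneq U0 => H; rewrite EP H mul0r.
  - by apply: contraNneq W0 => H; rewrite EQ H mul0r.
  - rewrite Eh1 {1}EP {1}EQ !rmorphM /= -mulf_div divff ?mulr1 //; exact: ev0.
  - by apply: coprimep_div_gcd; rewrite U0.
have [P EP] : exists P, g ^+ 2 = ev P.
  apply: integral_ev.
    move=> O cO nO; have /cpointP[vO _ _] := cO.
    by rewrite expr2; apply: (valringM vO); apply: rg2.
  rewrite Eg exprMn w_sqr expr2; apply: KtM; last exact: Kt_ev.
  exact: KtM.
have EPW : P * W ^+ 2 = Q4 * U ^+ 2.
  apply: ev_inj; rewrite !(rmorphXn, rmorphM) /= -EP Eg -w_sqr Eh1.
  have := ev0 W0; move: (ev U) (ev W) (w) => u z v z0.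
  by field.
have sW : (size W <= 1)%N.
  apply: Q4_sqfree.
  have : W ^+ 2 %| Q4 * U ^+ 2 by rewrite -EPW dvdp_mulIr.
  by rewrite Gauss_dvdpl // coprimep_expl // coprimep_expr // coprimep_sym.
have sP : (4 < size P)%N.
  have q0 : Q4 != 0.
    by rewrite -size_poly_gt0; exact: leq_trans Q4_size.
  have P0 : P != 0.
    apply: contra_neq gn0 => P0; apply/eqP; rewrite -(sqrf_eq0 g) EP P0 rmorph0 //.
  have W1 : size W = 1%N by apply/eqP; rewrite eqn_leq sW size_poly_gt0.
  have : size (P * W ^+ 2) = size P.
    have /eqP/size_poly1P[r r0 ->] := W1.
    by rewrite -rmorphXn /= mulrC mul_polyC size_scale // expf_neq0.
  rewrite EPW => <-; rewrite size_mul ?expf_neq0 //.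
  have : (0 < size (U ^+ 2))%N by rewrite size_poly_gt0 expf_neq0.
  have := Q4_size; case: (size (U ^+ 2)) => // m sq _.
  by rewrite addnS /=; exact: leq_trans (leq_addr _ _).
have P0 : P != 0 by rewrite -size_poly_gt0; exact: leq_trans sP.
have [uE um] := ev_degree P0.
have [u0 uV] := maxidN_unit vE uE um.
set n := (size P).-1 in uE um u0 uV.
have n4 : (4 <= n)%N by rewrite /n -ltnS prednK // (leq_trans _ sP).
have : E (t^-1 * g) by apply: rg1.
move=> Etg; have : E ((t^-1 * g) ^+ 2) by rewrite expr2; apply: (valringM vE).
rewrite exprMn EP => H.
have : E (t ^+ (n - 2)).
  have -> : t ^+ (n - 2) = t^-1 ^+ 2 * ev P * (ev P / t ^+ n)^-1.
    have ep : ev P != 0 := ev0 P0.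
    have -> : t ^+ n = t ^+ (n - 2) * t ^+ 2 by rewrite -exprD subnK // (leq_trans _ n4).
    have t20 : t ^+ 2 != 0 by rewrite expf_neq0.
    rewrite [(ev P / _)^-1]invf_div [t^-1 ^+ 2]exprVn.
    move: (t ^+ (n - 2)) (ev P) (t ^+ 2) ep t20 => v e z e0 z0.
    by field; rewrite e0 z0.
  exact: (valringM vE).
have : (0 < n - 2)%N by rewrite subn_gt0 (leq_trans _ n4).
case: (n - 2)%N => // j _ Etj; have : maxid E (t^-1 ^+ j.+1).
  rewrite exprS; apply: maxidMr => //.
  by apply: subringX; [exact: valring_subring | exact: maxid_in mt].
move=> mtj; have := maxidMr vE mtj Etj.
by rewrite -exprMn mulVf // expr1n => /(maxid1 vE).
Qed.

End RiemannRoch.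

(** * Coordinates adapted to a base point *)

Section Frames.
Variable R : comNzRingType.
Implicit Types (v x y z : R) (r : nat).

(** Linear maps that carry (a : 1 : 1) to the base points (base_ptE) and
    preserve the cubic and the sextic. *)
Definition frame r v (u : R * R * R) : R * R * R :=
  let: (u0, u1, u2) := u in
  match r with
  | 0 => (v * u0, v ^+ 2 * u1, u2)
  | 1 => (v * u2, v ^+ 2 * u0, u1)
  | _ => (v * u1, v ^+ 2 * u2, u0)
  end.
Definition coframe r v (x : R * R * R) : R * R * R :=
  let: (x0, x1, x2) := x in
  match r with
  | 0 => (v ^+ 2 * x0, v * x1, x2)
  | 1 => (v * x1, x2, v ^+ 2 * x0)
  | _ => (x2, v ^+ 2 * x0, v * x1)
  end.
Definition swap23 (u : R * R * R) : R * R * R := let: (u0, u1, u2) := u in (u0, u2, u1).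
Definition reflect_pt r v (x : R * R * R) := frame r v (swap23 (coframe r v x)).

Variables (r : nat) (v : R).
Hypothesis v3 : v ^+ 3 = 1.
Let vv : v * v ^+ 2 = 1. Proof. by rewrite -exprS. Qed.
Let vv' : v ^+ 2 * v = 1. Proof. by rewrite mulrC. Qed.

Lemma frameK u : coframe r v (frame r v u) = u.
Proof.
by move: u => [[u0 u1] u2]; case: r => [|[|?]] /=; rewrite !mulrA ?vv ?vv' !mul1r.
Qed.
Lemma coframeK (x : R * R * R) : frame r v (coframe r v x) = x.
Proof.
by move: x => [[u0 u1] u2]; case: r => [|[|?]] /=; rewrite !mulrA ?vv ?vv' !mul1r.
Qed.

Lemma frame_cubic a x y z : let: (x0, x1, x2) := frame r v (x, y, z) in
  cubic_at a x0 x1 x2 = cubic_at a x y z.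
Proof.
have H p q s : cubic_at a (v * p) (v ^+ 2 * q) s = cubic_at a p q s.
  have -> : cubic_at a (v * p) (v ^+ 2 * q) s =
    a * (v ^+ 3 * p ^+ 3 + (v ^+ 3) ^+ 2 * q ^+ 3 + s ^+ 3) - (a ^+ 3 + 2%:R) * (v ^+ 3 * (p * q * s)).
    by rewrite /cubic_at; ring.
  by rewrite v3 expr1n !mul1r.
by case: r => [|[|?]] /=; rewrite H // /cubic_at; ring.
Qed.
Lemma frame_sextic a x y z : let: (x0, x1, x2) := frame r v (x, y, z) in
  sextic_at a x0 x1 x2 = sextic_at a x y z.
Proof.
have H p q s : sextic_at a (v * p) (v ^+ 2 * q) s = sextic_at a p q s.
  have -> : sextic_at a (v * p) (v ^+ 2 * q) s =
    v ^+ 3 * (v ^+ 3 * (p * q) - a * s ^+ 2) * (p * s - a * (v ^+ 3 * q ^+ 2)) * (q * s - a * p ^+ 2).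
    by rewrite /sextic_at; ring.
  by rewrite v3 !mul1r.
by case: r => [|[|?]] /=; rewrite H // /sextic_at; ring.
Qed.
End Frames.

Lemma frame_morph (R S : comNzRingType) (φ : {rmorphism R -> S}) r v (u : R * R * R) :
  frame r (φ v) (φ u.1.1, φ u.1.2, φ u.2) =
  (let: (x0, x1, x2) := frame r v u in (φ x0, φ x1, φ x2)).
Proof. by move: u => [[u0 u1] u2]; case: r => [|[|?]] /=; rewrite !(rmorphXn, rmorphM). Qed.

Lemma frame_scale (R : comNzRingType) r (v s : R) u0 u1 u2 :
  frame r v (s * u0, s * u1, s * u2) =
  (let: (x0, x1, x2) := frame r v (u0, u1, u2) in (s * x0, s * x1, s * x2)).
Proof. by case: r => [|[|?]] /=; rewrite ![s * (_ * _)]mulrCA. Qed.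

Arguments frame : simpl nomatch.
Arguments coframe : simpl nomatch.

Section FrameField.
Variables (k : fieldType) (F : fieldType) (κ : {rmorphism k -> F}).
Variables (r : nat) (v : k) (x y : F).
Hypotheses (v3 : v ^+ 3 = 1) (x0 : x != 0) (y0 : y != 0).
Let V := κ v.
Let V3 : V ^+ 3 = 1. Proof. by rewrite /V -rmorphXn v3 rmorph1. Qed.
Let V0 : V != 0.
Proof. by apply: contra_eq_neq V3 => ->; rewrite expr0n eq_sym oner_eq0. Qed.

Definition adapted : F * F :=
  let: (ξ, η, ζ) := coframe r V (x, y, 1) in (ξ / ζ, η / ζ).
Local Notation x' := adapted.1.
Local Notation y' := adapted.2.

Lemma coframe_neq0 : let: (ξ, η, ζ) := coframe r V (x, y, 1) in
  [/\ ξ != 0, η != 0 & ζ != 0].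
Proof. by case: r => [|[|?]] /=; split; rewrite ?mulf_neq0 ?expf_neq0 ?oner_neq0. Qed.

Lemma adapted_frame : exists2 s, s != 0 & frame r V (x', y', 1) = (s * x, s * y, s).
Proof.
have := coframe_neq0; have := coframeK r V3 (x, y, 1); rewrite /adapted.
case: (coframe r V (x, y, 1)) => [[ξ η] ζ] E [ξ0 η0 ζ0] /=; exists ζ^-1.
  by rewrite invr_eq0.
by rewrite ![_ / ζ]mulrC -(mulVf ζ0) frame_scale E mulr1.
Qed.

Lemma adapted_eq a f : f * cubic_at a x y 1 ^+ 2 = - sextic_at a x y 1 ->
  f * cubic_at a x' y' 1 ^+ 2 = - sextic_at a x' y' 1.
Proof.
move=> fE; have [s s0 E] := adapted_frame.
have := frame_cubic r V3 a x' y' 1; have := frame_sextic r V3 a x' y' 1; rewrite E => <- <-.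
have := cubic_scale a s x y 1; have := sextic_scale a s x y 1; rewrite !mulr1 => -> ->.
by rewrite -mulrN -fE; ring.
Qed.

Lemma adapted_gen (S : F -> Prop) : (forall c, S (κ c)) ->
  (forall g h, S g -> S h -> S (g * h)) -> (forall h, S h -> S h^-1) ->
  S x' -> S y' -> S x /\ S y.
Proof.
move=> Sc SM SV Sx Sy; have [s s0 E] := adapted_frame.
have S1 : S 1 by rewrite -(rmorph1 κ).
have : let: (p0, p1, p2) := frame r V (x', y', 1) in [/\ S p0, S p1 & S p2].
  have SV2 : S (V ^+ 2) by rewrite expr2; apply: SM; exact: Sc.
  by case: r => [|[|?]] /=; split=> //; apply: SM => //; exact: Sc.
rewrite E => -[S0 S1' S2]; split.
  by rewrite -[x](mulKf s0); apply: SM => //; exact: SV.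
by rewrite -[y](mulKf s0); apply: SM => //; exact: SV.
Qed.

Lemma adapted_reflect (τ : {rmorphism F -> F}) : (forall c, τ (κ c) = κ c) ->
  (let: (p0, p1, p2) := reflect_pt r V (x, y, 1) in τ x = p0 / p2 /\ τ y = p1 / p2) ->
  [/\ τ x' = x' / y' & τ y' = y'^-1].
Proof.
move=> τκ; have V30 : V ^+ 3 - 1 = 0 by rewrite V3 subrr.
have V20 : V ^+ 2 != 0 by rewrite expf_neq0.
have VE : V ^+ 2 = V^-1 by apply: (mulfI V0); rewrite -exprS V3 mulfV.
rewrite /adapted; case: r => [|[|?]] /= [ex ey]; rewrite !fmorph_div !(rmorphXn, rmorphM, rmorph1) /= ?τκ ex ey -/V !VE.
- by split; field; rewrite -?/V ?oner_neq0 ?V0 ?y0 ?x0.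
- by split; field; rewrite -?/V ?oner_neq0 ?V0 ?y0 ?x0.
- by split; field; rewrite -?/V ?oner_neq0 ?V0 ?y0 ?x0.
Qed.

End FrameField.

(** * The function field of the plane and its reflections *)

Section FormMorph.
Variables (R S : comNzRingType) (φ : {rmorphism R -> S}).
Let φE := (rmorphB φ, rmorphD φ, rmorphN φ, rmorphXn φ, rmorphM φ, rmorph1 φ, rmorph_nat φ).
Lemma rmorph_cubic_at a x y z : φ (cubic_at a x y z) = cubic_at (φ a) (φ x) (φ y) (φ z).
Proof. by rewrite /cubic_at !φE. Qed.
Lemma rmorph_sextic_at a x y z : φ (sextic_at a x y z) = sextic_at (φ a) (φ x) (φ y) (φ z).
Proof. by rewrite /sextic_at !φE. Qed.
End FormMorph.

Lemma pencil_sexticE (k : fieldType) (a : k) :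
  pencil_sextic a = sextic_at a%:MP 'X_0 'X_1 'X_(2%:R) :> {mpoly k[3]}.
Proof. by rewrite /pencil_sextic -!mul_mpolyC. Qed.
Lemma pencil_cubicE (k : fieldType) (a : k) :
  pencil_cubic a = cubic_at a%:MP 'X_0 'X_1 'X_(2%:R) :> {mpoly k[3]}.
Proof. by rewrite /pencil_cubic -!mul_mpolyC /cubic_at mpolyCD rmorphXn /= mpolyC_nat. Qed.

Lemma mpoly_rmorph_ind (n : nat) (k : nzRingType) (S : {mpoly k[n]} -> Prop) :
  (forall c, S c%:MP) -> (forall i, S 'X_i) -> (forall p q, S p -> S q -> S (p + q)) ->
  (forall p q, S p -> S q -> S (p * q)) -> forall p, S p.
Proof.
move=> SC SX SD SM p; elim/mpolyind: p => [|c m p _ _ Sp].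
  by rewrite -mpolyC0.
apply: (SD) => //; rewrite -mul_mpolyC; apply: (SM) => //.
rewrite mpolyXE_id; elim/big_rec: _ => [|i q _ Sq]; first by rewrite -mpolyC1.
apply: (SM) => //; elim: (m i) => [|j IH]; first by rewrite expr0 -mpolyC1.
by rewrite exprS; apply: SM.
Qed.

Lemma mpoly_rmorph_ext (n : nat) (k : nzRingType) (S : nzRingType)
  (φ ψ : {rmorphism {mpoly k[n]} -> S}) : (forall c, φ c%:MP = ψ c%:MP) ->
  (forall i, φ 'X_i = ψ 'X_i) -> forall p, φ p = ψ p.
Proof.
move=> EC EX; apply: mpoly_rmorph_ind => // p q Ep Eq.
  by rewrite !rmorphD /= Ep Eq.
by rewrite !rmorphM /= Ep Eq.
Qed.

(** k is infinite. *)
Lemma poly2_nonroot (k : closedFieldType) (A : {poly {poly k}}) : A != 0 ->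
  exists s t : k, eval_pair idfun s t A != 0.
Proof.
move=> A0; have /closed_nonrootP[t nt] : lead_coef A != 0 by rewrite lead_coef_eq0.
pose φ : {rmorphism {poly k} -> k} := horner_eval t \o map_poly idfun.
have A1 : map_poly φ A != 0.
  apply/negP => /eqP /(congr1 (fun p : {poly k} => p`_(size A).-1)).
  rewrite coef_map coef0 /= -lead_coefE /horner_eval map_poly_id // => /eqP.
  by rewrite -rootE (negPf nt).
have /closed_nonrootP[s ns] := A1; exists s, t.
by rewrite /eval_pair /= /horner_eval -rootE.
Qed.

Section PlaneField.
Variable k : closedFieldType.
Local Notation FF := (funfield k).

Definition cstm : {rmorphism k -> FF} := @tofrac {mpoly k[2]} \o @mpolyC 2 k.
Definition xF : FF := tofrac 'X_0.
Definition yF : FF := tofrac 'X_1.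

Lemma cstmE c : cstm c = tofrac c%:MP. Proof. by []. Qed.

Lemma ord2E (i : 'I_2) : i = 0 \/ i = 1.
Proof. by case: i => [[|[|i]] //= Hi]; [left|right]; apply: val_inj. Qed.

Lemma mpoly2_ind (S : {mpoly k[2]} -> Prop) :
  (forall c, S c%:MP) -> S 'X_0 -> S 'X_1 -> (forall p q, S p -> S q -> S (p + q)) ->
  (forall p q, S p -> S q -> S (p * q)) -> forall p, S p.
Proof.
by move=> SC S0 S1; apply: mpoly_rmorph_ind => // i; case: (ord2E i) => ->.
Qed.

Lemma funfield_gen (S : FF -> Prop) : (forall c, S (cstm c)) ->
  (forall g h, S g -> S h -> S (g - h)) -> (forall g h, S g -> S h -> S (g * h)) ->
  (forall h, S h -> S h^-1) -> S xF -> S yF -> forall h, S h.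
Proof.
move=> SC SB SM SV Sx Sy h; have [N [D [D0 ->]]] := fracE h.
suff SP p : S (tofrac p) by apply: SM => //; exact: SV.
elim/mpoly2_ind: p => //.
- move=> p q Sp Sq; rewrite tofracD -[tofrac q]opprK; apply: (SB) => //.
  have S0 : S 0 by rewrite -(subrr (cstm 0)); apply: (SB).
  by rewrite -sub0r; apply: SB.
- by move=> p q Sp Sq; rewrite tofracM; apply: SM.
Qed.

(** A partial evaluation, as a relation. It shows that two functions are
    algebraically independent if they have enough common values
    (eval_pair_inj). *)
Definition eval_at (q : 'I_2 -> k) (h : FF) (c : k) : Prop :=
  exists N D : {mpoly k[2]}, [/\ D.@[q] != 0, h = tofrac N / tofrac D & c = N.@[q] / D.@[q]].

Section EvalAt.
Variable q : 'I_2 -> k.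

Let D0 (D : {mpoly k[2]}) : D.@[q] != 0 -> tofrac D != 0.
Proof. by rewrite tofrac_eq0; apply: contra_neq => ->; rewrite meval0. Qed.

Lemma eval_at_poly N : eval_at q (tofrac N) N.@[q].
Proof. by exists N, 1; rewrite meval1 tofrac1 !divr1 oner_neq0. Qed.
Lemma eval_at_cst c : eval_at q (cstm c) c.
Proof. by rewrite -{2}(mevalC q c); exact: eval_at_poly. Qed.
Lemma eval_atD g h c d : eval_at q g c -> eval_at q h d -> eval_at q (g + h) (c + d).
Proof.
move=> [N [D [nD -> ->]]] [N' [D' [nD' -> ->]]]; exists (N * D' + N' * D), (D * D').
rewrite mevalM mulf_neq0 // mevalD !mevalM tofracD !tofracM.
by rewrite !addf_div ?D0.
Qed.
Lemma eval_atM g h c d : eval_at q g c -> eval_at q h d -> eval_at q (g * h) (c * d).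
Proof.
move=> [N [D [nD -> ->]]] [N' [D' [nD' -> ->]]]; exists (N * N'), (D * D').
by rewrite !mevalM mulf_neq0 // !tofracM !mulf_div.
Qed.
Lemma eval_at0 c : eval_at q 0 c -> c = 0.
Proof.
move=> [N [D [nD + ->]]] => /esym/eqP; rewrite mulf_eq0 invr_eq0 (negPf (D0 nD)) orbF.
by rewrite tofrac_eq0 => /eqP ->; rewrite meval0 mul0r.
Qed.
Lemma eval_atV g c : eval_at q g c -> c != 0 -> eval_at q g^-1 c^-1.
Proof.
move=> [N [D [nD -> ->]]] c0; exists D, N; rewrite !invf_div; split=> //.
by apply: contra_neq c0 => ->; rewrite mul0r.
Qed.
Lemma eval_at_pair s t s0 t0 A : eval_at q s s0 -> eval_at q t t0 ->
  eval_at q (eval_pair cstm s t A) (eval_pair idfun s0 t0 A).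
Proof.
move=> Es Et; elim/poly_ind: A => [|A c IH].
  by rewrite !rmorph0 -(rmorph0 cstm); exact: eval_at_cst.
rewrite !rmorphD !rmorphM /= !eval_pairX; apply: eval_atD; first exact: eval_atM.
rewrite !eval_pairC; elim/poly_ind: c => [|c d IHc].
  by rewrite !rmorph0 !horner0 -(rmorph0 cstm); exact: eval_at_cst.
rewrite !rmorphD !rmorphM /= !map_polyX !map_polyC !hornerE /=.
by apply: eval_atD; [exact: eval_atM | exact: eval_at_cst].
Qed.
End EvalAt.

Definition pair_fun (s t : k) (i : 'I_2) : k := if i == 0 then s else t.
Lemma eval_at_x s t : eval_at (pair_fun s t) xF s.
Proof. by have := eval_at_poly (pair_fun s t) 'X_0; rewrite mevalXU. Qed.
Lemma eval_at_y s t : eval_at (pair_fun s t) yF t.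
Proof. by have := eval_at_poly (pair_fun s t) 'X_1; rewrite mevalXU. Qed.

(** A relation between s and t would hold for all their common values, which
    include the complement of the curve H = 0. *)
Lemma eval_pair_inj (s t : FF) (H : {poly {poly k}}) : H != 0 ->
  (forall s0 t0, eval_pair idfun s0 t0 H != 0 -> exists q, eval_at q s s0 /\ eval_at q t t0) ->
  injective (eval_pair cstm s t).
Proof.
move=> H0 ex; apply: raddf_inj => A EA; apply/eqP/contraT => A0.
have [s0 [t0]] : exists s0 t0, eval_pair idfun s0 t0 (A * H) != 0.
  by apply: poly2_nonroot; rewrite mulf_neq0.
rewrite rmorphM mulf_eq0 negb_or => /andP[nA nH]; have [q [es et]] := ex _ _ nH.
have := eval_at_pair A es et; rewrite EA => /eval_at0 E.
by case/eqP: nA.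
Qed.

Lemma rmorph_frac_onto (ev : {rmorphism {poly {poly k}} -> FF}) : injective ev ->
  (forall c, ev (c%:P)%:P = cstm c) ->
  (forall S : FF -> Prop, (forall c, S (cstm c)) ->
    (forall g h, S g -> S h -> S (g - h)) -> (forall g h, S g -> S h -> S (g * h)) ->
    (forall h, S h -> S h^-1) -> S (ev 'X) -> S (ev ('X)%:P) -> S xF /\ S yF) ->
  forall h, exists A B, B != 0 /\ h = ev A / ev B.
Proof.
move=> inj evc gen h; pose S := frac_image ev.
have SP A : S (ev A) by exact: frac_image_in.
have SC c : S (cstm c) by rewrite -evc; exact: SP.
have SB g g' : S g -> S g' -> S (g - g') by exact: frac_imageB.
have SM g g' : S g -> S g' -> S (g * g') by exact: frac_imageM.
have SV g : S g -> S g^-1 by exact: frac_imageV.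
have [Sx Sy] := gen S SC SB SM SV (SP _) (SP _).
exact: (funfield_gen SC SB SM SV Sx Sy h).
Qed.

End PlaneField.

Lemma divf_sqrK (F : fieldType) (p c : F) : c != 0 -> p / c ^+ 2 * c ^+ 2 = p.
Proof. by move=> c0; rewrite mulfVK // expf_neq0. Qed.

Section PlaneFrames.
Variable k : closedFieldType.
Local Notation FF := (funfield k).

Lemma generic_ptE : generic_pt k = \row_(c < 3) [:: xF k; yF k; 1]`_c.
Proof. by apply/rowP => c; rewrite !mxE; case: c => [[|[|[|c]]] Hc]. Qed.

Lemma fibration_eq (a : k) : a != 0 ->
  cubic_at (cstm k a) (xF k) (yF k) 1 != 0 /\
  fibration a * cubic_at (cstm k a) (xF k) (yF k) 1 ^+ 2 =
    - sextic_at (cstm k a) (xF k) (yF k) 1.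
Proof.
move=> a0.
pose Φ : {rmorphism {mpoly k[3]} -> FF} := mmap (cstm k) (generic_pt k 0).
have ΦX (c : 'I_3) : Φ 'X_c = generic_pt k 0 c by rewrite /Φ /= mmapX mmap1U.
have ΦC c : Φ c%:MP = cstm k c by rewrite /Φ /= mmapC.
have Φx : Φ 'X_0 = xF k by rewrite ΦX mxE.
have Φy : Φ 'X_1 = yF k by rewrite ΦX mxE.
have Φz : Φ 'X_(2%:R) = 1 by rewrite ΦX mxE.
have c0 : cubic_at (cstm k a) (xF k) (yF k) 1 != 0.
  have -> : cubic_at (cstm k a) (xF k) (yF k) 1 =
      tofrac (cubic_at a%:MP 'X_0 'X_1 1) by rewrite rmorph_cubic_at rmorph1.
  rewrite tofrac_eq0; apply/negP => /eqP /(congr1 (meval (fun _ => 0 : k))).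
  rewrite meval0 rmorph_cubic_at /= mevalC !mevalXU meval1 /cubic_at.
  by rewrite expr0n expr1n /= !add0r !mul0r mulr0 subr0 mulr1 => /eqP; rewrite (negPf a0).
split=> //; rewrite /fibration.
have -> : mmap (@cst k) (generic_pt k 0) (pencil_sextic a) = sextic_at (cstm k a) (xF k) (yF k) 1.
  by rewrite -[LHS]/(Φ _) pencil_sexticE rmorph_sextic_at ΦC Φx Φy Φz.
have -> : mmap (@cst k) (generic_pt k 0) (pencil_cubic a) = cubic_at (cstm k a) (xF k) (yF k) 1.
  by rewrite -[LHS]/(Φ _) pencil_cubicE rmorph_cubic_at ΦC Φx Φy Φz.
exact: divf_sqrK c0.
Qed.

Variables (r : nat) (v : k).
Hypothesis v3 : v ^+ 3 = 1.
Local Notation x' := (adapted (cstm k) r v (xF k) (yF k)).1.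
Local Notation y' := (adapted (cstm k) r v (xF k) (yF k)).2.

Let v0 : v != 0. Proof. by apply: contra_eq_neq v3 => ->; rewrite expr0n eq_sym oner_eq0. Qed.

Lemma xF_neq0 : xF k != 0.
Proof.
rewrite tofrac_eq0; apply/negP => /eqP /(congr1 (meval (fun _ => 1 : k))).
by rewrite mevalXU meval0 => /eqP; rewrite oner_eq0.
Qed.
Lemma yF_neq0 : yF k != 0.
Proof.
rewrite tofrac_eq0; apply/negP => /eqP /(congr1 (meval (fun _ => 1 : k))).
by rewrite mevalXU meval0 => /eqP; rewrite oner_eq0.
Qed.

Lemma eval_at_coframe q x0 y0 : eval_at q (xF k) x0 -> eval_at q (yF k) y0 ->
  let: (ξ, η, ζ) := coframe r (cstm k v) (xF k, yF k, 1) in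
  let: (u0, u1, u2) := coframe r v (x0, y0, 1) in
  [/\ eval_at q ξ u0, eval_at q η u1 & eval_at q ζ u2].
Proof.
move=> ex ey.
have ev : eval_at q (cstm k v) v by exact: eval_at_cst.
have ev2 : eval_at q (cstm k v ^+ 2) (v ^+ 2) by rewrite !expr2; exact: eval_atM.
have e1 : eval_at q 1 1 by rewrite -(rmorph1 (cstm k)); exact: eval_at_cst.
by case: r => [|[|?]] /=; split=> //; exact: eval_atM.
Qed.

Lemma eval_at_adapted α β : α != 0 -> β != 0 -> exists q, eval_at q x' α /\ eval_at q y' β.
Proof.
move=> α0 β0; case E : (frame r v (α, β, 1)) => [[p0 p1] p2].
have p20 : p2 != 0 by move: E; case: (r) => [|[|?]] [_ _ <-] //; exact: oner_neq0.
exists (pair_fun (p0 / p2) (p1 / p2)).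
have := eval_at_coframe (eval_at_x (p0 / p2) (p1 / p2)) (eval_at_y (p0 / p2) (p1 / p2)).
have -> : coframe r v (p0 / p2, p1 / p2, 1) = (α / p2, β / p2, 1 / p2).
  have := frameK r v3 (α / p2, β / p2, 1 / p2) => <-.
  by rewrite ![_ / p2]mulrC frame_scale E mulVf.
rewrite /adapted; case: (coframe r _ _) => [[ξ η] ζ] [e0 e1 e2] /=.
have i0 : 1 / p2 != 0 by rewrite mul1r invr_eq0.
have H z : z = z / p2 * (1 / p2)^-1 by rewrite mul1r invrK mulfVK.
by split; [rewrite [α]H | rewrite [β]H]; apply: eval_atM => //; exact: eval_atV.
Qed.

Lemma adapted_generates (S : FF -> Prop) : (forall c, S (cstm k c)) ->
    (forall g h, S g -> S h -> S (g - h)) -> (forall g h, S g -> S h -> S (g * h)) ->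
    (forall h, S h -> S h^-1) -> S x' -> S y' -> S (xF k) /\ S (yF k).
Proof.
move=> SC SB SM SV; apply: (adapted_gen v3 xF_neq0 yF_neq0) => //.
Qed.

(** The axis of the reflection is y' = 1. In base_chart, the exceptional
    curve over the base point is x' = a, and the other coordinate is the
    slope there. *)
Definition line_chart : {rmorphism {poly {poly k}} -> FF} := eval_pair (cstm k) (y' - 1) x'.
Definition base_chart (a : k) : {rmorphism {poly {poly k}} -> FF} :=
  eval_pair (cstm k) (x' - cstm k a) ((y' - 1) / (x' - cstm k a)).

Lemma line_chartX : line_chart 'X = y' - 1. Proof. exact: eval_pairX. Qed.
Lemma line_chartC p : line_chart p%:P = (map_poly (cstm k) p).[x']. Proof. exact: eval_pairC. Qed.
Lemma base_chartX a : base_chart a 'X = x' - cstm k a. Proof. exact: eval_pairX. Qed.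
Lemma base_chartC a p : base_chart a p%:P = (map_poly (cstm k) p).[(y' - 1) / (x' - cstm k a)].
Proof. exact: eval_pairC. Qed.

Lemma subfield_add (S : FF -> Prop) : (forall c, S (cstm k c)) ->
    (forall g h, S g -> S h -> S (g - h)) -> forall g h, S g -> S h -> S (g + h).
Proof.
move=> SC SB g h Sg Sh; rewrite -[h]opprK; apply: (SB) => //; rewrite -sub0r.
by apply: (SB) => //; rewrite -(rmorph0 (cstm k)).
Qed.

Lemma line_chart_inj : injective line_chart.
Proof.
apply: (@eval_pair_inj k _ _ (('X + 1) * ('X)%:P)).
  by rewrite mulf_neq0 ?polyC_eq0 ?polyX_eq0 // -polyC1 -size_poly_eq0 size_XaddC.
move=> s0 t0; rewrite rmorphM rmorphD rmorph1 /= eval_pairX eval_pairCX mulf_eq0 negb_or.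
move=> /andP[n1 n2]; have [q [ex ey]] := eval_at_adapted n2 n1; exists q; split=> //.
have -> : s0 = (s0 + 1) + - 1 by rewrite addrK.
apply: eval_atD => //; rewrite -(rmorph1 (cstm k)) -rmorphN; exact: eval_at_cst.
Qed.

Lemma base_chart_inj a : injective (base_chart a).
Proof.
apply: (@eval_pair_inj k _ _ (('X + a%:P%:P) * ('X * ('X)%:P + 1) * 'X)).
  rewrite !mulf_neq0 ?polyX_eq0 // -?size_poly_eq0 ?size_XaddC // size_poly_eq0.
  apply/negP => /eqP /(congr1 (fun p : {poly {poly k}} => p`_0)).
  by rewrite coefD coefXM coef1 coef0 add0r => /eqP; rewrite oner_eq0.
move=> s0 t0; rewrite !rmorphM !rmorphD !rmorphM rmorph1 /= eval_pairX eval_pairCX eval_pairCC /=.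
rewrite !mulf_eq0 !negb_or => /andP[/andP[n1 n2] n3].
have [q [ex ey]] := eval_at_adapted n1 n2; exists q.
have es : eval_at q (x' - cstm k a) s0.
  rewrite -[s0](addrK a); apply: eval_atD => //; rewrite -rmorphN; exact: eval_at_cst.
split=> //.
have -> : t0 = (s0 * t0 + 1 - 1) / s0 by rewrite addrK mulrC mulKf.
apply: eval_atM; last exact: eval_atV.
apply: eval_atD => //; rewrite -(rmorph1 (cstm k)) -rmorphN; exact: eval_at_cst.
Qed.

Lemma line_chart_onto h : exists A B, B != 0 /\ h = line_chart A / line_chart B.
Proof.
apply: rmorph_frac_onto; [exact: line_chart_inj | by move=> c; exact: eval_pairCC |].
move=> S SC SB SM SV; rewrite line_chartX line_chartC map_polyX hornerX => S1 Sx.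
apply: adapted_generates => //; rewrite -[y'](subrK 1); apply: (subfield_add SC SB) => //.
by rewrite -(rmorph1 (cstm k)).
Qed.

Lemma base_chart_onto a h : exists A B, B != 0 /\ h = base_chart a A / base_chart a B.
Proof.
apply: rmorph_frac_onto; [exact: base_chart_inj | by move=> c; exact: eval_pairCC |].
move=> S SC SB SM SV; rewrite base_chartX base_chartC map_polyX hornerX => S1 S2.
have n0 : x' - cstm k a != 0.
  by rewrite -(base_chartX a) (raddf_eq0 _ (@base_chart_inj a)) polyX_eq0.
apply: adapted_generates => //.
  by rewrite -[x'](subrK (cstm k a)); apply: (subfield_add SC SB).
rewrite -[y'](subrK 1); apply: (subfield_add SC SB); last by rewrite -(rmorph1 (cstm k)).
by rewrite -[y' - 1](mulfVK n0); apply: SM.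
Qed.

End PlaneFrames.

Lemma reflect_ptK (R : comNzRingType) r (v : R) (u : R * R * R) : v ^+ 3 = 1 ->
  reflect_pt r v (reflect_pt r v u) = u.
Proof.
move=> v3; rewrite /reflect_pt frameK // -{2}(coframeK r v3 u).
by case: (coframe r v u) => [[u0 u1] u2].
Qed.

Lemma reflect_scale (R : comNzRingType) r (v s : R) u0 u1 u2 :
  reflect_pt r v (s * u0, s * u1, s * u2) =
  (let: (x0, x1, x2) := reflect_pt r v (u0, u1, u2) in (s * x0, s * x1, s * x2)).
Proof.
by rewrite /reflect_pt; case: r => [|[|?]] /=; congr (_, _, _); ring.
Qed.

Section Reflection.
Variable k : closedFieldType.
Local Notation FF := (funfield k).
Variables (r : nat) (v : k).
Hypothesis v3 : v ^+ 3 = 1.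
Let v0 : v != 0. Proof. by apply: contra_eq_neq v3 => ->; rewrite expr0n eq_sym oner_eq0. Qed.

Let image := reflect_pt r (cstm k v) (xF k, yF k, 1).
Let X' := image.1.1 / image.2.
Let Y' := image.1.2 / image.2.

(** The reflection is its own inverse, so that the common values of X' and
    Y' are found by reflecting. *)
Lemma eval_at_reflect s0 t0 : s0 != 0 -> t0 != 0 ->
  exists q, eval_at q X' s0 /\ eval_at q Y' t0.
Proof.
move=> s00 t00; case E : (reflect_pt r v (s0, t0, 1)) => [[p0 p1] p2].
have p20 : p2 != 0.
  by move: E; rewrite /reflect_pt; case: (r) => [|[|?]] [_ _ <-];
    rewrite ?mulf_neq0 ?expf_neq0 ?oner_neq0.
exists (pair_fun (p0 / p2) (p1 / p2)).
have ex := eval_at_x (p0 / p2) (p1 / p2); have ey := eval_at_y (p0 / p2) (p1 / p2).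
set q := pair_fun _ _ in ex ey *.
have ev c : eval_at q (cstm k c) c by exact: eval_at_cst.
have ev2 : eval_at q (cstm k v ^+ 2) (v ^+ 2) by rewrite !expr2; exact: eval_atM.
have e1 : eval_at q 1 1 by rewrite -(rmorph1 (cstm k)); exact: eval_at_cst.
have : let: (w0, w1, w2) := reflect_pt r v (p0 / p2, p1 / p2, 1) in
  [/\ eval_at q image.1.1 w0, eval_at q image.1.2 w1 & eval_at q image.2 w2].
  have := ev v; move: ev2; rewrite /image /reflect_pt; move: (cstm k v) => V ev2 ev1.
  by case: (r) => [|[|?]] /=; split=> //; do ! apply: eval_atM => //.
have -> : reflect_pt r v (p0 / p2, p1 / p2, 1) = (s0 / p2, t0 / p2, 1 / p2).
  have := reflect_ptK r (s0 / p2, t0 / p2, 1 / p2) v3 => <-.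
  by rewrite ![_ / p2]mulrC reflect_scale E mulVf.
move=> [a0 a1 a2]; have i0 : 1 / p2 != 0 by rewrite mul1r invr_eq0.
have H z : z = z / p2 * (1 / p2)^-1 by rewrite mul1r invrK mulfVK.
by split; [rewrite [s0]H | rewrite [t0]H]; apply: eval_atM => //; exact: eval_atV.
Qed.

Lemma reflect_inj : injective (eval_pair (cstm k) X' Y').
Proof.
apply: (@eval_pair_inj k _ _ ('X * ('X)%:P)).
  by rewrite mulf_neq0 ?polyC_eq0 ?polyX_eq0.
move=> s0 t0; rewrite rmorphM /= eval_pairX eval_pairCX mulf_eq0 negb_or => /andP[n1 n2].
exact: eval_at_reflect.
Qed.

Definition bivariate : {rmorphism {mpoly k[2]} -> {poly {poly k}}} :=
  mmap (polyC \o polyC) (fun i : 'I_2 => if i == 0 then 'X else ('X)%:P).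

Lemma bivariateC c : bivariate c%:MP = c%:P%:P. Proof. by rewrite /bivariate /= mmapC. Qed.
Lemma bivariateX0 : bivariate 'X_0 = 'X. Proof. by rewrite /bivariate /= mmapX mmap1U. Qed.
Lemma bivariateX1 : bivariate 'X_1 = ('X)%:P. Proof. by rewrite /bivariate /= mmapX mmap1U. Qed.

Lemma bivariate_inj : injective bivariate.
Proof.
pose ψ : {rmorphism {mpoly k[2]} -> FF} := eval_pair (cstm k) (xF k) (yF k) \o bivariate.
have Eψ p : ψ p = tofrac p.
  apply: mpoly_rmorph_ext => [c|i].
    by rewrite -[LHS]/(eval_pair _ _ _ (bivariate _)) bivariateC eval_pairCC.
  rewrite -[LHS]/(eval_pair _ _ _ (bivariate _)); case: (ord2E i) => ->.
    by rewrite bivariateX0 eval_pairX.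
  by rewrite bivariateX1 eval_pairCX.
move=> p q E; apply/eqP; rewrite -tofrac_eq -!Eψ; apply/eqP.
by rewrite -[LHS]/(eval_pair _ _ _ (bivariate _)) E.
Qed.

Lemma reflection_exists : exists τ : {rmorphism FF -> FF},
  [/\ forall c, τ (cstm k c) = cstm k c, τ (xF k) = X' & τ (yF k) = Y'].
Proof.
pose φ : {rmorphism {mpoly k[2]} -> FF} := eval_pair (cstm k) X' Y' \o bivariate.
have φE p : φ p = eval_pair (cstm k) X' Y' (bivariate p) by [].
have φ_inj : injective φ by move=> p q; rewrite !φE => /reflect_inj /bivariate_inj.
have [τ τE] := frac_lift φ_inj; exists τ; split.
- by move=> c; rewrite cstmE τE φE bivariateC eval_pairCC.
- by rewrite τE φE bivariateX0 eval_pairX.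
- by rewrite τE φE bivariateX1 eval_pairCX.
Qed.

Lemma reflection_adapted (τ : {rmorphism FF -> FF}) :
  (forall c, τ (cstm k c) = cstm k c) -> τ (xF k) = X' -> τ (yF k) = Y' ->
  let: (x', y') := adapted (cstm k) r v (xF k) (yF k) in
  τ x' = x' / y' /\ τ y' = y'^-1.
Proof.
move=> τc τx τy.
have := @adapted_reflect k FF (cstm k) r v (xF k) (yF k) v3 (xF_neq0 k) (yF_neq0 k) τ τc.
move: τx τy; rewrite /X' /Y' /image; case: (reflect_pt _ _ _) => [[p0 p1] p2] /= τx τy H.
by case: (adapted _ _ _ _ _) H => u w [] //; split.
Qed.

End Reflection.

(** * Multihomogeneous forms *)

Lemma big_mxvec (S : comNzRingType) (f : 'I_((1 + 9) * 3) -> S) :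
  \prod_l f l = \prod_(j < 1 + 9) \prod_(c < 3) f (mxvec_index j c).
Proof.
rewrite pair_bigA /= (reindex (uncurry (@mxvec_index (1 + 9) 3))) /=; last exact: curry_mxvec_bij.
by apply: eq_bigr => -[j c].
Qed.

Section MultiForms.
Variables (k : fieldType) (S : comNzRingType) (κ : {rmorphism k -> S}).
Implicit Types (P : {mpoly k[(1 + 9) * 3]}) (z : 'I_(1 + 9) -> 'I_3 -> S).

(** The values form_at and form_generic of a form are both of this kind; z
    gives the coordinates of a point of P^2 x (P^2)^9. *)
Definition form_val z : {rmorphism {mpoly k[(1 + 9) * 3]} -> S} :=
  mmap κ (fun l => mxvec (\matrix_(j, c) z j c) 0 l).

Lemma form_valX z j c : form_val z 'X_(mxvec_index j c) = z j c.
Proof. by rewrite /form_val /= mmapX mmap1U mxvecE mxE. Qed.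
Lemma form_valC z c : form_val z c%:MP = κ c.
Proof. by rewrite /form_val /= mmapC. Qed.

Lemma form_val_eq z z' P : (forall j c, z j c = z' j c) -> form_val z P = form_val z' P.
Proof.
move=> E; rewrite /form_val /=.
by have -> : \matrix_(j, c) z j c = \matrix_(j, c) z' j c by apply/matrixP => j c; rewrite !mxE.
Qed.

Lemma form_val_scale d P (μ : 'I_(1 + 9) -> S) z : multihomog d P ->
  form_val (fun j c => μ j * z j c) P = (\prod_j μ j ^+ d j) * form_val z P.
Proof.
move=> dP; rewrite /form_val /= /mmap mulr_sumr; apply: eq_big_seq => m mP.
rewrite mulrCA; congr (_ * _); rewrite /mmap1.
rewrite !big_mxvec.
rewrite -big_split /=; apply: eq_bigr => j _; rewrite -(dP m mP j) -prodrXr -big_split /=.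
by apply: eq_bigr => c _; rewrite !mxvecE !mxE exprMn.
Qed.

End MultiForms.

Lemma rmorph_form_val (k : fieldType) (S T : comNzRingType) (κ : {rmorphism k -> S})
  (κ' : {rmorphism k -> T}) (φ : {rmorphism S -> T}) z P : (forall c, φ (κ c) = κ' c) ->
  φ (form_val κ z P) = form_val κ' (fun j c => φ (z j c)) P.
Proof.
move=> φκ; rewrite -[LHS]/((φ \o form_val κ z) P).
apply: mpoly_rmorph_ext => [c|l] /=; first by rewrite !form_valC.
by case/mxvec_indexP: l => j c; rewrite !form_valX.
Qed.

Section LinearForms.
Variable k : fieldType.
Local Notation form := {mpoly k[(1 + 9) * 3]}.

Lemma multihomog_sum (I : Type) (s : seq I) (Q : pred I) (E : I -> form) d :
  (forall i, Q i -> multihomog d (E i)) -> multihomog d (\sum_(i <- s | Q i) E i).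
Proof.
move=> H; elim/big_rec: _ => [m|i P Qi IH m]; first by rewrite msupp0.
move=> /msuppD_le; rewrite mem_cat => /orP[]; [exact: H | exact: IH].
Qed.

Lemma multihomogZ c (P : form) d : multihomog d P -> multihomog d (c *: P).
Proof. by move=> H m /msuppZ_le; exact: H. Qed.

Lemma multihomogM d e (P Q : form) : multihomog d P -> multihomog e Q ->
  multihomog (fun j => d j + e j)%N (P * Q).
Proof.
move=> HP HQ m /msuppM_le /allpairsP[[m1 m2] /= [H1 H2 ->]] j.
rewrite -(HP _ H1 j) -(HQ _ H2 j) -big_split /=.
by apply: eq_bigr => c _; rewrite mnmDE.
Qed.

Lemma multihomog1 : multihomog (fun=> 0%N) (1 : form).
Proof. by move=> m; rewrite msupp1 inE => /eqP -> j; rewrite big1 // => c _; rewrite mnm0E. Qed.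

Lemma multihomogX d n (P : form) : multihomog d P -> multihomog (fun j => n * d j)%N (P ^+ n).
Proof.
move=> HP; elim: n => [|n IH]; first by rewrite expr0; exact: multihomog1.
by rewrite exprS; exact: multihomogM.
Qed.

Lemma multihomog_ext d e (P : form) : d =1 e -> multihomog d P -> multihomog e P.
Proof. by move=> E H m mP j; rewrite -E; exact: H. Qed.

Definition linear_form (j : 'I_(1 + 9)) (u : 'rV[k]_3) : form :=
  \sum_(c < 3) u 0 c *: 'X_(mxvec_index j c).

Lemma mxvec_index_inj (j j' : 'I_(1 + 9)) (c c' : 'I_3) :
  (mxvec_index j c == mxvec_index j' c') = (j == j') && (c == c').
Proof.
rewrite -xpair_eqE; apply/eqP/eqP => [E|[-> ->] //].
have [g gK _] := @curry_mxvec_bij (1 + 9) 3.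
by rewrite -(gK (j, c)) // -(gK (j', c')) //=; congr g.
Qed.

Lemma linear_form_homog j u : multihomog (fun j' => (j' == j) : nat) (linear_form j u).
Proof.
apply: multihomog_sum => c _; apply: multihomogZ => m; rewrite msuppX inE => /eqP -> j'.
have E c' : (U_(mxvec_index j c) (mxvec_index j' c') = ((j == j') && (c == c')) :> nat)%MM.
  by rewrite mnm1E mxvec_index_inj.
rewrite (eq_bigr _ (fun c' _ => E c')) [j' == j]eq_sym; case: (j == j') => /=; last by rewrite big1.
rewrite (bigD1 c) //= eqxx big1 ?addn0 // => c' nc.
by rewrite eq_sym (negPf nc).
Qed.

Lemma form_val_linear (S : comNzRingType) (κ : {rmorphism k -> S}) z j u :
  form_val κ z (linear_form j u) = \sum_(c < 3) κ (u 0 c) * z j c.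
Proof.
rewrite /linear_form rmorph_sum /=; apply: eq_bigr => c _.
by rewrite -mul_mpolyC rmorphM /= form_valC form_valX.
Qed.

End LinearForms.

(** * Vectors and points of the projective plane *)

Definition vec3 (R : nzRingType) (u : R * R * R) : 'rV[R]_3 :=
  \row_(c < 3) [:: u.1.1; u.1.2; u.2]`_c.

Lemma ord3P (P : 'I_3 -> Prop) : P 0 -> P 1 -> P 2%:R -> forall c, P c.
Proof.
move=> P0 P1 P2 [[|[|[|c]]] Hc] //.
- by have -> : Ordinal Hc = 0 by exact: val_inj.
- by have -> : Ordinal Hc = 1 by exact: val_inj.
- by have -> : Ordinal Hc = 2%:R by exact: val_inj.
Qed.

Lemma sum3 (R : nmodType) (E : 'I_3 -> R) : \sum_(c < 3) E c = E 0 + E 1 + E 2%:R.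
Proof.
rewrite !big_ord_recr big_ord0 /= add0r.
by congr (E _ + E _ + E _); exact: val_inj.
Qed.

Section Vec3.
Variable R : comNzRingType.
Implicit Types (u w : R * R * R) (x y : 'rV[R]_3).

Lemma vec3E0 u : vec3 u 0 0 = u.1.1. Proof. by rewrite mxE. Qed.
Lemma vec3E1 u : vec3 u 0 1 = u.1.2. Proof. by rewrite mxE. Qed.
Lemma vec3E2 u : vec3 u 0 2%:R = u.2. Proof. by rewrite mxE. Qed.
Definition vec3E := (vec3E0, vec3E1, vec3E2).

Lemma vec3K x : vec3 (x 0 0, x 0 1, x 0 2%:R) = x.
Proof. by apply/rowP; apply: ord3P; rewrite vec3E. Qed.

Lemma dotE x y : dot x y = x 0 0 * y 0 0 + x 0 1 * y 0 1 + x 0 2%:R * y 0 2%:R.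
Proof. by rewrite /dot sum3. Qed.

Lemma crossE x y : cross x y = vec3 (x 0 1 * y 0 2%:R - x 0 2%:R * y 0 1,
  x 0 2%:R * y 0 0 - x 0 0 * y 0 2%:R, x 0 0 * y 0 1 - x 0 1 * y 0 0).
Proof.
have e1 : (1 + 1 : 'I_3) = 2%:R by exact: val_inj.
have e2 : (1 + 2%:R : 'I_3) = 0 by exact: val_inj.
have e3 : (2%:R + 1 : 'I_3) = 0 by exact: val_inj.
have e4 : (2%:R + 2%:R : 'I_3) = 1 by exact: val_inj.
apply/rowP; apply: ord3P; rewrite mxE vec3E /= ?add0r ?e1 ?e2 ?e3 ?e4 //.
Qed.

Lemma dotZl c x y : dot (c *: x) y = c * dot x y.
Proof. by rewrite !dotE !mxE; ring. Qed.
Lemma dotC x y : dot x y = dot y x.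
Proof. by rewrite !dotE; ring. Qed.
Lemma cross_dotl x y : dot x (cross x y) = 0.
Proof. by rewrite dotE crossE !vec3E /=; ring. Qed.
Lemma cross_dotr x y : dot y (cross x y) = 0.
Proof. by rewrite dotE crossE !vec3E /=; ring. Qed.
Lemma crossZl c x y : cross (c *: x) y = c *: cross x y.
Proof. by rewrite !crossE; apply/rowP; apply: ord3P; rewrite !mxE /= ?mxE; ring. Qed.
Lemma crossZr c x y : cross x (c *: y) = c *: cross x y.
Proof. by rewrite !crossE; apply/rowP; apply: ord3P; rewrite !mxE /= ?mxE; ring. Qed.
Lemma crossDr x y z : cross x (y + z) = cross x y + cross x z.
Proof. by rewrite !crossE; apply/rowP; apply: ord3P; rewrite !mxE /= ?mxE; ring. Qed.
Lemma crossxx x : cross x x = 0.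
Proof. by rewrite crossE; apply/rowP; apply: ord3P; rewrite !mxE /= ?mxE; ring. Qed.

End Vec3.

Lemma map_cross (R S : comNzRingType) (φ : {rmorphism R -> S}) x y :
  map_mx φ (cross x y) = cross (map_mx φ x) (map_mx φ y).
Proof. by apply/rowP => c; rewrite !mxE rmorphB !rmorphM. Qed.
Lemma map_vec3 (R S : comNzRingType) (φ : {rmorphism R -> S}) (u : R * R * R) :
  map_mx φ (vec3 u) = vec3 (φ u.1.1, φ u.1.2, φ u.2).
Proof. by apply/rowP; apply: ord3P; rewrite !mxE. Qed.

Lemma row_neq0P (R : nzRingType) n (p : 'rV[R]_n) : p != 0 -> exists c, p 0 c != 0.
Proof.
move=> p0; apply/existsP; apply: contraT; rewrite negb_exists => /forallP H.
by case/eqP: p0; apply/rowP => c; rewrite [RHS]mxE; apply/eqP; rewrite -[_ == _]negbK.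
Qed.

(** The cross products with p span the plane orthogonal to p. *)
Lemma cross_onto (k : fieldType) (p l : 'rV[k]_3) : p != 0 -> dot p l = 0 ->
  exists u, l = cross p u.
Proof.
move=> p0; rewrite dotE => E.
have [c pc] : exists c, p 0 c != 0.
  exact: row_neq0P.
move: c pc; apply: ord3P => pc.
- exists (vec3 (0, l 0 2%:R / p 0 0, - l 0 1 / p 0 0)).
  rewrite crossE; apply/rowP; apply: ord3P; rewrite !vec3E /=.
  + apply: (mulfI pc); have -> : p 0 0 * l 0 0 = - (p 0 1 * l 0 1 + p 0 2%:R * l 0 2%:R).
      by apply/eqP; rewrite -subr_eq0 opprK addrA E.
    by field.
  + by field.
  + by field.
- exists (vec3 (- l 0 2%:R / p 0 1, 0, l 0 0 / p 0 1)).
  rewrite crossE; apply/rowP; apply: ord3P; rewrite !vec3E /=.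
  + by field.
  + apply: (mulfI pc); have -> : p 0 1 * l 0 1 = - (p 0 0 * l 0 0 + p 0 2%:R * l 0 2%:R).
      by apply/eqP; rewrite -subr_eq0 opprK addrA [_ * l 0 1 + _]addrC E.
    by field.
  + by field.
- exists (vec3 (l 0 1 / p 0 2%:R, - l 0 0 / p 0 2%:R, 0)).
  rewrite crossE; apply/rowP; apply: ord3P; rewrite !vec3E /=.
  + by field.
  + by field.
  + apply: (mulfI pc); have -> : p 0 2%:R * l 0 2%:R = - (p 0 0 * l 0 0 + p 0 1 * l 0 1).
      by apply/eqP; rewrite -subr_eq0 opprK addrC E.
    by field.
Qed.

Lemma cross_eq0 (R : comNzRingType) (n l : 'rV[R]_3) : cross n l = 0 ->
  forall c c', n 0 c * l 0 c' = l 0 c * n 0 c'.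
Proof.
rewrite crossE => /rowP H.
have [h0 h1 h2] : [/\ n 0 1 * l 0 2%:R = n 0 2%:R * l 0 1, n 0 2%:R * l 0 0 = n 0 0 * l 0 2%:R
    & n 0 0 * l 0 1 = n 0 1 * l 0 0].
  have H0 := H 0; have H1 := H 1; have H2 := H 2%:R.
  rewrite vec3E [RHS]mxE in H0; rewrite vec3E [RHS]mxE in H1; rewrite vec3E [RHS]mxE in H2.
  by split; apply/eqP; rewrite -subr_eq0; apply/eqP.
apply: ord3P; apply: ord3P; first exact: mulrC.
- by rewrite h2 mulrC.
- by rewrite -h1 mulrC.
- by rewrite -h2 mulrC.
- exact: mulrC.
- by rewrite h0 mulrC.
- by rewrite h1 mulrC.
- by rewrite -h0 mulrC.
- exact: mulrC.
Qed.

Lemma cross_span (k : fieldType) (p q l : 'rV[k]_3) : cross p q != 0 ->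
  dot p l = 0 -> dot q l = 0 -> exists c, l = c *: cross p q.
Proof.
move=> n0 pl ql.
have [c nc] : exists c, cross p q 0 c != 0.
  exact: row_neq0P.
set n := cross p q in n0 nc *.
have key c' : n 0 c * l 0 c' = l 0 c * n 0 c'.
  have : cross n l = 0.
    have -> : cross n l = dot p l *: q - dot q l *: p.
      rewrite /n !crossE !dotE; apply/rowP; apply: ord3P; rewrite !mxE /= ?mxE; ring.
    by rewrite pl ql !scale0r subrr.
  by move=> /cross_eq0; apply.
exists (l 0 c / n 0 c); apply/rowP => c'; rewrite mxE.
by apply: (mulfI nc); rewrite key; field.
Qed.

Section ProjectivePoints.
Variable k : fieldType.
Implicit Types (v w : 'rV[k]_3) (q : proj2 k).

Lemma proj_default_proof : \dim <[vec3 (1, 0, 0) : 'rV[k]_3]> == 1%N.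
Proof.
rewrite dim_vline (_ : _ != 0) //; apply/eqP => /rowP /(_ 0).
by rewrite vec3E0 mxE => /eqP; rewrite oner_eq0.
Qed.
Definition proj_default : proj2 k := exist (fun U => \dim U == 1%N) _ proj_default_proof.

Definition proj_pt v : proj2 k := insubd proj_default <[v]>%VS.

Lemma proj_ptE v : v != 0 -> val (proj_pt v) = <[v]>%VS.
Proof. by move=> v0; rewrite /proj_pt /insubd insubT ?dim_vline ?v0. Qed.

Lemma coords_neq0 q : coords q != 0.
Proof. by rewrite /coords vpick0 -dimv_eq0 (eqP (valP q)). Qed.

Lemma coords_line q : val q = <[coords q]>%VS.
Proof.
apply/eqP; rewrite eq_sym eqEdim -memvE memv_pick (eqP (valP q)).
by rewrite dim_vline coords_neq0.
Qed.

Lemma proj_ptK q : proj_pt (coords q) = q.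
Proof. by apply: val_inj; rewrite proj_ptE ?coords_neq0 // -coords_line. Qed.

Lemma coords_proj_pt v : v != 0 -> exists2 c, c != 0 & coords (proj_pt v) = c *: v.
Proof.
move=> v0; have : coords (proj_pt v) \in <[v]>%VS by rewrite -(proj_ptE v0) coords_line memv_line.
move=> /vlineP[c E]; exists c => //.
by apply: contraNneq (coords_neq0 (proj_pt v)) => c0; rewrite E c0 scale0r.
Qed.

Lemma proj_pt_scale c v : c != 0 -> proj_pt (c *: v) = proj_pt v.
Proof.
move=> c0; case: (eqVneq v 0) => [->|v0]; first by rewrite scaler0.
apply: val_inj; rewrite !proj_ptE // ?scaler_eq0 ?negb_or ?c0 //.
apply/eqP; rewrite eqEdim -memvE memvZ ?memv_line // !dim_vline scaler_eq0 negb_or c0 v0 //.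
Qed.

Lemma on_lineE v w : v != 0 -> w != 0 -> on_line (proj_pt v) (proj_pt w) = (dot v w == 0).
Proof.
move=> /coords_proj_pt[c c0 Ev] /coords_proj_pt[d d0 Ew]; rewrite /on_line Ev Ew.
by rewrite dotZl dotC dotZl dotC !mulf_eq0 (negPf c0) (negPf d0).
Qed.

Lemma on_line_pt q w : w != 0 -> on_line q (proj_pt w) = (dot (coords q) w == 0).
Proof. by move=> w0; rewrite -{1}(proj_ptK q) on_lineE // coords_neq0. Qed.

Lemma proj_pt_cross v w : v != 0 -> w != 0 -> (proj_pt v = proj_pt w) <-> cross v w = 0.
Proof.
move=> v0 w0; split.
  move=> E; have [c c0 Ev] := coords_proj_pt v0; have [d d0 Ew] := coords_proj_pt w0.
  rewrite E Ew in Ev; have -> : w = (d^-1 * c) *: v by rewrite -scalerA -Ev scalerK.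
  by rewrite crossZr crossxx scaler0.
move=> /cross_eq0 H; have [c nc] := row_neq0P v0.
have E : w = (w 0 c / v 0 c) *: v.
  apply/rowP => c'; rewrite mxE; apply: (mulfI nc); rewrite H; field => //.
rewrite E proj_pt_scale //; apply: contraNneq w0 => H0; rewrite E H0 scale0r //.
Qed.

End ProjectivePoints.

(** * Base points and axes *)

Section BasePoints.
Variable k : closedFieldType.
Variables (a eps : k).
Hypotheses (a0 : a != 0) (eps_prim : 3.-primitive_root eps) (a3 : a ^+ 3 != 1).

Definition pt_type (i : 'I_9) : nat := i %/ 3.
Definition pt_root (i : 'I_9) : k := eps ^+ (i %% 3).
Local Notation p := (base_pt eps a).

Lemma eps3 : eps ^+ 3 = 1. Proof. exact: prim_expr_order eps_prim. Qed.

Lemma eps_quad : eps ^+ 2 + eps + 1 = 0.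
Proof.
have e1 : eps - 1 != 0.
  by rewrite subr_eq0 -[1](expr0 eps) -{1}[eps]expr1 (eq_prim_root_expr eps_prim).
apply: (mulfI e1); rewrite mulr0.
have -> : (eps - 1) * (eps ^+ 2 + eps + 1) = eps ^+ 3 - 1 by ring.
by rewrite eps3 subrr.
Qed.

Lemma pt_root3 i : pt_root i ^+ 3 = 1.
Proof. by rewrite /pt_root exprAC eps3 expr1n. Qed.

Lemma pt_root_neq0 i : pt_root i != 0.
Proof. by apply: contra_eq_neq (pt_root3 i) => ->; rewrite expr0n eq_sym oner_eq0. Qed.

Lemma pt_type_lt i : (pt_type i < 3)%N.
Proof. by rewrite /pt_type ltn_divLR. Qed.

Lemma pt_inj i j : pt_type i = pt_type j -> pt_root i = pt_root j -> i = j.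
Proof.
move=> Et /eqP; rewrite /pt_root (eq_prim_root_expr eps_prim) !modn_mod => /eqP Er.
by apply: val_inj; rewrite /= (divn_eq i 3) (divn_eq j 3) Er -/(pt_type i) Et.
Qed.

Lemma base_ptE i : p i = vec3 (frame (pt_type i) (pt_root i) (a, 1, 1)).
Proof.
have e4 : (eps ^+ 2) ^+ 2 = eps by rewrite -exprM (exprD eps 3 1) eps3 mul1r.
apply/rowP => c; rewrite !mxE /pt_type /pt_root.
case: i => [[|[|[|[|[|[|[|[|[|i]]]]]]]]] Hi] //=;
  move: c; apply: ord3P => /=; rewrite ?expr0 ?expr1 ?expr1n ?mul1r ?mulr1 ?e4 //.
Qed.

Lemma base_pt_neq0 i : p i != 0.
Proof.
rewrite base_ptE; apply/eqP => /rowP H.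
have := H 1; rewrite vec3E1 mxE => /eqP; have := pt_root_neq0 i.
by case: (pt_type i) => [|[|?]] /= v0; rewrite mulf_eq0 expf_eq0 (negPf v0) ?oner_eq0 ?(negPf a0).
Qed.

Lemma cube_root_mul u v : u ^+ 3 = 1 -> v ^+ 3 = 1 -> u = v * a -> False.
Proof.
by move=> u3 v3 E; move: u3; rewrite E exprMn v3 mul1r => /eqP; rewrite (negPf a3).
Qed.

Lemma frame_cross_neq0 r r' u v : u ^+ 3 = 1 -> v ^+ 3 = 1 -> (r < 3)%N -> (r' < 3)%N ->
  cross (vec3 (frame r u (a, 1, 1))) (vec3 (frame r' v (a, 1, 1))) = 0 -> r = r' /\ u = v.
Proof.
move=> u3 v3 lr lr'; rewrite crossE => /rowP H.
have [h0 h1] : (vec3 (frame r u (a, 1, 1)) 0 1 * vec3 (frame r' v (a, 1, 1)) 0 2%:R =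
   vec3 (frame r u (a, 1, 1)) 0 2%:R * vec3 (frame r' v (a, 1, 1)) 0 1) /\
   (vec3 (frame r u (a, 1, 1)) 0 2%:R * vec3 (frame r' v (a, 1, 1)) 0 0 =
   vec3 (frame r u (a, 1, 1)) 0 0 * vec3 (frame r' v (a, 1, 1)) 0 2%:R).
  have H0 := H 0; have H1 := H 1.
  rewrite [LHS]vec3E0 [RHS]mxE in H0; rewrite [LHS]vec3E1 [RHS]mxE in H1.
  by split; apply/eqP; rewrite -subr_eq0; apply/eqP.
have u6 : (u ^+ 2) ^+ 3 = 1 by rewrite exprAC u3 expr1n.
have v6 : (v ^+ 2) ^+ 3 = 1 by rewrite exprAC v3 expr1n.
have E1 := expr1n k 3.
move: h0 h1; rewrite !vec3E.
case: r lr {H} => [|[|[|//]]] _; case: r' lr' => [|[|[|//]]] _ /=;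
  rewrite ?mulr1 ?mul1r => h0 h1.
- by split=> //; apply: (mulIf a0).
- by case: (cube_root_mul u6 v6 h0).
- by case: (cube_root_mul v6 u6 (esym h0)).
- by case: (cube_root_mul v6 u6 (esym h0)).
- by split.
- by case: (cube_root_mul v3 u3 h1).
- by case: (cube_root_mul u6 v6); rewrite h0 mulrC.
- by case: (cube_root_mul u3 v3); rewrite -h1 mulrC.
- by split=> //; apply: (mulIf a0); rewrite -h1 mulrC.
Qed.

Lemma base_cross_neq0 i j : i != j -> cross (p i) (p j) != 0.
Proof.
apply: contra_neq; rewrite !base_ptE => /frame_cross_neq0[]; rewrite ?pt_root3 ?pt_type_lt //.
exact: pt_inj.
Qed.

(** The line where the last two coordinates adapted to a base point agree
    (axisE). *)
Definition axis r (v : k) : 'rV[k]_3 :=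
  vec3 (match r with 0 => (0, v, -1) | 1 => (- v ^+ 2, 0, 1) | _ => (v ^+ 2, - v, 0) end).

Lemma axisE (S : comNzRingType) (κ : {rmorphism k -> S}) r v (x : S * S * S) :
  dot (map_mx κ (axis r v)) (vec3 x) =
  (let: (_, η, ζ) := coframe r (κ v) x in η - ζ).
Proof.
move: x => [[x0 x1] x2]; rewrite dotE !mxE.
by case: r => [|[|?]] /=; rewrite ?rmorph0 ?rmorphN ?rmorph1 ?rmorphXn /=; ring.
Qed.

Lemma axis_neq0 r v : v != 0 -> axis r v != 0.
Proof.
move=> v0; apply/eqP => /rowP H; have := H 0; have := H 1; have := H 2%:R.
rewrite /axis; case: r {H} => [|[|?]]; rewrite !vec3E !mxE /=.
- by move=> /eqP; rewrite oppr_eq0 oner_eq0.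
- by move=> /eqP; rewrite oner_eq0.
- by move=> _ /eqP; rewrite oppr_eq0 (negPf v0).
Qed.

Lemma axis_base_pt i j : (dot (axis (pt_type i) (pt_root i)) (p j) == 0) = (i == j).
Proof.
have := @axisE k idfun (pt_type i) (pt_root i) (frame (pt_type j) (pt_root j) (a, 1, 1)).
rewrite map_mx_id // -base_ptE => ->; case: (eqVneq i j) => [->|nij].
  by rewrite frameK ?pt_root3 // subrr eqxx.
apply/negP => /eqP H; move/eqP: nij; apply; move: H.
have u3 := pt_root3 i; have v3 := pt_root3 j.
have Et : pt_type i = pt_type j -> pt_root i = pt_root j -> i = j := @pt_inj i j.
move: (pt_root i) (pt_root j) u3 v3 Et => u v u3 v3 Et.
have u6 : (u ^+ 2) ^+ 3 = 1 by rewrite exprAC u3 expr1n.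
have v6 : (v ^+ 2) ^+ 3 = 1 by rewrite exprAC v3 expr1n.
have uv3 : (u * v ^+ 2) ^+ 3 = 1 by rewrite exprMn u3 v6 mulr1.
have uv3' : (u ^+ 2 * v) ^+ 3 = 1 by rewrite exprMn u6 v3 mulr1.
have o3 := expr1n k 3.
have e1 : u * v ^+ 2 = 1 -> u = v.
  by move=> E; rewrite -[u]mulr1 -v3 exprSr mulrA E mul1r.
have e2 : u ^+ 2 * v = 1 -> u = v.
  by move=> E; rewrite -[v]mul1r -u3 exprS -mulrA E mulr1.
have li := pt_type_lt i; have lj := pt_type_lt j; move: Et li lj.
case: (pt_type i) => [|[|[|//]]]; case: (pt_type j) => [|[|[|//]]] Et _ _ /=;
  rewrite ?mulr1 => /eqP; rewrite subr_eq0 => /eqP H.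
- by apply: Et => //; exact: e1.
- by case: (cube_root_mul o3 uv3); rewrite -mulrA -H.
- by case: (cube_root_mul uv3 o3); rewrite H mul1r.
- by case: (cube_root_mul o3 uv3'); rewrite -mulrA -H.
- by apply: Et => //; apply: e2; rewrite -H.
- by case: (cube_root_mul uv3' o3); rewrite -H mul1r.
- by case: (cube_root_mul uv3 uv3'); rewrite -mulrA H.
- by case: (cube_root_mul uv3' uv3); rewrite -mulrA H.
- apply: Et => //; apply: (mulfI (_ : u * v != 0)).
    by rewrite mulf_neq0 //; [apply: contra_eq_neq u3 | apply: contra_eq_neq v3] => ->; rewrite expr0n eq_sym oner_eq0.
  by rewrite mulrAC -expr2 H; ring.
Qed.

End BasePoints.

(** * Local rings of the blow-up *)

Section Assemble.
Variable S : comNzRingType.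
Definition assemble (X : 'rV[S]_3) (L : 'I_9 -> 'rV[S]_3) (j : 'I_(1 + 9)) (c : 'I_3) : S :=
  match split j with inl _ => X 0 c | inr i => L i 0 c end.
Definition row_pt : 'I_(1 + 9) := lshift 9 ord0.
Definition row_line (i : 'I_9) : 'I_(1 + 9) := rshift 1 i.
Definition with_line (i : 'I_9) (l : 'rV[S]_3) (L : 'I_9 -> 'rV[S]_3) (j : 'I_9) :=
  if j == i then l else L j.

Lemma assemble_pt X L c : assemble X L row_pt c = X 0 c.
Proof. by rewrite /assemble /row_pt; case: splitP => // j /= E. Qed.
Lemma assemble_line X L i c : assemble X L (row_line i) c = L i 0 c.
Proof.
by rewrite /assemble /row_line; case: splitP => [[[|//] Hj]|j] //= [/val_inj ->].
Qed.
Lemma rowP' (P : 'I_(1 + 9) -> Prop) : P row_pt -> (forall i, P (row_line i)) -> forall j, P j.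
Proof.
move=> P0 P1 j; case: (split_ordP j) => i ->; last exact: P1.
by rewrite (ord1 i).
Qed.
Lemma row_line_eq i j : (row_line i == row_line j) = (i == j).
Proof. by rewrite /row_line; apply/eqP/eqP => [/rshift_inj|->]. Qed.
Lemma row_pt_line i : (row_pt == row_line i) = false.
Proof. by apply/eqP => /(congr1 val). Qed.
End Assemble.

Lemma map_assemble (S T : comNzRingType) (φ : S -> T) X L j c :
  φ (assemble X L j c) = assemble (map_mx φ X) (fun i => map_mx φ (L i)) j c.
Proof. by rewrite /assemble; case: (split j) => ?; rewrite mxE. Qed.

Section HomogSpan.
Variable k : closedFieldType.

Lemma poly_zero_off0 (g : {poly k}) : (forall u, u != 0 -> g.[u] = 0) -> g = 0.
Proof.
move=> H; apply/eqP; apply: contraT => g0.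
have : g * 'X != 0 by rewrite mulf_neq0 ?polyX_eq0.
move=> /closed_nonrootP[u]; rewrite rootE hornerM hornerX.
by case: (eqVneq u 0) => [->|/H ->]; rewrite ?mulr0 ?mul0r eqxx.
Qed.

(** In a pencil u0 A + u1 B, homogeneity reaches the points with u0 != 0;
    the remaining one follows since k is infinite. *)
Lemma form_val_span (d : 'I_(1 + 9) -> nat) P (J : pred 'I_(1 + 9)) (A B C : 'I_(1 + 9) -> 'I_3 -> k) :
  multihomog d P ->
  (forall t, form_val idfun (fun j c => if J j then A j c + t * B j c else C j c) P = 0) ->
  forall u0 u1, form_val idfun (fun j c => if J j then u0 * A j c + u1 * B j c else C j c) P = 0.
Proof.
move=> dP H.
have H0 u0 u1 : u0 != 0 ->
    form_val idfun (fun j c => if J j then u0 * A j c + u1 * B j c else C j c) P = 0.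
  move=> u00; have := form_val_scale idfun (fun j => if J j then u0 else 1)
    (fun j c => if J j then A j c + (u1 / u0) * B j c else C j c) dP.
  rewrite H mulr0 => <-; apply: form_val_eq => j c.
  by case: (J j); rewrite ?mul1r // mulrDr mulrA mulrCA divff // mulr1.
move=> u0 u1; case: (eqVneq u0 0) => [->|]; last exact: H0.
pose g : {poly k} := form_val polyC
   (fun j c => if J j then 'X * (A j c)%:P + (u1 * B j c)%:P else (C j c)%:P) P.
have gE u : g.[u] = form_val idfun (fun j c => if J j then u * A j c + u1 * B j c else C j c) P.
  rewrite -[g.[u]]/(horner_eval u g) /g.
  rewrite (@rmorph_form_val _ _ _ polyC idfun) => [|c]; last exact: hornerC.
  by apply: form_val_eq => j c; case: (J j); rewrite /= /horner_eval ?hornerE /=.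
by rewrite -gE (@poly_zero_off0 g) ?horner0 // => u u0'; rewrite gE; exact: H0.
Qed.

End HomogSpan.

Section FormsOnS.
Variables (k : closedFieldType) (p : 'I_9 -> 'rV[k]_3).

Lemma mx_coordsE (S : comNzRingType) (κ : {rmorphism k -> S}) X L P :
  mmap κ (mx_coords X L) P = form_val κ (assemble X L) P.
Proof.
rewrite /form_val /= /mx_coords.
suff -> : \matrix_(j, c) assemble X L j c = col_mx X (\matrix_i L i) by [].
by apply/matrixP => j c; rewrite !mxE /assemble; case: (split j) => l; rewrite ?mxE // ?(ord1 l).
Qed.

Lemma form_atE (s : blowup p) P :
  form_at s P = form_val idfun (assemble (coords (proj s)) (fun i => coords (dir s i))) P.
Proof. by rewrite /form_at -mx_coordsE. Qed.

Lemma form_genericE P : form_generic p P =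
  form_val (cstm k) (assemble (generic_pt k) (fun i => cross (map_mx (cstm k) (p i)) (generic_pt k))) P.
Proof. by rewrite -mx_coordsE. Qed.

End FormsOnS.

Section GenericPoint.
Variables (k : closedFieldType) (p : 'I_9 -> 'rV[k]_3).
Variables (R : comNzRingType) (κ : {rmorphism k -> R}) (φ : {rmorphism R -> funfield k}).
Hypothesis φκ : forall c, φ (κ c) = cstm k c.
Variables (G : 'rV[R]_3) (σ : funfield k).
Hypothesis GE : map_mx φ G = σ *: generic_pt k.

(** In the function field G is proportional to the generic point, and P is
    homogeneous. *)
Lemma form_generic_chart d P : multihomog d P ->
  φ (form_val κ (assemble G (fun j => cross (map_mx κ (p j)) G)) P) =
  σ ^+ (\sum_j d j) * form_generic p P.
Proof.
move=> dP; rewrite (rmorph_form_val _ _ φκ) form_genericE -prodrXr.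
rewrite -(form_val_scale _ (fun=> σ) _ dP); apply: form_val_eq => j c.
rewrite map_assemble /=; elim/rowP': j => [|i].
  by rewrite !assemble_pt GE mxE.
rewrite !assemble_line map_cross GE -map_mx_comp.
rewrite crossZr mxE; congr (_ * _); congr (cross _ _ 0 _).
by apply/rowP => c'; rewrite !mxE /= φκ.
Qed.

End GenericPoint.

Definition frame_vec (R : comNzRingType) r (v u0 u1 u2 : R) : 'rV[R]_3 :=
  vec3 (frame r v (u0, u1, u2)).

Lemma map_frame_vec (R S : comNzRingType) (φ : {rmorphism R -> S}) r v u0 u1 u2 :
  map_mx φ (frame_vec r v u0 u1 u2) = frame_vec r (φ v) (φ u0) (φ u1) (φ u2).
Proof.
rewrite map_vec3 /frame_vec (frame_morph φ r v (u0, u1, u2)) /=.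
by case: (frame r v _) => [[p0 p1] p2].
Qed.

Lemma frame_vec_comb (R : comNzRingType) r (v c d u0 u1 u2 w0 w1 w2 : R) :
  frame_vec r v (c * u0 + d * w0) (c * u1 + d * w1) (c * u2 + d * w2) =
  c *: frame_vec r v u0 u1 u2 + d *: frame_vec r v w0 w1 w2.
Proof.
by apply/rowP; apply: ord3P; rewrite !mxE /=; case: r => [|[|?]] /=; ring.
Qed.

Lemma frame_vec_scale (R : comNzRingType) r (v c u0 u1 u2 : R) :
  frame_vec r v (c * u0) (c * u1) (c * u2) = c *: frame_vec r v u0 u1 u2.
Proof. by apply/rowP; apply: ord3P; rewrite !mxE /=; case: r => [|[|?]] /=; ring. Qed.

Lemma frame_vecK (R : comNzRingType) r (v : R) (x : 'rV[R]_3) : v ^+ 3 = 1 ->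
  exists u0 u1 u2, x = frame_vec r v u0 u1 u2.
Proof.
move=> v3; case E : (coframe r v (x 0 0, x 0 1, x 0 2%:R)) => [[u0 u1] u2].
by exists u0, u1, u2; rewrite /frame_vec -E coframeK // vec3K.
Qed.

Section Charts.
Variable k : closedFieldType.
Local Notation FF := (funfield k).
Variables (a eps : k).
Hypotheses (a0 : a != 0) (eps_prim : 3.-primitive_root eps) (a3 : a ^+ 3 != 1).
Local Notation p := (base_pt eps a).
Local Notation R2 := {poly {poly k}}.
Variable i : 'I_9.
Let r := pt_type i.
Let v := pt_root eps i.
Let v3 : v ^+ 3 = 1 := pt_root3 eps_prim i.
Let κ2 : {rmorphism k -> R2} := polyC \o polyC.
Local Notation x' := (adapted (cstm k) r v (xF k) (yF k)).1.
Local Notation y' := (adapted (cstm k) r v (xF k) (yF k)).2.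

Let piE : p i = frame_vec r v a 1 1 := base_ptE a eps_prim i.

Lemma adapted_generic : exists2 σ : FF, σ != 0 & frame_vec r (cstm k v) x' y' 1 = σ *: generic_pt k.
Proof.
have [σ σ0 E] := adapted_frame (cstm k) r v3 (xF_neq0 k) (yF_neq0 k).
exists σ => //; rewrite /frame_vec E generic_ptE.
by apply/rowP; apply: ord3P; rewrite !mxE /= ?mulr1.
Qed.

(* Along E_i the line joining p_i to X degenerates, and is replaced by a
   multiple l of it that does not vanish. *)
Let lines (S : comNzRingType) (κ : {rmorphism k -> S}) (X l : 'rV[S]_3) : 'I_9 -> 'rV[S]_3 :=
  with_line i l (fun j => cross (map_mx κ (p j)) X).

Lemma form_val_line_scale (S : comNzRingType) (κ : {rmorphism k -> S}) X L (c : S) l d P :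
  multihomog d P ->
  form_val κ (assemble X (with_line i (c *: l) L)) P =
  c ^+ d (row_line i) * form_val κ (assemble X (with_line i l L)) P.
Proof.
move=> dP; have -> : c ^+ d (row_line i) = \prod_j (if j == row_line i then c else 1) ^+ d j.
  rewrite (bigD1 (row_line i)) //= eqxx big1 ?mulr1 // => j nj.
  by rewrite (negPf nj) expr1n.
rewrite -(form_val_scale _ _ _ dP); apply: form_val_eq => j c'.
elim/rowP': j => [|j]; first by rewrite !assemble_pt row_pt_line mul1r.
rewrite !assemble_line row_line_eq /with_line; case: (j == i); first by rewrite mxE.
by rewrite mul1r.
Qed.

Lemma form_val_lines_at_p (S : comNzRingType) (κ : {rmorphism k -> S}) X c l P d :
  multihomog d P -> cross (map_mx κ (p i)) X = c *: l ->
  form_val κ (assemble X (fun j => cross (map_mx κ (p j)) X)) P =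
  c ^+ d (row_line i) * form_val κ (assemble X (lines κ X l)) P.
Proof.
move=> dP E; rewrite -form_val_line_scale //; apply: form_val_eq => j c'.
elim/rowP': j => [|j]; first by rewrite !assemble_pt.
by rewrite !assemble_line /with_line; case: eqP => // ->; rewrite E.
Qed.

Section BaseChart.
Let G : 'rV[R2]_3 := frame_vec r (κ2 v) (κ2 a + 'X) (1 + 'X * ('X)%:P) 1.
Let w : 'rV[R2]_3 := frame_vec r (κ2 v) 1 ('X)%:P 0.
Let bc := base_chart r v a.

Lemma base_chart_den : x' - cstm k a != 0.
Proof.
rewrite -(base_chartX r v a) (raddf_eq0 _ (@base_chart_inj k r v v3 a)) polyX_eq0 //.
Qed.

Lemma base_chart_cst c : bc (κ2 c) = cstm k c.
Proof. exact: eval_pairCC. Qed.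

Lemma base_chart_pt : map_mx bc G = frame_vec r (cstm k v) x' y' 1.
Proof.
have ex : bc 'X = x' - cstm k a by exact: base_chartX.
have et : bc ('X)%:P = (y' - 1) / (x' - cstm k a) by exact: eval_pairCX.
rewrite map_frame_vec; congr frame_vec.
- exact: base_chart_cst.
- by rewrite rmorphD /= base_chart_cst ex addrC subrK.
- by rewrite rmorphD rmorphM rmorph1 /= ex et mulrC mulfVK ?base_chart_den // addrC subrK.
- exact: rmorph1.
Qed.

Lemma base_chart_cross : cross (map_mx κ2 (p i)) G = 'X *: cross (map_mx κ2 (p i)) w.
Proof.
have -> : map_mx κ2 (p i) = frame_vec r (κ2 v) (κ2 a) 1 1.
  by rewrite piE map_frame_vec !rmorph1.
have -> : G = frame_vec r (κ2 v) (κ2 a) 1 1 + 'X *: w.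
  rewrite -[X in X + _]scale1r -frame_vec_comb /G; congr frame_vec; ring.
by rewrite [LHS]crossDr [X in X + _]crossxx add0r [LHS]crossZr.
Qed.

(** The coordinates of the line joining p_i to G are divisible by the
    equation 'X of the exceptional curve (base_chart_cross). They are
    divided by it here, so that the form can be restricted to that curve. *)
Definition chart_form P : R2 := form_val κ2 (assemble G (lines κ2 G (cross (map_mx κ2 (p i)) w))) P.

Lemma form_generic_base (σ : FF) d P : multihomog d P ->
  frame_vec r (cstm k v) x' y' 1 = σ *: generic_pt k ->
  (bc 'X) ^+ d (row_line i) * bc (chart_form P) = σ ^+ (\sum_j d j) * form_generic p P.
Proof.
move=> dP Eσ; rewrite -rmorphXn -rmorphM /= /chart_form.
rewrite -(form_val_lines_at_p dP base_chart_cross).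
have GE : map_mx bc G = σ *: generic_pt k by rewrite base_chart_pt.
exact: (@form_generic_chart k p R2 κ2 bc base_chart_cst G σ GE d P dP).
Qed.

Lemma chart_form_at0 P (t : k) : ((chart_form P)`_0).[t] =
  form_val idfun (assemble (p i) (with_line i (cross (p i) (frame_vec r v 1 t 0))
     (fun j => cross (p j) (p i)))) P.
Proof.
have [φ φE] : exists φ : {rmorphism R2 -> k}, forall B, φ B = B.[0].[t].
  by exists (horner_eval t \o horner_eval 0).
have -> : ((chart_form P)`_0).[t] = φ (chart_form P) by rewrite φE horner_coef0.
have φκ c : φ (κ2 c) = idfun c by rewrite φE !hornerC.
have φX : φ 'X = 0 by rewrite φE hornerX horner0.
have φT : φ ('X)%:P = t by rewrite φE hornerC hornerX.
have φp j : map_mx φ (map_mx κ2 (p j)) = p j.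
  by apply/rowP => c; rewrite 2!mxE φκ.
rewrite /chart_form (rmorph_form_val _ _ φκ); apply: form_val_eq => j c.
rewrite map_assemble; elim/rowP': j => [|j].
  rewrite !assemble_pt map_frame_vec piE; congr (frame_vec r _ _ _ _ 0 c).
  - exact: φκ.
  - by rewrite rmorphD φX addr0 φκ.
  - by rewrite rmorphD rmorphM rmorph1 φX mul0r addr0.
  - exact: rmorph1.
have φG : map_mx φ G = p i.
  rewrite map_frame_vec piE; congr frame_vec.
  - exact: φκ.
  - by rewrite rmorphD φX addr0 φκ.
  - by rewrite rmorphD rmorphM rmorph1 φX mul0r addr0.
  - exact: rmorph1.
have φw : map_mx φ w = frame_vec r v 1 t 0.
  by rewrite map_frame_vec; congr frame_vec; [exact: φκ | exact: rmorph1 | exact: φT | exact: rmorph0].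
rewrite !assemble_line /lines /with_line; case: (j == i).
  by rewrite map_cross φp φw.
by rewrite map_cross φp φG.
Qed.

(** At a point of E_i all lines but the i-th one are the lines joining the
    base points to p_i, up to scalars, and the i-th one is any line through
    p_i. The chart covers all of these lines but one, which form_val_span
    takes care of. *)
Lemma chart_form_neq0 (s : blowup p) d P : multihomog d P -> exceptional i s ->
  form_at s P <> 0 -> (chart_form P)`_0 != 0.
Proof.
move=> dP exc; apply: contra_notN => /eqP E0.
pose A := cross (p i) (frame_vec r v 1 0 0); pose B := cross (p i) (frame_vec r v 0 1 0).
have Hspan u0 u1 : form_val idfun (assemble (p i) (with_line i (u0 *: A + u1 *: B)
     (fun j => cross (p j) (p i)))) P = 0.
  pose J j := j == row_line i.
  pose C := assemble (p i) (fun j => cross (p j) (p i)).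
  have Ec u0' u1' : form_val idfun (assemble (p i) (with_line i (u0' *: A + u1' *: B)
     (fun j => cross (p j) (p i)))) P =
     form_val idfun (fun j c => if J j then u0' * A 0 c + u1' * B 0 c else C j c) P.
    apply: form_val_eq => j c; rewrite /J; elim/rowP': j => [|j].
      by rewrite row_pt_line /C !assemble_pt.
    rewrite row_line_eq assemble_line /with_line; case: (j == i); first by rewrite !mxE.
    by rewrite /C assemble_line.
  rewrite Ec; apply: (form_val_span dP) => t.
  have <- : ((chart_form P)`_0).[t] = 0 by rewrite E0 horner0.
  rewrite chart_form_at0 -[t]mulr1.
  have -> : frame_vec r v 1 (t * 1) 0 = 1 *: frame_vec r v 1 0 0 + t *: frame_vec r v 0 1 0.
    by rewrite -frame_vec_comb; congr frame_vec; ring.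
  rewrite crossDr !crossZr -/A -/B Ec; apply: form_val_eq => j c; by rewrite mul1r mulr1.
have [c0 Ec0] : exists c, coords (proj s) = c *: p i.
  have : coords (proj s) \in <[p i]>%VS by rewrite -exc coords_line memv_line.
  by move=> /vlineP.
have c00 : c0 != 0 by apply: contraNneq (coords_neq0 (proj s)) => E; rewrite Ec0 E scale0r.
have orth j : dot (p i) (coords (dir s j)) = 0.
  have := dir_proj s j; rewrite /on_line Ec0 dotZl mulf_eq0 (negPf c00) /= => /eqP.
  by [].
have ex j : exists c, j != i -> coords (dir s j) = c *: cross (p j) (p i).
  case: (eqVneq j i) => [->|nij]; first by exists 0.
  have [c Ec] := cross_span (base_cross_neq0 a0 eps_prim a3 nij) (dir_base s j) (orth j).
  by exists c.
pose cf j := proj1_sig (constructive_indefinite_description _ (ex j)).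
have cfE j : j != i -> coords (dir s j) = cf j *: cross (p j) (p i).
  exact: (proj2_sig (constructive_indefinite_description _ (ex j))).
have [l El] := cross_onto (base_pt_neq0 a0 eps_prim i) (orth i).
have [u0 [u1 [u2 Eu]]] := frame_vecK r l v3.
have Ei : coords (dir s i) = (u0 - a * u2) *: A + (u1 - u2) *: B.
  rewrite El.
  have -> : l = u2 *: p i + ((u0 - a * u2) *: frame_vec r v 1 0 0 + (u1 - u2) *: frame_vec r v 0 1 0).
    rewrite Eu piE -frame_vec_comb -[X in _ + X]scale1r -frame_vec_comb; congr frame_vec; ring.
  by rewrite !crossDr !crossZr crossxx scaler0 add0r.
rewrite form_atE.
pose μ (j : 'I_(1 + 9)) := match split j with inl _ => c0 | inr j => if j == i then 1 else cf j end.
have -> : form_val idfun (assemble (coords (proj s)) (fun j => coords (dir s j))) P =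
  form_val idfun (fun j c => μ j * assemble (p i) (with_line i ((u0 - a * u2) *: A + (u1 - u2) *: B)
     (fun j => cross (p j) (p i))) j c) P.
  apply: form_val_eq => j c; elim/rowP': j => [|j].
    by rewrite !assemble_pt /μ Ec0 mxE /row_pt; case: splitP => // j' /= E.
  rewrite !assemble_line /μ /row_line; case: splitP => [[[|//] Hj]|j'] //= [/val_inj <-].
  rewrite /with_line; case: eqP => [->|/eqP nj]; first by rewrite mul1r Ei.
  by rewrite cfE // mxE.
by rewrite (form_val_scale _ _ _ dP) Hspan mulr0.
Qed.

End BaseChart.
End Charts.

Lemma blowup_point (k : fieldType) (p : 'I_9 -> 'rV[k]_3) (q : 'rV[k]_3) (L : 'I_9 -> 'rV[k]_3) :
  q != 0 -> (forall j, L j != 0) -> (forall j, dot (p j) (L j) = 0) -> (forall j, dot q (L j) = 0) ->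
  exists s : blowup p, proj s = proj_pt q /\ forall j, dir s j = proj_pt (L j).
Proof.
move=> q0 L0 pL qL.
have H1 j : dot (p j) (coords (proj_pt (L j))) = 0.
  by have [c _ ->] := coords_proj_pt (L0 j); rewrite dotC dotZl dotC pL mulr0.
have H2 j : on_line (proj_pt q) (proj_pt (L j)) by rewrite on_lineE // qL.
by exists (BlowUp H1 H2).
Qed.

Lemma eval_pair_sum (k : fieldType) (F : fieldType) (κ : {rmorphism k -> F}) s t M T
  (A : {poly {poly k}}) : (size A <= M.+1)%N -> (forall m, (size (A`_m)%R <= T.+1)%N) ->
  eval_pair κ s t A = \sum_(m < M.+1) \sum_(n < T.+1) κ ((A`_m)`_n) * (s ^+ m * t ^+ n).
Proof.
move=> sA sAm; rewrite /eval_pair /= /horner_eval.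
have sA' : (size (map_poly (horner_eval t \o map_poly κ) A) <= M.+1)%N.
  exact: leq_trans (size_poly _ _) sA.
rewrite (horner_coef_wide _ sA'); apply: eq_bigr => m _; rewrite coef_map /= /horner_eval.
have sm : (size (map_poly κ A`_m) <= T.+1)%N by apply: leq_trans (size_poly _ _) (sAm m).
rewrite (horner_coef_wide _ sm) mulr_suml; apply: eq_bigr => n _.
by rewrite coef_map /=; ring.
Qed.

Lemma homog_monomial (F : fieldType) (u w : F) m M : w != 0 -> (m < M.+1)%N ->
  u ^+ m * w ^+ (M - m) = w ^+ M * (u / w) ^+ m.
Proof.
move=> w0 mM; rewrite -{2}(subnK (mM : (m <= M)%N)) exprD expr_div_n.
by rewrite -mulrA [w ^+ m * _]mulrC mulfVK ?expf_neq0 // mulrC.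
Qed.

Section Homogenize.
Variable k : fieldType.
Local Notation form := {mpoly k[(1 + 9) * 3]}.
Variables (jp jl : 'I_(1 + 9)) (α ζ λ1 λ0 : 'rV[k]_3) (M T : nat).

(** A made bihomogeneous: its outer variable becomes α / ζ on the plane, its
    inner variable λ1 / λ0 on one of the lines. *)
Definition homogenize (A : {poly {poly k}}) : form :=
  \sum_(m < M.+1) \sum_(n < T.+1) (A`_m)`_n *:
    (linear_form jp α ^+ m * linear_form jp ζ ^+ (M - m) *
     (linear_form jl λ1 ^+ n * linear_form jl λ0 ^+ (T - n))).

Lemma homogenize_homog A :
  multihomog (fun j => M * (j == jp) + T * (j == jl))%N (homogenize A).
Proof.
apply: multihomog_sum => m _; apply: multihomog_sum => n _; apply: multihomogZ.
apply: (multihomog_ext (d := fun j => (m * (j == jp) + (M - m) * (j == jp)) +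
   (n * (j == jl) + (T - n) * (j == jl)))%N).
  by move=> j; rewrite -!mulnDl !subnKC // -ltnS ltn_ord.
by apply: multihomogM; apply: multihomogM; apply: multihomogX; exact: linear_form_homog.
Qed.

Lemma form_val_homogenize (F : fieldType) (κ : {rmorphism k -> F}) z (A : {poly {poly k}}) :
  (size A <= M.+1)%N -> (forall m, (size (A`_m)%R <= T.+1)%N) ->
  form_val κ z (linear_form jp ζ) != 0 -> form_val κ z (linear_form jl λ0) != 0 ->
  form_val κ z (homogenize A) =
    form_val κ z (linear_form jp ζ) ^+ M * form_val κ z (linear_form jl λ0) ^+ T *
    eval_pair κ (form_val κ z (linear_form jp α) / form_val κ z (linear_form jp ζ))
                (form_val κ z (linear_form jl λ1) / form_val κ z (linear_form jl λ0)) A.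
Proof.
move=> sA sAm n0 n1; rewrite (eval_pair_sum κ _ _ sA sAm) /homogenize rmorph_sum mulr_sumr.
apply: eq_bigr => m _; rewrite rmorph_sum mulr_sumr; apply: eq_bigr => n _.
rewrite -mul_mpolyC !rmorphM form_valC !rmorphXn.
rewrite (homog_monomial _ n0 (ltn_ord m)) (homog_monomial _ n1 (ltn_ord n)).
move: (form_val κ z _) (form_val κ z _) (form_val κ z _) (form_val κ z _) => q1 q2 q3 q4; ring.
Qed.

End Homogenize.

Lemma poly2_bound (R : nzRingType) (A : {poly {poly R}}) : exists T, forall m, (size (A`_m)%R <= T.+1)%N.
Proof.
exists (\max_(m < size A) size (A`_m)%R) => m; case: (ltnP m (size A)) => H.
  by apply: leqW; rewrite (leq_bigmax (Ordinal H)).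
by rewrite nth_default // size_poly0.
Qed.

(** The linear forms zeta_vec and alpha_vec on the plane, lam0_vec and
    lam1_vec on the line joining the base point to a point of the plane,
    whose quotients are the two coordinates of the chart along the
    exceptional curve. *)
Section FrameForms.
Variable k : fieldType.
Definition zeta_vec r (v : k) : 'rV[k]_3 :=
  vec3 (match r with 0 => (0, 0, 1) | 1 => (v ^+ 2, 0, 0) | _ => (0, v, 0) end).
Definition alpha_vec r (v a : k) : 'rV[k]_3 :=
  vec3 (match r with 0 => (v ^+ 2, 0, - a) | 1 => (- a * v ^+ 2, v, 0) | _ => (0, - a * v, 1) end).
Definition lam0_vec r (v : k) : 'rV[k]_3 :=
  vec3 (match r with 0 => (0, v ^+ 2, 0) | 1 => (0, 0, 1) | _ => (v, 0, 0) end).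
Definition lam1_vec r (v : k) : 'rV[k]_3 :=
  vec3 (match r with 0 => (- v, 0, 0) | 1 => (0, - v ^+ 2, 0) | _ => (0, 0, - 1) end).

Variables (S : comNzRingType) (κ : {rmorphism k -> S}) (r : nat) (v a : k).
Hypothesis v3 : v ^+ 3 = 1.
Variables (u0 u1 u2 : S).
Let X := frame_vec r (κ v) u0 u1 u2.
Let P := map_mx κ (frame_vec r v a 1 1).
Let V3 : κ v ^+ 3 = 1. Proof. by rewrite -rmorphXn v3 rmorph1. Qed.

Let κE := (rmorphB κ, rmorphD κ, rmorphN κ, rmorphXn κ, rmorphM κ, rmorph1 κ, rmorph0 κ).

Lemma zeta_vecE : dot (map_mx κ (zeta_vec r v)) X = u2.
Proof.
rewrite dotE /X /frame_vec !vec3E map_vec3 !vec3E.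
case: (r) => [|[|?]] /=; rewrite ?κE ?mul0r ?add0r ?addr0 ?mul1r // mulrA.
  by rewrite -exprSr V3 mul1r.
by rewrite -exprS V3 mul1r.
Qed.

Lemma alpha_vecE : dot (map_mx κ (alpha_vec r v a)) X = u0 - κ a * u2.
Proof.
rewrite dotE /X /frame_vec !vec3E map_vec3 !vec3E.
case: (r) => [|[|?]] /=; rewrite ?κE ?mul0r ?add0r ?addr0 ?mul1r ?mulN1r.
- by ring: V3.
- by ring: V3.
- by ring: V3.
Qed.

Lemma lam0_vecE : dot (map_mx κ (lam0_vec r v)) (cross P X) = u0 - κ a * u2.
Proof.
rewrite crossE dotE /P /X map_frame_vec !rmorph1 /frame_vec !vec3E map_vec3 !vec3E.
case: (r) => [|[|?]] /=; rewrite ?κE ?mul0r ?add0r ?addr0 ?mul1r ?mulN1r.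
- by ring: V3.
- by ring: V3.
- by ring: V3.
Qed.

Lemma lam1_vecE : dot (map_mx κ (lam1_vec r v)) (cross P X) = u1 - u2.
Proof.
rewrite crossE dotE /P /X map_frame_vec !rmorph1 /frame_vec !vec3E map_vec3 !vec3E.
case: (r) => [|[|?]] /=; rewrite ?κE ?mul0r ?add0r ?addr0 ?mul1r ?mulN1r.
- by ring: V3.
- by ring: V3.
- by ring: V3.
Qed.
End FrameForms.

Lemma form_val_pt (k : fieldType) (S : comNzRingType) (κ : {rmorphism k -> S}) X L u :
  form_val κ (assemble X L) (linear_form row_pt u) = dot (map_mx κ u) X.
Proof.
by rewrite form_val_linear /dot; apply: eq_bigr => c _; rewrite assemble_pt mxE.
Qed.
Lemma form_val_line (k : fieldType) (S : comNzRingType) (κ : {rmorphism k -> S}) X L i u :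
  form_val κ (assemble X L) (linear_form (row_line i) u) = dot (map_mx κ u) (L i).
Proof.
by rewrite form_val_linear /dot; apply: eq_bigr => c _; rewrite assemble_line mxE.
Qed.

Lemma ratio_of_scaled (F : fieldType) (c d n m n' m' : F) : c != 0 -> d != 0 ->
  c * n' = d * n -> c * m' = d * m -> n / m = n' / m'.
Proof.
move=> c0 d0 En Em; case: (eqVneq m 0) => [m0|m0].
  have m'0 : m' = 0 by apply: (mulfI c0); rewrite Em m0 !mulr0.
  by rewrite m0 m'0 !invr0 !mulr0.
have m'0 : m' != 0 by apply: contra_neq m0 => E; apply: (mulfI d0); rewrite -Em E !mulr0.
by apply/eqP; rewrite eqr_div //; apply/eqP/(mulfI c0); rewrite mulrCA Em mulrCA !mulrA -En; ring.
Qed.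

Lemma eval_pair0 (k F : fieldType) (κ : {rmorphism k -> F}) t (A : {poly {poly k}}) :
  eval_pair κ 0 t A = (map_poly κ A`_0).[t].
Proof.
elim/poly_ind: A => [|A c _]; first by rewrite coef0 !rmorph0 horner0.
by rewrite rmorphD rmorphM /= eval_pairX mulr0 add0r coefD coefMX coefC add0r eval_pairC.
Qed.

Section LocalRings.
Variable k : closedFieldType.
Local Notation FF := (funfield k).
Variables (a eps : k).
Hypotheses (a0 : a != 0) (eps_prim : 3.-primitive_root eps) (a3 : a ^+ 3 != 1).
Local Notation p := (base_pt eps a).
Local Notation R2 := {poly {poly k}}.
Variable i : 'I_9.
Local Notation r := (pt_type i).
Local Notation v := (pt_root eps i).
Local Notation κ2 := (polyC \o polyC : {rmorphism k -> R2}).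
Local Notation x' := (adapted (cstm k) r v (xF k) (yF k)).1.
Local Notation y' := (adapted (cstm k) r v (xF k) (yF k)).2.
Let v3 : v ^+ 3 = 1 := pt_root3 eps_prim i.
Let piE : p i = frame_vec r v a 1 1 := base_ptE a eps_prim i.

(** In the chart, the numerator and the denominator of a function are forms
    of the same multidegree, so that the powers of the equation of E_i and
    of the factor of proportionality cancel. *)
Lemma exc_ring_sub h : exc_ring p i h -> chart_ring (base_chart r v a) h.
Proof.
move=> [s [exc [d [N [D [dN dD nD ->]]]]]].
have [σ σ0 Eσ] := adapted_generic eps_prim i.
exists (chart_form a eps i N), (chart_form a eps i D); split.
  exact: (chart_form_neq0 a0 eps_prim a3 dD exc nD).
have s0 : base_chart r v a 'X != 0.
  by rewrite raddf_eq0 ?polyX_eq0 //; exact: base_chart_inj.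
have EN := form_generic_base a eps_prim dN Eσ.
have ED := form_generic_base a eps_prim dD Eσ.
exact: (ratio_of_scaled (expf_neq0 _ s0) (expf_neq0 _ σ0) EN ED).
Qed.

Section ExcPoint.
Variable t0 : k.
Let L (j : 'I_9) : 'rV[k]_3 := if j == i then cross (p i) (frame_vec r v 1 t0 0) else cross (p j) (p i).

Let lam0L : dot (lam0_vec r v) (L i) = 1.
Proof.
rewrite /L eqxx piE; have := lam0_vecE (idfun : {rmorphism k -> k}) r a v3 1 t0 0.
by rewrite !map_mx_id // => ->; rewrite mulr0 subr0.
Qed.

Let lam1L : dot (lam1_vec r v) (L i) = t0.
Proof.
rewrite /L eqxx piE; have := lam1_vecE (idfun : {rmorphism k -> k}) r a v3 1 t0 0.
by rewrite !map_mx_id // => ->; rewrite subr0.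
Qed.

Let zetap : dot (zeta_vec r v) (p i) = 1.
Proof.
by rewrite piE; have := zeta_vecE (idfun : {rmorphism k -> k}) r v3 a 1 1; rewrite !map_mx_id.
Qed.

Let alphap : dot (alpha_vec r v a) (p i) = 0.
Proof.
rewrite piE; have := alpha_vecE (idfun : {rmorphism k -> k}) r a v3 a 1 1.
by rewrite !map_mx_id // => ->; rewrite mulr1 subrr.
Qed.

Lemma exc_point : exists s : blowup p, exceptional i s /\
  forall M T (A : R2), (size A <= M.+1)%N -> (forall m, (size (A`_m)%R <= T.+1)%N) ->
  exists2 c, c != 0 &
    form_at s (homogenize row_pt (row_line i) (alpha_vec r v a) (zeta_vec r v)
      (lam1_vec r v) (lam0_vec r v) M T A) = c * (A`_0).[t0].
Proof.
have Li0 : L i != 0.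
  by apply: contra_eq_neq lam0L => ->; rewrite dotC dotE !mxE !mul0r !addr0 eq_sym oner_neq0.
have L0 j : L j != 0.
  by case: (eqVneq j i) => [->|nj] //; rewrite /L (negPf nj) base_cross_neq0.
have pL j : dot (p j) (L j) = 0.
  by rewrite /L; case: eqP => [->|_]; rewrite cross_dotl.
have qL j : dot (p i) (L j) = 0.
  by rewrite /L; case: eqP => _; rewrite ?cross_dotl ?cross_dotr.
have [s [Ep Ed]] := blowup_point (base_pt_neq0 a0 eps_prim i) L0 pL qL.
exists s; split; first by rewrite /exceptional Ep proj_ptE // base_pt_neq0.
move=> M T A sA sAm; rewrite form_atE.
have [c c0 Ec] := coords_proj_pt (base_pt_neq0 a0 eps_prim i).
have [d d0 Edi] := coords_proj_pt (L0 i).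
have Vz : form_val idfun (assemble (coords (proj s)) (fun j => coords (dir s j)))
    (linear_form row_pt (zeta_vec r v)) = c.
  by rewrite form_val_pt map_mx_id // Ep Ec dotC dotZl dotC zetap mulr1.
have Va : form_val idfun (assemble (coords (proj s)) (fun j => coords (dir s j)))
    (linear_form row_pt (alpha_vec r v a)) = 0.
  by rewrite form_val_pt map_mx_id // Ep Ec dotC dotZl dotC alphap mulr0.
have V0 : form_val idfun (assemble (coords (proj s)) (fun j => coords (dir s j)))
    (linear_form (row_line i) (lam0_vec r v)) = d.
  by rewrite form_val_line map_mx_id // Ed Edi dotC dotZl dotC lam0L mulr1.
have V1 : form_val idfun (assemble (coords (proj s)) (fun j => coords (dir s j)))
    (linear_form (row_line i) (lam1_vec r v)) = d * t0.
  by rewrite form_val_line map_mx_id // Ed Edi dotC dotZl dotC lam1L.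
exists (c ^+ M * d ^+ T); first by rewrite mulf_neq0 // expf_neq0.
rewrite form_val_homogenize ?Vz ?V0 // Va V1; congr (_ * _).
by rewrite mul0r [d * t0]mulrC mulfK // eval_pair0 map_poly_id.
Qed.
End ExcPoint.

Lemma homogenize_frame (F : fieldType) (κ : {rmorphism k -> F}) (c u0 u1 : F) X M T (A : R2) :
  c != 0 -> u0 - κ a != 0 -> X = c *: frame_vec r (κ v) u0 u1 1 ->
  (size A <= M.+1)%N -> (forall m, (size (A`_m)%R <= T.+1)%N) ->
  form_val κ (assemble X (fun j => cross (map_mx κ (p j)) X))
      (homogenize row_pt (row_line i) (alpha_vec r v a) (zeta_vec r v)
      (lam1_vec r v) (lam0_vec r v) M T A) =
  c ^+ M * (c * (u0 - κ a)) ^+ T * eval_pair κ (u0 - κ a) ((u1 - 1) / (u0 - κ a)) A.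
Proof.
move=> c0 x0 EX sA sAm; set z := assemble _ _.
have Vz : form_val κ z (linear_form row_pt (zeta_vec r v)) = c.
  by rewrite form_val_pt EX dotC dotZl dotC zeta_vecE // mulr1.
have Va : form_val κ z (linear_form row_pt (alpha_vec r v a)) = c * (u0 - κ a).
  by rewrite form_val_pt EX dotC dotZl dotC alpha_vecE // mulr1.
have V0 : form_val κ z (linear_form (row_line i) (lam0_vec r v)) = c * (u0 - κ a).
  by rewrite form_val_line EX crossZr dotC dotZl dotC piE lam0_vecE // mulr1.
have V1 : form_val κ z (linear_form (row_line i) (lam1_vec r v)) = c * (u1 - 1).
  by rewrite form_val_line EX crossZr dotC dotZl dotC piE lam1_vecE.
rewrite form_val_homogenize ?Vz ?V0 ?mulf_neq0 // Va V1.
by rewrite [c * _ / c]mulrAC mulfV // mul1r -mulf_div mulfV // mul1r.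
Qed.

Lemma scale_eq_inv (F : fieldType) (σ : F) (X Y : 'rV[F]_3) : σ != 0 -> X = σ *: Y ->
  exists2 c, c != 0 & Y = c *: X.
Proof. by move=> σ0 ->; exists σ^-1; rewrite ?invr_eq0 // scalerK. Qed.

Lemma homogenize_ratio (F : fieldType) (κ : {rmorphism k -> F}) (c u0 u1 : F) X M T (A B : R2) :
  c != 0 -> u0 - κ a != 0 -> X = c *: frame_vec r (κ v) u0 u1 1 ->
  (size A <= M.+1)%N -> (forall m, (size (A`_m)%R <= T.+1)%N) ->
  (size B <= M.+1)%N -> (forall m, (size (B`_m)%R <= T.+1)%N) ->
  let H C := form_val κ (assemble X (fun j => cross (map_mx κ (p j)) X))
      (homogenize row_pt (row_line i) (alpha_vec r v a) (zeta_vec r v)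
      (lam1_vec r v) (lam0_vec r v) M T C) in
  let E := eval_pair κ (u0 - κ a) ((u1 - 1) / (u0 - κ a)) in
  E A / E B = H A / H B.
Proof.
move=> c0 x0 EX sA tA sB tB H E; rewrite /H !(homogenize_frame c0 x0 EX) //.
by rewrite -mulf_div divff ?mul1r // mulf_neq0 ?expf_neq0 ?mulf_neq0.
Qed.

(** Conversely, a fraction in the chart is the quotient of two
    homogenizations of the same multidegree, and it is regular at a point of
    E_i where the denominator does not vanish. *)
Lemma exc_ringE h : exc_ring p i h <-> chart_ring (base_chart r v a) h.
Proof.
split; first exact: exc_ring_sub.
move=> [A [B [B0 ->]]].
have [σ σ0 Eσ] := adapted_generic eps_prim i.
have [t0 nt] : exists t0, (B`_0).[t0] != 0.
  by have /closed_nonrootP[t0] := B0; rewrite rootE; exists t0.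
have [s [exc H]] := exc_point t0; exists s; split=> //.
have [TA sTA] := poly2_bound A; have [TB sTB] := poly2_bound B.
pose M := maxn (size A) (size B); pose T := maxn TA TB.
have sA : (size A <= M.+1)%N by apply: leqW; exact: leq_maxl.
have sB : (size B <= M.+1)%N by apply: leqW; exact: leq_maxr.
have tA m : (size (A`_m)%R <= T.+1)%N by apply: leq_trans (sTA m) _; rewrite ltnS leq_maxl.
have tB m : (size (B`_m)%R <= T.+1)%N by apply: leq_trans (sTB m) _; rewrite ltnS leq_maxr.
pose H0 C : {mpoly k[(1 + 9) * 3]} := homogenize row_pt (row_line i) (alpha_vec r v a)
  (zeta_vec r v) (lam1_vec r v) (lam0_vec r v) M T C.
exists (fun j => M * (j == row_pt) + T * (j == row_line i))%N, (H0 A), (H0 B).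
split; [exact: homogenize_homog | exact: homogenize_homog | |].
  by have [c c0 ->] := H M T B sB tB; apply/eqP; rewrite mulf_neq0.
rewrite !form_genericE.
have [c c0 Ec] := scale_eq_inv σ0 Eσ.
have x0 : x' - cstm k a != 0 by exact: base_chart_den.
exact: (homogenize_ratio c0 x0 Ec sA tA sB tB).
Qed.

End LocalRings.

Lemma dotDl (R : comNzRingType) (x y z : 'rV[R]_3) : dot (x + y) z = dot x z + dot y z.
Proof. by rewrite !dotE !mxE; ring. Qed.

Section AxisPoints.
Variable k : closedFieldType.
Local Notation FF := (funfield k).
Variables (a eps : k).
Hypotheses (a0 : a != 0) (eps_prim : 3.-primitive_root eps) (a3 : a ^+ 3 != 1).
Local Notation p := (base_pt eps a).
Local Notation R2 := {poly {poly k}}.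
Variable i : 'I_9.
Local Notation r := (pt_type i).
Local Notation v := (pt_root eps i).
Local Notation κ2 := (polyC \o polyC : {rmorphism k -> R2}).
Local Notation x' := (adapted (cstm k) r v (xF k) (yF k)).1.
Local Notation y' := (adapted (cstm k) r v (xF k) (yF k)).2.
Let v3 : v ^+ 3 = 1 := pt_root3 eps_prim i.
Let piE : p i = frame_vec r v a 1 1 := base_ptE a eps_prim i.

Let G : 'rV[R2]_3 := frame_vec r (κ2 v) ('X)%:P (1 + 'X) 1.

Lemma line_chart_pt : map_mx (line_chart r v) G = frame_vec r (cstm k v) x' y' 1.
Proof.
have ex : line_chart r v 'X = y' - 1 by exact: line_chartX.
have et : line_chart r v ('X)%:P = x' by exact: eval_pairCX.
rewrite map_frame_vec; congr frame_vec.
- exact: eval_pairCC.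
- exact: et.
- by rewrite rmorphD rmorph1 /= ex addrC subrK.
- exact: rmorph1.
Qed.

Definition line_form P : R2 := form_val κ2 (assemble G (fun j => cross (map_mx κ2 (p j)) G)) P.

Lemma form_generic_line (σ : FF) d P : multihomog d P ->
  frame_vec r (cstm k v) x' y' 1 = σ *: generic_pt k ->
  line_chart r v (line_form P) = σ ^+ (\sum_j d j) * form_generic p P.
Proof.
move=> dP Eσ.
have GE : map_mx (line_chart r v) G = σ *: generic_pt k by rewrite line_chart_pt.
have κE c : line_chart r v (κ2 c) = cstm k c by exact: eval_pairCC.
exact: (@form_generic_chart k p R2 κ2 (line_chart r v) κE G σ GE d P dP).
Qed.

Local Notation w0 := (frame_vec r v 1 0 0).
Local Notation w1 := (frame_vec r v 0 1 1).

Lemma line_form_at0 P (t : k) : ((line_form P)`_0).[t] =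
  form_val idfun (assemble (t *: w0 + w1) (fun j => cross (p j) (t *: w0 + w1))) P.
Proof.
have [φ φE] : exists φ : {rmorphism R2 -> k}, forall B, φ B = B.[0].[t].
  by exists (horner_eval t \o horner_eval 0).
have -> : ((line_form P)`_0).[t] = φ (line_form P) by rewrite φE horner_coef0.
have φκ c : φ (κ2 c) = idfun c by rewrite φE !hornerC.
have φX : φ 'X = 0 by rewrite φE hornerX horner0.
have φT : φ ('X)%:P = t by rewrite φE hornerC hornerX.
have φp j : map_mx φ (map_mx κ2 (p j)) = p j.
  by apply/rowP => c; rewrite 2!mxE φκ.
have φG : map_mx φ G = t *: w0 + w1.
  rewrite map_frame_vec -[w1]scale1r -frame_vec_comb; congr frame_vec.
  - exact: φκ.
  - by rewrite φT; ring.
  - by rewrite rmorphD rmorph1 φX; ring.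
  - by rewrite rmorph1; ring.
rewrite /line_form (rmorph_form_val _ _ φκ); apply: form_val_eq => j c.
rewrite map_assemble; elim/rowP': j => [|j]; first by rewrite !assemble_pt φG.
by rewrite !assemble_line map_cross φp φG.
Qed.

Let ℓ := cross (p i) w0.

Lemma cross_pi_line t : cross (p i) (t *: w0 + w1) = (t - a) *: ℓ.
Proof.
have -> : t *: w0 + w1 = 1 *: p i + (t - a) *: w0.
  by rewrite piE -frame_vec_comb -[w1]scale1r -frame_vec_comb; congr frame_vec; ring.
by rewrite crossDr !crossZr crossxx scaler0 add0r.
Qed.

(** The line ℓ joining p_i to another point of the axis is the axis itself.
    A form that vanishes along the axis away from p_i also vanishes at p_i,
    if ℓ is taken for the i-th line. *)
Lemma line_form_axis P d : multihomog d P -> (line_form P)`_0 = 0 -> forall u0 u1,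
  form_val idfun (assemble (u0 *: w0 + u1 *: w1)
    (with_line i ℓ (fun j => cross (p j) (u0 *: w0 + u1 *: w1)))) P = 0.
Proof.
move=> dP E0 u0 u1.
pose J j := j != row_line i.
pose A := assemble w1 (fun j => cross (p j) w1).
pose B := assemble w0 (fun j => cross (p j) w0).
pose C := assemble (0 : 'rV[k]_3) (fun=> ℓ).
have EJ s0 s1 : form_val idfun (assemble (s0 *: w0 + s1 *: w1)
    (with_line i ℓ (fun j => cross (p j) (s0 *: w0 + s1 *: w1)))) P =
   form_val idfun (fun j c => if J j then s1 * A j c + s0 * B j c else C j c) P.
  apply: form_val_eq => j c; rewrite /J; elim/rowP': j => [|j].
    by rewrite row_pt_line /A /B !assemble_pt /= !mxE addrC.
  rewrite row_line_eq assemble_line /with_line; case: (j == i) => /=.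
    by rewrite /C assemble_line.
  by rewrite /A /B !assemble_line crossDr !crossZr; move: (cross _ _) (cross _ _) => X Y; rewrite !mxE addrC.
rewrite EJ; apply: (form_val_span dP) => t; move: t.
pose g : {poly k} := form_val polyC (fun j c => if J j then (A j c)%:P + 'X * (B j c)%:P else (C j c)%:P) P.
have gE t : g.[t] = form_val idfun (fun j c => if J j then A j c + t * B j c else C j c) P.
  rewrite -[g.[t]]/(horner_eval t g) /g.
  rewrite (@rmorph_form_val _ _ _ polyC idfun) => [|c]; last exact: hornerC.
  by apply: form_val_eq => j c; case: (J j); rewrite /= /horner_eval ?hornerE /=.
suff g0 : g = 0 by move=> t; rewrite -gE g0 horner0.
apply/eqP; apply: contraT => gn0.
have : g * ('X - a%:P) != 0 by rewrite mulf_neq0 ?polyXsubC_eq0.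
move=> /closed_nonrootP[t]; rewrite rootE hornerM hornerXsubC mulf_eq0 negb_or => /andP[/eqP ng ta].
case: ng; rewrite gE.
have -> : form_val idfun (fun j c => if J j then A j c + t * B j c else C j c) P =
  form_val idfun (fun j c => if J j then 1 * A j c + t * B j c else C j c) P.
  by apply: form_val_eq => j c; rewrite mul1r.
rewrite -EJ scale1r.
have := line_form_at0 P t; rewrite E0 horner0 => /esym.
have -> : form_val idfun (assemble (t *: w0 + w1) (fun j => cross (p j) (t *: w0 + w1))) P =
  form_val idfun (assemble (t *: w0 + w1) (with_line i ((t - a) *: ℓ) (fun j => cross (p j) (t *: w0 + w1)))) P.
  apply: form_val_eq => j c; elim/rowP': j => [|j]; first by rewrite !assemble_pt.
  by rewrite !assemble_line /with_line; case: eqP => // ->; rewrite cross_pi_line.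
rewrite (form_val_line_scale _ _ _ _ _ _ dP) => /eqP.
by rewrite mulf_eq0 expf_eq0 (negPf ta) andbF /= => /eqP.
Qed.

Lemma axis_span (q : 'rV[k]_3) : dot q (axis r v) = 0 -> exists u0 u1, q = u0 *: w0 + u1 *: w1.
Proof.
move=> qa; have [u0 [u1 [u2 Eq]]] := frame_vecK r q v3.
have := axisE (idfun : {rmorphism k -> k}) r v (frame r v (u0, u1, u2)).
rewrite map_mx_id // frameK // -/(frame_vec r v u0 u1 u2) -Eq dotC qa => /esym/eqP.
rewrite subr_eq0 => /eqP E; exists u0, u1; rewrite Eq -E -frame_vec_comb.
by congr frame_vec; ring.
Qed.

Lemma cross_pi_w0 : ℓ != 0.
Proof.
have := lam0_vecE (idfun : {rmorphism k -> k}) r a v3 1 0 0.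
rewrite !map_mx_id // -piE mulr0 subr0 -/ℓ => E.
by apply: contra_eq_neq E => ->; rewrite dotC dotE !mxE !mul0r !addr0 eq_sym oner_neq0.
Qed.

(** Take the point over q of the proper transform of the axis, for which the
    i-th line is the axis. A form that is not zero there is not zero along
    the axis (line_form_axis). *)
Lemma axis_point (q : 'rV[k]_3) : q != 0 -> dot q (axis r v) = 0 ->
  exists s : blowup p, proj s = proj_pt q /\
    forall h, regular_at s h -> chart_ring (line_chart r v) h.
Proof.
move=> q0 qa; have [u0 [u1 Eq]] := axis_span qa.
pose L := with_line i ℓ (fun j => cross (p j) q).
have n0 j : j != i -> cross (p j) q != 0.
  move=> nji; apply/negP => /eqP /(proj_pt_cross (base_pt_neq0 a0 eps_prim j) q0) E.
  have /negP : ~~ (dot (axis r v) (p j) == 0).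
    by rewrite (axis_base_pt eps_prim a3) eq_sym.
  apply.
  have [c c0 Ec] := coords_proj_pt (base_pt_neq0 a0 eps_prim j).
  have [e e0 Ee] := coords_proj_pt q0; rewrite E Ee in Ec.
  have -> : p j = (c^-1 * e) *: q by rewrite -scalerA Ec scalerK.
  by rewrite dotC dotZl qa mulr0.
have L0 j : L j != 0.
  by rewrite /L /with_line; case: (eqVneq j i) => [_|nj]; [exact: cross_pi_w0 | exact: n0].
have pL j : dot (p j) (L j) = 0.
  by rewrite /L /with_line; case: eqP => [->|_]; rewrite cross_dotl.
have qℓ : dot q ℓ = 0.
  rewrite Eq; have -> : u0 *: w0 + u1 *: w1 = u1 *: p i + (u0 - a * u1) *: w0.
    by rewrite piE -!frame_vec_comb; congr frame_vec; ring.
  by rewrite dotDl !dotZl cross_dotl cross_dotr !mulr0 addr0.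
have qL j : dot q (L j) = 0.
  by rewrite /L /with_line; case: eqP => _ //; rewrite cross_dotr.
have [s [Ep Ed]] := blowup_point q0 L0 pL qL; exists s; split=> // h.
have nz P d : multihomog d P -> form_at s P <> 0 -> (line_form P)`_0 != 0.
  move=> dP; apply: contra_notN => /eqP /(line_form_axis dP) /(_ u0 u1); rewrite -Eq form_atE => E.
  have exc (w : 'rV[k]_3) : w != 0 -> exists c, coords (proj_pt w) = c *: w.
    by move=> /coords_proj_pt[c _ ->]; exists c.
  have [c Ec] := exc q q0.
  pose cf j := proj1_sig (constructive_indefinite_description _ (exc _ (L0 j))).
  have cfE j : coords (proj_pt (L j)) = cf j *: L j.
    exact: (proj2_sig (constructive_indefinite_description _ (exc _ (L0 j)))).
  have -> : form_val idfun (assemble (coords (proj s)) (fun j => coords (dir s j))) P =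
    form_val idfun (fun j c' => assemble (const_mx c : 'rV[k]_3) (fun j => const_mx (cf j)) j 0 * assemble q L j c') P.
    apply: form_val_eq => j c'; elim/rowP': j => [|j].
      by rewrite !assemble_pt Ep Ec !mxE.
    by rewrite !assemble_line Ed cfE !mxE.
  by rewrite (form_val_scale _ (fun j => assemble (const_mx c : 'rV[k]_3) (fun j => const_mx (cf j)) j 0) _ dP) E mulr0.
move=> [d [N [D [dN dD nD ->]]]].
have [σ σ0 Eσ] := adapted_generic eps_prim i.
exists (line_form N), (line_form D); split; first exact: nz dD nD.
have EN := form_generic_line dN Eσ; have ED := form_generic_line dD Eσ.
have H (F : fieldType) (e n m n' m' : F) : e != 0 -> n' = e * n -> m' = e * m -> n / m = n' / m'.
  by move=> e0 -> ->; rewrite -mulf_div divff // mul1r.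
exact: (H _ _ _ _ _ _ (expf_neq0 _ σ0) EN ED).
Qed.

End AxisPoints.

(** * The Bertini involution is a reflection *)

Lemma horner_natr (R : nzRingType) n (z : R) : (n%:R : {poly R}).[z] = n%:R.
Proof. by rewrite -(rmorph_nat polyC) hornerC. Qed.

(** The subfield k(f). *)
Definition func_field (k F : fieldType) (κ : {rmorphism k -> F}) (f h : F) : Prop :=
  exists u v : {poly k}, (map_poly κ v).[f] != 0 /\ h = (map_poly κ u).[f] / (map_poly κ v).[f].

Definition fibre_pt (k F : fieldType) (κ : {rmorphism k -> F}) (f : F) (O : F -> Prop) : Prop :=
  [/\ valring O, (forall h, func_field κ f h -> O h) & exists h, ~ O h].

Section FuncField.
Variables (k : closedFieldType) (F : fieldType) (κ : {rmorphism k -> F}) (f : F).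
Lemma func_field_poly p : func_field κ f (map_poly κ p).[f].
Proof. by exists p, 1; rewrite rmorph1 hornerC divr1 oner_neq0. Qed.
Lemma func_field_cst c : func_field κ f (κ c).
Proof. by have := func_field_poly c%:P; rewrite map_polyC hornerC. Qed.
Lemma func_field_f : func_field κ f f.
Proof. by have := func_field_poly 'X; rewrite map_polyX hornerX. Qed.
Lemma func_field_inv p : (map_poly κ p).[f] != 0 -> func_field κ f (map_poly κ p).[f]^-1.
Proof. by move=> p0; exists 1, p; rewrite rmorph1 hornerC mul1r. Qed.

(** For r in k, f - r is a non-zero element of k(f), hence a unit. *)
Lemma fibre_pt_nres O : fibre_pt κ f O -> (forall r, f != κ r) -> forall r, ~ res κ O f r.
Proof.
move=> [vO bO [h nOh]] nf r; rewrite /res.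
have E : f - κ r = (map_poly κ ('X - r%:P)).[f].
  by rewrite rmorphB /= map_polyX map_polyC hornerD hornerN hornerX hornerC.
have n0 : f - κ r != 0 by rewrite subr_eq0.
by apply: unit_maxidN => //; apply: bO; rewrite E; apply: func_field_inv; rewrite -E.
Qed.
End FuncField.

Section BaseChartFibre.
Variables (k : closedFieldType) (F : fieldType) (κ : {rmorphism k -> F}).
Variables (a eps : k) (x y f : F) (ev : {rmorphism {poly {poly k}} -> F}).
Hypotheses (two0 : 2%:R != 0 :> k) (three0 : 3%:R != 0 :> k).
Hypotheses (a0 : a != 0) (a3 : a ^+ 3 != 1) (eps2 : eps ^+ 2 + eps + 1 = 0).
Local Notation A := (κ a).
Local Notation s := (x - A).
Local Notation u := ((y - 1) / (x - A)).
Local Notation c := (cubic_at A x y 1).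
Local Notation d := (nodal_cubic_at A x y 1).
Hypothesis evX : ev 'X = s.
Hypothesis evC : forall p, ev p%:P = (map_poly κ p).[u].
Hypothesis ev_inj : injective ev.
Hypothesis ev_frac : forall h, exists A B : {poly {poly k}}, B != 0 /\ h = ev A / ev B.
Hypothesis fE : f * c ^+ 2 = - sextic_at A x y 1.
Hypothesis gen : forall S : F -> Prop, (forall r, S (κ r)) ->
  (forall g h, S g -> S h -> S (g - h)) -> (forall g h, S g -> S h -> S (g * h)) ->
  (forall h, S h -> S h^-1) -> S x -> S y -> forall h, S h.
Variable τ : {rmorphism F -> F}.
Hypotheses (τκ : forall r, τ (κ r) = κ r) (τx : τ x = x / y) (τy : τ y = y^-1).

Local Notation V := (chart_ring ev).
Local Notation R2 := {poly {poly k}}.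
Local Notation α := (a%:P%:P : R2).
Local Notation S := ('X : R2).
Local Notation T := (('X)%:P : R2).

(* The cubic, the nodal cubic and the sextic in the chart, divided by s, 1
   and s^2; the factor Q comes from the conic that does not pass through the
   base point. *)
Let C1 : R2 := (α ^+ 3 - 1) * (2%:R - α * T) +
  S * (α * (3%:R * α + S + 3%:R * T ^+ 2 + S * T ^+ 3) - (α ^+ 3 + 2%:R) * T).
Let Q : R2 := 1 - α ^+ 3 + S * (T - 2%:R * α ^+ 2 - α * S).
Let D1 : R2 := Q * (3%:R * α + S + α * S * T).
Let P1 : R2 := (1 + α * T + S * T) * (1 - 2%:R * α * T - α * S * T ^+ 2) * Q.

Let s0 : s != 0. Proof. by rewrite -evX raddf_eq0 // polyX_eq0. Qed.
Let evCC r : ev (r%:P%:P) = κ r. Proof. by rewrite evC map_polyC hornerC. Qed.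
Let evα : ev α = A. Proof. exact: evCC. Qed.
Let evT : ev T = u. Proof. by rewrite evC map_polyX hornerX. Qed.
Let evE := (rmorphB ev, rmorphD ev, rmorphN ev, rmorphXn ev, rmorphM ev, rmorph1 ev, rmorph_nat ev).
Let xE : x = A + s. Proof. by rewrite addrC subrK. Qed.
Let yE : y = 1 + s * u. Proof. by rewrite mulrC mulfVK // addrC subrK. Qed.

Lemma chart_cubic : c = s * ev C1.
Proof.
rewrite /C1 !evE evX evα evT /cubic_at {1 2}xE {1 2}yE.
by move: s u => s u; ring.
Qed.
Lemma chart_nodal : d = ev D1.
Proof.
rewrite /D1 /Q !evE evX evα evT /nodal_cubic_at {1 2}xE {1 2}yE.
by move: s u => s u; ring.
Qed.
Lemma chart_sextic : sextic_at A x y 1 = s ^+ 2 * ev P1.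
Proof.
rewrite /P1 /Q !evE evX evα evT /sextic_at {1 2 3}xE {1 2 3}yE.
by move: s u => s u; ring.
Qed.

Let c0E (B : R2) : B`_0 = B.[0]. Proof. by rewrite horner_coef0. Qed.
Lemma chart_cubic0 : C1`_0 = (a ^+ 3 - 1)%:P * (2%:R - a%:P * 'X).
Proof.
by rewrite c0E /C1 !(hornerE, horner_exp) /= polyCB polyC1 !polyC_exp; ring.
Qed.
Lemma chart_nodal0 : D1`_0 = (3%:R * a * (1 - a ^+ 3))%:P.
Proof.
by rewrite c0E /D1 /Q !(hornerE, horner_exp) /= !(polyCM, polyCB, polyC_exp, polyCMn, polyC1) ?rmorph_nat; ring.
Qed.
Lemma chart_sextic0 : P1`_0 = (1 + a%:P * 'X) * (1 - 2%:R * a%:P * 'X) * (1 - a ^+ 3)%:P.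
Proof.
by rewrite c0E /P1 /Q !(hornerE, horner_exp) /= polyCB polyC1 !polyC_exp; ring.
Qed.

Let a31 : a ^+ 3 - 1 != 0. Proof. by rewrite subr_eq0. Qed.
Let a13 : 1 - a ^+ 3 != 0. Proof. by rewrite -opprB oppr_eq0. Qed.

Let C10n : C1`_0 != 0.
Proof.
rewrite chart_cubic0 mulf_neq0 ?polyC_eq0 //; apply/negP => /eqP /(congr1 (fun p : {poly k} => p.[0])).
by rewrite hornerD hornerN hornerM hornerX hornerC mulr0 subr0 horner_natr hornerC => /eqP; rewrite (negPf two0).
Qed.
Let D10n : D1`_0 != 0.
Proof. by rewrite chart_nodal0 polyC_eq0 !mulf_neq0. Qed.
Let ev0 (B : R2) : B`_0 != 0 -> ev B != 0.
Proof.
move=> B0; rewrite raddf_eq0 //; apply: contra_neq B0 => ->; exact: coef0.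
Qed.
Let c0 : c != 0. Proof. by rewrite chart_cubic mulf_neq0 // ev0. Qed.

Let fE' : f = - ev P1 / ev (C1 ^+ 2).
Proof.
apply: (mulIf (expf_neq0 2 c0)); rewrite fE chart_sextic chart_cubic.
by rewrite rmorphXn /= exprMn; field; rewrite ev0.
Qed.

Let vV : valring V. Proof. exact: (chart_valring evX ev_inj ev_frac). Qed.
Let Vκ r : V (κ r). Proof. exact: (chart_ring_cst evC). Qed.
Let C12 : (C1 ^+ 2)`_0 != 0. Proof. by rewrite coef0M mulf_neq0. Qed.
Let Vf : V f.
Proof. by rewrite fE' -rmorphN; exact: chart_ringE. Qed.

Let Vf_nres r : ~ res κ V f r.
Proof.
rewrite /res; have -> : f - κ r = ev (- (P1 + r%:P%:P * C1 ^+ 2)) / ev (C1 ^+ 2).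
  have -> : ev (- (P1 + r%:P%:P * C1 ^+ 2)) = - (ev P1 + κ r * ev (C1 ^+ 2)).
    by rewrite (rmorphN ev) (rmorphD ev) (rmorphM ev (r%:P%:P)) evCC.
  by rewrite fE'; field; rewrite ev0.
move=> /(chart_maxid ev_inj _ C12).
rewrite coefN coefD (coef0M r%:P%:P) coefC /= expr2 (coef0M C1) chart_sextic0 chart_cubic0.
(* The slope 2 / a is that of the tangent of the cubic, and f has a pole
   there on E_i. *)
move=> /(congr1 (fun p : {poly k} => p.[2%:R / a])) /eqP.
rewrite !(hornerD, hornerN, hornerM, hornerX, hornerC, horner_natr).
have -> : - ((1 + a * (2%:R / a)) * (1 - 2%:R * a * (2%:R / a)) * (1 - a ^+ 3) +
    r * ((a ^+ 3 - 1) * (2%:R - a * (2%:R / a)) * ((a ^+ 3 - 1) * (2%:R - a * (2%:R / a))))) =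
    3%:R * 3%:R * (1 - a ^+ 3) by field.
by rewrite !mulf_eq0 (negPf three0) (negPf a13).
Qed.

Let f_nonconst r : f != κ r.
Proof.
by apply/eqP => E; apply: (Vf_nres (r := r)); rewrite /res E subrr; exact: maxid0.
Qed.

Lemma f_transc p : p != 0 -> (map_poly κ p).[f] != 0.
Proof.
move=> p0; apply/eqP => E; apply: (res_poly_unit vV Vκ Vf Vf_nres p0).
by rewrite E; exact: maxid0.
Qed.

Lemma base_fibre_pt : fibre_pt κ f V.
Proof.
split=> //; last first.
  exists s^-1 => H; apply: (unit_maxidN _ H); rewrite ?s0 //.
  exact: (chart_maxid_s evX ev_inj).
have VP p : V (map_poly κ p).[f].
  apply: (subring_horner (valring_subring vV)) => // j; rewrite coef_map; exact: Vκ.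
move=> _ [p [q [q0 ->]]]; apply: (valringM vV) => //.
have q0' : q != 0 by apply: contra_neq q0 => ->; rewrite rmorph0 horner0.
by have [] := maxidN_unit vV (VP q) (res_poly_unit vV Vκ Vf Vf_nres q0').
Qed.

Let t0 : d / c != 0. Proof. by rewrite mulf_neq0 ?invr_eq0 // chart_nodal ev0. Qed.
Let mt : maxid V (d / c)^-1.
Proof.
rewrite invf_div chart_nodal chart_cubic -evX -rmorphM.
by apply/(chart_maxid ev_inj _ D10n); rewrite coef0M coefX mul0r.
Qed.
Let Et g : maxid V g -> V (g * (d / c)).
Proof.
move=> /(chart_uniformizer evX ev_inj)[h Vh ->].
have -> : s * h * (d / c) = h * (ev D1 / ev C1).
  rewrite chart_nodal chart_cubic; have := ev0 C10n; move: (ev C1) (ev D1) s s0 => e e' z z0 e0.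
    by field; rewrite z0 e0.
by apply: (valringM vV) => //; exact: chart_ringE.
Qed.

Let Eother O : fibre_pt κ f O -> ~ (forall g, O g <-> V g) -> O (d / c).
Proof.
move=> fO nO; apply: NNPP => nOt; apply: nO.
have [vO bO [h nOh]] := fO.
have Oκ r : O (κ r) by apply: bO; exact: func_field_cst.
have [_ rx ry x0 [Ou nu]] := pole_center vO Oκ (bO _ (func_field_f κ f))
  (fibre_pt_nres fO f_nonconst) a0 eps2 three0 a3 c0 fE nOt.
rewrite !divr1 in rx ry x0 Ou nu.
have sub := chart_sub evX evC vO Oκ rx Ou nu.
move=> g; split; last exact: sub.
by apply: (chart_maximal evX ev_inj ev_frac vO sub); exists h.
Qed.

Let y0 : y != 0.
Proof.
rewrite yE -evT -evX -rmorphM -(rmorph1 ev) -rmorphD; apply: ev0.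
by rewrite coefD coef0M coefX mul0r addr0 coef1 oner_neq0.
Qed.
Let y1 : y + 1 != 0.
Proof.
have -> : y + 1 = ev (2%:R + S * T).
  by rewrite rmorphD rmorphM rmorph_nat /= evX evT {1}yE; ring.
by apply: ev0; rewrite coefD coef0M coefX mul0r addr0 -(rmorph_nat polyC) coefC /= -(rmorph_nat polyC) polyC_eq0.
Qed.

Local Notation K := {fraction {poly k}}.
Let jK_ex : exists jK : {rmorphism K -> F}, forall p, jK (tofrac p) = (map_poly κ p).[f].
Proof.
pose φ : {rmorphism {poly k} -> F} := horner_eval f \o map_poly κ.
apply: (@frac_lift _ _ φ); apply: raddf_inj => p E; apply/eqP/contraT => /f_transc.
by rewrite -[X in X != 0]/(φ p) E eqxx.
Qed.

Let cpointP (jK : {rmorphism K -> F}) : (forall p, jK (tofrac p) = (map_poly κ p).[f]) ->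
  forall O, fibre_pt κ f O <-> [/\ valring O, forall r, O (jK r) & exists h, ~ O h].
Proof.
move=> jKE O; split=> -[vO H nO]; split=> //.
  move=> r; have [n [m [m0 ->]]] := fracE r; rewrite rmorphM fmorphV /= !jKE.
  by apply: H; exists n, m; rewrite f_transc.
by move=> _ [n [m [m0 ->]]]; rewrite -!jKE -fmorphV -rmorphM.
Qed.

Let tK_frac (r : K) : exists n m : {poly k}, m != 0 /\ r = tofrac n / tofrac m.
Proof. exact: fracE. Qed.
Let tK_inj : injective (@tofrac {poly k}).
Proof. by move=> p q /eqP; rewrite tofrac_eq => /eqP. Qed.

Lemma reflection_fixes_rr h : rr_space (fibre_pt κ f) V h -> τ h = h.
Proof.
have [jK jKE] := jK_ex.
pose e : {rmorphism {poly K} -> F} := horner_eval (d / c) \o map_poly jK.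
apply: (@rr_fixed k F κ K (@tofrac _) tK_inj tK_frac a x y f two0 three0 a0 a3 y0 y1 c0 fE gen
  jK jKE e _ _ _ (cpointP jKE) V base_fibre_pt t0 mt Eother τ τκ τx τy).
- by rewrite /e /= map_polyX /horner_eval hornerX.
- by move=> r; rewrite /e /= map_polyC /horner_eval hornerC.
Qed.

Lemma reflection_unique (σ : {rmorphism F -> F}) :
  (forall h, rr_space (fibre_pt κ f) V h -> σ h = h) -> (exists h, σ h <> h) ->
  forall h, σ h = τ h.
Proof.
have [jK jKE] := jK_ex.
pose e : {rmorphism {poly K} -> F} := horner_eval (d / c) \o map_poly jK.
apply: (@deck_unique k F κ K (@tofrac _) tK_inj tK_frac a x y f two0 a0 y0 y1 c0 fE gen
  jK jKE e _ _ _ (cpointP jKE) V base_fibre_pt t0 mt Et Eother τ τκ τx τy).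
- by rewrite /e /= map_polyX /horner_eval hornerX.
- by move=> r; rewrite /e /= map_polyC /horner_eval hornerC.
Qed.

Lemma reflection_invol h : τ (τ h) = h.
Proof. exact: (τK y0 gen τκ τx τy). Qed.

Lemma reflection_nontrivial : τ y <> y.
Proof.
rewrite τy => E.
have : y ^+ 2 - 1 != 0.
  have -> : y ^+ 2 - 1 = s * u * (y + 1) by rewrite {1}yE; rewrite -[in RHS](addrK 1 (s * u)) [s * u + 1]addrC -yE; ring.
  by rewrite mulf_neq0 // -evT -evX -rmorphM raddf_eq0 // mulf_neq0 ?polyC_eq0 ?polyX_eq0.
by rewrite expr2 -{1}E mulVf // subrr eqxx.
Qed.

End BaseChartFibre.

Lemma natr_neq0 (k : fieldType) n : prime n -> n \notin [pchar k] -> n%:R != 0 :> k.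
Proof. by move=> pn; rewrite inE /= pn. Qed.

Lemma closed_pointP (k : closedFieldType) (f : funfield k) O :
  closed_point f O <-> fibre_pt (cstm k) f O.
Proof.
split=> [[H1 H2 H3 H4 H5]|[[H2 H3 H4] H1 H5]]; last by split.
by split=> //; split.
Qed.

Section Bertini.
Variable k : closedFieldType.
Local Notation FF := (funfield k).
Variables (a eps : k).
Hypotheses (two0 : 2%:R != 0 :> k) (three0 : 3%:R != 0 :> k).
Hypotheses (a0 : a != 0) (eps_prim : 3.-primitive_root eps) (a3 : a ^+ 3 != 1).
Local Notation p := (base_pt eps a).
Variable i : 'I_9.
Local Notation r := (pt_type i).
Local Notation v := (pt_root eps i).
Local Notation x' := (adapted (cstm k) r v (xF k) (yF k)).1.
Local Notation y' := (adapted (cstm k) r v (xF k) (yF k)).2.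
Local Notation f := (fibration a).
Let v3 : v ^+ 3 = 1 := pt_root3 eps_prim i.
Let E := exc_ring p i.

Lemma exc_ring_chart : E = chart_ring (base_chart r v a).
Proof.
apply: functional_extensionality => h; apply: propositional_extensionality.
exact: exc_ringE.
Qed.

Lemma RRspace_rr : RRspace f E = rr_space (fibre_pt (cstm k) f) (chart_ring (base_chart r v a)).
Proof.
apply: functional_extensionality => h; apply: propositional_extensionality.
rewrite /RRspace exc_ring_chart; split=> -[H1 H2]; split=> // O /closed_pointP; exact: H2.
Qed.

Lemma adapted_fE : f * cubic_at (cstm k a) x' y' 1 ^+ 2 = - sextic_at (cstm k a) x' y' 1.
Proof.
by have [_ H] := fibration_eq a0; exact: (@adapted_eq k FF (cstm k) r v (xF k) (yF k) v3 (xF_neq0 k) (yF_neq0 k) (cstm k a) f H).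
Qed.

Lemma adapted_field_gen (S : FF -> Prop) : (forall c, S (cstm k c)) ->
  (forall g h, S g -> S h -> S (g - h)) -> (forall g h, S g -> S h -> S (g * h)) ->
  (forall h, S h -> S h^-1) -> S x' -> S y' -> forall h, S h.
Proof.
move=> S1 S2 S3 S4 S5 S6; have [Sx Sy] := adapted_generates v3 S1 S2 S3 S4 S5 S6.
exact: funfield_gen.
Qed.

(** The reflection is a deck transformation (reflection_fixes_rr) and the
    only one (reflection_unique), hence the one that is chosen in bertini. *)
Lemma bertini_reflection : exists τ : {rmorphism FF -> FF},
  [/\ forall h, bertini f E h = τ h, forall c, τ (cstm k c) = cstm k c,
      τ x' = x' / y', τ y' = y'^-1 & forall h, τ (τ h) = h].
Proof.
have [τ [τκ τx τy]] := @reflection_exists k r v v3.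
have := @reflection_adapted k r v v3 τ τκ τx τy.
case EA : (adapted _ _ _ _ _) => [X Y] [τX τY].
have evX : base_chart r v a 'X = X - cstm k a by rewrite base_chartX EA.
have evC p : base_chart r v a p%:P = (map_poly (cstm k) p).[(Y - 1) / (X - cstm k a)].
  by rewrite base_chartC EA.
have inj : injective (base_chart r v a) by exact: base_chart_inj.
have onto := @base_chart_onto k r v v3 a.
have fE : f * cubic_at (cstm k a) X Y 1 ^+ 2 = - sextic_at (cstm k a) X Y 1.
  by have := adapted_fE; rewrite EA.
have gen := adapted_field_gen; rewrite EA in gen.
have e2 := eps_quad eps_prim.
have τK := reflection_invol evX evC inj gen τκ τX τY.
have fix_rr := reflection_fixes_rr two0 three0 a0 a3 e2 evX evC inj onto fE gen τκ τX τY.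
have uniq := reflection_unique two0 three0 a0 a3 e2 evX evC inj onto fE gen τκ τX τY.
have ntriv := reflection_nontrivial two0 evX evC inj τY.
exists τ; split=> // h.
have dτ : deck f E τ.
  split; first by exists τ.
    by move=> g; rewrite RRspace_rr; exact: fix_rr.
  by exists Y.
have [_ B2 B3] := epsilon_spec (inhabits (idfun : {rmorphism FF -> FF})) (deck f E) (ex_intro _ τ dτ).
by apply: uniq => // g; rewrite -RRspace_rr; exact: B2.
Qed.

End Bertini.

(** * The fixed curve lies over the axis *)

Section LineChartFibre.
Variables (k : closedFieldType) (F : fieldType) (κ : {rmorphism k -> F}).
Variables (a : k) (x y f : F) (ev : {rmorphism {poly {poly k}} -> F}).
Hypotheses (a0 : a != 0) (a3 : a ^+ 3 != 1).
Local Notation A := (κ a).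
Hypothesis evX : ev 'X = y - 1.
Hypothesis evC : forall p, ev p%:P = (map_poly κ p).[x].
Hypothesis ev_inj : injective ev.
Hypothesis ev_frac : forall h, exists A B : {poly {poly k}}, B != 0 /\ h = ev A / ev B.
Hypothesis fE : f * cubic_at A x y 1 ^+ 2 = - sextic_at A x y 1.
Variable τ : {rmorphism F -> F}.
Hypotheses (τκ : forall r, τ (κ r) = κ r) (τx : τ x = x / y) (τy : τ y = y^-1).
Local Notation V := (chart_ring ev).
Local Notation R2 := {poly {poly k}}.
Local Notation α := (a%:P%:P : R2).
Local Notation S := ('X : R2).
Local Notation T := (('X)%:P : R2).

Let vV : valring V. Proof. exact: (chart_valring evX ev_inj ev_frac). Qed.
Let sV := valring_subring vV.
Let Vκ r : V (κ r). Proof. exact: (chart_ring_cst evC). Qed.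
Let Vev P : V (ev P). Proof. exact: chart_ring_ev. Qed.
Let evT : ev T = x. Proof. by rewrite evC map_polyX hornerX. Qed.
Let evCC r : ev (r%:P%:P) = κ r. Proof. by rewrite evC map_polyC hornerC. Qed.
Let ms : maxid V (y - 1). Proof. by have := chart_maxid_s evX ev_inj. Qed.
Let Vx : V x. Proof. by rewrite -evT. Qed.
Let Vy : V y. Proof. by rewrite -[y](subrK 1) -evX -(rmorph1 ev) -rmorphD. Qed.
Let ev0 (B : R2) : B`_0 != 0 -> ev B != 0.
Proof. by move=> B0; rewrite raddf_eq0 //; apply: contra_neq B0 => ->; exact: coef0. Qed.

Let unitD g m : V g -> ~ maxid V g -> maxid V m -> V (g + m) /\ ~ maxid V (g + m).
Proof.
move=> Vg ng mm; split; first by apply: (subringD sV) => //; exact: maxid_in.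
by move=> H; apply: ng; rewrite -[g](addrK m); apply: (maxidB vV).
Qed.

Let y_unit : y != 0 /\ V y^-1.
Proof.
apply: (maxidN_unit vV Vy) => my; apply: (maxid1 vV).
by rewrite -[1](subKr y); apply: (maxidB vV).
Qed.

(** The elements that τ fixes modulo the maximal ideal form a ring, which
    contains x and y - 1 because τ x - x and τ (y - 1) - (y - 1) are
    multiples of y - 1. *)
Lemma line_fixed h : V h -> maxid V (τ h - h).
Proof.
have [y0 Vyi] := y_unit.
pose fixed g := V g /\ maxid V (τ g - g).
have fB g g' : fixed g -> fixed g' -> fixed (g - g').
  move=> [Vg mg] [Vg' mg']; split; first exact: (valringB vV).
  have -> : τ (g - g') - (g - g') = (τ g - g) - (τ g' - g') by rewrite rmorphB; ring.
  exact: (maxidB vV).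
have fM g g' : fixed g -> fixed g' -> fixed (g * g').
  move=> [Vg mg] [Vg' mg']; split; first exact: (valringM vV).
  have -> : τ (g * g') - g * g' = (τ g - g) * (τ g' - g') + (g * (τ g' - g') + g' * (τ g - g)).
    by rewrite rmorphM; ring.
  apply: (maxidD vV); first by apply: (maxidMr vV) => //; exact: maxid_in.
  by apply: (maxidD vV); exact: (maxidMl vV).
have fκ r : fixed (κ r) by split=> //; rewrite τκ subrr; exact: maxid0.
have f0 : fixed 0 by rewrite -(rmorph0 κ).
have fD g g' : fixed g -> fixed g' -> fixed (g + g').
  by move=> fg fg'; rewrite -[g']opprK -[- g']sub0r; apply: (fB) => //; exact: fB.
have fx : fixed x.
  split=> //; have -> : τ x - x = - (x / y * (y - 1)) by rewrite τx; field.
  by apply: (maxidNN vV); apply: (maxidMl vV) => //; exact: (valringM vV).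
have fy1 : fixed (y - 1).
  split; first exact: maxid_in.
  have -> : τ (y - 1) - (y - 1) = - (y^-1 * (y - 1)) - (y - 1).
    by rewrite rmorphB rmorph1 τy; field.
  by apply: (maxidB vV) => //; apply: (maxidNN vV); exact: (maxidMl vV).
have fev (P : R2) : fixed (ev P).
  elim/poly_ind: P => [|P c IH]; first by rewrite rmorph0.
  rewrite rmorphD rmorphM /= evX evC; apply: (fD); first exact: fM.
  elim/poly_ind: c => [|c d IHc]; first by rewrite rmorph0 horner0.
  rewrite rmorphD rmorphM /= map_polyX map_polyC /= !hornerE.
  by apply: (fD) => //; exact: fM.
move=> [P [Q [Q0 ->]]].
have nQ : ~ maxid V (ev Q).
  have := @chart_maxid _ _ _ ev_inj Q 1; rewrite rmorph1 divr1 => H.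
  by move/H => E; move: Q0; rewrite E ?eqxx // coef1 oner_neq0.
have [Q00 VQi] := maxidN_unit vV (Vev Q) nQ.
have [_ mQ] := fev Q; have [_ mP] := fev P.
have [VτQ nτQ] := unitD (Vev Q) nQ mQ; rewrite addrC subrK in VτQ nτQ.
have [τQ0 VτQi] := maxidN_unit vV VτQ nτQ.
have -> : τ (ev P / ev Q) - ev P / ev Q =
   ((τ (ev P) - ev P) - (ev P / ev Q) * (τ (ev Q) - ev Q)) * (τ (ev Q))^-1.
  by rewrite fmorph_div; field; rewrite τQ0.
apply: (maxidMr vV) => //; apply: (maxidB vV) => //; apply: (maxidMl vV) => //.
exact: (valringM vV).
Qed.

Let C1 : R2 := α * (T ^+ 3 + (1 + S) ^+ 3 + 1) - (α ^+ 3 + 2%:R) * (T * (1 + S)).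
Let P1 : R2 := (T * (1 + S) - α) * (T - α * (1 + S) ^+ 2) * (1 + S - α * T ^+ 2).
Let evE := (rmorphB ev, rmorphD ev, rmorphN ev, rmorphXn ev, rmorphM ev, rmorph1 ev, rmorph_nat ev).

Lemma line_cubic : cubic_at A x y 1 = ev C1.
Proof. by rewrite /C1 !evE evX evCC evT /cubic_at; ring. Qed.
Lemma line_sextic : sextic_at A x y 1 = ev P1.
Proof. by rewrite /P1 !evE evX evCC evT /sextic_at; ring. Qed.

Let c0E (B : R2) : B`_0 = B.[0]. Proof. by rewrite horner_coef0. Qed.
Lemma line_cubic0 z : (C1`_0).[z] = (z - a) * (a * z ^+ 2 + a ^+ 2 * z - 2%:R).
Proof.
rewrite c0E /C1 !(hornerD, hornerN, hornerM, hornerX, hornerC, horner_exp, horner_natr); ring.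
Qed.
Lemma line_sextic0 z : (P1`_0).[z] = (z - a) ^+ 2 * (1 - a * z ^+ 2).
Proof.
rewrite c0E /P1 !(hornerD, hornerN, hornerM, hornerX, hornerC, horner_exp, horner_natr); ring.
Qed.

(* On the axis f is - (1 - a x^2) / (a x^2 + a^2 x - 2)^2; at a zero z of
   1 - a x^2 the form a x^2 + a^2 x - 2 has the value a^2 z - 1. *)
Let root_ex : exists z : k, a * z ^+ 2 = 1 /\ (z - a) * (a ^+ 2 * z - 1) != 0.
Proof.
have [z Ez] := @solve_monicpoly k 2 (fun i => if i == 0%N then a^-1 else 0) isT.
rewrite !big_ord_recr big_ord0 /= add0r expr0 mulr1 mul0r addr0 in Ez.
have Ez1 : a * z ^+ 2 = 1 by rewrite Ez mulfV.
exists z; split=> //; rewrite mulf_neq0 // subr_eq0; apply/eqP => E.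
  by move: a3; rewrite exprS -{2}E Ez1 eqxx.
have : a ^+ 3 = 1.
  have -> : a ^+ 3 = a ^+ 3 * (a * z ^+ 2) by rewrite Ez1 mulr1.
  have -> : a ^+ 3 * (a * z ^+ 2) = (a ^+ 2 * z) ^+ 2 by ring.
  by rewrite E expr1n.
by move/eqP; rewrite (negPf a3).
Qed.

Let C10n : C1`_0 != 0.
Proof.
have [z [Ez nz]] := root_ex; apply: contraNneq nz => E.
have := line_cubic0 z; rewrite E horner0 Ez => ->; apply/eqP; ring.
Qed.

(** f is not constant on the axis: it vanishes at a zero of 1 - a x^2, but
    not at x = 0. Hence k(f) embeds into the residue field of the axis. *)
Lemma line_fibre_pt : fibre_pt κ f V.
Proof.
have C12 : (C1 ^+ 2)`_0 != 0 by rewrite expr2 coef0M mulf_neq0.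
have fE' : f = - ev P1 / ev (C1 ^+ 2).
  apply: (mulIf (expf_neq0 2 (ev0 C10n))); rewrite -line_cubic fE line_sextic.
  by rewrite rmorphXn /= line_cubic; field; rewrite ev0.
have Vf : V f by rewrite fE' -rmorphN; exact: chart_ringE.
have Vf_nres r : ~ res κ V f r.
  rewrite /res; have -> : f - κ r = ev (- (P1 + r%:P%:P * C1 ^+ 2)) / ev (C1 ^+ 2).
    have -> : ev (- (P1 + r%:P%:P * C1 ^+ 2)) = - (ev P1 + κ r * ev (C1 ^+ 2)).
      by rewrite (rmorphN ev) (rmorphD ev) (rmorphM ev (r%:P%:P)) evCC.
    by rewrite fE'; field; rewrite ev0.
  move=> /(chart_maxid ev_inj _ C12).
  rewrite coefN coefD (coef0M r%:P%:P) coefC /= expr2 (coef0M C1) => E.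
  have {}E z : (z - a) ^+ 2 * (1 - a * z ^+ 2) + r * ((z - a) * (a * z ^+ 2 + a ^+ 2 * z - 2%:R)) ^+ 2 = 0.
    rewrite -line_sextic0 -line_cubic0; move: (congr1 (fun p : {poly k} => (- p).[z]) E).
    by rewrite opprK oppr0 horner0 hornerD !hornerM hornerC expr2.
  have [z [Ez nz]] := root_ex.
  have r0 : r = 0.
    apply/eqP; have := E z; rewrite Ez subrr mulr0 add0r.
    have -> : (z - a) * (1 + a ^+ 2 * z - 2%:R) = (z - a) * (a ^+ 2 * z - 1) by ring.
    by move/eqP; rewrite mulf_eq0 expf_eq0 (negPf nz) orbF.
  have := E 0; rewrite r0 mul0r addr0 expr0n /= mulr0 subr0 mulr1 sub0r sqrrN => /eqP.
  by rewrite expf_eq0 (negPf a0).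
split=> //.
- have VP p : V (map_poly κ p).[f].
    apply: (subring_horner sV) => // j; rewrite coef_map; exact: Vκ.
  move=> _ [p [q [q0 ->]]]; apply: (valringM vV) => //.
  have q0' : q != 0 by apply: contra_neq q0 => ->; rewrite rmorph0 horner0.
  by have [] := maxidN_unit vV (VP q) (res_poly_unit vV Vκ Vf Vf_nres q0').
- exists (y - 1)^-1 => H; apply: (unit_maxidN _ H) => //.
  by rewrite -evX raddf_eq0 // polyX_eq0.
Qed.

End LineChartFibre.

Section FixedCenter.
Variables (k F : fieldType) (κ : {rmorphism k -> F}) (O : F -> Prop).
Variables (a : k) (x y f : F) (τ : {rmorphism F -> F}).
Hypotheses (two0 : 2%:R != 0 :> k) (a0 : a != 0).
Local Notation A := (κ a).
Hypotheses (vO : valring O) (Oκ : forall r, O (κ r)) (Of : O f).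
Hypothesis fE : f * cubic_at A x y 1 ^+ 2 = - sextic_at A x y 1.
Hypotheses (τx : τ x = x / y) (τy : τ y = y^-1) (x0 : x != 0) (y0 : y != 0).
Hypotheses (ym1 : y - 1 != 0) (yp1 : y + 1 != 0).
Hypothesis fixO : forall h, O h -> maxid O (τ h - h).
Local Notation m := (maxid O).
Let sO := valring_subring vO.

Let half_unit h : O h -> m (- (h + h)) -> m h.
Proof.
move=> Oh mh; have -> : h = κ (- 2%:R^-1) * - (h + h).
  have t0 : (2%:R : F) != 0 by rewrite -(rmorph_nat κ) fmorph_eq0.
  by rewrite rmorphN fmorphV rmorph_nat; field.
exact: (maxidMl vO).
Qed.

Let anti h : O h -> τ h = - h -> m h.
Proof. by move=> Oh E; apply: half_unit => //; have := fixO Oh; rewrite E opprD. Qed.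

(** u is the point of the plane where O is centred. If u is not on the axis,
    then y - z does not vanish at u, and its quotient by an invariant linear
    form that does not vanish at u is an anti-invariant unit of O; but
    anti-invariant elements of O are in the maximal ideal. The invariant
    linear forms x and y + z both vanish only at (0 : 1 : -1), and there the
    cubic vanishes and the sextic does not, in contradiction with the
    equation of f. *)
Lemma fixed_center (u0 u1 u2 : k) :
  (forall c0 c1 c2 d0 d1 d2, d0 * u0 + d1 * u1 + d2 * u2 != 0 ->
     O ((κ c0 * x + κ c1 * y + κ c2) / (κ d0 * x + κ d1 * y + κ d2))) ->
  [|| u0 != 0, u1 != 0 | u2 != 0] -> u1 = u2.
Proof.
move=> reg u_neq0; apply/eqP; rewrite -subr_eq0; apply: contraT => u12.
have um c0 c1 c2 : O ((κ c0 * x + κ c1 * y + κ c2) / (y - 1)).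
  have := reg c0 c1 c2 0 1 (- 1); rewrite !(rmorphN, rmorph0, rmorph1) !(mul0r, mul1r, mulN1r, add0r).
  exact.
have inv_contra g : g != 0 -> m g -> O g^-1 -> False by move=> g0 mg Og; apply: unit_maxidN mg.
case: (eqVneq u0 0) => [u00|u00]; last first.
  exfalso; apply: (inv_contra ((y - 1) / x)).
  - by rewrite mulf_neq0 ?invr_eq0.
  - apply: anti; last by rewrite fmorph_div rmorphB rmorph1 τx τy; field; rewrite y0 x0.
    have := reg 0 1 (- 1) 1 0 0; rewrite !(rmorphN, rmorph0, rmorph1) !(mul0r, mul1r, mulN1r, add0r, addr0).
    exact.
  - by rewrite invf_div; have := um 1 0 0; rewrite !(rmorph0, rmorph1) !(mul0r, mul1r, addr0).
case: (eqVneq (u1 + u2) 0) => [us|us]; last first.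
  exfalso; apply: (inv_contra ((y - 1) / (y + 1))).
  - by rewrite mulf_neq0 ?invr_eq0.
  - apply: anti; last first.
      by rewrite fmorph_div rmorphB rmorphD rmorph1 τy; field; rewrite y0 yp1.
    have := reg 0 1 (- 1) 0 1 1; rewrite !(rmorphN, rmorph0, rmorph1) !(mul0r, mul1r, mulN1r, add0r, addr0).
    exact.
  - by rewrite invf_div; have := um 0 1 1; rewrite !(rmorph0, rmorph1) !(mul0r, mul1r, add0r).
exfalso.
(* The point (0 : 1 : -1) is left, with the coordinates x / (y - 1) and
   (y + 1) / (y - 1), in terms of which (x : y : 1) = (2 g : h + 1 : h - 1). *)
have Og1 : O (x / (y - 1)) by have := um 1 0 0; rewrite !(rmorph0, rmorph1) !(mul0r, mul1r, addr0).
have Og2 : O ((y + 1) / (y - 1)) by have := um 0 1 1; rewrite !(rmorph0, rmorph1) !(mul0r, mul1r, add0r).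
have eyi : y^-1 - 1 = - ((y - 1) / y) by field.
have m1 : m (x / (y - 1)).
  by apply: anti => //; rewrite fmorph_div rmorphB rmorph1 τx τy eyi; field; rewrite ?oppr_eq0 y0 ym1.
have m2 : m ((y + 1) / (y - 1)).
  by apply: anti => //; rewrite fmorph_div rmorphB rmorphD rmorph1 τy eyi; field; rewrite ?oppr_eq0 y0 ym1.
pose g := x / (y - 1); pose h := (y + 1) / (y - 1).
have Es : 2%:R / (y - 1) * x = 2%:R * g /\ 2%:R / (y - 1) * y = h + 1 /\ 2%:R / (y - 1) * 1 = h - 1.
  by rewrite /g /h; do !split; field.
have [E1 [E2 E3]] := Es.
have ON n : O n%:R by exact: subringMn.
have mg : m (2%:R * g) by apply: (maxidMl vO).
have Oh1 : O (h + 1) by apply: (subringD sO) => //; exact: valring1.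
have Oh2 : O (h - 1) by apply: (valringB vO) => //; exact: valring1.
have Oexp n z : O z -> O (z ^+ n) by move=> Oz; exact: subringX.
have OX : O (2%:R * g) by exact: maxid_in mg.
have mc : m (cubic_at A (2%:R * g) (h + 1) (h - 1)).
  have -> : cubic_at A (2%:R * g) (h + 1) (h - 1) =
     2%:R * g * (A * (2%:R * g) ^+ 2 - (A ^+ 3 + 2%:R) * ((h + 1) * (h - 1))) +
     h * (A * (2%:R * h ^+ 2 + 6%:R)) by rewrite /cubic_at; ring.
  have O1 : O (A * (2%:R * g) ^+ 2) by apply: (valringM vO) => //; exact: Oexp.
  have O2 : O ((A ^+ 3 + 2%:R) * ((h + 1) * (h - 1))).
    apply: (valringM vO); last exact: (valringM vO).
    by apply: (subringD sO) => //; exact: Oexp.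
  have O3 : O (A * (2%:R * h ^+ 2 + 6%:R)).
    apply: (valringM vO) => //; apply: (subringD sO) => //; apply: (valringM vO) => //; exact: Oexp.
  by apply: (maxidD vO); apply: (maxidMr vO) => //; exact: (valringB vO).
have fE2 : f * cubic_at A (2%:R * g) (h + 1) (h - 1) ^+ 2 = - sextic_at A (2%:R * g) (h + 1) (h - 1).
  by rewrite -E1 -E2 -E3 cubic_scale sextic_scale -mulrN -fE; ring.
have mS : m (sextic_at A (2%:R * g) (h + 1) (h - 1)).
  rewrite -[sextic_at _ _ _ _]opprK -fE2; apply: (maxidNN vO); apply: (maxidMl vO) => //.
  by rewrite expr2; apply: (maxidMl vO) => //; exact: maxid_in mc.
have nA : ~ m A.
  by apply: unit_maxidN; rewrite ?fmorph_eq0 // -fmorphV.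
have OA2 (z : F) : O z -> O (A * z ^+ 2) by move=> Oz; apply: (valringM vO) => //; exact: Oexp.
have O1 : O (2%:R * g * (h + 1) - A * (h - 1) ^+ 2).
  by apply: (valringB vO); [exact: (valringM vO) | exact: OA2].
have O2 : O (2%:R * g * (h - 1) - A * (h + 1) ^+ 2).
  by apply: (valringB vO); [exact: (valringM vO) | exact: OA2].
have O3 : O ((h + 1) * (h - 1) - A * (2%:R * g) ^+ 2).
  by apply: (valringB vO); [exact: (valringM vO) | exact: OA2].
have mgh z : O z -> m (2%:R * g * z) by move=> Oz; apply: (maxidMr vO).
have mhz z : O z -> m (h * z) by move=> Oz; apply: (maxidMr vO).
have Ohn n : O (A * (h + n%:R)) by apply: (valringM vO) => //; apply: (subringD sO).
have Ohn' n : O (A * (h - n%:R)) by apply: (valringM vO) => //; apply: (valringB vO).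
move: mS; rewrite /sextic_at => /(maxidM_prime vO (valringM vO O1 O2) O3)[].
  move=> /(maxidM_prime vO O1 O2)[] mF; apply: nA.
    have -> : A = 2%:R * g * (h + 1) - h * (A * (h - 2%:R)) - (2%:R * g * (h + 1) - A * (h - 1) ^+ 2) by ring.
    by apply: (maxidB vO) => //; apply: (maxidB vO); [exact: mgh | exact: mhz].
  have -> : A = 2%:R * g * (h - 1) - h * (A * (h + 2%:R)) - (2%:R * g * (h - 1) - A * (h + 1) ^+ 2) by ring.
  by apply: (maxidB vO) => //; apply: (maxidB vO); [exact: mgh | exact: mhz].
move=> mF; apply: (maxid1 vO).
have -> : 1 = h * h - 2%:R * g * (A * (2%:R * g)) - ((h + 1) * (h - 1) - A * (2%:R * g) ^+ 2) by ring.
by apply: (maxidB vO) => //; apply: (maxidB vO); [exact: mhz | apply: mgh; exact: (valringM vO)].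
Qed.

End FixedCenter.

Lemma linear_fraction_regular (k : closedFieldType) (p : 'I_9 -> 'rV[k]_3) (s : blowup p) (c d : 'rV[k]_3) :
  dot d (coords (proj s)) != 0 ->
  regular_at s (dot (map_mx (cstm k) c) (generic_pt k) / dot (map_mx (cstm k) d) (generic_pt k)).
Proof.
move=> d0; exists (fun j => (j == row_pt) : nat), (linear_form row_pt c), (linear_form row_pt d).
split; [exact: linear_form_homog | exact: linear_form_homog | |].
  by rewrite form_atE form_val_pt map_mx_id //; apply/eqP.
by rewrite !form_genericE !form_val_pt.
Qed.

Definition adapted_form (k : closedFieldType) r (v c0 c1 c2 : k) : 'rV[k]_3 :=
  c0 *: alpha_vec r v 0 + c1 *: (axis r v + zeta_vec r v) + c2 *: zeta_vec r v.

Lemma adapted_formE (k : closedFieldType) (S : comNzRingType) (κ : {rmorphism k -> S}) r v c0 c1 c2 u0 u1 u2 :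
  v ^+ 3 = 1 ->
  dot (map_mx κ (adapted_form r v c0 c1 c2)) (frame_vec r (κ v) u0 u1 u2) =
  κ c0 * u0 + κ c1 * u1 + κ c2 * u2.
Proof.
move=> v3; rewrite /adapted_form !map_mxD !map_mxZ map_mxD !dotDl !dotZl dotDl.
rewrite alpha_vecE // zeta_vecE // axisE.
have V3 : κ v ^+ 3 = 1 by rewrite -rmorphXn v3 rmorph1.
by rewrite frameK // rmorph0; ring.
Qed.

Lemma scaled_dot_ratio (k F : fieldType) (κ : {rmorphism k -> F}) (σ : F) X Y (c d : 'rV[k]_3) :
  σ != 0 -> Y = σ *: X ->
  dot (map_mx κ c) X / dot (map_mx κ d) X = dot (map_mx κ c) Y / dot (map_mx κ d) Y.
Proof.
move=> σ0 ->; rewrite ![dot _ (σ *: X)]dotC !dotZl ![dot X _]dotC -mulf_div divff // mul1r //.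
Qed.

Section FixedCurve.
Variable k : closedFieldType.
Local Notation FF := (funfield k).
Variables (a eps : k).
Hypotheses (two0 : 2%:R != 0 :> k) (three0 : 3%:R != 0 :> k).
Hypotheses (a0 : a != 0) (eps_prim : 3.-primitive_root eps) (a3 : a ^+ 3 != 1).
Local Notation p := (base_pt eps a).
Variable i : 'I_9.
Local Notation r := (pt_type i).
Local Notation v := (pt_root eps i).
Local Notation x' := (adapted (cstm k) r v (xF k) (yF k)).1.
Local Notation y' := (adapted (cstm k) r v (xF k) (yF k)).2.
Local Notation f := (fibration a).
Let v3 : v ^+ 3 = 1 := pt_root3 eps_prim i.
Let v0 : v != 0 := pt_root_neq0 eps_prim i.

Lemma adapted_fraction_regular (s : blowup p) c0 c1 c2 d0 d1 d2 u0 u1 u2 :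
  coords (proj s) = frame_vec r v u0 u1 u2 -> d0 * u0 + d1 * u1 + d2 * u2 != 0 ->
  regular_at s ((cstm k c0 * x' + cstm k c1 * y' + cstm k c2) / (cstm k d0 * x' + cstm k d1 * y' + cstm k d2)).
Proof.
move=> Eu nd; have [σ σ0 Eσ] := adapted_generic eps_prim i.
have nd' : dot (adapted_form r v d0 d1 d2) (coords (proj s)) != 0.
  by rewrite Eu; have := adapted_formE (idfun : {rmorphism k -> k}) r d0 d1 d2 u0 u1 u2 v3; rewrite map_mx_id // => ->.
have := linear_fraction_regular (adapted_form r v c0 c1 c2) nd'.
have H := scaled_dot_ratio (cstm k) (adapted_form r v c0 c1 c2) (adapted_form r v d0 d1 d2) σ0 Eσ.
rewrite {}H.
have E e0 e1 e2 : dot (map_mx (cstm k) (adapted_form r v e0 e1 e2)) (frame_vec r (cstm k v) x' y' 1) =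
   cstm k e0 * x' + cstm k e1 * y' + cstm k e2.
  by rewrite adapted_formE // mulr1.
by rewrite !E.
Qed.

Let x'0 : x' != 0.
Proof.
have := @line_chart_inj k r v v3; have := eval_pairCX (cstm k) (y' - 1) x' => E inj.
by rewrite -E raddf_eq0 // polyC_eq0 polyX_eq0.
Qed.
Let ym1 : y' - 1 != 0.
Proof.
have := @line_chart_inj k r v v3; have := line_chartX r v => E inj.
by rewrite -E raddf_eq0 // polyX_eq0.
Qed.
Let y_shift (c : k) : y' + cstm k c != 0.
Proof.
have inj := @line_chart_inj k r v v3; have E := line_chartX r v.
have -> : y' + cstm k c = line_chart r v ('X + (1 + c)%:P%:P).
  rewrite rmorphD /= [line_chart r v _%:P]eval_pairCC E rmorphD rmorph1.
  by rewrite addrA subrK.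
by rewrite raddf_eq0 // -size_poly_eq0 size_XaddC.
Qed.

(** A fixed point is centred on the axis (fixed_center). Conversely the
    local ring of the axis is a fixed point, and it contains the local ring
    of a point of S over each point of the axis (axis_point). *)
Lemma fixed_curve_axis q :
  proj_image (@fixed_curve k f p (exc_ring p i)) q <-> on_line q (proj_pt (axis r v)).
Proof.
have [τ [τE τκ τx τy τK]] := bertini_reflection two0 three0 a0 eps_prim a3 i.
have fE := adapted_fE a0 eps_prim i.
have y'0 : y' != 0 by have := y_shift 0; rewrite rmorph0 addr0.
have yp1 : y' + 1 != 0 by have := y_shift 1; rewrite rmorph1.
rewrite on_line_pt ?axis_neq0 //; split.
- move=> [s [[O [[/closed_pointP fO fixO] sub]] <-]].
  have [vO bO _] := fO.
  have [u0 [u1 [u2 Eu]]] := frame_vecK r (coords (proj s)) v3.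
  have := axisE (idfun : {rmorphism k -> k}) r v (frame r v (u0, u1, u2)).
  rewrite map_mx_id // frameK // -/(frame_vec r v u0 u1 u2) -Eu dotC => ->.
  rewrite subr_eq0; apply/eqP.
  have fixτ h : O h -> maxid O (τ h - h) by move=> Oh; rewrite -τE; exact: fixO.
  apply: (fixed_center two0 a0 vO (fun c => bO _ (func_field_cst _ _ c)) (bO _ (func_field_f _ _))
     fE τx τy x'0 y'0 ym1 yp1 fixτ (u0 := u0)).
    move=> c0 c1 c2 d0 d1 d2 nd; apply: sub.
    exact: (adapted_fraction_regular c0 c1 c2 Eu nd).
  have := coords_neq0 (proj s); apply: contraR; rewrite !negb_or !negbK => /and3P[/eqP E0 /eqP E1 /eqP E2].
  rewrite Eu E0 E1 E2; apply/eqP.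
  have -> : frame_vec r v 0 0 0 = frame_vec r v (0 * 0) (0 * 0) (0 * 0) by rewrite mul0r.
  by rewrite frame_vec_scale scale0r.
- move=> /eqP qa.
  have [s [Es sub]] := axis_point a0 eps_prim a3 (coords_neq0 q) qa.
  exists s; rewrite Es proj_ptK; split=> //.
  have evX : line_chart r v 'X = y' - 1 by exact: line_chartX.
  have evC P : line_chart r v P%:P = (map_poly (cstm k) P).[x'] by exact: line_chartC.
  have inj := @line_chart_inj k r v v3; have onto := @line_chart_onto k r v v3.
  exists (chart_ring (line_chart r v)); split=> //; split.
    by apply/closed_pointP; exact: (line_fibre_pt a0 a3 evX evC inj onto fE).
  move=> h Vh; rewrite τE.
  exact: (line_fixed evX evC inj onto τκ τx τy Vh).
Qed.

End FixedCurve.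

(** * The four reducible members *)

Section MemberIdentity.
Variables (F : fieldType) (e : F).
Hypothesis e2 : e ^+ 2 + e + 1 = 0.
Hypothesis three0 : 3%:R != 0 :> F.

(** In the coordinates given by another triangle of the Hesse pencil, the
    pencil has the same form with this parameter in place of A. *)
Definition new_a (A : F) := (A + 2%:R) / (A - 1).

Let eE : e ^+ 2 = - e - 1.
Proof. by apply/eqP; rewrite -subr_eq0 opprD !opprK addrA; apply/eqP. Qed.

Lemma sextic_expand (a X Y Z : F) : sextic_at a X Y Z =
  (Y * Z - a * X ^+ 2) * (X ^+ 2 * (Y * Z) - a * X * (Y ^+ 3 + Z ^+ 3) + a ^+ 2 * (Y * Z) ^+ 2).
Proof. by rewrite /sextic_at; ring. Qed.

Lemma member_identity1 (A x y z : F) : A - 1 != 0 -> A + 2%:R != 0 ->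
  sextic_at A x y z + ((A - 1) * (A + 2%:R) ^+ 2)^-1 * cubic_at A x y z ^+ 2 =
  - (A ^+ 2 * (A - 1) ^+ 2 / (27%:R * (A + 2%:R) ^+ 2)) *
  sextic_at (new_a A) (x + y + z) (x + e * y + e ^+ 2 * z) (x + e ^+ 2 * y + e * z).
Proof.
move=> A1 A2; rewrite [sextic_at (new_a A) _ _ _]sextic_expand.
have -> : (x + e * y + e ^+ 2 * z) * (x + e ^+ 2 * y + e * z) =
  x ^+ 2 + y ^+ 2 + z ^+ 2 - x * y - y * z - z * x by ring: eE.
have -> : (x + e * y + e ^+ 2 * z) ^+ 3 + (x + e ^+ 2 * y + e * z) ^+ 3 =
  2%:R * (x ^+ 3 + y ^+ 3 + z ^+ 3) - 3%:R * (x ^+ 2 * y + x ^+ 2 * z + y ^+ 2 * x + y ^+ 2 * z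
    + z ^+ 2 * x + z ^+ 2 * y) + 12%:R * (x * y * z) by ring: eE.
have n27 : 27%:R != 0 :> F by rewrite (natrM _ 3 9) (natrM _ 3 3) !mulf_neq0.
by rewrite /sextic_at /cubic_at /new_a; field; rewrite A1 A2 n27.
Qed.

Variable w : F.
Hypothesis w3 : w ^+ 3 = 1.

(** Scaling x by w multiplies the sextic and the cubic by powers of w and
    replaces A by w A, which reduces the identity to the case w = 1. *)
Lemma member_identity (A x y z : F) : w * A - 1 != 0 -> w * A + 2%:R != 0 ->
  sextic_at A x y z + ((w * A - 1) * (w * A + 2%:R) ^+ 2)^-1 * cubic_at A x y z ^+ 2 =
  - (w * ((w * A) ^+ 2 * (w * A - 1) ^+ 2 / (27%:R * (w * A + 2%:R) ^+ 2))) *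
  sextic_at (new_a (w * A)) (w * x + y + z) (w * x + e * y + e ^+ 2 * z) (w * x + e ^+ 2 * y + e * z).
Proof.
move=> A1 A2; have := member_identity1 (w * x) y z A1 A2.
have -> : sextic_at (w * A) (w * x) y z = w ^+ 2 * sextic_at A x y z.
  by rewrite /sextic_at; ring: w3.
have -> : cubic_at (w * A) (w * x) y z = w * cubic_at A x y z.
  by rewrite /cubic_at; ring: w3.
move=> E; have -> (u s : F) : - (w * u) * s = w * (- u * s) by ring.
rewrite -E.
move: (_ ^-1) => L; ring: w3.
Qed.

Lemma cubic_identity (A x y z : F) : w * A - 1 != 0 ->
  cubic_at (new_a (w * A)) (w * x + y + z) (w * x + e * y + e ^+ 2 * z) (w * x + e ^+ 2 * y + e * z) =
  - (27%:R * w / (w * A - 1) ^+ 3) * cubic_at A x y z.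
Proof.
move=> A1; set x1 := w * x.
have E1 : (x1 + y + z) * (x1 + e * y + e ^+ 2 * z) * (x1 + e ^+ 2 * y + e * z) =
  x1 ^+ 3 + y ^+ 3 + z ^+ 3 - 3%:R * (x1 * y * z) by ring: eE.
have E2 : (x1 + y + z) ^+ 3 + (x1 + e * y + e ^+ 2 * z) ^+ 3 + (x1 + e ^+ 2 * y + e * z) ^+ 3 =
  3%:R * (x1 ^+ 3 + y ^+ 3 + z ^+ 3) + 18%:R * (x1 * y * z) by ring: eE.
rewrite {1}/cubic_at E1 E2.
have -> : - (27%:R * w / (w * A - 1) ^+ 3) * cubic_at A x y z =
  - (27%:R / (w * A - 1) ^+ 3) * cubic_at (w * A) x1 y z.
  have -> : cubic_at (w * A) x1 y z = w * cubic_at A x y z.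
    by rewrite /cubic_at /x1; ring: w3.
  by move: (_ ^-1) => D; ring.
by rewrite /cubic_at /new_a; field.
Qed.

End MemberIdentity.

(** The conic touches two sides of the triangle n, in the vertices on the
    third one. *)
Definition tri_conic (R : comNzRingType) (a : R) (n : 'I_3 -> 'rV[R]_3) (c : 'I_3) (X : 'rV[R]_3) : R :=
  dot (n (c + 1)) X * dot (n (c + 2%:R)) X - a * dot (n c) X ^+ 2.

Lemma prod3 (R : comNzRingType) (E : 'I_3 -> R) : \prod_(c < 3) E c = E 0 * E 1 * E 2%:R.
Proof.
rewrite !big_ord_recr big_ord0 /= mul1r.
by congr (E _ * E _ * E _); exact: val_inj.
Qed.

Lemma ord3_add : [/\ (1 + 1 : 'I_3) = 2%:R, (1 + 2%:R : 'I_3) = 0, (2%:R + 1 : 'I_3) = 0 & (2%:R + 2%:R : 'I_3) = 1].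
Proof. by split; exact: val_inj. Qed.

Lemma tri_conic_prod (R : comNzRingType) (a : R) n (X : 'rV[R]_3) :
  \prod_c tri_conic a n c X = sextic_at a (dot (n 0) X) (dot (n 1) X) (dot (n 2%:R) X).
Proof.
rewrite prod3 /tri_conic !add0r; have [-> -> -> ->] := ord3_add.
by rewrite /sextic_at; ring.
Qed.

Section Members.
Variable k : closedFieldType.
Variables (a eps : k).
Hypotheses (three0 : 3%:R != 0 :> k) (a0 : a != 0) (eps_prim : 3.-primitive_root eps).
Hypotheses (a3 : a ^+ 3 != 1) (a8 : a ^+ 3 + 8%:R != 0).

Definition unit_vec (c : 'I_3) : 'rV[k]_3 := \row_d (d == c)%:R.
Definition mem_root (m : nat) : k := eps ^+ m.-1.
(** The triangles of the Hesse pencil: the coordinate triangle for m = 0,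
    and for the other m the triangle with equation X^3 + y^3 + z^3 = 3 X y
    z, where X is the product of x with the cube root of unity mem_root m. *)
Definition tri_side (m : nat) (c : 'I_3) : 'rV[k]_3 :=
  if m == 0%N then unit_vec c else vec3 (mem_root m, eps ^+ c, eps ^+ (2 * c)).
Definition tri_vertex (m : nat) (c : 'I_3) : 'rV[k]_3 :=
  if m == 0%N then unit_vec c else vec3 (mem_root m ^+ 2, eps ^+ (2 * c), eps ^+ c).
Definition tri_param (m : nat) : k := if m == 0%N then a else new_a (mem_root m * a).
Definition mem_lambda (m : nat) : k :=
  if m == 0%N then 0 else ((mem_root m * a - 1) * (mem_root m * a + 2%:R) ^+ 2)^-1.
Definition mem_scale (m : nat) : k :=
  if m == 0%N then 1 else
  let b := mem_root m * a in
  - (mem_root m * (b ^+ 2 * (b - 1) ^+ 2 / (27%:R * (b + 2%:R) ^+ 2))).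
Definition tri_norm (m : nat) : k := if m == 0%N then 1 else 3%:R.

Let e2 := eps_quad eps_prim.
Let e3 : eps ^+ 3 = 1 := eps3 eps_prim.
Let e4 : eps ^+ (2 * 2) = eps. Proof. by rewrite (exprD eps 3 1) e3 mul1r. Qed.

Lemma mem_root3 m : mem_root m ^+ 3 = 1.
Proof. by rewrite /mem_root exprAC e3 expr1n. Qed.
Lemma mem_root_neq0 m : mem_root m != 0.
Proof. by apply: contra_eq_neq (mem_root3 m) => ->; rewrite expr0n eq_sym oner_eq0. Qed.

Lemma root_a_cube m : (mem_root m * a) ^+ 3 = a ^+ 3.
Proof. by rewrite exprMn mem_root3 mul1r. Qed.

Lemma root_a1 m : mem_root m * a - 1 != 0.
Proof.
rewrite subr_eq0; apply: contra_neq a3 => E.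
by rewrite -(root_a_cube m) E expr1n.
Qed.
Lemma root_a2 m : mem_root m * a + 2%:R != 0.
Proof.
rewrite addr_eq0; apply: contra_neq a8 => E.
by rewrite -(root_a_cube m) E; ring.
Qed.

Lemma tri_norm_neq0 m : tri_norm m != 0.
Proof. by rewrite /tri_norm; case: ifP => _ //; exact: oner_neq0. Qed.

Lemma tri_param_neq0 m : tri_param m != 0.
Proof.
rewrite /tri_param; case: ifP => // _.
by rewrite /new_a mulf_neq0 ?invr_eq0 ?root_a1 ?root_a2.
Qed.

Lemma tri_param3 m : tri_param m ^+ 3 != 1.
Proof.
rewrite /tri_param; case: ifP => // _; have := root_a1 m; have b3 : (mem_root m * a) ^+ 3 != 1.
  by rewrite exprMn mem_root3 mul1r.
move: (mem_root m * a) b3 => b b3 b1; rewrite -subr_eq0 /new_a.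
have -> : ((b + 2%:R) / (b - 1)) ^+ 3 - 1 = 3%:R * 3%:R * (b ^+ 3 - 1) / (b - 1) ^+ 4 by field.
by rewrite !mulf_neq0 ?invr_eq0 ?expf_neq0 // subr_eq0.
Qed.

Lemma mem_scale_neq0 m : mem_scale m != 0.
Proof.
rewrite /mem_scale; case: ifP => _; first exact: oner_neq0.
have n27 : 27%:R != 0 :> k by rewrite (natrM _ 3 9) (natrM _ 3 3) !mulf_neq0.
move: (root_a1 m) (root_a2 m) (mem_root_neq0 m); move: (mem_root m) => w h1 h2 h3.
rewrite oppr_eq0; apply: mulf_neq0 => //; apply: mulf_neq0.
  by apply: mulf_neq0; apply: expf_neq0 => //; exact: mulf_neq0.
by rewrite invr_eq0; apply: mulf_neq0 => //; exact: expf_neq0.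
Qed.

Lemma dot_unit (c : 'I_3) X : dot (unit_vec c) X = X 0 c.
Proof.
by move: c; apply: ord3P; rewrite dotE !mxE /=; ring.
Qed.

Lemma tri_dual m c d : dot (tri_side m c) (tri_vertex m d) = tri_norm m * (c == d)%:R.
Proof.
rewrite /tri_side /tri_vertex /tri_norm; case: ifP => _.
  by rewrite dot_unit mxE mul1r.
have w3 := mem_root3 m; move: (mem_root m) w3 => w w3.
have eE : eps ^+ 2 = - eps - 1 by apply/eqP; rewrite -subr_eq0 opprD !opprK addrA e2.
move: c d; apply: ord3P; apply: ord3P; rewrite dotE !vec3E /= ?e4 ?expr1 ?muln0 ?muln1 ?expr0;
  ring: w3 eE.
Qed.

Lemma tri_complete m X : tri_norm m *: X = \sum_c dot (tri_side m c) X *: tri_vertex m c.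
Proof.
rewrite /tri_side /tri_vertex /tri_norm sum3; case: ifP => _.
  rewrite scale1r !dot_unit; apply/rowP; apply: ord3P; rewrite !mxE /=; ring.
have w3 := mem_root3 m; move: (mem_root m) w3 => w w3.
have eE : eps ^+ 2 = - eps - 1 by apply/eqP; rewrite -subr_eq0 opprD !opprK addrA e2.
rewrite !dotE !vec3E /= ?e4 ?expr1 ?muln0 ?muln1 ?expr0.
by apply/rowP; apply: ord3P; rewrite !mxE /= ?e4 ?expr1 ?muln0 ?muln1 ?expr0; ring: w3 eE.
Qed.

Lemma tri_member (F : fieldType) (κ : {rmorphism k -> F}) m (X : 'rV[F]_3) :
  sextic_at (κ a) (X 0 0) (X 0 1) (X 0 2%:R) +
    κ (mem_lambda m) * cubic_at (κ a) (X 0 0) (X 0 1) (X 0 2%:R) ^+ 2 =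
  κ (mem_scale m) * \prod_c tri_conic (κ (tri_param m)) (fun c => map_mx κ (tri_side m c)) c X.
Proof.
rewrite tri_conic_prod /mem_lambda /mem_scale /tri_param /tri_side; case: ifP => _.
  rewrite rmorph0 mul0r addr0 rmorph1 mul1r; congr sextic_at; rewrite dotE !mxE !rmorph_nat /=; ring.
have n3 : 3%:R != 0 :> F by rewrite -(rmorph_nat κ) fmorph_eq0.
have E2 : κ eps ^+ 2 + κ eps + 1 = 0 by rewrite -rmorphXn -rmorphD -(rmorph1 κ) -rmorphD e2 rmorph0.
have W3 : κ (mem_root m) ^+ 3 = 1 by rewrite -rmorphXn mem_root3 rmorph1.
have A1 : κ (mem_root m) * κ a - 1 != 0.
  by rewrite -rmorphM -(rmorph1 κ) -rmorphB fmorph_eq0 root_a1.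
have A2 : κ (mem_root m) * κ a + 2%:R != 0.
  by rewrite -rmorphM -(rmorph_nat κ) -rmorphD fmorph_eq0 root_a2.
have := member_identity E2 n3 W3 (X 0 0) (X 0 1) (X 0 2%:R) A1 A2.
have -> : κ ((mem_root m * a - 1) * (mem_root m * a + 2%:R) ^+ 2)^-1 =
  ((κ (mem_root m) * κ a - 1) * (κ (mem_root m) * κ a + 2%:R) ^+ 2)^-1.
  by rewrite fmorphV !(rmorphXn, rmorphB, rmorphD, rmorphM, rmorph1, rmorph_nat).
move=> ->; congr (_ * sextic_at _ _ _ _).
- by rewrite !(fmorph_div, rmorphN, rmorphXn, rmorphB, rmorphD, rmorphM, rmorph1, rmorph_nat).
- by rewrite /new_a !(fmorph_div, rmorphB, rmorphD, rmorphM, rmorph1, rmorph_nat).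
- by rewrite map_vec3 dotE !vec3E /= !expr0 !rmorph1; ring.
- by rewrite map_vec3 dotE !vec3E /= !rmorphXn /=; ring.
- by rewrite map_vec3 dotE !vec3E /= e4 !rmorphXn /=; ring.
Qed.

Lemma tri_cubic m (X : 'rV[k]_3) : exists2 c, c != 0 &
  cubic_at (tri_param m) (dot (tri_side m 0) X) (dot (tri_side m 1) X) (dot (tri_side m 2%:R) X) =
  c * cubic_at a (X 0 0) (X 0 1) (X 0 2%:R).
Proof.
rewrite /tri_param /tri_side; case: ifP => _.
  by exists 1; rewrite ?oner_neq0 // !dot_unit mul1r.
exists (- (27%:R * mem_root m / (mem_root m * a - 1) ^+ 3)).
  have n27 : 27%:R != 0 :> k by rewrite (natrM _ 3 9) (natrM _ 3 3) !mulf_neq0.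
  rewrite oppr_eq0; apply: mulf_neq0; first by apply: mulf_neq0 => //; exact: mem_root_neq0.
  by rewrite invr_eq0 expf_neq0 ?root_a1.
rewrite -(cubic_identity e2 (mem_root3 m)) ?root_a1 //; congr cubic_at.
- by rewrite dotE !vec3E /= !expr0; ring.
- by rewrite dotE !vec3E /=; ring.
- by rewrite dotE !vec3E /= e4; ring.
Qed.

(** For m > 0 the inverse of the parameter is a^3 - 4 + 3 a^2 w^2, where w
    is the cube root of unity, and this determines w. *)
Lemma mem_lambda_inj m m' : (m < 4)%N -> (m' < 4)%N -> mem_lambda m = mem_lambda m' -> m = m'.
Proof.
have nz n : (mem_root n * a - 1) * (mem_root n * a + 2%:R) ^+ 2 != 0.
  by rewrite mulf_neq0 ?expf_neq0 ?root_a1 ?root_a2.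
rewrite /mem_lambda; case: m => [|m] /= lm; case: m' => [|m'] /= lm' //.
- by move=> /esym/eqP; rewrite invr_eq0 (negPf (nz m'.+1)).
- by move=> /eqP; rewrite invr_eq0 (negPf (nz m.+1)).
move/invr_inj => E.
have H w : w ^+ 3 = 1 -> (w * a - 1) * (w * a + 2%:R) ^+ 2 = a ^+ 3 - 4%:R + 3%:R * a ^+ 2 * w ^+ 2.
  by move=> w3; ring: w3.
move: E; rewrite !H ?mem_root3 // => /addrI /mulfI E.
have {}E : mem_root m.+1 ^+ 2 = mem_root m'.+1 ^+ 2 by apply: E; rewrite mulf_neq0 ?expf_neq0.
have : mem_root m.+1 = mem_root m'.+1.
  have sq (w : k) : w ^+ 3 = 1 -> w = (w ^+ 2) ^+ 2 by move=> w3; rewrite -exprM (exprD w 3 1) w3 mul1r.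
  by rewrite (sq _ (mem_root3 m.+1)) (sq _ (mem_root3 m'.+1)) E.
move=> /eqP; rewrite /mem_root (eq_prim_root_expr eps_prim) /= !modn_small // => /eqP -> //.
Qed.

End Members.

Lemma rmorph_dot (R S : comNzRingType) (φ : {rmorphism R -> S}) x y :
  φ (dot x y) = dot (map_mx φ x) (map_mx φ y).
Proof. by rewrite /dot rmorph_sum; apply: eq_bigr => c _; rewrite rmorphM !mxE. Qed.

Lemma rmorph_tri_conic (R S : comNzRingType) (φ : {rmorphism R -> S}) a n c X :
  φ (tri_conic a n c X) = tri_conic (φ a) (fun c => map_mx φ (n c)) c (map_mx φ X).
Proof. by rewrite /tri_conic rmorphB [φ (a * _)]rmorphM rmorphXn rmorphM !rmorph_dot. Qed.

(** Factors of F that vanish at the origin are not constant. *)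
Lemma reducible_factor (k : fieldType) (F G H : {mpoly k[3]}) : F = G * H -> F != 0 ->
  G.@[fun=> 0] = 0 -> H.@[fun=> 0] = 0 -> reducible F.
Proof.
have nc (P : {mpoly k[3]}) : P != 0 -> P.@[fun=> 0] = 0 -> (1 < msize P)%N.
  move=> P0 E; rewrite ltnNge; apply: contra P0 => /msize1_polyC EP.
  by move: E; rewrite EP mevalC => ->; rewrite mpolyC0.
move=> E F0 G0 H0; exists G, H; split=> //; apply: nc => //.
  by apply: contra_neq F0 => EG; rewrite E EG mul0r.
by apply: contra_neq F0 => EH; rewrite E EH mulr0.
Qed.

Section QuadraticForms.
Variable k : fieldType.
Implicit Types F : {mpoly k[3]}.

Lemma monomial2 (m : 'X_{1..3}) : mdeg m = 2%N -> exists i j, m = (U_(i) + U_(j))%MM.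
Proof.
move=> dm; have [i mi] : exists i, m i != 0%N.
  apply/existsP; apply: contra_eqT dm; rewrite negb_exists => /forallP H.
  by rewrite mdegE big1 // => i _; have := H i; rewrite negbK => /eqP.
have le : (U_(i) <= m)%MM.
  by apply/mnm_lepP => j; rewrite mnm1E; case: eqP => // <-; rewrite lt0n.
have E := submK le.
have /mdeg1P[j /eqP Ej] : mdeg (m - U_(i))%MM == 1%N.
  by move: dm; rewrite -{1}E mdegD mdeg1 addn1 => -[->].
by exists j, i; rewrite -Ej E.
Qed.

Lemma quad_comb F (u v w : 'rV[k]_3) : F \is 2.-homog -> exists A B C D E G, forall x y z : k,
  F.@[(x *: u + y *: v + z *: w) 0] =
  A * x ^+ 2 + B * y ^+ 2 + C * z ^+ 2 + D * (x * y) + E * (x * z) + G * (y * z).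
Proof.
move=> hF.
suff H s : (forall m, m \in s -> mdeg m = 2%N) -> exists A B C D E G, forall x y z : k,
    (\sum_(m <- s) F@_m *: 'X_[m]).@[(x *: u + y *: v + z *: w) 0] =
    A * x ^+ 2 + B * y ^+ 2 + C * z ^+ 2 + D * (x * y) + E * (x * z) + G * (y * z).
  have [A [B [C [D [E [G EG]]]]]] := H (msupp F) (dhomog_mf hF).
  by exists A, B, C, D, E, G => x y z; rewrite -EG -mpolyE.
elim: s => [|m s IH] H.
  by exists 0, 0, 0, 0, 0, 0 => x y z; rewrite big_nil meval0 !mul0r !addr0.
have [i [j Em]] := monomial2 (H m (mem_head _ _)).
have [A [B [C [D [E [G EG]]]]]] := IH (fun m' Hm => H m' (@mem_behead _ (m :: s) m' Hm)).
pose c := F@_m.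
exists (A + c * (u 0 i * u 0 j)), (B + c * (v 0 i * v 0 j)), (C + c * (w 0 i * w 0 j)),
  (D + c * (u 0 i * v 0 j + v 0 i * u 0 j)), (E + c * (u 0 i * w 0 j + w 0 i * u 0 j)),
  (G + c * (v 0 i * w 0 j + w 0 i * v 0 j)) => x y z.
rewrite big_cons mevalD EG mevalZ Em mpolyXD mevalM !mevalXU !mxE -Em -/c; ring.
Qed.

End QuadraticForms.

Lemma ord3_cases (c d : 'I_3) : [\/ d = c, d = c + 1 | d = c + 2%:R].
Proof.
move: c d; apply: ord3P; apply: ord3P; rewrite ?add0r;
  first [by apply: Or31; exact: val_inj | by apply: Or32; exact: val_inj | by apply: Or33; exact: val_inj].
Qed.

Lemma ord3_neq (c : 'I_3) :
  [/\ (c == c + 1) = false, (c == c + 2%:R) = false & (c + 1 == c) = false] /\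
  [/\ (c + 1 == c + 2%:R) = false, (c + 2%:R == c) = false & (c + 2%:R == c + 1) = false].
Proof. by move: c; apply: ord3P; repeat split. Qed.

Lemma poly_zero (k : closedFieldType) (p : {poly k}) : (forall t, p.[t] = 0) -> p = 0.
Proof. by move=> H; apply: poly_zero_off0 => t _. Qed.

Section Triangle.
Variables (k : closedFieldType) (n ver : 'I_3 -> 'rV[k]_3) (N b : k).
Hypotheses (N0 : N != 0) (b0 : b != 0) (b3 : b ^+ 3 != 1).
Hypothesis dual : forall c d, dot (n c) (ver d) = N * (c == d)%:R.
Hypothesis complete : forall X, N *: X = \sum_c dot (n c) X *: ver c.
Local Notation Q := (tri_conic b n).

Lemma dotDr (x y z : 'rV[k]_3) : dot x (y + z) = dot x y + dot x z.
Proof. by rewrite ![dot x _]dotC dotDl. Qed.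
Lemma dotZr c (x y : 'rV[k]_3) : dot x (c *: y) = c * dot x y.
Proof. by rewrite ![dot x _]dotC dotZl. Qed.

Lemma side_comb c (x y z : k) : let X := x *: ver c + y *: ver (c + 1) + z *: ver (c + 2%:R) in
  [/\ dot (n c) X = N * x, dot (n (c + 1)) X = N * y & dot (n (c + 2%:R)) X = N * z].
Proof.
have [[e1 e2 e3] [e4 e5 e6]] := ord3_neq c.
by split; rewrite !dotDr !dotZr !dual ?eqxx ?e1 ?e2 ?e3 ?e4 ?e5 ?e6 !(mulr0, mulr1, addr0, add0r) mulrC.
Qed.

Lemma comb_side c X : X = (dot (n c) X / N) *: ver c + (dot (n (c + 1)) X / N) *: ver (c + 1) +
   (dot (n (c + 2%:R)) X / N) *: ver (c + 2%:R).
Proof.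
rewrite -[LHS](scalerK N0) complete sum3 ![_ / N]mulrC -!scalerA -!scalerDr; congr (_ *: _).
move: c; apply: ord3P; rewrite ?add0r; have [E1 E2 E3 E4] := ord3_add; rewrite ?E1 ?E2 ?E3 ?E4 //.
  by rewrite [RHS]addrC addrA.
by rewrite -[RHS]addrA [RHS]addrC.
Qed.

Definition conic_param c t := t *: ver c + (b * t ^+ 2) *: ver (c + 1) + 1 *: ver (c + 2%:R).

Lemma conic_param_on c t : Q c (conic_param c t) = 0.
Proof.
by have [E1 E2 E3] := side_comb c t (b * t ^+ 2) 1; rewrite /tri_conic E1 E2 E3; ring.
Qed.

(** The six coefficients of F, in the basis ver, appear in the five
    coefficients of its restriction to the parametrized conic; if those
    vanish, only the multiples of Q c are left. *)
Lemma conic_param_poly (F : {mpoly k[3]}) c : F \is 2.-homog ->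
  exists2 p : {poly k}, forall t, F.@[conic_param c t 0] = p.[t] &
    p = 0 -> exists φ, forall Y : 'rV[k]_3, F.@[Y 0] = φ * Q c Y.
Proof.
move=> hF; have [A [B [C [D [E [G EG]]]]]] := quad_comb (ver c) (ver (c + 1)) (ver (c + 2%:R)) hF.
exists (Poly [:: C; E; A + G * b; D * b; B * b ^+ 2]).
  by move=> t; rewrite /conic_param EG horner_Poly /=; ring.
move=> p0; have cf i : [:: C; E; A + G * b; D * b; B * b ^+ 2]`_i = 0.
  by rewrite -coef_Poly p0 coef0.
have C0 : C = 0 := cf 0%N; have E0 : E = 0 := cf 1%N.
have A0 : A = - (G * b) by apply/eqP; rewrite -addr_eq0; apply/eqP; exact: (cf 2%N).
have D0 : D = 0 by apply/eqP; move/eqP: (cf 3%N); rewrite /= mulf_eq0 (negPf b0) orbF.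
have B0 : B = 0 by apply/eqP; move/eqP: (cf 4%N); rewrite /= mulf_eq0 expf_eq0 (negPf b0) andbF orbF.
exists (G / N ^+ 2) => Y; rewrite {1}(comb_side c Y) EG A0 B0 C0 D0 E0 /tri_conic.
by field.
Qed.

Let center := \sum_c ver c.
Lemma tri_conic_center c : Q c center != 0.
Proof.
have D d : dot (n d) center = N.
  by rewrite /center sum3 !dotDr !dual; move: d; apply: ord3P; rewrite /= !(mulr0, mulr1, addr0, add0r).
have b1 : b != 1 by apply: contra_neq b3 => ->; rewrite expr1n.
have -> : Q c center = N ^+ 2 * (1 - b) by rewrite /tri_conic !D; ring.
by rewrite mulf_neq0 ?expf_neq0 // subr_eq0 eq_sym.
Qed.

Lemma tri_conic_vertex c d : Q c (ver d) = - (b * N ^+ 2 * (c == d)%:R).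
Proof.
rewrite /tri_conic !dual; have [[e1 e2 e3] [e4 e5 e6]] := ord3_neq c.
by case: (ord3_cases c d) => ->; rewrite ?eqxx ?e1 ?e2 ?e3 ?e4 ?e5 ?e6 /=; ring.
Qed.

Variables (C : 'I_3 -> {mpoly k[3]}) (κ : k).
Hypotheses (κ0 : κ != 0) (hC : forall j, C j \is 2.-homog).
Hypothesis prodC : forall X : 'rV[k]_3, \prod_j (C j).@[X 0] = κ * \prod_c Q c X.

(** The product vanishes on the conic Q c, so one of the three factors
    vanishes identically on it, and is a multiple of Q c by
    conic_param_poly. The factors found for different c are different, as Q
    c is the only one of the conics that does not pass through the vertex c. *)
Lemma conic_match : exists2 g : 'I_3 -> 'I_3, injective g &
  forall c, exists2 φ, φ != 0 & forall Y : 'rV[k]_3, (C (g c)).@[Y 0] = φ * Q c Y.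
Proof.
have ex c : exists j, exists2 φ, φ != 0 & forall Y : 'rV[k]_3, (C j).@[Y 0] = φ * Q c Y.
  have [p0 e0 z0] := conic_param_poly c (hC 0); have [p1 e1 z1] := conic_param_poly c (hC 1).
  have [p2 e2 z2] := conic_param_poly c (hC 2%:R).
  (* The factor φ is not zero because no conic passes through the sum of the
     vertices. *)
  have H j : (exists φ, forall Y : 'rV[k]_3, (C j).@[Y 0] = φ * Q c Y) ->
      exists j, exists2 φ, φ != 0 & forall Y : 'rV[k]_3, (C j).@[Y 0] = φ * Q c Y.
    move=> [φ E]; exists j, φ => //; apply: contraTneq (tri_conic_center 0) => φ0.
    have := prodC center; rewrite (bigD1 j) //= E φ0 !mul0r => /esym/eqP.
    by rewrite mulf_eq0 (negPf κ0) (bigD1 0) //= !mulf_eq0 prodf_seq_eq0 => /orP[->|/hasP[d _ /andP[_]]] //;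
      rewrite (negPf (tri_conic_center d)).
  have : p0 * p1 * p2 = 0.
    apply: poly_zero => t; rewrite !hornerM -e0 -e1 -e2.
    have := prodC (conic_param c t); rewrite [X in _ * X](bigD1 c) //= conic_param_on mul0r mulr0.
    by rewrite prod3.
  move=> /eqP; rewrite !mulf_eq0 => /orP[/orP[]|] /eqP => [/z0|/z1|/z2]; exact: H.
pose g c := proj1_sig (constructive_indefinite_description _ (ex c)).
have gP c : exists2 φ, φ != 0 & forall Y : 'rV[k]_3, (C (g c)).@[Y 0] = φ * Q c Y.
  exact: (proj2_sig (constructive_indefinite_description _ (ex c))).
exists g => // c d E; apply/eqP; apply: contraT => ncd.
have [φ φ0 Eφ] := gP c; have [ψ ψ0 Eψ] := gP d.
have := Eψ (ver c); rewrite -E Eφ !tri_conic_vertex eqxx eq_sym (negPf ncd) mulr1 mulr0 oppr0 mulr0.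
by move=> /eqP; rewrite mulrN oppr_eq0 !mulf_eq0 (negPf φ0) (negPf b0) ?expf_eq0 ?(negPf N0).
Qed.
End Triangle.

Lemma member_morph (k : fieldType) (S : comNzRingType) (φ : {rmorphism {mpoly k[3]} -> S}) (a l : k) :
  φ (pencil_member a l) =
  sextic_at (φ a%:MP) (φ 'X_0) (φ 'X_1) (φ 'X_(2%:R)) +
  φ l%:MP * cubic_at (φ a%:MP) (φ 'X_0) (φ 'X_1) (φ 'X_(2%:R)) ^+ 2.
Proof.
rewrite /pencil_member -mul_mpolyC pencil_sexticE pencil_cubicE rmorphD rmorph_sextic_at.
by rewrite (rmorphM φ l%:MP) rmorphXn rmorph_cubic_at.
Qed.

Lemma member_eval (k : fieldType) (a l : k) (Y : 'rV[k]_3) :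
  (pencil_member a l).@[Y 0] = sextic_at a (Y 0 0) (Y 0 1) (Y 0 2%:R) +
  l * cubic_at a (Y 0 0) (Y 0 1) (Y 0 2%:R) ^+ 2.
Proof.
pose φ : {rmorphism {mpoly k[3]} -> k} := meval (Y 0).
rewrite -[LHS]/(φ _) member_morph /φ /= !mevalC !mevalXU //.
Qed.

Section ReducibleMembers.
Variable k : closedFieldType.
Variables (a eps : k).
Hypotheses (three0 : 3%:R != 0 :> k) (a0 : a != 0) (eps_prim : 3.-primitive_root eps).
Hypotheses (a3 : a ^+ 3 != 1) (a8 : a ^+ 3 + 8%:R != 0).
Local Notation side := (tri_side eps).
Local Notation ver := (tri_vertex eps).
Local Notation par := (tri_param a eps).
Local Notation mlam := (mem_lambda a eps).

Lemma member_tri m (Y : 'rV[k]_3) :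
  (pencil_member a (mlam m)).@[Y 0] = mem_scale a eps m * \prod_c tri_conic (par m) (side m) c Y.
Proof.
rewrite member_eval; have := tri_member three0 eps_prim a3 a8 (idfun : {rmorphism k -> k}) m Y.
rewrite /= => ->; congr (_ * _); apply: eq_bigr => c _.
by rewrite /tri_conic !map_mx_id.
Qed.

Let vars : 'rV[{mpoly k[3]}]_3 := \row_c 'X_c.
Definition conic_poly m c : {mpoly k[3]} :=
  tri_conic (par m)%:MP (fun c => map_mx (@mpolyC 3 k) (side m c)) c vars.

Lemma conic_poly_at0 m c : (conic_poly m c).@[fun=> 0] = 0.
Proof.
pose φ : {rmorphism {mpoly k[3]} -> k} := meval (fun=> 0).
rewrite -[LHS]/(φ _) rmorph_tri_conic.
have -> : map_mx φ vars = 0 by apply/rowP => d; rewrite !mxE /φ /= mevalXU.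
rewrite /tri_conic !(dotC _ (0 : 'rV[k]_3)).
have D (x : 'rV[k]_3) : dot 0 x = 0 by rewrite dotE !mxE !mul0r !addr0.
by rewrite !D expr0n /= !(mulr0, mul0r, subr0).
Qed.

Lemma member_factor m :
  pencil_member a (mlam m) = (mem_scale a eps m)%:MP * conic_poly m 0 * (conic_poly m 1 * conic_poly m 2%:R).
Proof.
pose φ : {rmorphism {mpoly k[3]} -> {fraction {mpoly k[3]}}} := @tofrac _.
apply/eqP; rewrite -tofrac_eq; apply/eqP.
rewrite -[LHS]/(φ _) -[RHS]/(φ _) member_morph.
pose κ : {rmorphism k -> {fraction {mpoly k[3]}}} := φ \o @mpolyC 3 k.
have := tri_member three0 eps_prim a3 a8 κ m (map_mx φ vars); rewrite !mxE.
rewrite -[κ a]/(φ a%:MP) -[κ (mlam m)]/(φ (mlam m)%:MP) => ->.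
have E c : φ (conic_poly m c) = tri_conic (κ (par m)) (fun c => map_mx κ (side m c)) c (map_mx φ vars).
  rewrite /conic_poly rmorph_tri_conic; congr tri_conic.
  by apply: functional_extensionality => d; rewrite -map_mx_comp.
rewrite prod3 -!E.
move: (conic_poly m 0) (conic_poly m 1) (conic_poly m 2%:R) => q0 q1 q2.
rewrite -[κ _]/(φ (mem_scale a eps m)%:MP).
have M (x y : {mpoly k[3]}) : φ x * φ y = φ (x * y) by rewrite rmorphM.
by rewrite !M !mulrA.
Qed.

Lemma member_neq0 m : pencil_member a (mlam m) != 0.
Proof.
apply/negP => /eqP E.
have := member_tri m (\sum_c ver m c); rewrite E meval0 => /esym/eqP.
rewrite mulf_eq0 (negPf (mem_scale_neq0 three0 a0 eps_prim a3 a8 m)) prodf_seq_eq0 => /hasP[c _ /= H].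
have := tri_conic_center (tri_norm_neq0 three0 m) (tri_param3 three0 eps_prim a3 m) (tri_dual eps_prim m) c.
by rewrite H.
Qed.

Lemma member_reducible m : reducible (pencil_member a (mlam m)).
Proof.
apply: (reducible_factor (member_factor m)); first exact: member_neq0.
  by rewrite mevalM conic_poly_at0 mulr0.
have := conic_poly_at0 m 1; move: (conic_poly m 1) (conic_poly m 2%:R) => q q' E.
by rewrite mevalM E mul0r.
Qed.

(** Four reducible members of the pencil are known from member_reducible,
    and the given members are exactly the reducible ones and are four in
    number, so they are the same. *)
Lemma chilean_structure (lambda : 'I_4 -> k) (C : 'I_4 -> 'I_3 -> {mpoly k[3]}) :
  chilean a lambda C -> exists2 m : 'I_4 -> 'I_4, injective m &
    forall r, exists2 g : 'I_3 -> 'I_3, injective g &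
      forall c, exists2 φ, φ != 0 &
        forall Y : 'rV[k]_3, (C r (g c)).@[Y 0] = φ * tri_conic (par (m r)) (side (m r)) c Y.
Proof.
move=> [linj lred con mem].
have ex (m : 'I_4) : exists r, lambda r = mlam m by apply/lred; exact: member_reducible.
pose h m := proj1_sig (constructive_indefinite_description _ (ex m)).
have hP m : lambda (h m) = mlam m by exact: (proj2_sig (constructive_indefinite_description _ (ex m))).
have hinj : injective h.
  move=> m m' E; apply: val_inj; have := congr1 lambda E; rewrite !hP.
  exact: (mem_lambda_inj three0 a0 eps_prim a3 a8 (ltn_ord m) (ltn_ord m')).
exists (invF hinj); first exact: (can_inj (f_invF hinj)).
move=> r; set m := invF hinj r.
have Er : lambda r = mlam m by rewrite -hP /m f_invF.
apply: (@conic_match k (side m) (ver m) (tri_norm k m) (par m) _ _ _ _ _ (C r) (mem_scale a eps m)).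
- exact: tri_norm_neq0.
- exact: tri_param_neq0.
- exact: tri_param3.
- exact: tri_dual.
- exact: tri_complete.
- exact: mem_scale_neq0.
- by move=> j; have [] := con r j.
- by move=> X; rewrite -member_tri -Er mem rmorph_prod.
Qed.

End ReducibleMembers.

(** * Singular points of the reducible fibres *)

Lemma multihomogD (k : fieldType) d (P Q : {mpoly k[(1 + 9) * 3]}) :
  multihomog d P -> multihomog d Q -> multihomog d (P + Q).
Proof. by move=> HP HQ m /msuppD_le; rewrite mem_cat => /orP[]; [exact: HP | exact: HQ]. Qed.

Lemma triple_cyc (R : comNzRingType) (n l r : 'rV[R]_3) : dot (cross r n) l = dot n (cross l r).
Proof.
by rewrite !crossE dotE [RHS]dotE !vec3E /=; ring.
Qed.

Lemma cross_cross (R : comNzRingType) (p X r : 'rV[R]_3) :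
  cross (cross p X) r = dot p r *: X - dot X r *: p.
Proof.
rewrite !crossE !vec3E !dotE; apply/rowP; apply: ord3P; rewrite ?vec3E !mxE /=; ring.
Qed.

Lemma exists_dot (k : fieldType) (p : 'rV[k]_3) : p != 0 -> exists r : 'rV[k]_3, dot r p != 0.
Proof.
move=> /row_neq0P[c pc]; exists (\row_d (d == c)%:R); rewrite /dot (bigD1 c) //= mxE eqxx mul1r.
rewrite big1 ?addr0 // => d nd; by rewrite mxE (negPf nd) mul0r.
Qed.

Section Tangent.
Variables (k : closedFieldType) (p : 'I_9 -> 'rV[k]_3) (l : 'I_9).
Hypothesis p0 : p l != 0.
Hypothesis two0 : 2%:R != 0 :> k.
Variables (b : k) (f g h : 'rV[k]_3) (F : {mpoly k[3]}) (φ : k).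
Hypothesis φ0 : φ != 0.
Let q (X : 'rV[k]_3) := dot f X * dot h X - b * dot g X ^+ 2.
Hypothesis FE : forall Y : 'rV[k]_3, F.@[Y 0] = φ * q Y.

(** The bilinear form q (U + W) - q U - q W. *)
Definition polar (U W : 'rV[k]_3) : k :=
  dot f U * dot h W + dot h U * dot f W - 2%:R * b * (dot g U * dot g W).

Let on_q t : on_curve F (proj t) -> q (coords (@proj k p t)) = 0.
Proof. by rewrite /on_curve FE => /eqP; rewrite mulf_eq0 (negPf φ0) => /eqP. Qed.

Lemma proper_transform_on s : proper_transform F s -> q (coords (@proj k p s)) = 0.
Proof.
pose P := linear_form row_pt f * linear_form row_pt h - b *: (linear_form row_pt g * linear_form row_pt g).
have PE t : form_at t P = q (coords (@proj k p t)).
  by rewrite form_atE rmorphB -mul_mpolyC !rmorphM form_valC !form_val_pt !map_mx_id.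
have dP : multihomog (fun j => (j == row_pt) + (j == row_pt))%N P.
  rewrite /P -scaleNr; apply: multihomogD; last apply: multihomogZ; apply: multihomogM;
    exact: linear_form_homog.
by move=> /(_ _ _ dP); rewrite PE; apply=> t /on_q Ht _; rewrite PE.
Qed.

Variable ρ : 'rV[k]_3.
Hypothesis ρp : dot ρ (p l) != 0.

Let L1 n := linear_form row_pt (dot ρ (p l) *: n + dot n (p l) *: ρ).
Let L2 n := linear_form (row_line l) (cross ρ n).
Let tangent_form := L1 f * L2 h + L1 h * L2 f - (2%:R * b) *: (L1 g * L2 g).

Let tangent_homog : multihomog (fun j => (j == row_pt) + (j == row_line l))%N tangent_form.
Proof.
rewrite /tangent_form -scaleNr; apply: multihomogD; first apply: multihomogD.
- by apply: multihomogM; exact: linear_form_homog.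
- by apply: multihomogM; exact: linear_form_homog.
- by apply: multihomogZ; apply: multihomogM; exact: linear_form_homog.
Qed.

Let tangent_formE t : let X := coords (@proj k p t) in
  form_at t tangent_form = polar (dot ρ (p l) *: X + dot ρ X *: p l) (cross (coords (dir t l)) ρ).
Proof.
move=> X; have E1 n : form_val idfun (assemble X (fun i => coords (dir t i))) (L1 n) =
    dot n (dot ρ (p l) *: X + dot ρ X *: p l).
  by rewrite form_val_pt map_mx_id // dotDl !dotZl dotDr !dotZr [dot n _ * _]mulrC.
have E2 n : form_val idfun (assemble X (fun i => coords (dir t i))) (L2 n) =
    dot n (cross (coords (dir t l)) ρ).
  by rewrite form_val_line map_mx_id // triple_cyc.
by rewrite form_atE /tangent_form rmorphB rmorphD -mul_mpolyC (rmorphM _ (2%:R * b)%:MP) form_valC !rmorphM !E1 !E2.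
Qed.

(** With W = l x ρ, where l is the line through p given by a point of S, the
    expression polar ((ρ.p) X + (ρ.X) p, W) is bihomogeneous in X and l. At
    a point X of the conic other than p, W is proportional to (ρ.p)
    X - (ρ.X) p, so that the expression is a multiple of (ρ.p)^2
    q(X) - (ρ.X)^2 q(p) = 0. So it vanishes on the proper transform, and at
    X = p it is a multiple of polar (p, W). *)
Lemma proper_transform_tangent (s : blowup p) : q (p l) = 0 -> proper_transform F s -> exceptional l s ->
  polar (p l) (cross (coords (dir s l)) ρ) = 0.
Proof.
move=> qp pt exc.
have Ep : val (@proj k p s) = <[p l]>%VS by [].
have [c Ec] : exists c, coords (proj s) = c *: p l.
  have : coords (proj s) \in <[p l]>%VS by rewrite -Ep coords_line memv_line.
  by move=> /vlineP.
have c0 : c != 0 by apply: contraNneq (coords_neq0 (proj s)) => E; rewrite Ec E scale0r.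
have := pt _ _ tangent_homog; rewrite tangent_formE Ec.
have -> : polar (dot ρ (p l) *: (c *: p l) + dot ρ (c *: p l) *: p l) (cross (coords (dir s l)) ρ) =
  2%:R * (dot ρ (p l) * c) * polar (p l) (cross (coords (dir s l)) ρ).
  by rewrite /polar !dotDr !dotZr; ring.
move=> H; apply: (mulfI (_ : 2%:R * (dot ρ (p l) * c) != 0)); first by rewrite !mulf_neq0.
rewrite mulr0; apply: H => t ont nexc; rewrite tangent_formE.
set X := coords (proj t); have qX : q X = 0 by exact: on_q.
have X0 : X != 0 by exact: coords_neq0.
have nX : cross (p l) X != 0.
  apply/eqP => /(proj_pt_cross p0 X0) E; apply: (nexc l).
  by rewrite /exceptional -(proj_ptK (proj t)) -/X -E proj_ptE.
have Xl : dot X (coords (dir t l)) = 0 by apply/eqP; exact: (dir_proj t l).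
have [e Ee] := cross_span nX (dir_base t l) Xl.
rewrite Ee crossZl cross_cross.
have -> : polar (dot ρ (p l) *: X + dot ρ X *: p l) (e *: (dot (p l) ρ *: X - dot X ρ *: p l)) =
  2%:R * e * (dot ρ (p l) ^+ 2 * q X - dot ρ X ^+ 2 * q (p l)).
  by rewrite /polar /q ![dot _ ρ]dotC -scaleNr !dotZr !dotDr !dotZr; ring.
by rewrite qX qp !mulr0 subrr mulr0.
Qed.

End Tangent.

Section BaseLocus.
Variable k : closedFieldType.
Variables (a eps : k).
Hypotheses (three0 : 3%:R != 0 :> k) (a0 : a != 0) (eps_prim : 3.-primitive_root eps).
Hypotheses (a3 : a ^+ 3 != 1) (a8 : a ^+ 3 + 8%:R != 0).
Local Notation p := (base_pt eps a).

Lemma base_cubic i : cubic_at a (p i 0 0) (p i 0 1) (p i 0 2%:R) = 0.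
Proof.
rewrite base_ptE //; have := frame_cubic (pt_type i) (pt_root3 eps_prim i) a a 1 1.
case: (frame _ _ _) => [[p0 p1] p2]; rewrite !vec3E /= => ->; rewrite /cubic_at; ring.
Qed.

Lemma pt_exists r (v : k) : v ^+ 3 = 1 -> exists i : 'I_9, p i = vec3 (frame r v (a, 1, 1)).
Proof.
move=> v3; have [j Ej] := prim_rootP eps_prim v3.
pose n := (minn r 2 * 3 + j)%N.
have n9 : (n < 9)%N.
  have : (minn r 2 <= 2)%N by exact: geq_minr.
  by rewrite /n; have := ltn_ord j; case: (minn r 2) => [|[|[|]]] //; lia.
exists (Ordinal n9); rewrite base_ptE //.
have -> : pt_root eps (Ordinal n9) = v.
  by rewrite /pt_root /= /n modnMDl modn_small // Ej.
have -> : pt_type (Ordinal n9) = minn r 2.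
  by rewrite /pt_type /= /n divnMDl // divn_small // addn0.
by case: (r) => [|[|r']] //; rewrite /minn; case: ifP.
Qed.

(** This is base_center for the trivial valuation ring of k. *)
Lemma base_locus (q : 'rV[k]_3) : q != 0 ->
  cubic_at a (q 0 0) (q 0 1) (q 0 2%:R) = 0 -> sextic_at a (q 0 0) (q 0 1) (q 0 2%:R) = 0 ->
  exists i, proj_pt q = proj_pt (p i).
Proof.
move=> q0 c0 s0; pose O := fun _ : k => True.
have vO : valring O by split=> // h; left.
have mE h : maxid O h <-> h = 0 by split=> [[_ []//]|->]; split=> //; left.
have n0 : ~ [/\ maxid O (q 0 0), maxid O (q 0 1) & maxid O (q 0 2%:R)].
  move=> [/mE E0 /mE E1 /mE E2]; case/eqP: q0.
  by apply/rowP; apply: ord3P; rewrite mxE.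
have Tr : forall h, O h by [].
have Mc : maxid O (cubic_at a (q 0 0) (q 0 1) (q 0 2%:R)) by apply/mE.
have Ms : maxid O (sextic_at a (q 0 0) (q 0 1) (q 0 2%:R)) by apply/mE.
have [r [v [v3 nZ]]] : exists r v, [/\ v ^+ 3 = 1, ~ maxid O (q 0 2%:R) &
    let: (p0, p1, p2) := std_pt a r v in
    maxid O (p2 * q 0 0 - p0 * q 0 2%:R) /\ maxid O (p2 * q 0 1 - p1 * q 0 2%:R)].
  exact: (@base_center k k idfun O vO (fun c => Tr c) a eps a0 (eps_quad eps_prim)
    _ _ _ (Tr _) (Tr _) (Tr _) n0 Mc Ms).
have -> : std_pt a r v = frame r v (a, 1, 1) by case: r => [|[|r]] //=; rewrite ?mulr1.
have [i Ei] := pt_exists r v3.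
have pi0 := base_pt_neq0 a0 eps_prim i.
case EF : (frame r v _) => [[p0 p1] p2] [/mE Ex /mE Ey]; exists i.
have z0 : q 0 2%:R != 0 by apply/eqP => E; apply: nZ; apply/mE.
have Ep : p i = (p2 / q 0 2%:R) *: q.
  rewrite Ei EF; apply/rowP; apply: ord3P; rewrite ?vec3E [RHS]mxE /=; apply: (mulIf z0); rewrite mulrAC divfK //.
  - by apply/esym/eqP; rewrite -subr_eq0 Ex.
  - by apply/esym/eqP; rewrite -subr_eq0 Ey.
rewrite Ep proj_pt_scale //; apply: contra_neq pi0 => E.
by rewrite Ep E scale0r.
Qed.

Section Member.
Variable m : nat.
Local Notation n := (tri_side eps m).
Local Notation ver := (tri_vertex eps m).
Local Notation b := (tri_param a eps m).
Local Notation N := (tri_norm k m).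
Local Notation Q := (tri_conic b n).
Let N0 := tri_norm_neq0 three0 m.
Let b0 := tri_param_neq0 a0 eps_prim a3 a8 m.
Let dual := tri_dual eps_prim m.
Let complete := tri_complete eps_prim m.

Lemma vertex_neq0 c : ver c != 0.
Proof.
apply/eqP => E; have := dual c c; rewrite E eqxx mulr1 dotC dotE !mxE !mul0r !addr0 => /esym/eqP.
by rewrite (negPf N0).
Qed.

Lemma cubic_sides (X : 'rV[k]_3) c : cubic_at b (dot (n 0) X) (dot (n 1) X) (dot (n 2%:R) X) =
  cubic_at b (dot (n c) X) (dot (n (c + 1)) X) (dot (n (c + 2%:R)) X).
Proof.
have [E1 E2 E3 E4] := ord3_add.
by move: c; apply: ord3P; rewrite ?add0r ?E1 ?E2 ?E3 ?E4 // /cubic_at; ring.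
Qed.

(** The cubic vanishes at the base points, but not at the vertices. *)
Lemma vertex_base c i : proj_pt (ver c) <> proj_pt (p i).
Proof.
move=> E; have [e e0 Ee] := coords_proj_pt (vertex_neq0 c).
have [d d0 Ed] := coords_proj_pt (base_pt_neq0 a0 eps_prim i).
have {E} Ev : ver c = (e^-1 * d) *: p i by rewrite -scalerA -Ed -E Ee scalerK.
have [u u0 Eu] := tri_cubic three0 eps_prim a3 m (ver c).
have : cubic_at a (ver c 0 0) (ver c 0 1) (ver c 0 2%:R) = 0.
  have Z z (y : 'rV[k]_3) j : (z *: y) 0 j = z * y 0 j by rewrite mxE.
  by rewrite Ev !Z cubic_scale base_cubic mulr0.
move: Eu => /[swap] ->; rewrite mulr0 (cubic_sides _ c) !dual eqxx.
have [[e1 e2 e3] [e4 e5 e6]] := ord3_neq c; rewrite e3 e5 /cubic_at => /eqP.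
have -> : b * ((N * 1%:R) ^+ 3 + (N * 0%:R) ^+ 3 + (N * 0%:R) ^+ 3) -
  (b ^+ 3 + 2%:R) * (N * 1%:R * (N * 0%:R) * (N * 0%:R)) = b * N ^+ 3 by ring.
by rewrite mulf_eq0 expf_eq0 (negPf b0) (negPf N0).
Qed.

Lemma tri_conic_next c (X : 'rV[k]_3) :
  Q (c + 1) X = dot (n c) X * dot (n (c + 2%:R)) X - b * dot (n (c + 1)) X ^+ 2 /\
  Q (c + 2%:R) X = dot (n c) X * dot (n (c + 1)) X - b * dot (n (c + 2%:R)) X ^+ 2.
Proof.
have [E1 E2 E3 E4] : [/\ c + 1 + 1 = c + 2%:R, c + 1 + 2%:R = c, c + 2%:R + 1 = c & c + 2%:R + 2%:R = c + 1].
  by move: c; apply: ord3P; split; apply: val_inj.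
by rewrite /tri_conic E1 E2 E3 E4; split; ring.
Qed.

(** Away from the vertex, the equations of the two conics imply that of the
    cubic, so that X is in the base locus of the pencil. *)
Lemma conics_meet c (X : 'rV[k]_3) : X != 0 -> Q (c + 1) X = 0 -> Q (c + 2%:R) X = 0 ->
  proj_pt X = proj_pt (ver c) \/
  [/\ dot (n (c + 1)) X != 0, dot (n (c + 2%:R)) X != 0 & exists i, proj_pt X = proj_pt (p i)].
Proof.
move=> X0; have [-> ->] := tri_conic_next c X.
have EX := comb_side N0 complete c X.
move: EX (cubic_sides X c).
set ξ := dot (n c) X; set η := dot (n (c + 1)) X; set ζ := dot (n (c + 2%:R)) X.
move=> EX Ecub H1 H2.
have vert : η = 0 -> ζ = 0 -> proj_pt X = proj_pt (ver c).
  move=> h0 z0; rewrite EX h0 z0 !mul0r !scale0r !addr0 proj_pt_scale //.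
  by apply: contraNneq X0 => E; rewrite EX E h0 z0 !mul0r !scale0r !addr0.
case: (eqVneq η 0) => [h0|h0].
  left; apply: vert => //; move: H2; rewrite h0 mulr0 sub0r => /eqP.
  by rewrite oppr_eq0 mulf_eq0 (negPf b0) expf_eq0 => /eqP.
case: (eqVneq ζ 0) => [z0|z0].
  left; apply: vert => //; move: H1; rewrite z0 mulr0 sub0r => /eqP.
  by rewrite oppr_eq0 mulf_eq0 (negPf b0) expf_eq0 => /eqP.
have Ecub0 : cubic_at b ξ η ζ = 0.
  have e1 : ξ ^+ 2 - b ^+ 2 * η * ζ = 0.
    apply: (mulfI (mulf_neq0 h0 z0)); rewrite mulr0.
    have -> : η * ζ * (ξ ^+ 2 - b ^+ 2 * η * ζ) =
      (ξ * ζ - b * η ^+ 2) * (ξ * η) + b * η ^+ 2 * (ξ * η - b * ζ ^+ 2) by ring.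
    by rewrite H1 H2 mul0r mulr0 addr0.
  have -> : cubic_at b ξ η ζ = b * ξ * (ξ ^+ 2 - b ^+ 2 * η * ζ) - η * (ξ * ζ - b * η ^+ 2)
    - ζ * (ξ * η - b * ζ ^+ 2) by rewrite /cubic_at; ring.
  by rewrite e1 H1 H2 !mulr0 !subr0.
have c0 : cubic_at a (X 0 0) (X 0 1) (X 0 2%:R) = 0.
  have [u u0 Eu] := tri_cubic three0 eps_prim a3 m X.
  by apply: (mulfI u0); rewrite -Eu mulr0 Ecub.
right; split=> //; apply: base_locus => //.
have := member_tri three0 eps_prim a3 a8 m X; rewrite member_eval c0 expr0n /= mulr0 addr0 => ->.
have [Q1 _] := tri_conic_next c X.
by rewrite (bigD1 (c + 1)) //= Q1 -/ξ -/η -/ζ H1 mul0r mulr0.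
Qed.
End Member.

End BaseLocus.

(** A point (w0, w1, w2) on both tangents at (ξ, η, ζ) is that point itself:
    eliminating w0 from the equations of the tangents gives ζ^2 w2 = η^2 w1,
    and those of the conics give η^3 = ζ^3. *)
Lemma tangents_differ (F : fieldType) (b ξ η ζ w0 w1 w2 : F) : b != 0 -> 3%:R != 0 :> F ->
  η != 0 -> ζ != 0 -> ξ * ζ = b * η ^+ 2 -> ξ * η = b * ζ ^+ 2 ->
  ξ * w2 + ζ * w0 - 2%:R * b * (η * w1) = 0 -> ξ * w1 + η * w0 - 2%:R * b * (ζ * w2) = 0 ->
  η * w0 = w1 * ξ /\ η * w2 = w1 * ζ.
Proof.
move=> b0 n3 h0 z0 H1 H2 T1 T2.
have e1 : ζ ^+ 2 * w2 = η ^+ 2 * w1.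
  apply: (mulfI (mulf_neq0 n3 b0)); apply/eqP; rewrite -subr_eq0; apply/eqP.
  have -> : 3%:R * b * (ζ ^+ 2 * w2) - 3%:R * b * (η ^+ 2 * w1) =
    η * (ξ * w2 + ζ * w0 - 2%:R * b * (η * w1)) - ζ * (ξ * w1 + η * w0 - 2%:R * b * (ζ * w2))
    + w2 * (b * ζ ^+ 2 - ξ * η) - w1 * (b * η ^+ 2 - ξ * ζ) by ring.
  by rewrite T1 T2 H1 H2; ring.
have e2 : η ^+ 3 = ζ ^+ 3.
  apply: (mulfI b0); have -> : b * η ^+ 3 = (b * η ^+ 2) * η by ring.
  rewrite -H1; have -> : b * ζ ^+ 3 = (b * ζ ^+ 2) * ζ by ring.
  by rewrite -H2; ring.
split; last first.
  apply: (mulfI (expf_neq0 2 z0)); have -> : ζ ^+ 2 * (η * w2) = η * (ζ ^+ 2 * w2) by ring.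
  rewrite e1; have -> : η * (η ^+ 2 * w1) = η ^+ 3 * w1 by ring.
  by rewrite e2; ring.
have e3 : η * w2 = ζ * w1.
  apply: (mulfI (expf_neq0 2 z0)); have -> : ζ ^+ 2 * (η * w2) = η * (ζ ^+ 2 * w2) by ring.
  rewrite e1; have -> : η * (η ^+ 2 * w1) = η ^+ 3 * w1 by ring.
  by rewrite e2; ring.
apply: (mulfI z0); apply/eqP; rewrite -subr_eq0; apply/eqP.
have -> : ζ * (η * w0) - ζ * (w1 * ξ) =
   η * (ξ * w2 + ζ * w0 - 2%:R * b * (η * w1)) - ξ * (η * w2 - ζ * w1)
   + 2%:R * w1 * (b * η ^+ 2 - ξ * ζ) by ring.
by rewrite T1 e3 H1; ring.
Qed.

Section FibreSing.
Variable k : closedFieldType.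
Variables (a eps : k).
Hypotheses (two0 : 2%:R != 0 :> k) (three0 : 3%:R != 0 :> k) (a0 : a != 0) (eps_prim : 3.-primitive_root eps).
Hypotheses (a3 : a ^+ 3 != 1) (a8 : a ^+ 3 + 8%:R != 0).
Local Notation p := (base_pt eps a).
Variable m : nat.
Local Notation n := (tri_side eps m).
Local Notation ver := (tri_vertex eps m).
Local Notation b := (tri_param a eps m).
Local Notation N := (tri_norm k m).
Local Notation Q := (tri_conic b n).
Let N0 := tri_norm_neq0 three0 m.
Let b0 := tri_param_neq0 a0 eps_prim a3 a8 m.
Let dual := tri_dual eps_prim m.
Let complete := tri_complete eps_prim m.

Variables (C : 'I_3 -> {mpoly k[3]}) (g : 'I_3 -> 'I_3).
Hypothesis g_inj : injective g.
Hypothesis gP : forall c, exists2 φ, φ != 0 & forall Y : 'rV[k]_3, (C (g c)).@[Y 0] = φ * Q c Y.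

Lemma tri_conic_scale c e (X : 'rV[k]_3) : Q c (e *: X) = e ^+ 2 * Q c X.
Proof. by rewrite /tri_conic !dotZr; ring. Qed.

(** If the conics met over a base point, then by proper_transform_tangent
    the line through it would be tangent to both, in contradiction with
    tangents_differ. *)
Lemma meet_vertex c (s : blowup p) : proper_transform (C (g (c + 1))) s ->
  proper_transform (C (g (c + 2%:R))) s -> proj_pt (ver c) = proj s.
Proof.
move=> pt1 pt2; have [φ1 φ10 E1] := gP (c + 1); have [φ2 φ20 E2] := gP (c + 2%:R).
have {}E1 (Y : 'rV[k]_3) : (C (g (c + 1))).@[Y 0] =
    φ1 * (dot (n c) Y * dot (n (c + 2%:R)) Y - b * dot (n (c + 1)) Y ^+ 2).
  by rewrite E1; have [->] := tri_conic_next a eps m c Y.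
have {}E2 (Y : 'rV[k]_3) : (C (g (c + 2%:R))).@[Y 0] =
    φ2 * (dot (n c) Y * dot (n (c + 1)) Y - b * dot (n (c + 2%:R)) Y ^+ 2).
  by rewrite E2; have [_ ->] := tri_conic_next a eps m c Y.
have on1 := proper_transform_on φ10 E1 pt1; have on2 := proper_transform_on φ20 E2 pt2.
have X0 := coords_neq0 (proj s).
have [T1 T2] := tri_conic_next a eps m c (coords (proj s)).
have [|[h0 z0 [i]]] := conics_meet three0 a0 eps_prim a3 a8 X0 (etrans T1 on1) (etrans T2 on2).
  by rewrite proj_ptK.
rewrite proj_ptK => Ei; exfalso.
have pi0 := base_pt_neq0 a0 eps_prim i.
have exc : exceptional i s by rewrite /exceptional Ei proj_ptE.
have [e e0 Ee] := coords_proj_pt pi0; rewrite -Ei in Ee.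
have scal d : dot (n d) (coords (proj s)) = e * dot (n d) (p i) by rewrite Ee dotZr.
rewrite !scal in on1 on2 h0 z0.
move: h0 z0; rewrite !mulf_eq0 !negb_or => /andP[_ h0] /andP[_ z0].
set ξ := dot (n c) (p i) in on1 on2; set η := dot (n (c + 1)) (p i) in on1 on2 h0.
set ζ := dot (n (c + 2%:R)) (p i) in on1 on2 z0.
have q1 : ξ * ζ - b * η ^+ 2 = 0.
  apply: (mulfI (expf_neq0 2 e0)); rewrite mulr0 -on1; ring.
have q2 : ξ * η - b * ζ ^+ 2 = 0.
  apply: (mulfI (expf_neq0 2 e0)); rewrite mulr0 -on2; ring.
have [ρ ρp] := exists_dot pi0.
have t1 := proper_transform_tangent pi0 two0 φ10 E1 ρp q1 pt1 exc.
have t2 := proper_transform_tangent pi0 two0 φ20 E2 ρp q2 pt2 exc.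
set ℓ := coords (dir s i) in t1 t2; set W := cross ℓ ρ in t1 t2.
have H1 : ξ * ζ = b * η ^+ 2 by apply/eqP; rewrite -subr_eq0 q1.
have H2 : ξ * η = b * ζ ^+ 2 by apply/eqP; rewrite -subr_eq0 q2.
have [w0 w2] := tangents_differ b0 three0 h0 z0 H1 H2 t1 t2.
set w1 := dot (n (c + 1)) W in w0 w2.
have EW : η *: W = w1 *: p i.
  rewrite (comb_side N0 complete c W) (comb_side N0 complete c (p i)) -/ξ -/η -/ζ -/w1.
  rewrite !scalerDr !scalerA; congr (_ *: _ + _ *: _ + _ *: _).
  - by rewrite mulrA w0 -mulrA.
  - by rewrite mulrCA.
  - by rewrite mulrA w2 -mulrA.
have ρW : dot ρ W = 0 by exact: cross_dotr.
have w10 : w1 = 0.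
  have : dot ρ (η *: W) = dot ρ (w1 *: p i) by rewrite EW.
  by rewrite !dotZr ρW mulr0 => /esym/eqP; rewrite mulf_eq0 (negPf ρp) orbF => /eqP.
have W0 : W = 0.
  by apply/eqP; move/eqP: EW; rewrite w10 scale0r scaler_eq0 (negPf h0).
have := cross_cross ℓ ρ (p i); rewrite -/W W0.
have -> : dot ℓ (p i) = 0 by rewrite dotC; exact: dir_base.
have -> : cross 0 (p i) = 0 by have := crossZl 0 (0 : 'rV[k]_3) (p i); rewrite !scale0r.
rewrite scale0r sub0r => /esym/eqP; rewrite oppr_eq0 scaler_eq0 (negPf ρp) /=.
by rewrite (negPf (coords_neq0 (dir s i))).
Qed.

Lemma third_index (c d : 'I_3) : c != d -> exists e,
  (c = e + 1 /\ d = e + 2%:R) \/ (c = e + 2%:R /\ d = e + 1).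
Proof.
move=> ncd; case: (ord3_cases c d) => E.
- by rewrite E eqxx in ncd.
- exists (c + 2%:R); left; rewrite E; split; move: (c); apply: ord3P; exact: val_inj.
- exists (c + 1); right; rewrite E; split; move: (c); apply: ord3P; exact: val_inj.
Qed.

(** Conversely, over a vertex, which is not a base point, the blow-up is an
    isomorphism, and two of the conics pass through it. *)
Lemma fibre_sing_vertex q : proj_image (@fibre_sing k p C) q <-> exists c, proj_pt (ver c) = q.
Proof.
split.
- move=> [s [[i [j [nij pti ptj]]] <-]].
  have Ei := f_invF g_inj i; have Ej := f_invF g_inj j.
  have [|e [[e1 e2]|[e1 e2]]] := @third_index (invF g_inj i) (invF g_inj j).
  + by apply: contra_neq nij => E; rewrite -Ei -Ej E.
  + by exists e; apply: meet_vertex; rewrite -?e1 -?e2 ?Ei ?Ej.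
  + by exists e; apply: meet_vertex; rewrite -?e1 -?e2 ?Ei ?Ej.
- move=> [c <-]; have v0 := vertex_neq0 three0 eps_prim m c.
  have nb i : proj_pt (ver c) <> proj_pt (p i) by exact: vertex_base.
  have L0 j : cross (p j) (ver c) != 0.
    apply/eqP => /(proj_pt_cross (base_pt_neq0 a0 eps_prim j) v0) E; exact: (nb j (esym E)).
  have [s [Es _]] := blowup_point v0 L0 (fun j => cross_dotl _ _) (fun j => cross_dotr _ _).
  exists s; split=> //.
  have on d : d != c -> proper_transform (C (g d)) s.
    move=> ndc D P dP H; apply: H.
      have [φ φ0 E] := gP d; rewrite /on_curve Es E.
      have [e _ ->] := coords_proj_pt v0.
      by rewrite tri_conic_scale (tri_conic_vertex _ dual) (negPf ndc) mulr0 oppr0 !mulr0.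
    move=> i; rewrite /exceptional Es => Ei; apply: (nb i); apply: val_inj.
    by rewrite Ei proj_ptE // base_pt_neq0.
  have [[e1 e2 e3] [e4 e5 e6]] := ord3_neq c.
  exists (g (c + 1)), (g (c + 2%:R)); split.
  + by apply/eqP => /g_inj /eqP; rewrite e4.
  + by apply: on; rewrite e3.
  + by apply: on; rewrite e5.
Qed.

End FibreSing.

(** * The affine plane over the field with three elements *)

Lemma inj_surj_bij (S T : Type) (f : S -> T) : injective f -> (forall y, exists x, f x = y) -> bijective f.
Proof.
move=> inj sur; pose g y := proj1_sig (constructive_indefinite_description _ (sur y)).
have gK y : f (g y) = y by exact: (proj2_sig (constructive_indefinite_description _ (sur y))).
by exists g => // x; apply: inj; rewrite gK.
Qed.

Lemma F3_nat_eq (x y : nat) : (x%:R == y%:R :> 'F_3) = (x == y %[mod 3]).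
Proof. by rewrite -val_eqE /= !val_Fp_nat. Qed.

Definition pt2 (x y : 'F_3) : hesse_pt := \row_(j < 2) (if j == 0 then x else y).
Lemma pt2_eq (u w : hesse_pt) : u 0 0 = w 0 0 -> u 0 1 = w 0 1 -> u = w.
Proof.
move=> E0 E1; apply/rowP => -[[|[|j]] Hj] //.
  by have -> : Ordinal Hj = 0 by exact: val_inj.
by have -> : Ordinal Hj = 1 by exact: val_inj.
Qed.

Lemma mem_affine_line (u v x : hesse_pt) : v != 0 ->
  (x \in [set u + t *: v | t : 'F_3]) = ((x 0 0 - u 0 0) * v 0 1 == (x 0 1 - u 0 1) * v 0 0).
Proof.
move=> v0; apply/imsetP/eqP => [[t _ ->]|E]; first by rewrite !mxE; ring.
case: (eqVneq (v 0 0) 0) => [v00|v00].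
  have v10 : v 0 1 != 0 by apply: contraNneq v0 => v10; apply/eqP/pt2_eq; rewrite ?mxE.
  exists ((x 0 1 - u 0 1) / v 0 1) => //; apply: pt2_eq; rewrite !mxE.
    move: E; rewrite v00 !mulr0 => /eqP; rewrite mulf_eq0 (negPf v10) orbF subr_eq0 => /eqP ->.
    by rewrite addr0.
  by rewrite divfK // addrC subrK.
exists ((x 0 0 - u 0 0) / v 0 0) => //; apply: pt2_eq; rewrite !mxE.
  by rewrite divfK // addrC subrK.
by rewrite mulrAC E mulfK // addrC subrK.
Qed.

(** The points of F_3^2 that number the base points whose axes pass through
    the vertex c of the triangle m (axis_vertex). *)
Definition vertex_line (m : nat) (c : nat) : {set hesse_pt} :=
  [set x : hesse_pt | if m == 0%N then x 0 0 == c%:R else x 0 1 + x 0 0 * (m.-1)%:R == (2 * c)%:R].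

Lemma vertex_line_affine m c : affine_line (vertex_line m c).
Proof.
case: m => [|w].
  apply/existsP; exists (pt2 c%:R 0); apply/existsP; exists (pt2 0 1).
  have v0 : pt2 0 1 != 0 by apply/eqP => /rowP /(_ 1); rewrite !mxE => /eqP; rewrite oner_eq0.
  rewrite v0; apply/eqP/setP => x; rewrite mem_affine_line // inE /= !mxE /= mulr1 mulr0.
  by rewrite subr_eq0.
apply/existsP; exists (pt2 0 (2 * c)%:R); apply/existsP; exists (pt2 1 (- w%:R)).
have v0 : pt2 1 (- w%:R) != 0 by apply/eqP => /rowP /(_ 0); rewrite !mxE => /eqP; rewrite oner_eq0.
rewrite v0; apply/eqP/setP => x; rewrite mem_affine_line // inE /= !mxE /= mulr1 subr0.
by rewrite -subr_eq0 [RHS]eq_sym -[RHS]subr_eq0; congr (_ == _); ring.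
Qed.

Definition vline m c : hesse_line := exist _ (vertex_line m c) (vertex_line_affine m c).

Lemma vline_inj (m m' : 'I_4) (c c' : 'I_3) : vline m c = vline m' c' -> m = m' /\ c = c'.
Proof.
move=> /(congr1 val) /= /setP E; have El x y := E (pt2 x y).
have c_eq (d d' : 'I_3) : d = d' %[mod 3] -> d = d' by move=> H; apply: val_inj; move: H; rewrite !modn_small.
case: m {E} El => -[|w] lm; case: m' => -[|w'] lm' El.
- split; first exact: val_inj.
  have := El c%:R 0; rewrite !inE !mxE /= eqxx => /esym; rewrite F3_nat_eq => /eqP; exact: c_eq.
- have := El c%:R 0; have := El c%:R 1; rewrite !inE !mxE /= eqxx => /esym/eqP E1 /esym/eqP E0.
  have : (1 : 'F_3) = 0 by rewrite -[LHS](addrK (c%:R * w'%:R)) E1 -E0 add0r subrr.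
  by move/eqP; rewrite oner_eq0.
- have := El c'%:R 0; have := El c'%:R 1; rewrite !inE !mxE /= eqxx => /eqP E1 /eqP E0.
  have : (1 : 'F_3) = 0 by rewrite -[LHS](addrK (c'%:R * w%:R)) E1 -E0 add0r subrr.
  by move/eqP; rewrite oner_eq0.
have := El 0 (2 * c)%:R; rewrite !inE !mxE /= !mul0r !addr0 eqxx => /esym; rewrite F3_nat_eq => /eqP Ec.
have {}Ec : c = c' by apply: val_inj; move: Ec; case: (c) => -[|[|[|?]]] ?; case: (c') => -[|[|[|?]]] ?.
split=> //; apply: val_inj => /=; congr S.
have := El 1 ((2 * c)%:R - w%:R); rewrite !inE !mxE /= !mul1r subrK eqxx Ec => /esym/eqP Ew.
have : (w%:R : 'F_3) == w'%:R.
  by apply/eqP; apply: (addrI ((2 * c')%:R - w%:R)); rewrite Ew subrK.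
by rewrite F3_nat_eq !modn_small // => /eqP.
Qed.

Lemma F3_natr (x : 'F_3) : exists d : 'I_3, x = d%:R.
Proof. by exists (x : 'I_3) => //; rewrite -[LHS]natr_Zp. Qed.

Lemma vline_surj (l : hesse_line) : exists (m : 'I_4) (c : 'I_3), vline m c = l.
Proof.
case: l => l Hl; have := Hl => /existsP[u /existsP[v /andP[v0 /eqP El]]].
case: (eqVneq (v 0 0) 0) => [v00|v00].
  have v10 : v 0 1 != 0 by apply: contraNneq v0 => v10; apply/eqP/pt2_eq; rewrite ?mxE.
  have [c Ec] := F3_natr (u 0 0); exists 0, c; apply: val_inj => /=; rewrite El; apply/setP => x.
  by rewrite mem_affine_line // inE /= v00 mulr0 mulf_eq0 (negPf v10) orbF subr_eq0 Ec.
have [w Ew] := F3_natr (- (v 0 1 / v 0 0)).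
have [c Ec] := F3_natr (2%:R * (u 0 1 + w%:R * u 0 0)).
have lw : (w.+1 < 4)%N by rewrite ltnS.
exists (Ordinal lw), c; apply: val_inj => /=; rewrite El; apply/setP => x.
rewrite mem_affine_line // inE /= natrM -Ec.
have -> : 2%:R * (2%:R * (u 0 1 + w%:R * u 0 0)) = u 0 1 + w%:R * u 0 0 :> 'F_3.
  by rewrite mulrA (_ : 2%:R * 2%:R = 1 :> 'F_3) ?mul1r //; apply: val_inj.
have Ev : v 0 1 = - w%:R * v 0 0 by rewrite -Ew opprK divfK.
rewrite Ev -[RHS]subr_eq0 mulrA -mulrBl mulf_eq0 (negPf v00) orbF -oppr_eq0.
by rewrite -subr_eq0; congr (_ == _); ring.
Qed.

Definition base_hesse (i : 'I_9) : hesse_pt := pt2 (i %/ 3)%:R (i %% 3)%:R.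

Lemma base_hesse_bij : bijective base_hesse.
Proof.
apply: inj_card_bij; last by rewrite card_mx !card_ord.
move=> i j /rowP E; have := E 0; have := E 1; rewrite !mxE /= => /eqP; rewrite F3_nat_eq !modn_mod => /eqP E1.
move=> /eqP; rewrite F3_nat_eq !modn_small ?ltn_divLR // => /eqP E0.
by apply: val_inj; rewrite /= (divn_eq i 3) (divn_eq j 3) E0 E1.
Qed.

(** * The configuration *)

Section Incidence.
Variable k : closedFieldType.
Variable eps : k.
Hypothesis eps_prim : 3.-primitive_root eps.

(** In terms of exponents of eps the left hand side is a congruence modulo
    3, which leaves finitely many cases to compute. *)
Lemma axis_vertex (i : 'I_9) (m : 'I_4) (c : 'I_3) :
  (dot (tri_vertex eps m c) (axis (pt_type i) (pt_root eps i)) == 0) = (base_hesse i \in vertex_line m c).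
Proof.
have li : (i %/ 3 < 3)%N by rewrite ltn_divLR.
have lj : (i %% 3 < 3)%N by rewrite ltn_mod.
rewrite inE !mxE /= /pt_type /pt_root; move: (i %/ 3)%N (i %% 3)%N li lj => r j lr lj.
have v0 : eps ^+ j != 0.
  by apply/expf_neq0; apply: contra_eq_neq (prim_expr_order eps_prim) => ->; rewrite expr0n eq_sym oner_eq0.
case: m => -[|w] lm; rewrite /tri_vertex /=.
  have v2 : (eps ^+ j) ^+ 2 != 0 by exact: expf_neq0.
  rewrite dot_unit F3_nat_eq; move: c; apply: ord3P; case: r lr => [|[|[|//]]] _;
    by rewrite /axis ?vec3E0 ?vec3E1 ?vec3E2 /= ?eqxx ?oppr_eq0 ?oner_eq0 ?(negPf v2) ?(negPf v0).
rewrite -natrM -natrD F3_nat_eq dotE !vec3E /mem_root -[w.+1.-1]/w.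
have lw : (w < 3)%N by [].
have H A B : (eps ^+ A - eps ^+ B == 0) = (A == B %[mod 3]).
  by rewrite subr_eq0 (eq_prim_root_expr eps_prim).
have sq x : eps ^+ (2 * x) = (eps ^+ x) ^+ 2 by rewrite mulnC exprM.
transitivity (if r == 0%N then (j + 2 * c == c %[mod 3]) else
    if r == 1%N then (2 * j + 2 * w == c %[mod 3]) else (2 * j + 2 * w == j + 2 * c %[mod 3])).
  case: r lr => [|[|[|//]]] _; rewrite /=.
  - by rewrite -H exprD !sq; congr (_ == _); ring.
  - by rewrite -H -[RHS]oppr_eq0 exprD !sq; congr (_ == _); ring.
  - by rewrite -H (exprD eps (2 * j)) (exprD eps j) !sq; congr (_ == _); ring.
move: {H} (nat_of_ord c) (ltn_ord c) => d ld; rewrite {v0}.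
case: r lr => [|[|[|//]]] _; case: j lj => [|[|[|//]]] _; case: w lm lw => [|[|[|//]]] _ _;
  by case: d ld => [|[|[|//]]] _.
Qed.

End Incidence.

Section Nonsingular.
Variable k : fieldType.

Lemma mderiv_var_eval (u : 'I_3 -> k) (c j : 'I_3) : (mderiv c 'X_j).@[u] = (j == c)%:R.
Proof.
rewrite mderivX mnm1E mevalZ; case: eqP => [->|_]; last by rewrite mul0r.
have -> : (U_(c) - U_(c) = 0 :> 'X_{1..3})%MM by apply/mnmP => i; rewrite !mnmE subnn.
by rewrite mpolyX0 meval1 mulr1.
Qed.

Lemma hesse_cubic_eval (a : k) (u : 'rV[k]_3) : (hesse_cubic a).@[u 0] =
  u 0 0 ^+ 3 + u 0 1 ^+ 3 + u 0 2%:R ^+ 3 - (a ^+ 3 + 2%:R) / a * (u 0 0 * u 0 1 * u 0 2%:R).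
Proof.
by rewrite /hesse_cubic !exprS !expr0 !mulr1 mevalB mevalZ !mevalD !mevalM !mevalXU.
Qed.

Lemma hesse_cubic_deriv (a : k) (u : 'rV[k]_3) c : (mderiv c (hesse_cubic a)).@[u 0] =
  3%:R * u 0 c ^+ 2 - (a ^+ 3 + 2%:R) / a * (u 0 (c + 1) * u 0 (c + 2%:R)).
Proof.
rewrite /hesse_cubic !exprS !expr0 !mulr1 mderivB mderivZ !mderivD !mderivM.
rewrite mevalB mevalZ !mevalD !mevalM !mevalD !mevalM !mderiv_var_eval !mevalXU.
by move: c; have [E1 E2 E3 E4] := ord3_add; apply: ord3P; rewrite ?add0r ?E1 ?E2 ?E3 ?E4 /=; ring.
Qed.

(** If a^3 = 1, then (a : 1 : 1) is a singular point of the cubic; if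
    a^3 = -8, then (a : -2 : -2) is one. *)
Lemma nonsingular_cubic (a : k) : a != 0 -> nonsingular (hesse_cubic a) ->
  a ^+ 3 != 1 /\ a ^+ 3 + 8%:R != 0.
Proof.
move=> a0 ns.
have sing t : a ^+ 3 + 2%:R * t ^+ 3 - (a ^+ 3 + 2%:R) * t ^+ 2 = 0 ->
    3%:R * a ^+ 3 = (a ^+ 3 + 2%:R) * t ^+ 2 -> 3%:R * t ^+ 2 = (a ^+ 3 + 2%:R) * t -> False.
  move=> H1 H2 H3; pose w : 'rV[k]_3 := vec3 (a, t, t).
  have w0 : w != 0 by apply: contra_neq a0 => /rowP /(_ 0); rewrite vec3E mxE.
  case: (ns w w0).
    by rewrite hesse_cubic_eval !vec3E /= -H1; field.
  move=> c; apply; rewrite hesse_cubic_deriv; move: c; have [E1 E2 E3 E4] := ord3_add.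
  apply: ord3P; rewrite ?add0r ?E1 ?E2 ?E3 ?E4 !vec3E /=.
  - apply: (mulfI a0); rewrite mulr0.
    have -> : a * (3%:R * a ^+ 2 - (a ^+ 3 + 2%:R) / a * (t * t)) = 3%:R * a ^+ 3 - (a ^+ 3 + 2%:R) * t ^+ 2 by field.
    by rewrite H2 subrr.
  - have -> : (a ^+ 3 + 2%:R) / a * (t * a) = (a ^+ 3 + 2%:R) * t by field.
    by rewrite H3 subrr.
  - have -> : (a ^+ 3 + 2%:R) / a * (a * t) = (a ^+ 3 + 2%:R) * t by field.
    by rewrite H3 subrr.
split; apply/eqP => E; [apply: (sing 1)|apply: (sing (- 2%:R))].
1-3: by rewrite E; ring.
1-3: by have -> : a ^+ 3 = - 8%:R by [apply/eqP; rewrite -addr_eq0 E]; ring.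
Qed.

End Nonsingular.

Theorem theorem6p9 (k : closedFieldType)
    (char2 : 2%N \notin [pchar k]) (char3 : 3%N \notin [pchar k])
    (eps a : k) (eps_prim : 3.-primitive_root eps) (a_neq0 : a != 0)
    (cubic_ns : nonsingular (hesse_cubic a))
    (lambda : 'I_4 -> k) (C : 'I_4 -> 'I_3 -> {mpoly k[3]})
    (chileanC : chilean a lambda C) :
  let p := base_pt eps a in
  let B (i : 'I_9) := @fixed_curve k (fibration a) p (exc_ring p i) in
  exists (ell : 'I_9 -> proj2 k) (pt : 'I_4 * 'I_3 -> proj2 k),
    [/\ (forall i q, proj_image (B i) q <-> on_line q (ell i)),
        injective ell,
        (forall r q, proj_image (@fibre_sing k p (C r)) q <-> exists j, pt (r, j) = q),
        injective pt
      & config_iso (fun n i => on_line (pt n) (ell i)) dual_hesse_inc].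
Proof.
have two0 : 2%:R != 0 :> k by exact: natr_neq0.
have three0 : 3%:R != 0 :> k by exact: natr_neq0.
have [a3 a8] := nonsingular_cubic a_neq0 cubic_ns.
have [m m_inj conics] := chilean_structure three0 a_neq0 eps_prim a3 a8 chileanC.
move=> p B.
pose ell (i : 'I_9) := proj_pt (axis (pt_type i) (pt_root eps i)).
pose pt (n : 'I_4 * 'I_3) := proj_pt (tri_vertex eps (m n.1) n.2).
pose phi (n : 'I_4 * 'I_3) := vline (m n.1) n.2.
have ax0 i : axis (pt_type i) (pt_root eps i) != 0 by rewrite axis_neq0 ?pt_root_neq0.
have v0 n : tri_vertex eps (m n.1) n.2 != 0 by exact: vertex_neq0.
have inc n i : on_line (pt n) (ell i) = (base_hesse i \in val (phi n)).
  by rewrite on_lineE // axis_vertex.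
have phi_inj : injective phi.
  by move=> [r c] [r' c'] /vline_inj /= [/m_inj -> ->].
have phi_bij : bijective phi.
  apply: inj_surj_bij => // l; have [m0 [c <-]] := vline_surj l.
  by exists (invF m_inj m0, c); rewrite /phi /= f_invF.
exists ell, pt; split.
- by move=> i q; exact: fixed_curve_axis.
- move=> i j E; apply/eqP; rewrite -(axis_base_pt eps_prim a3) dotC.
  have pj0 := base_pt_neq0 a_neq0 eps_prim j.
  have := on_lineE pj0 (ax0 i); rewrite -/(ell i) E on_lineE // => <-.
  by rewrite dotC (axis_base_pt eps_prim a3).
- move=> r q; have [g g_inj gP] := conics r.
  exact: (fibre_sing_vertex two0 three0 a_neq0 eps_prim a3 a8 g_inj gP).
- move=> n n' E; apply: phi_inj; apply: val_inj; apply/setP => u.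
  have [ψ _ ψK] := base_hesse_bij; rewrite -(ψK u) -!inc.
  by rewrite E.
- exists phi, base_hesse; split; [exact: phi_bij | exact: base_hesse_bij |].
  by move=> n i; rewrite inc.
Qed.
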